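(* Let $\mathcal{E}$ be an exponential family of dimension $n$ defined over a finite set $\Omega=\{x_1,\dots,x_m\}$, and let $\Phi:\mathbb{T}^n\times N\to N$ be a Kähler toric manifold with Kähler metric $g$ which is a regular torification of $\mathcal{E}$. Let $K:N\to\overline{\mathcal{E}}$ be the natural extension of some compatible projection, and let $f:N\to\mathbb{R}$ be a smooth function. Then: (a) $f$ is Kähler if and only if there exist a random variable $X\in\mathcal{A}_{\mathcal{E}}$ and a holomorphic isometry $\phi\in\mathrm{Aut}(N,g)^0$ such that $f(p)=\mathbb{E}_{K(\phi(p))}(X)$ for all $p\in N$. (b) Suppose that the estimator map $F:\Omega\to\mathbb{R}^n$ is injective. If $f(p)=\mathbb{E}_{K(\phi(p))}(X)=\mathbb{E}_{K(\phi'(p))}(X')$ for all $p\in N$, where $\phi,\phi'\in\mathrm{Aut}(N,g)^0$ and $X,X'\in\mathcal{A}_{\mathcal{E}}$, then there is a permutation $\sigma\in\mathrm{Perm}(\mathcal{E})\subseteq\mathbb{S}_m$ such that $X(x_k)=X'(x_{\sigma(k)})$ for all $k\in\{1,\dots,m\}$.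
   Context: Kähler toric manifolds. $\mathbb{T}^n=\mathbb{R}^n/\mathbb{Z}^n$; its Lie algebra is identified with $\mathbb{R}^n$ via the derivative at $0$ of the quotient map, and $\mathbb{R}^n$ with its dual via the Euclidean product $\langle\,,\,\rangle$. For an action $\Phi:\mathbb{T}^n\times N\to N$ write $\Phi_a(p)=\Phi(a,p)$ and $\xi_N(p)=\frac{d}{dt}\big|_0\Phi([t\xi],p)$ for $\xi\in\mathbb{R}^n$. A Kähler toric manifold is a connected compact Kähler manifold $N$ of complex dimension $n$ (metric $g$, complex structure $I$, Kähler form $\omega=g(I\cdot,\cdot)$) with an effective action $\Phi$ of $\mathbb{T}^n$ by holomorphic isometries and a momentum map $\mathbf{J}:N\to\mathbb{R}^n$, i.e. a smooth $\mathbb{T}^n$-invariant map with $\omega(\xi_N,\cdot)=d\mathbf{J}^\xi$ for all $\xi$, where $\mathbf{J}^\xi(p)=\langle\mathbf{J}(p),\xi\rangle$. $N^\circ$ is the (open, dense, connected) set of points where $\Phi$ is free. Exponential family. $\Omega$ carries the counting measure. $\mathcal{E}$ is the set of probability functions $p_\theta(x)=\exp\big(C(x)+\sum_{k=1}^n\theta_kF_k(x)-\psi(\theta)\big)$, $\theta\in\mathbb{R}^n$, where $C,F_1,\dots,F_n:\Omega\to\mathbb{R}$, $\psi:\mathbb{R}^n\to\mathbb{R}$, and $1,F_1,\dots,F_n$ are linearly independent; $\theta$ is a global chart of $\mathcal{E}$. $\mathbb{E}_p(X)=\sum_{x\in\Omega}X(x)p(x)$. $\mathcal{E}$ carries the Fisher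 metric $(h_F)_{ij}(\theta)=\mathbb{E}_{p_\theta}(\partial_i\ln p_\theta\,\partial_j\ln p_\theta)$ and the exponential connection $\nabla^{(e)}$, the flat connection for which $\theta_1,\dots,\theta_n$ are affine coordinates. The estimator map is $F=(F_1,\dots,F_n):\Omega\to\mathbb{R}^n$, and $\mathcal{A}_{\mathcal{E}}$ is the real vector space of functions on $\Omega$ spanned by $F_1,\dots,F_n,1$. Torification. With coordinates $(\theta,\dot\theta)$ on $T\mathcal{E}$ (for the tangent vector $\sum_k\dot\theta_k\partial/\partial\theta_k$ at $p_\theta$), $T\mathcal{E}$ is a Kähler manifold with holomorphic coordinates $z_k=\theta_k+i\dot\theta_k$ and metric given by the block-diagonal matrix $\mathrm{diag}(h_F(\theta),h_F(\theta))$. A parallel lattice $L\subset T\mathcal{E}$ is the set of all integer combinations $\sum k_iY_i(p)$, $p\in\mathcal{E}$, of a frame $Y=(Y_1,\dots,Y_n)$ of $\nabla^{(e)}$-parallel vector fields on $\mathcal{E}$ (a generator of $L$). $\Gamma(L)\cong\mathbb{Z}^n$ is the group of maps $u\mapsto u+\sum k_iY_i$ of $T\mathcal{E}$; $\mathcal{E}_L=T\mathcal{E}/\Gamma(L)$ with its induced Kähler structure, $q_L:T\mathcal{E}\to\mathcal{E}_L$ is the quotient map, $\pi_L:\mathcal{E}_L\to\mathcal{E}$ the induced projection, and $\mathbb{T}^n$ acts on $\mathcal{E}_L$ by $\Phi_Y([t],q_L(u))=q_L(u+\sum t_iY_i)$. $(N,\Phi)$ is a torification of $\mathcal{E}$ if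 there are a parallel lattice $L$, a generator $Y$ and a holomorphic isometric diffeomorphism $G:\mathcal{E}_L\to N^\circ$ with $G\circ(\Phi_Y)_a=\Phi_a\circ G$ for all $a\in\mathbb{T}^n$. It is regular if $N$ is connected, simply connected, complete and has real-analytic Kähler metric. A compatible projection is a map $\kappa=\pi_L\circ G^{-1}:N^\circ\to\mathcal{E}$ for some such triple $(L,Y,G)$. Natural extension. $\mathcal{P}_m$ is the set of all probability functions on $\Omega$, with the topology of pointwise convergence, and $\overline{\mathcal{E}}$ is the closure of $\mathcal{E}$ in $\mathcal{P}_m$. Each compatible projection $\kappa$ has a unique continuous extension $K:N\to\overline{\mathcal{E}}$, called its natural extension. Kähler functions. A smooth $f:N\to\mathbb{R}$ is Kähler if its Hamiltonian vector field $X_f$ (defined by $\omega(X_f,\cdot)=df$) is Killing, i.e. $\mathscr{L}_{X_f}g=0$. $\mathrm{Aut}(N,g)$ is the group of holomorphic isometries of $N$ with the compact-open topology (a compact Lie group), $\mathrm{Aut}(N,g)^0$ its identity component. Permutations. For $\sigma$ in the group $\mathbb{S}_m$ of permutations of $\{1,\dots,m\}$ put $T_\sigma(p)(x_k)=p(x_{\sigma(k)})$. $\mathrm{Perm}(\mathcal{E})$ is the group of diffeomorphisms of $\mathcal{E}$ of the form $T_\sigma$ (with $T_\sigma(\mathcal{E})=\mathcal{E}$); when $F$ is injective it is identified with a subgroup of $\mathbb{S}_m$ via $T_\sigma\mapsto\sigma^{-1}$. *)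

(* Defs.v *)
From HB Require Import structures.
From mathcomp Require Import all_boot all_order all_algebra all_fingroup.
From mathcomp Require Import generic_quotient ring_quotient archimedean.
From mathcomp Require Import all_classical all_reals all_analysis.

Set Implicit Arguments.
Unset Strict Implicit.
Unset Printing Implicit Defensive.

Import Order.TTheory GRing.Theory Num.Theory.
Import numFieldNormedType.Exports.

Local Open Scope classical_set_scope.
Local Open Scope ring_scope.
Local Open Scope quotient_scope.

Section Calculus.
Context {R : realType}.

(* The domain A is meant to be open. *)
Fixpoint Ck_on {V W : normedModType R} (k : nat) (A : set V) (f : V -> W)
    {struct k} : Prop :=
  if k is k'.+1 then
    (forall x, A x -> differentiable f x) /\
    (forall v, Ck_on k' A (fun x => 'd f x v))
  else forall x, A x -> {for x, continuous f}.

Definition smooth_on {V W : normedModType R} (A : set V) (f : V -> W) : Prop :=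
  forall k, Ck_on k A f.

(* The sum of a multi-index series is taken as the limit of its partial sums
   over the cubes [0,N)^d; absolute convergence is required separately, so the
   order of summation is immaterial. *)
Definition real_analytic_on {d : nat} (A : set 'rV[R]_d) (f : 'rV[R]_d -> R) :
    Prop :=
  forall x, A x -> exists (a : ('I_d -> nat) -> R) (r : R), 0 < r /\
    forall v : 'rV[R]_d, `|v| < r ->
      let term (N : nat) (al : {ffun 'I_d -> 'I_N}) :=
        a (fun i => al i : nat) * \prod_i v 0 i ^+ al i in
      (exists B, forall N, \sum_al `|term N al| <= B) /\
      (\sum_al term N al) @[N --> \oo] --> f (x + v).

(* C^n is R^(n+n), the vector x + iy being row_mx x y. *)
Definition mulI {n : nat} (v : 'rV[R]_(n + n)) : 'rV[R]_(n + n) :=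
  row_mx (- rsubmx v) (lsubmx v).

Definition holomorphic_on {n : nat} (A : set 'rV[R]_(n + n))
    (f : 'rV[R]_(n + n) -> 'rV[R]_(n + n)) : Prop :=
  smooth_on A f /\ forall x v, A x -> 'd f x (mulI v) = mulI ('d f x v).

End Calculus.

(* A partial homeomorphism from the subset dom of T onto the subset
   fwd @` dom of R^d, with inverse bwd; fwd and bwd are arbitrary elsewhere. *)
Record chart (R : realType) (T : Type) (d : nat) := Chart {
  dom : set T;
  fwd : T -> 'rV[R]_d;
  bwd : 'rV[R]_d -> T }.

HB.instance Definition _ R T d := gen_eqMixin (@chart R T d).
HB.instance Definition _ R T d := gen_choiceMixin (@chart R T d).

Definition cimage (R : realType) T d (c : chart R T d) : set 'rV[R]_d :=
  fwd c @` dom c.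

Record charted (R : realType) (d : nat) := Charted {
  points :> topologicalType;
  atlas : set (chart R points d) }.

Section Manifold.
Context {R : realType}.

(* A fixed choice of a chart around p. The tangent space at p is identified
   with R^d through this chart: a tangent vector is represented by its
   components in chart_at p. *)
Definition chart_at {d} {M : charted R d} (p : M) : chart R M d :=
  xget (Chart set0 (fun=> 0) (fun=> p)) [set c | atlas c /\ dom c p].

Definition good_chart {d} {M : charted R d} (c : chart R M d) : Prop :=
  [/\ open (dom c), open (cimage c),
      (forall p, dom c p -> {for p, continuous (fwd c)}),
      (forall x, cimage c x -> {for x, continuous (bwd c)}) &
      (forall p, dom c p -> bwd c (fwd c p) = p)].

Definition complex_manifold {n} (M : charted R (n + n)) : Prop :=
  [/\ hausdorff_space M, @second_countable M,
      (forall p : M, exists2 c, atlas c & dom c p),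
      (forall c : chart R M (n + n), atlas c -> good_chart c) &
      (forall c c' : chart R M (n + n), atlas c -> atlas c' ->
        holomorphic_on (cimage c `&` bwd c @^-1` dom c') (fwd c' \o bwd c))].

(* U is meant to be open. *)
Definition smooth_map_on {d d'} {M : charted R d} {M' : charted R d'}
    (U : set M) (f : M -> M') : Prop :=
  (forall p, U p -> {for p, continuous f}) /\
  forall (c : chart R M d) (c' : chart R M' d'), atlas c -> atlas c' ->
    smooth_on (cimage c `&` bwd c @^-1` (U `&` f @^-1` dom c'))
      (fwd c' \o f \o bwd c).

Definition smooth_fun {d} {M : charted R d} {W : normedModType R}
    (f : M -> W) : Prop :=
  forall c : chart R M d, atlas c -> smooth_on (cimage c) (f \o bwd c).

Definition smooth_curve {d} {M : charted R d} (gamma : R -> M) : Prop :=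
  continuous gamma /\
  forall c : chart R M d, atlas c ->
    smooth_on (gamma @^-1` dom c) (fwd c \o gamma : R^o -> _).

Definition dfun {d} {M : charted R d} {W : normedModType R} (f : M -> W)
    (p : M) (v : 'rV[R]_d) : W :=
  'd (f \o bwd (chart_at p)) (fwd (chart_at p) p) v.

Definition dmap {d d'} {M : charted R d} {M' : charted R d'} (f : M -> M')
    (p : M) (v : 'rV[R]_d) : 'rV[R]_d' :=
  'd (fwd (chart_at (f p)) \o f \o bwd (chart_at p)) (fwd (chart_at p) p) v.

Definition velocity {d} {M : charted R d} (gamma : R -> M) (t : R) :
    'rV[R]_d :=
  derive1 (fwd (chart_at (gamma t)) \o gamma) t.

(* A field of bilinear forms, resp. of vectors, given at p by its components
   in chart_at p; tensor_in and field_in give the components in the chart c,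
   at the point with coordinates x. *)
Definition tensor2 {d} (M : charted R d) := M -> 'rV[R]_d -> 'rV[R]_d -> R.
Definition vfield {d} (M : charted R d) := M -> 'rV[R]_d.

Definition tensor_in {d} {M : charted R d} (g : tensor2 M) (c : chart R M d)
    (x u v : 'rV[R]_d) : R :=
  let p := bwd c x in
  let push := 'd (fwd (chart_at p) \o bwd c) x in
  g p (push u) (push v).

Definition field_in {d} {M : charted R d} (X : vfield M) (c : chart R M d)
    (x : 'rV[R]_d) : 'rV[R]_d :=
  let p := bwd c x in
  'd (fwd c \o bwd (chart_at p)) (fwd (chart_at p) p) (X p).

Definition smooth_tensor {d} {M : charted R d} (g : tensor2 M) : Prop :=
  forall c : chart R M d, atlas c -> forall u v,
    smooth_on (cimage c) (fun x => tensor_in g c x u v : R^o).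

Definition smooth_field {d} {M : charted R d} (X : vfield M) : Prop :=
  forall c : chart R M d, atlas c -> smooth_on (cimage c) (field_in X c).

Definition riemannian {d} {M : charted R d} (g : tensor2 M) : Prop :=
  [/\ (forall p a u u' v, g p (a *: u + u') v = a * g p u v + g p u' v),
      (forall p u v, g p u v = g p v u),
      (forall p u, u != 0 -> 0 < g p u u) &
      smooth_tensor g].

(* dw (u, v, w) = 0 for constant u, v, w in each chart. *)
Definition closed_form {d} {M : charted R d} (om : tensor2 M) : Prop :=
  forall c : chart R M d, atlas c -> forall x, cimage c x -> forall u v w,
    'd (fun y => tensor_in om c y v w : R^o) x u
    + 'd (fun y => tensor_in om c y w u : R^o) x v
    + 'd (fun y => tensor_in om c y u v : R^o) x w = 0.

(* The components of the Lie derivative of g along X in each chart are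
   X^k d_k g_ij + g_kj d_i X^k + g_ik d_j X^k. *)
Definition killing {d} {M : charted R d} (g : tensor2 M) (X : vfield M) :
    Prop :=
  forall c : chart R M d, atlas c -> forall x, cimage c x -> forall u v,
    'd (fun y => tensor_in g c y u v : R^o) x (field_in X c x)
    + tensor_in g c x ('d (field_in X c) x u) v
    + tensor_in g c x u ('d (field_in X c) x v) = 0.

Definition isometric {d d'} {M : charted R d} {M' : charted R d'}
    (g : tensor2 M) (g' : tensor2 M') (f : M -> M') : Prop :=
  forall p u v, g' (f p) (dmap f p u) (dmap f p v) = g p u v.

Definition holomorphic_map {n n'} {M : charted R (n + n)}
    {M' : charted R (n' + n')} (f : M -> M') : Prop :=
  smooth_map_on setT f /\ forall p v, dmap f p (mulI v) = mulI (dmap f p v).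

(* Charts being holomorphic, the complex structure I is mulI at each point. *)
Definition kahler_form {n} {M : charted R (n + n)} (g : tensor2 M) :
    tensor2 M :=
  fun p u v => g p (mulI u) v.

Definition kahler_manifold {n} (M : charted R (n + n)) (g : tensor2 M) :
    Prop :=
  [/\ complex_manifold M, riemannian g,
      (forall p u v, g p (mulI u) (mulI v) = g p u v) &
      closed_form (kahler_form g)].

Definition hamiltonian {n} {M : charted R (n + n)} (g : tensor2 M)
    (f : M -> R) (X : vfield M) : Prop :=
  forall p v, kahler_form g p (X p) v = dfun (f : M -> R^o) p v.

Definition kahler_function {n} {M : charted R (n + n)} (g : tensor2 M)
    (f : M -> R) : Prop :=
  smooth_fun (f : M -> R^o) /\
  exists X : vfield M, [/\ smooth_field X, hamiltonian g f X & killing g X].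

Definition Aut {n} {M : charted R (n + n)} (g : tensor2 M) :
    set {compact-open, M -> M} :=
  [set phi | [/\ holomorphic_map phi, isometric g g phi &
    exists psi : M -> M,
      [/\ cancel phi psi, cancel psi phi & holomorphic_map psi]]].

Definition Aut0 {n} {M : charted R (n + n)} (g : tensor2 M) :
    set {compact-open, M -> M} :=
  connected_component (Aut g) (id : {compact-open, M -> M}).

Definition curve_length {d} {M : charted R d} (g : tensor2 M)
    (gamma : R -> M) : \bar R :=
  \int[lebesgue_measure]_(t in `[0, 1])
    (Num.sqrt (g (gamma t) (velocity gamma t) (velocity gamma t)))%:E.

Definition riemannian_dist {d} {M : charted R d} (g : tensor2 M) (p q : M) :
    \bar R :=
  ereal_inf [set curve_length g gamma | gamma in
    [set gamma | [/\ smooth_curve gamma, gamma 0 = p & gamma 1 = q]]].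

Definition complete_metric {d} {M : charted R d} (g : tensor2 M) : Prop :=
  forall u : nat -> M,
    (forall e : R, 0 < e -> exists k, forall i j, (k <= i)%N -> (k <= j)%N ->
      (riemannian_dist g (u i) (u j) < e%:E)%E) ->
    exists l : M, u @ \oo --> l.

Definition analytic_tensor {d} {M : charted R d} (g : tensor2 M) : Prop :=
  forall c : chart R M d, atlas c -> forall u v,
    real_analytic_on (cimage c) (fun x => tensor_in g c x u v).

Definition simply_connected (T : topologicalType) : Prop :=
  (forall p q : T, exists gamma : R -> T,
     [/\ {within `[0, 1], continuous gamma}, gamma 0 = p & gamma 1 = q]) /\
  (forall gamma : R -> T, {within `[0, 1], continuous gamma} ->
     gamma 0 = gamma 1 ->
     exists H : R * R -> T,
       {within `[0, 1] `*` `[0, 1], continuous H} /\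
       forall s, s \in `[0, 1] ->
         [/\ H (s, 0) = gamma s, H (s, 1) = gamma 0,
             H (0, s) = gamma 0 & H (1, s) = gamma 0]).

End Manifold.

Arguments simply_connected R T : clear implicits.

Section Toric.
Context {R : realType}.

Definition intvec {n} : {pred 'rV[R]_n} :=
  fun v => [forall k, v 0 k \is a Num.int].

Lemma intvec_zmod_closed n : zmod_closed (@intvec n).
Proof.
split=> [|u v /forallP uZ /forallP vZ]; apply/forallP => k.
  by rewrite mxE rpred0.
by rewrite !mxE rpredB.
Qed.

HB.instance Definition _ n :=
  GRing.isZmodClosed.Build 'rV[R]_n (@intvec n) (@intvec_zmod_closed n).

Definition torus (n : nat) : zmodType :=
  Quotient.quot (@intvec n : zmodClosed 'rV[R]_n).

Definition to_torus {n} (t : 'rV[R]_n) : torus n := \pi_(Quotient.quot (@intvec n : zmodClosed 'rV[R]_n)) t.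

Definition torus_repr {n} (a : torus n) : 'rV[R]_n :=
  repr (a : Quotient.quot (@intvec n : zmodClosed 'rV[R]_n)).

Definition inner {n} (x y : 'rV[R]_n) : R := \sum_k x 0 k * y 0 k.

(* Smoothness on T^n x N is smoothness of the lift to R^n x N. *)
Definition smooth_action {n d} {N : charted R d} (Phi : torus n -> N -> N) :
    Prop :=
  [/\ (forall p, Phi 0 p = p),
      (forall a b p, Phi (a + b) p = Phi a (Phi b p)),
      continuous (fun z : 'rV[R]_n * N => Phi (to_torus z.1) z.2) &
      forall c c' : chart R N d, atlas c -> atlas c' ->
        smooth_on
          [set z : 'rV[R]_n * 'rV[R]_d | cimage c z.2 /\
             dom c' (Phi (to_torus z.1) (bwd c z.2))]
          (fun z => fwd c' (Phi (to_torus z.1) (bwd c z.2)))].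

Definition fundamental_field {n d} {N : charted R d} (Phi : torus n -> N -> N)
    (xi : 'rV[R]_n) : vfield N :=
  fun p => derive1 (fun t : R => fwd (chart_at p) (Phi (to_torus (t *: xi)) p)) 0.

Definition momentum_map {n} {N : charted R (n + n)} (g : tensor2 N)
    (Phi : torus n -> N -> N) (J : N -> 'rV[R]_n) : Prop :=
  [/\ smooth_fun J,
      (forall a p, J (Phi a p) = J p) &
      forall xi p v, kahler_form g p (fundamental_field Phi xi p) v =
        dfun (fun q => inner (J q) xi : R^o) p v].

Definition kahler_toric {n} (N : charted R (n + n)) (g : tensor2 N)
    (Phi : torus n -> N -> N) : Prop :=
  [/\ kahler_manifold g, connected [set: N] /\ compact [set: N],
      smooth_action Phi /\ (forall a, Aut g (Phi a)),
      (forall a, (forall p, Phi a p = p) -> a = 0) &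
      exists J, momentum_map g Phi J].

Definition free_points {n d} {N : charted R d} (Phi : torus n -> N -> N) :
    set N :=
  [set p | forall a, Phi a p = p -> a = 0].

End Toric.

Arguments torus R n : clear implicits.

Section ExponentialFamily.
Context {R : realType}.

Definition exp_density {m n} (C : 'I_m -> R) (F : 'I_n -> 'I_m -> R)
    (psi : 'rV[R]_n -> R) (th : 'rV[R]_n) : {ptws 'I_m -> R} :=
  fun x => expR (C x + \sum_k th 0 k * F k x - psi th).

(* m and n are the cardinality of the sample space and the dimension. *)
Record expfam (m n : nat) := ExpFam {
  ef_C : 'I_m -> R;
  ef_F : 'I_n -> 'I_m -> R;
  ef_psi : 'rV[R]_n -> R;
  ef_sum1 : forall th, \sum_x exp_density ef_C ef_F ef_psi th x = 1;
  ef_indep : forall (a0 : R) (a : 'I_n -> R),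
    (forall x, a0 + \sum_k a k * ef_F k x = 0) ->
    a0 = 0 /\ forall k, a k = 0 }.

Definition dens {m n} (E : expfam m n) (th : 'rV[R]_n) : {ptws 'I_m -> R} :=
  exp_density (ef_C E) (ef_F E) (ef_psi E) th.

Definition expect {m} (p X : 'I_m -> R) : R := \sum_x X x * p x.

Definition prob_functions m : set {ptws 'I_m -> R} :=
  [set p | (forall x, 0 <= p x) /\ \sum_x p x = 1].

Definition closure_fam {m n} (E : expfam m n) : set {ptws 'I_m -> R} :=
  @prob_functions m `&` closure (range (dens E)).

Definition estimator {m n} (E : expfam m n) (x : 'I_m) : 'rV[R]_n :=
  \row_k ef_F E k x.

Definition affine_rv {m n} (E : expfam m n) : set ('I_m -> R) :=
  [set X | exists (a0 : R) (a : 'I_n -> R),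
     forall x, X x = a0 + \sum_k a k * ef_F E k x].

Definition score {m n} (E : expfam m n) (th : 'rV[R]_n) (i : 'I_n)
    (x : 'I_m) : R :=
  'D_(delta_mx 0 i) (fun th => ln (dens E th x) : R^o) th.

Definition fisher {m n} (E : expfam m n) (th u v : 'rV[R]_n) : R :=
  \sum_i \sum_j u 0 i * v 0 j *
    expect (dens E th) (fun x => score E th i x * score E th j x).

Definition permute {m} (s : 'S_m) (p : 'I_m -> R) : 'I_m -> R :=
  fun k => p (s k).

(* T_s is a diffeomorphism of E, written in the global chart theta. *)
Definition Tperm_diffeo {m n} (E : expfam m n) (s : 'S_m) : Prop :=
  exists al be : 'rV[R]_n -> 'rV[R]_n,
    [/\ smooth_on setT al, smooth_on setT be, cancel al be, cancel be al &
        forall th, permute s (dens E th) = dens E (al th)].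

(* Perm(E) is seen in S_m through T_sigma |-> sigma^-1. *)
Definition PermE {m n} (E : expfam m n) : set 'S_m :=
  [set s | Tperm_diffeo E (s^-1)%g].

End ExponentialFamily.

Arguments expfam R m n : clear implicits.

Section Torification.
Context {R : realType}.

(* Vector fields on E are written in the affine coordinates theta, in which
   the exponential connection is the ordinary derivative. *)
Definition parallel {n} (Y : 'rV[R]_n -> 'rV[R]_n) : Prop :=
  smooth_on setT Y /\ forall th v, 'd Y th v = 0.

Definition parallel_frame {n} (Y : 'I_n -> 'rV[R]_n -> 'rV[R]_n) : Prop :=
  (forall i, parallel (Y i)) /\
  (forall th, (\matrix_i Y i th) \in unitmx).

(* TE is R^(n+n) with coordinates row_mx theta theta'; this is the map
   u |-> u + \sum_i t_i Y_i of TE. *)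
Definition translate {n} (Y : 'I_n -> 'rV[R]_n -> 'rV[R]_n) (t : 'rV[R]_n)
    (u : 'rV[R]_(n + n)) : 'rV[R]_(n + n) :=
  row_mx (lsubmx u) (rsubmx u + \sum_i t 0 i *: Y i (lsubmx u)).

Definition TE_metric {m n} (E : expfam R m n) (u v w : 'rV[R]_(n + n)) : R :=
  fisher E (lsubmx u) (lsubmx v) (lsubmx w)
  + fisher E (lsubmx u) (rsubmx v) (rsubmx w).

(* u and u' are in the same orbit of Gamma(L), for the lattice L with
   generator Y. *)
Definition lattice_rel {n} (Y : 'I_n -> 'rV[R]_n -> 'rV[R]_n) :
    rel 'rV[R]_(n + n) :=
  fun u u' => `[< exists2 k, k \in intvec & u' = translate Y k u >].

Lemma translateD {n} (Y : 'I_n -> 'rV[R]_n -> 'rV[R]_n) s t u :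
  translate Y s (translate Y t u) = translate Y (s + t) u.
Proof.
rewrite /translate row_mxKl row_mxKr -addrA -big_split /=.
congr (row_mx _ (_ + _)); apply: eq_bigr => i _.
by rewrite mxE scalerDl addrC.
Qed.

Lemma translate0 {n} (Y : 'I_n -> 'rV[R]_n -> 'rV[R]_n) u :
  translate Y 0 u = u.
Proof.
rewrite /translate big1 ?addr0 ?hsubmxK// => i _.
by rewrite mxE scale0r.
Qed.

Lemma lattice_rel_refl {n} (Y : 'I_n -> 'rV[R]_n -> 'rV[R]_n) :
  reflexive (lattice_rel Y).
Proof.
by move=> u; apply/asboolP; exists 0; [exact: rpred0|rewrite translate0].
Qed.

Lemma lattice_rel_sym {n} (Y : 'I_n -> 'rV[R]_n -> 'rV[R]_n) :
  symmetric (lattice_rel Y).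
Proof.
move=> u v; apply/idP/idP => /asboolP[k kZ ->]; apply/asboolP;
  by exists (- k); rewrite ?rpredN// translateD addNr translate0.
Qed.

Lemma lattice_rel_trans {n} (Y : 'I_n -> 'rV[R]_n -> 'rV[R]_n) :
  transitive (lattice_rel Y).
Proof.
move=> v u w /asboolP[k kZ ->] /asboolP[l lZ ->]; apply/asboolP.
by exists (l + k); [exact: rpredD|rewrite translateD].
Qed.

Canonical lattice_equiv {n} (Y : 'I_n -> 'rV[R]_n -> 'rV[R]_n) :=
  EquivRel (lattice_rel Y) (lattice_rel_refl Y) (lattice_rel_sym Y)
    (@lattice_rel_trans n Y).

Definition EL_space {n} (Y : 'I_n -> 'rV[R]_n -> 'rV[R]_n) : topologicalType :=
  quotient_topology {eq_quot (lattice_equiv Y)}.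

Definition qL {n} (Y : 'I_n -> 'rV[R]_n -> 'rV[R]_n) (u : 'rV[R]_(n + n)) :
    EL_space Y :=
  \pi_(quotient_topology {eq_quot (lattice_equiv Y)}) u.

Definition reprL {n} (Y : 'I_n -> 'rV[R]_n -> 'rV[R]_n) (x : EL_space Y) :
    'rV[R]_(n + n) :=
  repr (x : quotient_topology {eq_quot (lattice_equiv Y)}).

(* The charts of E_L are the continuous local sections of the covering qL. *)
Definition EL {n} (Y : 'I_n -> 'rV[R]_n -> 'rV[R]_n) : charted R (n + n) :=
  Charted [set c : chart R (EL_space Y) (n + n) |
    [/\ open (dom c), bwd c = qL Y,
        (forall p, dom c p -> {for p, continuous (fwd c)}) &
        (forall p, dom c p -> qL Y (fwd c p) = p)]].

Definition EL_metric {m n} (E : expfam R m n)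
    (Y : 'I_n -> 'rV[R]_n -> 'rV[R]_n) : tensor2 (EL Y) :=
  fun p => TE_metric E (fwd (chart_at p) p).

(* EL_proj, EL_action are defined on representatives; EL_projE, EL_actionE
   show that the choice does not matter. *)
Definition EL_proj {m n} (E : expfam R m n)
    (Y : 'I_n -> 'rV[R]_n -> 'rV[R]_n) (x : EL Y) : {ptws 'I_m -> R} :=
  dens E (lsubmx (reprL x)).

Definition EL_action {n} (Y : 'I_n -> 'rV[R]_n -> 'rV[R]_n) (a : torus R n)
    (x : EL Y) : EL Y :=
  qL Y (translate Y (torus_repr a) (reprL x)).

Lemma qL_reprL {n} (Y : 'I_n -> 'rV[R]_n -> 'rV[R]_n) u :
  exists2 k, k \in intvec & reprL (qL Y u) = translate Y k u.
Proof.
suff : lattice_rel Y u (reprL (qL Y u)) by move=> /asboolP.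
apply/eqmodP; rewrite /reprL /qL.
exact/esym/(@reprK _ (quotient_topology {eq_quot (lattice_equiv Y)})).
Qed.

Lemma EL_projE {m n} (E : expfam R m n) (Y : 'I_n -> 'rV[R]_n -> 'rV[R]_n) u :
  EL_proj E (qL Y u) = dens E (lsubmx u).
Proof.
by rewrite /EL_proj; have [k _ ->] := qL_reprL Y u; rewrite row_mxKl.
Qed.

Lemma torus_reprK {n} (t : 'rV[R]_n) :
  exists2 k, k \in intvec & torus_repr (to_torus t) = k + t.
Proof.
exists (torus_repr (to_torus t) - t); last by rewrite subrK.
rewrite /torus_repr /to_torus.
by rewrite (@Quotient.idealrBE _ (@intvec R n)) reprK.
Qed.

Lemma qL_translate {n} (Y : 'I_n -> 'rV[R]_n -> 'rV[R]_n) k u :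
  k \in intvec -> qL Y (translate Y k u) = qL Y u.
Proof.
move=> kZ; apply/esym/eqmodP; apply/asboolP.
by exists k.
Qed.

Lemma EL_actionE {n} (Y : 'I_n -> 'rV[R]_n -> 'rV[R]_n) t u :
  EL_action (to_torus t) (qL Y u) = qL Y (translate Y t u).
Proof.
rewrite /EL_action; have [k kZ ->] := qL_reprL Y u.
have [l lZ ->] := torus_reprK t.
by rewrite translateD addrAC -translateD qL_translate ?rpredD.
Qed.

(* (L, Y, G) witnesses that (N, Phi) is a torification of E, L being the
   lattice generated by Y. *)
Definition torification_by {m n} (E : expfam R m n) (N : charted R (n + n))
    (g : tensor2 N) (Phi : torus R n -> N -> N)
    (Y : 'I_n -> 'rV[R]_n -> 'rV[R]_n) (G : EL Y -> N) : Prop :=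
  [/\ parallel_frame Y,
      holomorphic_map G /\ isometric (EL_metric E (Y:=Y)) g G,
      range G = free_points Phi,
      (exists2 H : N -> EL Y, cancel G H & smooth_map_on (free_points Phi) H) &
      forall a x, G (EL_action a x) = Phi a (G x)].

Definition torification {m n} (E : expfam R m n) (N : charted R (n + n))
    (g : tensor2 N) (Phi : torus R n -> N -> N) : Prop :=
  exists Y G, @torification_by m n E N g Phi Y G.

Definition regular_torification {m n} (E : expfam R m n)
    (N : charted R (n + n)) (g : tensor2 N) (Phi : torus R n -> N -> N) :
    Prop :=
  [/\ torification E g Phi, connected [set: N], simply_connected R N,
      complete_metric g & analytic_tensor g].

(* kappa is the map pi_L \o G^-1 on free_points Phi = range G; its values
   outside this set are irrelevant. *)
Definition compatible_projection {m n} (E : expfam R m n)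
    (N : charted R (n + n)) (g : tensor2 N) (Phi : torus R n -> N -> N)
    (kappa : N -> {ptws 'I_m -> R}) : Prop :=
  exists Y G, @torification_by m n E N g Phi Y G /\
    forall x, kappa (G x) = EL_proj E x.

Definition natural_extension {m n} (E : expfam R m n)
    (N : charted R (n + n)) (Phi : torus R n -> N -> N)
    (kappa K : N -> {ptws 'I_m -> R}) : Prop :=
  [/\ continuous K, (forall p, closure_fam E (K p)) &
      (forall p, free_points Phi p -> K p = kappa p)].

End Torification.

(* Main.v *)
(* On the dense set of free points, [N] is the quotient of [TE] by a lattice.
   Pulled back to [TE] with coordinates z = theta + i theta', a Kahler function
   f satisfies f(z) Z(theta) = e(z)^* A e(z), where Z is the partition function,
   e(z) is the vector of the exponentials exp(<s, z> / 2) for s in the range of the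
   estimator, weighted by the base measure, and [A] is Hermitian: the
   Hamiltonian field is holomorphic, and the exponentials are linearly
   independent. Poisson brackets become commutators, and the diagonal matrices
   of Kahler functions are those of expectations of X in the span of the F_k
   and 1. Hamiltonian flows are complete by compactness and consist of
   automorphisms in the identity component; minimising the distance to a
   generic diagonal matrix along the orbits of these flows conjugates every
   Kahler function to one that commutes with it, hence to a diagonal one, which
   is (a). For (b), the expectations of the F_k and their images under an
   automorphism that carries X' to X are conjugated, keeping X fixed, so that the
   automorphism preserves the diagonal functions. It then acts on theta by an
   affine map; the partition function is transformed accordingly, and matching
   the exponentials in it yields the permutation. *)

From HB Require Import structures.
From mathcomp Require Import all_boot all_order all_algebra all_fingroup.
From mathcomp Require Import all_classical all_reals all_analysis.
From mathcomp Require Import ring lra complex generic_quotient ring_quotient.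
Require Import Defs.

Set Implicit Arguments.
Unset Strict Implicit.
Unset Printing Implicit Defensive.

Import Order.TTheory GRing.Theory Num.Theory.
Import numFieldNormedType.Exports.
Local Open Scope classical_set_scope.
Local Open Scope ring_scope.

(** * Smooth maps *)

(** The automorphism group is never given a Lie group structure. Its identity component enters
    through the automorphisms joined to the identity by a path, which include short flows and are
    closed under composition. They act linearly on the finite-dimensional space of coefficient
    matrices, where the conjugation becomes a statement on a Lie algebra with an invariant inner
    product. The obstacle is that this group of matrices is not known to be closed: an orbit need
    not be compact, and the distance to the diagonal matrix need not be attained on it. A best point
    is therefore taken in the closure of the orbit; it commutes with the diagonal matrix, and a
    quantitative local argument brings a true point of the orbit into its commutant, where the
    problem has smaller dimension. The compact manifold meets the explicit formulas on TE at two
    places: the density of the free points, and the momentum map, which extends the expectations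
    smoothly to all of N. *)

Section Differentiability.
Context {R : realType}.
Implicit Types V W : normedModType R.

Lemma diff_eps V W (f : V -> W) (x : V) : differentiable f x ->
  forall e, 0 < e ->
    \forall h \near (0 : V), `|f (x + h) - f x - 'd f x h| <= e * `|h|.
Proof.
move=> /diff_locally /eqaddoP fx e e0; have := fx e e0; apply: filterS => h.
by rewrite /= !fctE /= opprD addrA [h + x]addrC.
Qed.

Lemma eps_diff V W (f : V -> W) (x : V) (L : {linear V -> W}) : continuous L ->
  (forall e, 0 < e ->
    \forall h \near (0 : V), `|f (x + h) - f x - L h| <= e * `|h|) ->
  differentiable f x /\ 'd f x = L :> (V -> W).
Proof.
move=> Lc fL.
have fE : f \o shift x = cst (f x) + L +o_ 0 id.
  apply/eqaddoP => e e0; have := fL e e0; apply: filterS => h.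
  by rewrite /= !fctE /= opprD addrA [h + x]addrC.
have dE := diff_unique Lc fE; split => //.
by apply/diff_locallyP; rewrite dE.
Qed.

Lemma near0_shift V (x : V) (P : V -> Prop) :
  (\forall h \near (0 : V), P (x + h)) <-> \forall y \near x, P y.
Proof.
rewrite (near_shift x) sub0r; split; apply: filterS => y /=;
  by rewrite addrC subrK.
Qed.

Lemma near_eq_diff V W (f g : V -> W) (x : V) :
  (\forall y \near x, f y = g y) -> differentiable f x ->
  differentiable g x /\ 'd g x = 'd f x :> (V -> W).
Proof.
move=> fg df; apply: eps_diff; first exact: diff_continuous.
move=> e e0; have fgx := nbhs_singleton fg.
move/(near0_shift x) : fg => fg.
by have := diff_eps df e0; apply: filterS2 fg => h <-; rewrite fgx.
Qed.


Lemma mx_norm_entry m n (A : 'M[R]_(m, n)) i j : `|A i j| <= `|A|.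
Proof.
rewrite [leRHS]/Num.Def.normr/= mx_normrE.
exact: (le_bigmax _ (fun ij => `|A ij.1 ij.2|) (i, j)).
Qed.

Lemma mx_norm_le m n (A : 'M[R]_(m, n)) e : 0 <= e ->
  (forall i j, `|A i j| <= e) -> `|A| <= e.
Proof.
move=> e0 Ae; rewrite /Num.Def.normr/= mx_normrE.
by apply: bigmax_le => // -[i j] _ /=.
Qed.

Lemma entry_continuous m n (i : 'I_m) (j : 'I_n) :
  continuous (fun A : 'M[R]_(m, n) => A i j : R^o).
Proof.
exact: coord_continuous.
Qed.

Definition mklin V W (f : V -> W) (fP : linear f) : {linear V -> W} :=
  HB.pack f (GRing.isLinear.Build _ _ _ _ f fP).

Fact entry_is_linear m n i j :
  linear (fun A : 'M[R]_(m, n) => A i j : R^o).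
Proof. by move=> a A B; rewrite !mxE. Qed.

Lemma entry_diff V m n (f : V -> 'M[R]_(m, n)) (x : V) i j :
  differentiable f x ->
  differentiable (fun y => f y i j : R^o) x /\
  forall v, 'd (fun y => f y i j : R^o) x v = 'd f x v i j.
Proof.
move=> df.
pose L := mklin (@entry_is_linear m n i j).
have Lc : continuous L by apply: entry_continuous.
have [dL dLE] := (linear_differentiable (f x) Lc, diff_lin (f x) Lc).
split; first exact: (differentiable_comp df dL).
by move=> v; have /= -> := diff_comp df dL; rewrite /= dLE.
Qed.

Lemma mx_diff V m n (f : V -> 'M[R]_(m, n)) (x : V) :
  (forall i j, differentiable (fun y => f y i j : R^o) x) ->
  differentiable f x.
Proof.
move=> df.
pose L v := \matrix_(i, j) 'd (fun y => f y i j : R^o) x v : 'M[R]_(m, n).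
have Llin : linear L.
  by move=> a u v; apply/matrixP => i j; rewrite !mxE linearP.
suff : differentiable f x /\ 'd f x = mklin Llin :> (V -> _) by case.
apply: eps_diff.
  move=> v; apply/cvgrPdist_le => e e0.
  have : \forall t \near v, forall ij : 'I_m * 'I_n,
      `|L v ij.1 ij.2 - L t ij.1 ij.2| <= e.
    apply: filter_forall => -[i j]; rewrite !mxE /=.
    have dc : continuous ('d (fun y => f y i j : R^o) x).
      exact: diff_continuous.
    have /cvgrPdist_le := dc v.
    by move=> /(_ _ e0); apply: filterS => t; rewrite !mxE.
  apply: filterS => t Ht; apply: mx_norm_le (ltW e0) _ => i j.
  by have := Ht (i, j); rewrite !mxE.
move=> e e0.
have : \forall h \near (0 : V), forall ij : 'I_m * 'I_n,
    `|f (x + h) ij.1 ij.2 - f x ij.1 ij.2 - L h ij.1 ij.2| <= e * `|h|.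
  apply: filter_forall => -[i j]; have := diff_eps (df i j) e0.
  by apply: filterS => h; rewrite !mxE.
apply: filterS => h Ht; apply: mx_norm_le => [|i j].
  by rewrite mulr_ge0 // ltW.
by have := Ht (i, j); rewrite !mxE.
Qed.

End Differentiability.

Section CkTheory.
Context {R : realType}.
Implicit Types V W U : normedModType R.

Lemma Ck_on_sub V W k (A B : set V) (f : V -> W) :
  B `<=` A -> Ck_on k A f -> Ck_on k B f.
Proof.
elim: k f => [|k IH] f BA; first by move=> fA x /BA; exact: fA.
by move=> [df fA]; split => [x /BA|v]; [exact: df | exact: (IH _ BA (fA v))].
Qed.

Lemma Ck_on_cover V W k (A : set V) (f : V -> W) :
  (forall x, A x -> exists2 B, B x & Ck_on k B f) -> Ck_on k A f.
Proof.
elim: k f => [|k IH] f fA; first by move=> x /fA[B Bx]; apply.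
split=> [x /fA[B Bx [+ _]]|v]; first by apply.
by apply: IH => x /fA[B Bx [_ /(_ v)]]; exists B.
Qed.

Lemma Ck_on_ext V W k (A : set V) (f g : V -> W) : open A ->
  (forall x, A x -> f x = g x) -> Ck_on k A f -> Ck_on k A g.
Proof.
move=> oA; have nA x : A x -> nbhs x A by move=> Ax; apply: open_nbhs_nbhs.
elim: k f g => [|k IH] f g fg /=.
  move=> fA x Ax; have fx := fA x Ax.
  have : f @ x --> g x by rewrite -(fg x Ax); exact: fx.
  by apply: cvg_trans; apply: near_eq_cvg; apply: filterS (nA x Ax) => y /fg.
have dg x : A x -> differentiable f x -> differentiable g x /\
    'd g x = 'd f x :> (V -> W).
  by move=> Ax; apply: near_eq_diff; apply: filterS (nA x Ax) => y /fg.
move=> [df fA]; split => [x Ax|v]; first by have [] := dg x Ax (df x Ax).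
apply: IH (fA v) => x Ax.
by have [_ ->] := dg x Ax (df x Ax).
Qed.

Lemma Ck_onW V W k (A : set V) (f : V -> W) : Ck_on k.+1 A f -> Ck_on k A f.
Proof.
elim: k f => [|k IH] f.
  by move=> [df _] x Ax; apply/differentiable_continuous/df.
by move=> [df fA]; split => // v; apply: IH.
Qed.

Lemma smooth_on_continuous V W (A : set V) (f : V -> W) x :
  smooth_on A f -> A x -> {for x, continuous f}.
Proof. by move=> /(_ 0%N) fA Ax; exact: fA. Qed.

Lemma smooth_on_diff V W (A : set V) (f : V -> W) x :
  smooth_on A f -> A x -> differentiable f x.
Proof. by move=> /(_ 1%N)[+ _]; apply. Qed.

Lemma smooth_on_d V W (A : set V) (f : V -> W) v :
  smooth_on A f -> smooth_on A (fun x => 'd f x v).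
Proof. by move=> fA k; have [_ +] := fA k.+1; apply. Qed.

Lemma Ck_on_cst V W k (A : set V) (a : W) : Ck_on k A (fun=> a).
Proof.
elim: k A a => [|k IH] A a /=; first by move=> x _; apply: cst_continuous.
split=> [x _|v]; first exact: differentiable_cst.
suff -> : (fun x => 'd (fun=> a) x v) = (fun=> 0 : W) by [].
by apply/funext => x; have /= := @diff_cst _ V W a x; rewrite /cst => ->.
Qed.

Lemma dD V W (f g : V -> W) x v : differentiable f x -> differentiable g x ->
  'd (fun y => f y + g y) x v = 'd f x v + 'd g x v.
Proof.
move=> df dg; have -> : (fun y => f y + g y) = f + g by [].
by rewrite diffD.
Qed.

Lemma dM V (f g : V -> R^o) x v : differentiable f x -> differentiable g x ->
  'd (fun y => f y * g y : R^o) x v = f x * 'd g x v + g x * 'd f x v.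
Proof.
move=> df dg.
have -> : (fun y => f y * g y : R^o) = (f : V -> R) * g by [].
by rewrite diffM.
Qed.

Lemma dcompE V W U (f : V -> W) (g : W -> U) x v : differentiable f x ->
  differentiable g (f x) ->
  'd (fun y => g (f y)) x v = 'd g (f x) ('d f x v).
Proof.
move=> df dg; have -> : (fun y => g (f y)) = g \o f by [].
by rewrite diff_comp.
Qed.

Lemma Ck_onD V W k (A : set V) (f g : V -> W) : open A ->
  Ck_on k A f -> Ck_on k A g -> Ck_on k A (fun x => f x + g x).
Proof.
move=> oA; elim: k f g => [|k IH] f g /=.
  by move=> fA gA x Ax; apply: continuousD; [exact: fA | exact: gA].
move=> [df fA] [dg gA]; split => [x Ax|v].
  by apply: differentiableD; [exact: df | exact: dg].
apply: (@Ck_on_ext _ _ _ _ (fun x => 'd f x v + 'd g x v)) => //; last exact: IH.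
by move=> x Ax; rewrite dD; [| exact: df | exact: dg].
Qed.

Lemma Ck_onM V k (A : set V) (f g : V -> R^o) : open A ->
  Ck_on k A f -> Ck_on k A g -> Ck_on k A (fun x => f x * g x : R^o).
Proof.
move=> oA; elim: k f g => [|k IH] f g /=.
  by move=> fA gA x Ax; apply: continuousM; [exact: fA | exact: gA].
move=> fAS gAS; have [[df fA] [dg gA]] := (fAS, gAS); split => [x Ax|v].
  by apply: differentiableM; [exact: df | exact: dg].
apply: (@Ck_on_ext _ _ _ _ (fun x => f x * 'd g x v + g x * 'd f x v : R^o)) => //.
  by move=> x Ax; rewrite dM; [| exact: df | exact: dg].
exact: (Ck_onD oA (IH _ _ (Ck_onW fAS) (gA v)) (IH _ _ (Ck_onW gAS) (fA v))).
Qed.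

Lemma Ck_on_lin V W U k (A : set V) (f : V -> W) (L : {linear W -> U}) :
  open A -> continuous L -> Ck_on k A f -> Ck_on k A (fun x => L (f x)).
Proof.
move=> oA Lc; elim: k f => [|k IH] f /=.
  by move=> fA x Ax; apply: continuous_comp; [exact: fA | exact: Lc].
move=> [df fA]; have dL y := linear_differentiable y Lc.
split => [x Ax|v].
  exact: (differentiable_comp (df x Ax) (dL _)).
apply: (@Ck_on_ext _ _ _ _ (fun x => L ('d f x v))) => //; last exact: IH.
by move=> x Ax; have /= -> := diff_comp (df x Ax) (dL (f x)); rewrite diff_lin.
Qed.

Lemma Ck_on_id V k (A : set V) : Ck_on k A (id : V -> V).
Proof.
case: k => [x _|k]; first exact: cvg_id.
split=> [x _|v]; first exact: differentiable_id || exact: ex_diff.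
suff -> : (fun x : V => 'd id x v) = (fun=> v) by apply: Ck_on_cst.
by apply/funext => x; rewrite diff_val.
Qed.

Lemma Ck_on_linear V U k (A : set V) (L : {linear V -> U}) :
  open A -> continuous L -> Ck_on k A (L : V -> U).
Proof. by move=> oA Lc; apply: (Ck_on_lin oA Lc); apply: Ck_on_id. Qed.

Lemma Ck_on_entry V m n k (A : set V) (f : V -> 'M[R]_(m, n)) i j : open A ->
  Ck_on k A f -> Ck_on k A (fun x => f x i j : R^o).
Proof.
move=> oA.
exact: (Ck_on_lin (L := mklin (@entry_is_linear R m n i j)) oA
  (@entry_continuous R m n i j)).
Qed.

Lemma Ck_on_mx V m n k (A : set V) (f : V -> 'M[R]_(m, n)) : open A ->
  (forall i j, Ck_on k A (fun x => f x i j : R^o)) -> Ck_on k A f.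
Proof.
move=> oA; elim: k f => [|k IH] f fA.
  move=> x Ax; apply/cvgrPdist_le => e e0.
  have : \forall t \near x, forall ij : 'I_m * 'I_n,
      `|f x ij.1 ij.2 - f t ij.1 ij.2| <= e.
    apply: filter_forall => -[i j] /=.
    by have /cvgrPdist_le := fA i j x Ax; apply.
  apply: filterS => t Ht; apply: mx_norm_le (ltW e0) _ => i j.
  by have := Ht (i, j); rewrite !mxE.
have df x : A x -> differentiable f x.
  by move=> Ax; apply: mx_diff => i j; have [+ _] := fA i j; apply.
split=> // v; apply: IH => i j.
have [_ /(_ v)] := fA i j; apply: Ck_on_ext => // x Ax.
by have [_ ->] := entry_diff i j (df x Ax).
Qed.

Lemma Ck_on_sum V (I : finType) k (A : set V) (f : I -> V -> R^o) : open A ->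
  (forall i, Ck_on k A (f i)) -> Ck_on k A (fun x => \sum_i f i x : R^o).
Proof.
move=> oA fA; suff H (s : seq I) : Ck_on k A (fun x => \sum_(i <- s) f i x : R^o).
  by have := H (index_enum I).
elim: s => [|i s IH].
  apply: (Ck_on_ext oA _ (@Ck_on_cst _ _ k A (0 : R^o))) => x _.
  by rewrite big_nil.
apply: (Ck_on_ext oA _ (Ck_onD oA (fA i) IH)) => x _.
by rewrite big_cons.
Qed.

Lemma Ck_on_prod V (I : finType) k (A : set V) (f : I -> V -> R^o) : open A ->
  (forall i, Ck_on k A (f i)) -> Ck_on k A (fun x => \prod_i f i x : R^o).
Proof.
move=> oA fA; suff H (s : seq I) : Ck_on k A (fun x => \prod_(i <- s) f i x : R^o).
  by have := H (index_enum I).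
elim: s => [|i s IH].
  apply: (Ck_on_ext oA _ (@Ck_on_cst _ _ k A (1 : R^o))) => x _.
  by rewrite big_nil.
apply: (Ck_on_ext oA _ (Ck_onM oA (fA i) IH)) => x _.
by rewrite big_cons.
Qed.

(** [Ck_on] controls the derivative of [g] in constant directions only, so the moving direction
    ['d f x v] of the chain rule is expanded over the fixed basis [e]. *)
Lemma Ck_on_comp_basis V U d (e : 'I_d -> U) (co : 'I_d -> {linear U -> R^o})
    k (A : set V) (B : set U) (f : V -> U) (g : U -> R^o) :
  (forall u, u = \sum_i co i u *: e i) -> (forall i, continuous (co i)) ->
  open A -> (forall x, A x -> B (f x)) ->
  Ck_on k A f -> Ck_on k B g -> Ck_on k A (fun x => g (f x)).
Proof.
move=> coE coc oA AB; elim: k f g AB => [|k IH] f g AB.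
  move=> fA gB x Ax; apply: continuous_comp; first exact: fA.
  by apply: gB; apply: AB.
move=> fA gB; have [df fA'] := fA; have [dg gB'] := gB.
split=> [x Ax|v].
  by apply: differentiable_comp; [exact: df | apply: dg; apply: AB].
apply: (@Ck_on_ext _ _ _ _
    (fun x => \sum_i co i ('d f x v) * 'd g (f x) (e i) : R^o)) => //.
  move=> x Ax; have /= -> := diff_comp (df x Ax) (dg _ (AB x Ax)).
  rewrite /= [in RHS](coE ('d f x v)) linear_sum /=.
  by apply: eq_bigr => i _; rewrite linearZ.
apply: Ck_on_sum => // i; apply: Ck_onM => //; first exact: (Ck_on_lin oA (coc i) (fA' v)).
exact: (IH f (fun u => 'd g u (e i)) AB (Ck_onW fA) (gB' (e i))).
Qed.

Lemma Ck_on_comp V d k (A : set V) (B : set 'rV[R]_d) (f : V -> 'rV[R]_d)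
    (g : 'rV[R]_d -> R^o) :
  open A -> (forall x, A x -> B (f x)) ->
  Ck_on k A f -> Ck_on k B g -> Ck_on k A (fun x => g (f x)).
Proof.
apply: (@Ck_on_comp_basis _ _ d (fun i => delta_mx 0 i)
  (fun i => mklin (@entry_is_linear R 1 d 0 i))) => [u|i].
  by rewrite [LHS]row_sum_delta.
exact: entry_continuous.
Qed.

Lemma Ck_on_comp_mx V d m n k (A : set V) (B : set 'rV[R]_d) (f : V -> 'rV[R]_d)
    (g : 'rV[R]_d -> 'M[R]_(m, n)) :
  open A -> open B -> (forall x, A x -> B (f x)) ->
  Ck_on k A f -> Ck_on k B g -> Ck_on k A (fun x => g (f x)).
Proof.
move=> oA oB AB fA gB; apply: Ck_on_mx => // i j.
by apply: (Ck_on_comp (g := fun y => g y i j) oA AB fA); apply: Ck_on_entry.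
Qed.

Lemma Ck_on_comp1 V k (A : set V) (B : set R^o) (f : V -> R^o) (g : R^o -> R^o) :
  open A -> (forall x, A x -> B (f x)) ->
  Ck_on k A f -> Ck_on k B g -> Ck_on k A (fun x => g (f x)).
Proof.
have idl : linear (id : R^o -> R^o) by [].
apply: (@Ck_on_comp_basis V R^o 1 (fun=> 1) (fun=> mklin idl)) => [u|_].
  by rewrite big_ord1 /= /GRing.scale /= mulr1.
by move=> x; exact: cvg_id.
Qed.

End CkTheory.

(** * Mean value inequality and symmetry of second derivatives *)

Section MeanValue.
Context {R : realType}.
Implicit Types V W : normedModType R.

Lemma line_differentiable V (x v : V) (t : R^o) :
  differentiable (fun s : R^o => x + s *: v) t /\
  forall h, 'd (fun s : R^o => x + s *: v) t h = h *: v.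
Proof.
have dl : is_diff t (fun s : R^o => s *: v) (fun h => h *: v).
  exact: is_diff_scalel.
have dsv : differentiable (fun s : R^o => s *: v) t by exact: ex_diff.
have dc : differentiable (fun _ : R^o => x) t by exact: differentiable_cst.
split; first exact: (differentiableD dc dsv).
move=> h; have [_ dv] := dl; rewrite (dD h dc dsv) dv.
by rewrite (@diff_cst R R^o V x t) add0r.
Qed.

Lemma line_derive V W (f : V -> W) (x v : V) (t : R) :
  differentiable f (x + t *: v) ->
  is_derive t 1 (fun s : R => f (x + s *: v)) ('d f (x + t *: v) v).
Proof.
move=> df; have [dl dlE] := line_differentiable x v t.
have dfl := differentiable_comp dl df.
apply: DeriveDef; first exact: diff_derivable.
by rewrite deriveE// (dcompE (1 : R^o) dl df) dlE scale1r.
Qed.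

Lemma MVI_real V (f : V -> R^o) (x v : V) :
  (forall t, 0 <= t <= 1 -> differentiable f (x + t *: v)) ->
  exists2 t, 0 < t < 1 & f (x + v) - f x = 'd f (x + t *: v) v.
Proof.
move=> df.
have [||t /[!in_itv]/= t01] := @MVT R (fun s : R => f (x + s *: v))
    (fun s => 'd f (x + s *: v) v) 0 1 ltr01.
- move=> t /[!in_itv]/= /andP[t0 t1]; apply: line_derive; apply: df.
  by rewrite !ltW.
- apply: derivable_within_continuous => t /[!in_itv]/= t01.
  exact: (@ex_derive _ _ _ _ _ _ _ (line_derive (df t t01))).
- by rewrite scale1r scale0r addr0 subr0 mulr1; exists t.
Qed.

(** The norm is the largest absolute value of an entry, so the real mean value theorem may be used
    entry by entry, each with its own intermediate point. *)
Lemma MVI V m n (f : V -> 'M[R]_(m, n)) (x v : V) (M : R) :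
  (forall t, 0 <= t <= 1 -> differentiable f (x + t *: v)) ->
  (forall t, 0 < t < 1 -> `|'d f (x + t *: v) v| <= M) ->
  `|f (x + v) - f x| <= M.
Proof.
move=> df dM.
have M0 : 0 <= M.
  by apply: (le_trans (normr_ge0 _)); apply: (dM (1 / 2)); lra.
apply: mx_norm_le => // i j.
have dfij t (t01 : 0 <= t <= 1) := entry_diff i j (df t t01).
have [|t t01] := @MVI_real V (fun y => f y i j : R^o) x v.
  by move=> t /dfij[].
have t01' : 0 <= t <= 1 by move: t01 => /andP[t0 t1]; rewrite !ltW.
rewrite (dfij t t01').2 !mxE => ->.
exact: le_trans (mx_norm_entry _ _ _) (dM t t01).
Qed.

Lemma diff0_cst V m n (f : V -> 'M[R]_(m, n)) (x v : V) :
  (forall t, 0 <= t <= 1 -> differentiable f (x + t *: v)) ->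
  (forall t, 0 < t < 1 -> 'd f (x + t *: v) v = 0) ->
  f (x + v) = f x.
Proof.
move=> df d0; apply/eqP; rewrite -subr_eq0 -normr_eq0 eq_le normr_ge0 andbT.
by apply: (MVI df) => t /d0 ->; rewrite normr0.
Qed.

(** The second difference is symmetric in [u] and [v]: exchanging them gives a second expression of
    the same number, which is the source of [schwarz]. *)
Lemma second_difference V (f : V -> R^o) (x u v : V) :
  (forall s t, 0 <= s <= 1 -> 0 <= t <= 1 ->
    differentiable f (x + s *: u + t *: v) /\
    differentiable (fun y => 'd f y u : R^o) (x + s *: u + t *: v)) ->
  exists s t, [/\ 0 <= s <= 1, 0 <= t <= 1 &
    f (x + u + v) - f (x + u) - (f (x + v) - f x) =
    'd (fun y => 'd f y u : R^o) (x + s *: u + t *: v) v].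
Proof.
move=> df.
have i0 : 0 <= (0 : R) <= 1 by rewrite lexx/= ler01.
have i1 : 0 <= (1 : R) <= 1 by rewrite ler01 /= lexx.
have dsv s : 0 <= s <= 1 -> differentiable (fun y => f (y + v)) (x + s *: u) /\
    'd (fun y => f (y + v) : R^o) (x + s *: u) u = 'd f (x + s *: u + v) u.
  move=> s01; have [d1 _] := df s 1 s01 i1; rewrite scale1r in d1.
  have dsh : is_diff (x + s *: u) (fun y => y + v) id.
    have := is_diffD (is_diff_id (x + s *: u)) (is_diff_cst v (x + s *: u)).
    by rewrite addr0.
  have dsh' : differentiable (fun y => y + v) (x + s *: u) by exact: ex_diff.
  split; first exact: (differentiable_comp dsh' d1).
  by rewrite (dcompE u dsh' d1) diff_val.
have ds s : 0 <= s <= 1 -> differentiable f (x + s *: u).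
  by move=> s01; have [] := df s 0 s01 i0; rewrite scale0r addr0.
have [|s s01] := @MVI_real V (fun y => f (y + v) - f y : R^o) x u.
  by move=> s s01; apply: differentiableB; [have [] := dsv s s01 | exact: ds].
have s01' : 0 <= s <= 1 by move: s01 => /andP[? ?]; rewrite !ltW.
have -> : 'd (fun y => f (y + v) - f y : R^o) (x + s *: u) u =
    'd f (x + s *: u + v) u - 'd f (x + s *: u) u.
  have [d1 d2] := dsv s s01'.
  apply: (etrans (congr1 (fun h : V -> R^o => h u) (diffB d1 (ds s s01')))).
  exact: (congr1 (fun z => z - _) d2).
have [|t t01 ->] := @MVI_real V (fun y => 'd f y u : R^o) (x + s *: u) v.
  by move=> t t01; have [] := df s t s01' t01.
by move: t01 => /andP[t0 t1] E; exists s, t; split => //; rewrite !ltW.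
Qed.

Lemma schwarz V (A : set V) (f : V -> R^o) x u v : open A -> A x ->
  Ck_on 2 A f ->
  'd (fun y => 'd f y u : R^o) x v = 'd (fun y => 'd f y v : R^o) x u.
Proof.
move=> oA Ax [df fA].
have cont w z : {for x, continuous (fun y => 'd (fun y => 'd f y w : R^o) y z : R^o)}.
  by have [_ /(_ z)] := fA w; apply.
have dd w y : A y -> differentiable (fun y => 'd f y w : R^o) y.
  by have [+ _] := fA w; apply.
apply/eqP/contraT => neq.
(* Half of the supposed gap: if both mixed derivatives stay within [e] of their values at [x], they
   cannot meet. *)
pose e := `|'d (fun y => 'd f y u : R^o) x v - 'd (fun y => 'd f y v : R^o) x u| / 2.
have e0 : 0 < e by rewrite divr_gt0// normr_gt0 subr_eq0.
have /cvgrPdist_lt/(_ e e0) c1 := cont u v.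
have /cvgrPdist_lt/(_ e e0) c2 := cont v u.
have nA : \forall y \near x, A y by apply: open_nbhs_nbhs.
have [r /= r0 Hr] := (@nbhs_ballP _ _ _ _).1 (filterI nA (filterI c1 c2)).
(* The factor [h] shrinks the parallelogram spanned by [u] and [v] into the ball where both mixed
   derivatives vary by less than [e]. *)
have [h h0 hr] : exists2 h : R, 0 < h & h * (`|u| + `|v|) < r.
  have D0 : 0 <= `|u| + `|v| by rewrite addr_ge0.
  move: (`|u| + `|v|) D0 => D D0; exists (r / (D + 1)).
    by rewrite divr_gt0// ltr_wpDl.
  by rewrite mulrAC ltr_pdivrMr ?ltr_wpDl// ltr_pM2l// ltrDl.
have inb s t : 0 <= s <= 1 -> 0 <= t <= 1 ->
    ball x r (x + s *: (h *: u) + t *: (h *: v)).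
  move=> /andP[s0 s1] /andP[t0 t1]; rewrite -ball_normE /=.
  rewrite -addrA opprD addNKr normrN; apply: le_lt_trans (ler_normD _ _) _.
  rewrite !normrZ !ger0_norm// ?(ltW h0)//; apply: le_lt_trans hr.
  rewrite mulrDr; apply: lerD; rewrite ler_piMl// mulr_ge0// ltW//.
have sw s t : x + s *: (h *: u) + t *: (h *: v) = x + t *: (h *: v) + s *: (h *: u).
  by rewrite addrAC.
have [|s [t [s01 t01 E1]]] := @second_difference V f x (h *: u) (h *: v).
  move=> s t s01 t01; have [Ay _] := Hr _ (inb s t s01 t01).
  by split; [exact: df | apply: (dd (h *: u))].
have [|s' [t' [s'01 t'01 E2]]] := @second_difference V f x (h *: v) (h *: u).
  move=> s' t' s01' t01'; rewrite -sw; have [Ay _] := Hr _ (inb t' s' t01' s01').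
  by split; [exact: df | apply: (dd (h *: v))].
have hh : forall w z y, A y -> 'd (fun y => 'd f y (h *: w) : R^o) y (h *: z) =
    h * h * 'd (fun y => 'd f y w : R^o) y z.
  move=> w z y Ay; rewrite linearZ /= -mulrA; congr (_ * _).
  have -> : (fun y => 'd f y (h *: w) : R^o) = h *: (fun y => 'd f y w : R^o).
    by apply/funext => y'; rewrite linearZ.
  by rewrite diffZ//; exact: dd.
have [Ay1 [n1 _]] := Hr _ (inb s t s01 t01).
have [Ay2 [_ n2]] := Hr _ (inb t' s' t'01 s'01).
have : h * h * 'd (fun y => 'd f y u : R^o) (x + s *: (h *: u) + t *: (h *: v)) v =
   h * h * 'd (fun y => 'd f y v : R^o) (x + t' *: (h *: u) + s' *: (h *: v)) u.
  rewrite -hh// -hh// -E1 sw -E2 [x + h *: v + _]addrAC; lra.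
move/mulfI => /(_ _)/[dup]; rewrite mulf_neq0 ?gt_eqF// => /(_ isT) E _.
move: n1 n2; rewrite /= E => n1 n2.
have : `|'d (fun y => 'd f y u : R^o) x v - 'd (fun y => 'd f y v : R^o) x u| < e + e.
  rewrite -(subrKA ('d (fun y => 'd f y v : R^o) (x + t' *: (h *: u) + s' *: (h *: v)) u)).
  by apply: le_lt_trans (ler_normD _ _) _; rewrite ltrD// distrC.
by rewrite /e -splitr ltxx.
Qed.

End MeanValue.

Section OneVariable.
Context {R : realType}.

Lemma derive_diff (W : normedModType R) (f : R -> W) (x : R) (f' : W) :
  is_derive x 1 f f' -> differentiable (f : R^o -> W) x /\
  forall v, 'd (f : R^o -> W) x v = v *: f'.
Proof.
move=> df; have /derivable1_diffP df1 : derivable f x 1 by exact: ex_derive.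
split => // v; rewrite -{1}[v]mulr1 -[v * 1]/(v *: (1 : R^o)) linearZ /=.
by rewrite -deriveE// derive_val.
Qed.

Lemma Ck_on_1d k (A : set R^o) (f f' : R -> R) : open A ->
  (forall x, A x -> is_derive x 1 f (f' x)) ->
  Ck_on k A (f' : R^o -> R^o) -> Ck_on k.+1 A (f : R^o -> R^o).
Proof.
move=> oA df f'A; split => [x Ax|v]; first by have [] := derive_diff (df x Ax).
apply: (Ck_on_ext oA _ (Ck_onM oA (@Ck_on_cst _ _ R^o k A v) f'A)) => x Ax.
by rewrite (derive_diff (df x Ax)).2.
Qed.

Lemma smooth_expR (A : set R^o) : open A -> smooth_on A (@expR R : R^o -> R^o).
Proof.
move=> oA k; elim: k => [|k IH]; first by move=> x _; exact: continuous_expR.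
by apply: (Ck_on_1d oA _ IH) => x _; exact: is_derive_expR.
Qed.

Lemma smooth_trig (A : set R^o) : open A ->
  smooth_on A (@cos R : R^o -> R^o) /\ smooth_on A (@sin R : R^o -> R^o).
Proof.
move=> oA.
suff H k : Ck_on k A (@cos R : R^o -> R^o) /\ Ck_on k A (@sin R : R^o -> R^o).
  by split=> k; have [] := H k.
elim: k => [|k [IHc IHs]].
  by split=> x _; [exact: continuous_cos | exact: continuous_sin].
split; last by apply: (Ck_on_1d oA _ IHc) => x _; exact: is_derive_sin.
apply: (Ck_on_1d (f' := fun x => -1 * sin x) oA).
  by move=> x _; rewrite mulN1r; exact: is_derive_cos.
by apply: Ck_onM => //; exact: Ck_on_cst.
Qed.

Lemma smooth_inv : smooth_on [set x : R^o | x != 0] (fun x : R^o => x^-1 : R^o).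
Proof.
have oA : open [set x : R^o | x != 0].
  exact: open_neq.
elim => [|k IH]; first by move=> x /= x0; exact: inv_continuous.
apply: (Ck_on_1d (f' := fun x => -1 * (x^-1 * x^-1)) oA).
  move=> x /= x0; rewrite mulN1r.
  have := @is_deriveV R id x 1 1 x0 (is_derive_id x (1 : R)).
  by rewrite /GRing.scale /= mulr1 -exprVn expr2.
apply: Ck_onM => //; first exact: Ck_on_cst.
exact: Ck_onM.
Qed.

End OneVariable.

(** * Flows of ordinary differential equations *)

Section ODE.
Context {R : realType}.

(** The clamped value is the projection of [s] onto [[-c, c]]. It serves to extend data given near a
    point to globally defined, Lipschitz data. *)
Lemma clamp_lip (c s t : R) : 0 <= c ->
  `|Num.max (- c) (Num.min c s) - Num.max (- c) (Num.min c t)| <= `|s - t|.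
Proof.
move=> c0.
wlog st : s t / s <= t => [H|].
  by have [/H//|/ltW/H] := leP s t; rewrite distrC [in leRHS]distrC.
rewrite distrC [leRHS]distrC !ger0_norm ?subr_ge0//; last first.
  by rewrite /Num.max /Num.min; do !case: ifPn; rewrite -?leNgt; lra.
by rewrite /Num.max /Num.min; do !case: ifPn; rewrite -?leNgt; lra.
Qed.

Lemma clamp_id (c s : R) : `|s| <= c -> Num.max (- c) (Num.min c s) = s.
Proof.
by rewrite ler_norml => /andP[h1 h2]; rewrite min_r// max_r.
Qed.

Lemma lip_continuous_at (V W : normedModType R) (f : V -> W) (x : V) (L : R) :
  0 <= L -> (\forall y \near x, `|f x - f y| <= L * `|x - y|) ->
  {for x, continuous f}.
Proof.
move=> L0 fL; apply/cvgrPdist_le => e e0.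
have L1 : 0 < L + 1 by rewrite ltr_wpDl.
have : \forall y \near x, `|x - y| < e / (L + 1).
  by apply: (@cvgr_dist_lt _ _ _ (nbhs x) _ id); rewrite ?divr_gt0//; exact: cvg_id.
apply: filterS2 fL => y fL xy; apply: (le_trans fL).
apply: (@le_trans _ _ ((L + 1) * `|x - y|)); first by rewrite ler_wpM2r// lerDl.
by rewrite mulrC -ler_pdivlMr// ltW.
Qed.

Lemma lip_continuous (V W : normedModType R) (f : V -> W) (L : R) : 0 <= L ->
  (forall x y, `|f x - f y| <= L * `|x - y|) -> continuous f.
Proof. by move=> L0 fL x; apply: (lip_continuous_at L0); exact: nearW. Qed.

Lemma near_norm_lt (V : normedModType R) (x : V) (c : R) : `|x| < c ->
  \forall y \near x, `|y| < c.
Proof.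
move=> xc; apply/nbhs_ballP; exists (c - `|x|); rewrite /= ?subr_gt0// => y.
rewrite -ball_normE /= ltrBrDr => xy; apply: le_lt_trans xy.
by rewrite -{1}[y](subrK x) distrC (le_trans (ler_normD _ _))// distrC.
Qed.

Lemma continuous_mx (T : topologicalType) m n (f : T -> 'M[R]_(m, n)) (x : T) :
  (forall i j, {for x, continuous (fun y => f y i j : R^o)}) ->
  {for x, continuous f}.
Proof.
move=> fc; apply/cvgrPdist_le => e e0.
have : \forall y \near x, forall ij : 'I_m * 'I_n,
    `|f x ij.1 ij.2 - f y ij.1 ij.2| <= e.
  apply: filter_forall => -[i j] /=.
  by have /cvgrPdist_le/(_ _ e0) := fc i j.
apply: filterS => y Ht; apply: mx_norm_le (ltW e0) _ => i j.
by have := Ht (i, j); rewrite !mxE.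
Qed.

Lemma primitive (f : R -> R) (c : R) : 0 < c -> continuous f ->
  exists F : R -> R, [/\ continuous F, F 0 = 0 &
    forall t : R, `|t| < c -> is_derive t 1 F (f t)].
Proof.
move=> c0 fc.
pose mu := @lebesgue_measure R.
(* Starting the integral at [- (c + 1)] makes every point of [[-c, c]] interior to the domain where
   [F1] is differentiable; clamping the argument then gives a function continuous on the whole
   line. *)
pose F1 x := (\int[mu]_(t in [set` `[- (c + 1), x]]) (f t))%R.
have F1d (t : R) : `|t| < c + 1 -> is_derive t 1 F1 (f t).
  rewrite ltr_norml => /andP[t1 t2].
  have [|||| dF <-] := @continuous_FTC1_closed R f (- (c + 1)) t (c + 1).
  - exact: t2.
  - apply: continuous_compact_integrable; first exact: segment_compact.
    by apply: continuous_subspaceT.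
  - exact: t1.
  - exact: fc.
  - by rewrite derive1E; apply: DeriveDef.
have F1c (t : R) : `|t| < c + 1 -> {for t, continuous F1}.
  move=> /F1d dF; have [] := derive_diff dF.
  by move=> /differentiable_continuous.
pose cl s : R := Num.max (- c) (Num.min c s).
exists (fun t => F1 (cl t) - F1 0); split.
- have clc : continuous (cl : R^o -> R^o).
    apply: (@lip_continuous R^o R^o cl 1) => // x y; rewrite mul1r.
    exact/clamp_lip/ltW.
  have clb t : `|cl t| < c + 1.
    apply: (@le_lt_trans _ _ c); last by rewrite ltrDl.
    rewrite /cl ler_norml; apply/andP; split; first by rewrite le_max lexx.
    by rewrite ge_max ge_min lexx /= andbT; lra.
  move=> t; apply: (@continuousB R R^o R^o (fun t => F1 (cl t)) (fun=> F1 0)).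
    by apply: (@continuous_comp R^o R^o R^o); [exact: clc | apply: F1c].
  exact: cst_continuous.
- by rewrite /cl clamp_id ?subrr// normr0 ltW.
- move=> t tc.
  have tc1 : `|t| < c + 1 by rewrite (lt_trans tc)// ltrDl.
  have := is_deriveB (F1d t tc1) (is_derive_cst (F1 0) t (1 : R)).
  rewrite subr0; apply: near_eq_is_derive => //.
  near=> s; rewrite /cl clamp_id//.
  by near: s; apply: filterS (@near_norm_lt R^o t c tc) => s /ltW.
Unshelve. all: by end_near. Qed.

Lemma derive_mx_entries d (F : R -> 'rV[R]_d) (t : R) (f' : 'rV[R]_d) :
  (forall i, is_derive t 1 (fun s => F s 0 i) (f' 0 i)) -> is_derive t 1 F f'.
Proof.
move=> dF.
have dv : derivable F t 1 by apply/derivable_mxP => i j; rewrite ord1; exact: ex_derive.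
apply: DeriveDef => //; rewrite derive_mx//; apply/matrixP => i j.
by rewrite mxE ord1; exact: derive_val.
Qed.

Lemma primitive_vec d (f : R -> 'rV[R]_d) (c : R) : 0 < c -> continuous f ->
  exists F : R -> 'rV[R]_d, [/\ continuous F, F 0 = 0 &
    forall t : R, `|t| < c -> is_derive t 1 F (f t)].
Proof.
move=> c0 fc.
have fic i : continuous (fun t => f t 0 i).
  move=> t; apply: (@continuous_comp R^o 'rV[R]_d R^o f (fun A => A 0 i)).
    exact: fc.
  exact: entry_continuous.
have [F HF] := choice (fun i => primitive c0 (fic i)).
exists (fun t => \row_i F i t); split.
- move=> t; apply: continuous_mx => i j.
  have [Fc _ _] := HF j; have -> : (fun s => (\row_k F k s) i j) = F j.
    by apply/funext => s; rewrite mxE.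
  exact: Fc.
- by apply/rowP => i; rewrite !mxE; have [] := HF i.
- move=> t tc; apply: derive_mx_entries => i.
  have [_ _ /(_ t tc)] := HF i; apply: near_eq_is_derive => //.
  by near=> s; rewrite mxE.
Unshelve. all: by end_near. Qed.

Lemma segment_norm (s t r c : R) : `|s| < c -> `|t| < c -> 0 <= r <= 1 ->
  `|s + r *: (t - s) : R| < c.
Proof.
move=> sc tc /andP[r0 r1].
have -> : s + r *: (t - s) = (1 - r) * s + r * t by rewrite /GRing.scale /=; ring.
apply: (@le_lt_trans _ _ (Num.max `|s| `|t|)); last by rewrite gt_max sc.
apply: (le_trans (ler_normD _ _)); rewrite !normrM (ger0_norm r0) ger0_norm ?subr_ge0//.
have sm : `|s| <= Num.max `|s| `|t| by rewrite le_max lexx.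
have tm : `|t| <= Num.max `|s| `|t| by rewrite le_max lexx orbT.
by move: (Num.max _ _) sm tm => m sm tm; nra.
Qed.

Lemma curve_MVI d (u u' : R -> 'rV[R]_d) (c M : R) (s t : R) :
  `|s| < c -> `|t| < c -> (forall r : R, `|r| < c -> is_derive r 1 u (u' r)) ->
  (forall r : R, `|r| < c -> `|u' r| <= M) -> `|u t - u s| <= M * `|t - s|.
Proof.
move=> sc tc du Mu.
have inc r : 0 <= r <= 1 -> `|s + r *: (t - s) : R| < c by exact: segment_norm.
have := @MVI R R^o 1 d u s (t - s) (M * `|t - s|).
rewrite [s + (t - s)]addrC subrK; apply.
  by move=> r /inc /du /derive_diff[].
move=> r /andP[r0 r1]; have /inc rc : 0 <= r <= 1 by rewrite !ltW.
have [_ ->] := derive_diff (du _ rc).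
by rewrite normrZ mulrC ler_wpM2r//; apply: Mu.
Qed.

Lemma short_gronwall d (u u' : R -> 'rV[R]_d) (c L e B : R) :
  0 < c -> 0 <= L -> c * L <= 1 / 2 -> 0 <= e ->
  (forall t : R, `|t| < c -> is_derive t 1 u (u' t)) ->
  (forall t : R, `|t| < c -> `|u t| <= B) ->
  (forall t : R, `|t| < c -> `|u' t| <= L * `|u t| + e) ->
  forall t : R, `|t| < c -> `|u t| <= 2 * (`|u 0| + c * e).
Proof.
move=> c0 L0 cL e0 du uB u'B.
pose S := [set `|u t| | t in [set t : R | `|t| < c]].
have S0 : S (`|u 0|) by exists 0 => //=; rewrite normr0.
have hS : has_sup S.
  by split; [exists `|u 0| | exists B => _ [t /= tc <-]; exact: uB].
pose M := sup S.
have uM t : `|t| < c -> `|u t| <= M.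
  by move=> tc; apply: sup_upper_bound => //; exists t.
have M0 : 0 <= M by apply: le_trans (uM 0 _); rewrite ?normr0.
have H t : `|t| < c -> `|u t| <= `|u 0| + (M / 2 + c * e).
  move=> tc; rewrite -[u t](subrK (u 0)) addrC.
  apply: (le_trans (ler_normD _ _)); apply: lerD => //.
  apply: (@le_trans _ _ ((L * M + e) * `|t - 0|)).
    apply: (@curve_MVI d u u' c); rewrite ?normr0// => r rc.
    by apply: (le_trans (u'B r rc)); rewrite lerD2r ler_wpM2l// uM.
  rewrite subr0; apply: (@le_trans _ _ ((L * M + e) * c)).
    by apply: ler_wpM2l; [rewrite addr_ge0// mulr_ge0 | exact: ltW].
  have : c * L * M <= 1 / 2 * M by rewrite ler_wpM2r.
  lra.
have : M <= `|u 0| + (M / 2 + c * e).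
  by apply: ge_sup; [exists `|u 0| | move=> _ [t /= tc <-]; exact: H].
by move=> MM t /uM; lra.
Qed.

End ODE.

(** * Picard iteration for a Lipschitz field *)

Section Picard.
Context {R : realType} (d : nat).
Local Notation X := 'rV[R]_d.
Variables (V : X -> X) (L c : R).
Hypotheses (L0 : 0 <= L) (c0 : 0 < c) (cL : c * L <= 1 / 2).
Hypothesis VL : forall x y, `|V x - V y| <= L * `|x - y|.

Lemma picard_step (y : R -> X) : continuous y -> exists F : R -> X,
  [/\ continuous F, F 0 = 0 &
   forall t : R, `|t| < c -> is_derive t 1 F (V (y t))].
Proof.
move=> yc; apply: primitive_vec => // t.
by apply: continuous_comp; [exact: yc | exact: (lip_continuous L0 VL)].
Qed.

(** The primitive exists for continuous [y] only; the value 0 in the other branch is a default that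
    the iterates, being continuous, never reach. *)
Definition picard_next (x : X) (y : R -> X) : R -> X := fun t => x +
  (if pselect (continuous y) is left yc then sval (cid (picard_step yc)) t else 0).

Definition picard_iter (x : X) (k : nat) : R -> X :=
  iter k (picard_next x) (fun=> x).

Lemma picard_nextP x y : continuous y ->
  [/\ continuous (picard_next x y), picard_next x y 0 = x &
   forall t : R, `|t| < c -> is_derive t 1 (picard_next x y) (V (y t))].
Proof.
move=> yc; rewrite /picard_next; case: pselect => // yc'.
case: cid => F /= [Fc F0 dF]; split; last 1 first.
- move=> t /dF dFt; rewrite -[V (y t)]add0r.
  exact: (is_deriveD (is_derive_cst x t (1 : R)) dFt).
- by move=> t; apply: continuousD; [exact: cst_continuous | exact: Fc].
- by rewrite F0 addr0.
Qed.

Lemma picard_iterP x k : continuous (picard_iter x k) /\ picard_iter x k 0 = x.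
Proof.
elim: k => [|k [IHc IH0]]; first by split => // t; exact: cst_continuous.
by have [] := picard_nextP x IHc.
Qed.

Lemma picard_diff x k (t : R) : `|t| < c ->
  `|picard_iter x k.+1 t - picard_iter x k t| <= (1 / 2) ^+ k * (c * `|V x|).
Proof.
elim: k t => [|k IH] t tc.
  have [_ F0 dF] := picard_nextP x (@cst_continuous R^o _ x).
  rewrite expr0 mul1r /picard_iter /=.
  have := @curve_MVI R d (picard_next x (fun=> x)) (fun=> V x) c `|V x| 0 t.
  rewrite normr0 F0 subr0 => /(_ c0 tc dF (fun _ _ => lexx _)) /le_trans; apply.
  by rewrite mulrC ler_wpM2r// ltW.
have [c1 _] := picard_iterP x k; have [c2 _] := picard_iterP x k.+1.
have [_ F0 dF] := picard_nextP x c1; have [_ G0 dG] := picard_nextP x c2.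
set M := (1 / 2) ^+ k * _ in IH *.
have H : `|picard_iter x k.+2 t - picard_iter x k.+1 t| <= L * M * `|t|.
  have := @curve_MVI R d (picard_iter x k.+2 - picard_iter x k.+1)
    (fun t => V (picard_iter x k.+1 t) - V (picard_iter x k t)) c (L * M) 0 t.
  rewrite normr0 !fctE (picard_iterP x k.+2).2 (picard_iterP x k.+1).2 subrr !subr0.
  apply => // r rc; first by apply: is_deriveB; [exact: dG | exact: dF].
  by apply: (le_trans (VL _ _)); rewrite ler_wpM2l// IH.
apply: (le_trans H).
have -> : (1 / 2) ^+ k.+1 * (c * `|V x|) = 1 / 2 * M.
  by rewrite exprS /M; ring.
have M0 : 0 <= M by apply: le_trans (IH 0 _); rewrite ?normr0.
have : L * M * `|t| <= L * M * c by rewrite ler_wpM2l ?mulr_ge0// ltW.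
have : c * L * M <= 1 / 2 * M by rewrite ler_wpM2r.
lra.
Qed.

Lemma half_expr_cvg : (fun k : nat => (1 / 2 : R) ^+ k) @ \oo --> (0 : R).
Proof. by apply: cvg_expr; rewrite ger0_norm; lra. Qed.

Lemma picard_dist x k l (t : R) : `|t| < c ->
  `|picard_iter x (k + l) t - picard_iter x k t| <=
  2 * (1 / 2) ^+ k * (c * `|V x|).
Proof.
(* The sharper bound carries the partial sum [2 - 2 (1/2)^l] of the geometric series, so that the
   induction on [l] closes. *)
move=> tc; suff H : `|picard_iter x (k + l) t - picard_iter x k t| <=
  (2 - 2 * (1 / 2) ^+ l) * (1 / 2) ^+ k * (c * `|V x|).
  have h0 j : 0 <= (1 / 2 : R) ^+ j by rewrite exprn_ge0//; lra.
  apply: (le_trans H); apply: ler_wpM2r; first by rewrite mulr_ge0// ltW.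
  by apply: ler_wpM2r => //; rewrite gerBl mulr_ge0.
elim: l => [|l IH].
  by rewrite addn0 subrr normr0 expr0 mulr1 subrr !mul0r.
rewrite addnS -(subrKA (picard_iter x (k + l) t)).
apply: (le_trans (ler_normD _ _)); apply: (le_trans (lerD (picard_diff x _ tc) IH)).
by rewrite exprD exprS; set a := (1 / 2) ^+ l; set b := (1 / 2) ^+ k; nra.
Qed.

Lemma picard_cvg x (t : R) : `|t| < c -> exists l : X, forall k,
  `|l - picard_iter x k t| <= 2 * (1 / 2) ^+ k * (c * `|V x|).
Proof.
move=> tc; pose u k := picard_iter x k t.
set M := c * `|V x|.
have M0 : 0 <= M by rewrite mulr_ge0// ltW.
have cvu : cvgn u.
  apply/cauchy_cvgP/cauchy_ballP => e e0.
  have e4 : 0 < e / (4 * (M + 1)) by rewrite divr_gt0// mulr_gt0// ltr_wpDl.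
  have /cvgrPdist_lt/(_ _ e4)[K _ HK] := half_expr_cvg.
  have uK k : (K <= k)%N -> `|u k - u K| < e / 2.
    move=> Kk; rewrite -(subnKC Kk); apply: (le_lt_trans (picard_dist _ _ _ tc)).
    have := HK K (leqnn K); rewrite /= sub0r normrN ger0_norm; last first.
      by rewrite exprn_ge0//; lra.
    rewrite ltr_pdivlMr; last by rewrite mulr_gt0// ltr_wpDl.
    rewrite -/M; have : 0 <= (1 / 2 : R) ^+ K by rewrite exprn_ge0//; lra.
    by set b := (1 / 2) ^+ K; nra.
  pose Q := [set u k | k in [set k | (K <= k)%N]].
  exists (Q, Q); first by split; exists K => // k Kk; exists k.
  move=> [_ _] /= [[i /= Ki <-] [j /= Kj <-]]; rewrite -ball_normE /=.
  rewrite -(subrKA (u K)); apply: (le_lt_trans (ler_normD _ _)).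
  by rewrite [ltRHS]splitr ltrD// ?uK// distrC uK.
exists (limn u) => k.
have : \forall l \near \oo, `|u l - u k| <= 2 * (1 / 2) ^+ k * M.
  by exists k => // l /= kl; rewrite -(subnKC kl) picard_dist.
have uc : (fun l => `|u l - u k|) @ \oo --> `|limn u - u k|.
  by apply: cvg_norm; apply: cvgB => //; exact: cvg_cst.
by move=> /(cvgr_to_le uc).
Qed.

Lemma eps_derive (W : normedModType R) (f : R -> W) (t : R) (v : W) :
  (forall e : R, 0 < e ->
    \forall h \near (0 : R^o), `|f (t + h) - f t - h *: v| <= e * `|h|) ->
  is_derive t 1 f v.
Proof.
move=> fv.
have vl : linear (fun h : R^o => h *: v).
  by move=> a x y; rewrite scalerDl scalerA.
have vc : continuous (mklin vl) by move=> h; exact: scalel_continuous.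
have [df dfE] := @eps_diff R R^o W f t (mklin vl) vc fv.
apply: DeriveDef; first exact: diff_derivable.
by rewrite deriveE// dfE /= scale1r.
Qed.

Lemma is_derive_scalel (W : normedModType R) (t : R) (v : W) :
  is_derive t 1 (fun r : R => r *: v) v.
Proof.
apply: eps_derive => e e0.
apply: (filterS _ (@filterT _ (nbhs (0 : R^o)) _)) => h _.
by rewrite scalerDl [_ + h *: v]addrC addrK subrr normr0 mulr_ge0// ltW.
Qed.

Lemma quad_derive (W : normedModType R) (f : R -> W) (t c' B : R) (v : W) :
  `|t| < c' -> 0 <= B -> (forall s, `|s| < c' ->
    `|f s - f t - (s - t) *: v| <= B * `|s - t| ^+ 2) -> is_derive t 1 f v.
Proof.
move=> tc B0 H; apply: eps_derive => e e0.
have e1 : 0 < e / (B + 1) by rewrite divr_gt0// ltr_wpDl.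
have n1 : \forall h \near (0 : R^o), `|t + h| < c'.
  by apply/(near0_shift (t : R^o) (fun s : R^o => `|s| < c')); exact: near_norm_lt.
have n2 : \forall h \near (0 : R^o), `|h| < e / (B + 1).
  by apply: near_norm_lt; rewrite normr0.
apply: filterS2 n1 n2 => h th he; have := H _ th; rewrite [t + h]addrC addrK => /le_trans.
apply; rewrite expr2 mulrA ler_wpM2r//.
move: he; rewrite ltr_pdivlMr ?ltr_wpDl// => he.
by have := normr_ge0 h; nra.
Qed.

Lemma lipschitz_flow : exists phi : R -> X -> X,
  [/\ forall x, phi 0 x = x,
      forall x (t : R), `|t| < c -> is_derive t 1 (phi^~ x) (V (phi t x)) &
      forall x (t : R), `|t| < c -> `|phi t x - x| <= 2 * c * `|V x|].
Proof.
have [phi Hphi] : exists phi : R -> X -> X, forall t x, `|t| < c -> forall k,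
    `|phi t x - picard_iter x k t| <= 2 * (1 / 2) ^+ k * (c * `|V x|).
  have : forall tx : R * X, exists l : X, `|tx.1| < c -> forall k,
    `|l - picard_iter tx.2 k tx.1| <= 2 * (1 / 2) ^+ k * (c * `|V tx.2|).
    move=> [t x] /=; have [tc|] := boolP (`|t| < c); last by exists 0.
    by have [l Hl] := picard_cvg x tc; exists l.
  by move=> /choice[f Hf]; exists (fun t x => f (t, x)) => t x; exact: (Hf (t, x)).
(* All properties of the limit are obtained from estimates on the iterates with an error
   [(1/2)^k M], which [lim0] discards. *)
have lim0 (a b M : R) : 0 <= M -> (forall k : nat, a <= b + (1 / 2) ^+ k * M) -> a <= b.
  move=> M0 H; apply/ler_addgt0Pl => e e0.
  have eM : 0 < e / (M + 1) by rewrite divr_gt0// ltr_wpDl.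
  have /cvgrPdist_lt/(_ _ eM)[K _ /(_ K (leqnn K))] := half_expr_cvg.
  rewrite /= sub0r normrN ger0_norm; last by rewrite exprn_ge0//; lra.
  rewrite ltr_pdivlMr ?ltr_wpDl// => HK; apply: (le_trans (H K)).
  have : 0 <= (1 / 2 : R) ^+ K by rewrite exprn_ge0//; lra.
  by move: HK; set b' := (1 / 2) ^+ K; nra.
have VM x : 0 <= c * `|V x| by rewrite mulr_ge0// ltW.
exists phi; split.
- move=> x; apply/eqP; rewrite -subr_eq0 -normr_le0.
  apply: (lim0 _ _ (2 * (c * `|V x|))); first by rewrite mulr_ge0.
  move=> k; have := Hphi 0 x; rewrite normr0 => /(_ c0 k).
  by rewrite (picard_iterP x k).2 add0r; lra.
- move=> x t tc.
  have seg (s r : R) : `|s| < c -> 0 <= r <= 1 ->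
      `|t + r *: (s - t) : R| < c /\ `|t + r *: (s - t) - t| <= `|s - t|.
    move=> sc r01; split; first exact: segment_norm.
    by have /andP[r0 r1] := r01; rewrite addrC addKr normrZ (ger0_norm r0) ler_piMl.
  (* A bound [e] on the oscillation of the limit curve near [t] yields the error [L e |s - t|] in
     its first-order expansion. It is used twice: with a constant [e] to show that the curve is
     Lipschitz at [t], then with this Lipschitz bound to make the error quadratic. *)
  have key (s : R) (e : R) : `|s| < c -> (forall r : R, `|r - t| <= `|s - t| ->
      `|r| < c -> `|phi r x - phi t x| <= e) ->
      `|phi s x - phi t x - (s - t) *: V (phi t x)| <= L * e * `|s - t|.
    move=> sc He; set M := c * `|V x|.
    have h0 (k : nat) : 0 <= (1 / 2 : R) ^+ k by rewrite exprn_ge0//; lra.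
    apply: (lim0 _ _ (4 * M + 2 * L * M * `|s - t|)).
      by rewrite addr_ge0// !mulr_ge0// ltW.
    move=> k; pose y := picard_iter x k.+1.
    have [yc _] := picard_iterP x k; have [_ _ dy] := picard_nextP x yc.
    have dF (r : R) : `|r| < c -> is_derive r 1 (fun r => y r - r *: V (phi t x))
        (V (picard_iter x k r) - V (phi t x)).
      move=> rc; apply: is_deriveB; first exact: dy.
      exact: is_derive_scalel.
    have Hy : `|y s - s *: V (phi t x) - (y t - t *: V (phi t x))| <=
        L * (e + 2 * (1 / 2) ^+ k * M) * `|s - t|.
      rewrite -{1 2}[s](subrK t) [s - t + t]addrC.
      apply: (@MVI R R^o 1 d (fun r => y r - r *: V (phi t x)) t (s - t)).
        by move=> r /(seg s r sc)[rc _]; have [] := derive_diff (dF _ rc).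
      move=> r /andP[r0 r1]; have r01 : 0 <= r <= 1 by rewrite !ltW.
      have [rc rt] := seg s r sc r01.
      have [_ ->] := derive_diff (dF _ rc); rewrite normrZ mulrC ler_wpM2r//.
      apply: (le_trans (VL _ _)); rewrite ler_wpM2l//.
      rewrite -(subrKA (phi (t + r *: (s - t)) x)) addrC.
      apply: (le_trans (ler_normD _ _)); apply: lerD; first exact: He.
      by rewrite distrC; apply: Hphi.
    have e1 := Hphi s x sc k.+1; have e2 := Hphi t x tc k.+1.
    rewrite -/M in e1 e2.
    have -> : phi s x - phi t x - (s - t) *: V (phi t x) =
      (y s - s *: V (phi t x) - (y t - t *: V (phi t x))) +
      ((phi s x - y s) - (phi t x - y t)).
      by rewrite scalerBl; apply/rowP => i; rewrite !mxE; ring.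
    apply: (le_trans (ler_normD _ _)); apply: (le_trans (lerD Hy (ler_normB _ _))).
    apply: (le_trans (lerD (lexx _) (lerD e1 e2))).
    have := h0 k; rewrite exprS; move: (normr_ge0 (s - t)) (VM x); rewrite -/M.
    by move: (_ ^+ k) `|s - t| => a b b0 m0 a0; nra.
  set M := c * `|V x|.
  have crude (r : R) : `|r| < c -> `|phi r x - phi t x| <= 4 * M.
    move=> rc; rewrite -(subrKA x); apply: (le_trans (ler_normD _ _)).
    have := Hphi r x rc 0; have := Hphi t x tc 0.
    rewrite expr0 mulr1 /picard_iter /= -/M [`|x - _|]distrC; lra.
  pose B := `|V (phi t x)| + L * (4 * M).
  have lipB (s : R) : `|s| < c -> `|phi s x - phi t x| <= B * `|s - t|.
    move=> sc; have := key s _ sc (fun r _ => crude r).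
    move=> K; rewrite -[phi s x - _](subrK ((s - t) *: V (phi t x))).
    apply: (le_trans (ler_normD _ _)); rewrite normrZ /B mulrDl addrC.
    by apply: lerD => //; rewrite mulrC.
  have B0 : 0 <= B by rewrite addr_ge0// !mulr_ge0// ltW.
  apply: (@quad_derive _ (phi^~ x) t c (L * B)) => //; first by rewrite mulr_ge0.
  move=> s sc.
  have -> : L * B * `|s - t| ^+ 2 = L * (B * `|s - t|) * `|s - t| by rewrite expr2; ring.
  apply: key => // r rs rc; apply: (le_trans (lipB r rc)).
  by rewrite ler_wpM2l.
- move=> x t tc; have := Hphi t x tc 0; rewrite expr0 mulr1 mulrA.
  by rewrite /picard_iter.
Qed.

End Picard.

Section LocalFlow.
Context {R : realType}.

Lemma norm_lt_dist (W : normedModType R) (a b : W) (e : R) :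
  `|a - b| < e -> `|b| < `|a| + e.
Proof.
move=> ab; have -> : b = a - (a - b) by rewrite opprB addrC subrK.
by apply: (le_lt_trans (ler_normB _ _)); rewrite ltrD2l.
Qed.

Lemma near_forall_ord d (T : topologicalType) (x : T) (P : 'I_d -> T -> Prop) :
  (forall i, \forall y \near x, P i y) -> \forall y \near x, forall i, P i y.
Proof. exact: filter_forall. Qed.

Lemma ball_convex (V : normedModType R) (x0 x y : V) r t : 0 <= t <= 1 ->
  ball x0 r x -> ball x0 r y -> ball x0 r (x + t *: (y - x)).
Proof.
move=> /andP[t0 t1]; rewrite -ball_normE /= => xr yr.
have -> : x0 - (x + t *: (y - x)) = (1 - t) *: (x0 - x) + t *: (x0 - y).
  transitivity ((x0 - x) + t *: (x - y)).
    by rewrite opprD addrA -scalerN opprB.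
  rewrite scalerBl scale1r -[RHS]addrA [- _ + _]addrC -scalerBr opprB.
  by rewrite [x0 - y + _]addrC subrKA.
apply: (@le_lt_trans _ _ (Num.max `|x0 - x| `|x0 - y|)); last by rewrite gt_max xr.
apply: (le_trans (ler_normD _ _)).
rewrite !normrZ (ger0_norm t0) ger0_norm ?subr_ge0//.
have sm : `|x0 - x| <= Num.max `|x0 - x| `|x0 - y| by rewrite le_max lexx.
have tm : `|x0 - y| <= Num.max `|x0 - x| `|x0 - y| by rewrite le_max lexx orbT.
by move: (Num.max _ _) sm tm => m sm tm; nra.
Qed.

Lemma lin_bound d (W : normedModType R) (L : {linear 'rV[R]_d -> W}) v :
  `|L v| <= `|v| * \sum_i `|L (delta_mx 0 i)|.
Proof.
rewrite {1}(row_sum_delta v) linear_sum mulr_sumr.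
apply: (le_trans (ler_norm_sum _ _ _)); apply: ler_sum => i _.
by rewrite linearZ normrZ ler_wpM2r// mx_norm_entry.
Qed.

Lemma local_lip d m (A : set 'rV[R]_d) (f : 'rV[R]_d -> 'rV[R]_m) x0 :
  open A -> A x0 -> Ck_on 1 A f -> exists r M, [/\ 0 < r, 0 <= M,
    ball x0 r `<=` A,
    forall x y, ball x0 r x -> ball x0 r y -> `|f x - f y| <= M * `|x - y| &
    forall x, ball x0 r x -> `|f x| <= M /\
      \sum_i `|'d f x (delta_mx 0 i)| <= M].
Proof.
move=> oA Ax0 [df fA].
pose S := \sum_i (`|'d f x0 (delta_mx 0 i)| + 1).
have S0 : 0 <= S by apply: sumr_ge0 => i _; rewrite addr_ge0.
have n1 : \forall x \near x0, forall i : 'I_d,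
    `|'d f x (delta_mx 0 i)| < `|'d f x0 (delta_mx 0 i)| + 1.
  apply: near_forall_ord => i.
  have cf : {for x0, continuous (fun x => 'd f x (delta_mx 0 i))} by exact: fA.
  have /cvgrPdist_lt/(_ 1 ltr01) := cf; apply: filterS => y.
  exact: norm_lt_dist.
have n2 : \forall x \near x0, A x by apply: open_nbhs_nbhs.
have [r /= r0 Hr] := (@nbhs_ballP _ _ _ _).1 (filterI n1 n2).
have dS x : ball x0 r x -> \sum_i `|'d f x (delta_mx 0 i)| <= S.
  by move=> /Hr[H _]; apply: ler_sum => i _; exact/ltW/H.
have lipS x y : ball x0 r x -> ball x0 r y -> `|f x - f y| <= S * `|x - y|.
  move=> xr yr; rewrite -{1}[x](subrK y) [x - y + y]addrC.
  have inb t : 0 <= t <= 1 -> ball x0 r (y + t *: (x - y)).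
    by move=> t01; exact: ball_convex.
  apply: MVI => [t /inb/Hr[_ /df]//|t /andP[t0 t1]].
  apply: (le_trans (lin_bound _ _)); rewrite mulrC ler_wpM2r//.
  by apply: dS; apply: inb; rewrite !ltW.
exists r, (S + `|f x0| + S * r); split => //.
- by rewrite !addr_ge0// mulr_ge0// ltW.
- by move=> x /Hr[].
- move=> x y xr yr; apply: (le_trans (lipS x y xr yr)).
  by rewrite ler_wpM2r// -addrA lerDl addr_ge0// mulr_ge0// ltW.
- move=> x xr; split; last first.
    by apply: (le_trans (dS x xr)); rewrite -addrA lerDl addr_ge0// mulr_ge0// ltW.
  rewrite -[f x](subrK (f x0)) (le_trans (ler_normD _ _))//.
  have x0r : ball x0 r x0 by exact: ballxx.
  have xr' : `|x - x0| <= r by move: xr; rewrite -ball_normE /= distrC => /ltW.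
  have := lipS x x0 xr x0r; have : S * `|x - x0| <= S * r by rewrite ler_wpM2l.
  lra.
Qed.

(** The constant [M] is both a Lipschitz constant of [V] on [A] and a bound on the diameter of [A],
    so that [short_gronwall] applies directly to the difference of two trajectories. *)
Definition flow_on d (A : set 'rV[R]_d) (V : 'rV[R]_d -> 'rV[R]_d) (M : R) x0
    (r c : R) (phi : R -> 'rV[R]_d -> 'rV[R]_d) : Prop :=
  [/\ open A, ball x0 r `<=` A,
      (forall x y, A x -> A y -> `|V x - V y| <= M * `|x - y| /\ `|x - y| <= M),
      [/\ 0 < r, 0 < c, 0 <= M & c * M <= 1 / 2] &
      forall x, ball x0 r x -> phi 0 x = x /\ forall t : R, `|t| < c ->
        A (phi t x) /\ is_derive t 1 (phi^~ x) (V (phi t x))].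

Lemma flow_on_sub d (A : set 'rV[R]_d) V M x0 r c phi r' c' : 0 < r' <= r ->
  0 < c' <= c -> flow_on A V M x0 r c phi -> flow_on A V M x0 r' c' phi.
Proof.
move=> /andP[r0 rr] /andP[c0 cc] [oA rA lV [_ _ M0 cM] H].
have rb x : ball x0 r' x -> ball x0 r x by exact: le_ball.
split=> //; first by move=> x /rb/rA.
  by split=> //; apply: le_trans cM; rewrite ler_wpM2r.
move=> x /rb /H[-> Ht]; split => // t tc; apply: Ht.
exact: lt_le_trans tc cc.
Qed.

Lemma local_flow d (A : set 'rV[R]_d) V x0 : open A -> A x0 -> Ck_on 1 A V ->
  exists A' M r c phi, A' `<=` A /\ flow_on A' V M x0 r c phi.
Proof.
move=> oA Ax0 VA; have [r [M [r0 M0 rA lV bV]]] := local_lip oA Ax0 VA.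
pose rho := r / 2.
have rho0 : 0 < rho by rewrite divr_gt0.
(* Projecting each coordinate onto the cube of half-side [rho] around [x0] turns [V] into a globally
   Lipschitz field that agrees with [V] on the cube. *)
pose cl (x : 'rV[R]_d) : 'rV[R]_d :=
  \row_i (x0 0 i + Num.max (- rho) (Num.min rho ((x - x0) 0 i))).
have clL x y : `|cl x - cl y| <= `|x - y|.
  apply: mx_norm_le => // i j; rewrite (ord1 i) !mxE.
  set a := Num.max _ _; set b := Num.max _ _.
  have -> : x0 0 j + a - (x0 0 j + b) = a - b by lra.
  apply: (le_trans (clamp_lip _ _ (ltW rho0))).
  by have := mx_norm_entry (x - y) 0 j; rewrite !mxE; congr (`|_| <= _); lra.
have clb x : ball x0 r (cl x).
  rewrite -ball_normE /=; apply: (@le_lt_trans _ _ rho); last first.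
    by rewrite /rho ltr_pdivrMr// ltr_pMr// ltr1n.
  apply: mx_norm_le => [|i j]; first exact: ltW.
  rewrite (ord1 i) !mxE opprD addNKr normrN ler_norml le_max lexx /=.
  by rewrite ge_max ge_min lexx /= andbT; lra.
have clid x : `|x - x0| <= rho -> cl x = x.
  move=> xr; apply/rowP => i; rewrite mxE.
  rewrite (clamp_id (le_trans (mx_norm_entry (x - x0) 0 i) xr)).
  by rewrite !mxE [LHS]addrC subrK.
pose W x := V (cl x).
have WL x y : `|W x - W y| <= M * `|x - y|.
  by apply: (le_trans (lV _ _ (clb x) (clb y))); rewrite ler_wpM2l.
pose M' := M + 2 * r.
have M'0 : 0 <= M' by rewrite addr_ge0// mulr_ge0// ltW.
(* The first term gives [c * M' <= 1 / 2], where [M'] also majorises the diameter [2 r]; the second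
   keeps trajectories that start within [rho / 2] of [x0] inside the cube, where the field is still
   [V]. *)
pose c := Num.min (1 / (2 * (M' + 1))) (rho / (4 * (M + 1))).
have c0 : 0 < c.
  by rewrite lt_min !divr_gt0// mulr_gt0// ltr_wpDl.
have cM' : c * M' <= 1 / 2.
  have : c * (2 * (M' + 1)) <= 1.
    by rewrite -ler_pdivlMr ?mulr_gt0 ?ltr_wpDl// /c ge_min lexx.
  by move: c0 M'0 => c0 M'0; nra.
have cM : c * M <= 1 / 2.
  by apply: le_trans cM'; rewrite ler_wpM2l ?(ltW c0)// lerDl mulr_ge0// ltW.
have crho : 2 * c * M <= rho / 2.
  have : c * (4 * (M + 1)) <= rho.
    by rewrite -ler_pdivlMr ?mulr_gt0 ?ltr_wpDl// /c ge_min lexx orbT.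
  by move: c0 => c0; nra.
have [phi [phi0 dphi bphi]] := lipschitz_flow M0 c0 cM WL.
have rr : rho <= r by rewrite /rho; lra.
exists (ball x0 r), M', (rho / 2), c, phi; split => //; split => //.
- exact: ball_open.
- by apply: le_ball; rewrite /rho; lra.
- move=> x y xr yr; split.
    apply: (le_trans (lV _ _ xr yr)); rewrite ler_wpM2r// /M' lerDl.
    by rewrite mulr_ge0// ltW.
  move: xr yr; rewrite -ball_normE /= => xr yr.
  rewrite -(subrKA x0); apply: (le_trans (ler_normD _ _)); rewrite /M'.
  by rewrite [`|x - x0|]distrC; lra.
- by split => //; rewrite divr_gt0.
- move=> x; rewrite -ball_normE /= => xr; split => // t tc.
  have px : `|phi t x - x0| <= rho.
    rewrite -(subrKA x); apply: (le_trans (ler_normD _ _)).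
    have := bphi x t tc; have [Wx _] := bV _ (clb x).
    rewrite [`|x - x0|]distrC -/(W x) in Wx *.
    have : 2 * c * `|W x| <= 2 * c * M by rewrite ler_wpM2l// mulr_ge0// ltW.
    lra.
  split; first by rewrite distrC; apply: (le_lt_trans px); rewrite /rho; lra.
  by have := dphi x t tc; rewrite /W clid.
Qed.

End LocalFlow.

(** * Smooth dependence of flows on the initial point *)

Section SmoothDependence.
Context {R : realType}.

Lemma flow_on_bound d (A : set 'rV[R]_d) V M x0 r c phi x (t : R) :
  flow_on A V M x0 r c phi -> ball x0 r x -> `|t| < c ->
  `|phi t x - x| <= (`|V x0| + M * M) * `|t|.
Proof.
move=> [oA rA lV [r0 c0 M0 cM] H] xr tc; have [p0 pt] := H x xr.
rewrite -{2}p0 -{2}[t]subr0.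
apply: (@curve_MVI R d (phi^~ x) (fun t => V (phi t x)) c) => //.
- by rewrite normr0.
- by move=> s /pt[].
- move=> s /pt[As _]; have [V1 V2] := lV _ _ As (rA _ (ballxx x0 r0)).
  rewrite -[V (phi s x)](subrK (V x0)) (le_trans (ler_normD _ _))// addrC lerD2l.
  by apply: (le_trans V1); rewrite ler_wpM2l.
Qed.

Lemma flow_on_lip d (A : set 'rV[R]_d) V M x0 r c phi x y (t : R) :
  flow_on A V M x0 r c phi -> ball x0 r x -> ball x0 r y -> `|t| < c ->
  `|phi t x - phi t y| <= 2 * `|x - y|.
Proof.
move=> [oA rA lV [r0 c0 M0 cM] H] xr yr tc.
have [[p0 pt] [q0 qt]] := (H x xr, H y yr).
have := @short_gronwall R d (fun t => phi t x - phi t y)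
  (fun t => V (phi t x) - V (phi t y)) c M 0 M c0 M0 cM (lexx 0).
rewrite p0 q0 mulr0 addr0; apply => // s sc.
- by have [[_ d1] [_ d2]] := (pt s sc, qt s sc); exact: is_deriveB.
- by have [[a1 _] [a2 _]] := (pt s sc, qt s sc); have [] := lV _ _ a1 a2.
- by have [[a1 _] [a2 _]] := (pt s sc, qt s sc); have [] := lV _ _ a1 a2; rewrite addr0.
Qed.

(** The complete lift of [V] to the tangent bundle. Its flow consists of the flow of [V] and its
    differential, which lets higher smoothness be obtained from first-order differentiability by
    induction. *)
Definition lift_field d (V : 'rV[R]_d -> 'rV[R]_d) (z : 'rV[R]_(d + d)) :
    'rV[R]_(d + d) :=
  row_mx (V (lsubmx z)) ('d V (lsubmx z) (rsubmx z)).

Lemma lsubmx_continuous d e : continuous (lsubmx : 'rV[R]_(d + e) -> 'rV[R]_d).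
Proof. by move=> x; apply/differentiable_continuous/differentiable_lsubmx. Qed.

Lemma rsubmx_continuous d e : continuous (rsubmx : 'rV[R]_(d + e) -> 'rV[R]_e).
Proof. by move=> x; apply/differentiable_continuous/differentiable_rsubmx. Qed.

Lemma smooth_lsubmx d e (A : set 'rV[R]_(d + e)) : open A ->
  smooth_on A (lsubmx : 'rV[R]_(d + e) -> 'rV[R]_d).
Proof. by move=> oA k; apply: Ck_on_linear => //; exact: lsubmx_continuous. Qed.

Lemma smooth_rsubmx d e (A : set 'rV[R]_(d + e)) : open A ->
  smooth_on A (rsubmx : 'rV[R]_(d + e) -> 'rV[R]_e).
Proof. by move=> oA k; apply: Ck_on_linear => //; exact: rsubmx_continuous. Qed.

Lemma Ck_on_row_mx (U : normedModType R) d e k (A : set U)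
    (f : U -> 'rV[R]_d) (g : U -> 'rV[R]_e) : open A ->
  Ck_on k A f -> Ck_on k A g -> Ck_on k A (fun x => row_mx (f x) (g x)).
Proof.
move=> oA fA gA; apply: Ck_on_mx => // i j.
rewrite -(splitK j); case: (fintype.split j) => l /=.
  apply: (Ck_on_ext oA _ (Ck_on_entry i l oA fA)) => x _.
  by rewrite row_mxEl.
apply: (Ck_on_ext oA _ (Ck_on_entry i l oA gA)) => x _.
by rewrite row_mxEr.
Qed.

Lemma smooth_lift d (A : set 'rV[R]_d) V : open A -> smooth_on A V ->
  open (lsubmx @^-1` A : set 'rV[R]_(d + d)) /\
  smooth_on (lsubmx @^-1` A : set 'rV[R]_(d + d)) (lift_field V).
Proof.
move=> oA VA.
have oB : open (lsubmx @^-1` A : set 'rV[R]_(d + d)).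
  by apply: open_comp => // x _; exact: lsubmx_continuous.
split=> // k; apply: Ck_on_row_mx => //.
  by apply: (Ck_on_comp_mx oB oA); [|exact: smooth_lsubmx|exact: VA].
apply: Ck_on_mx => // i j.
apply: (@Ck_on_ext _ _ _ _ _
  (fun z => \sum_l (rsubmx z 0 l : R^o) * ('d V (lsubmx z) (delta_mx 0 l)) i j : R^o)) => //.
  move=> z _; rewrite [in RHS](row_sum_delta (rsubmx z)) linear_sum summxE.
  by apply: eq_bigr => l _; rewrite linearZ /= [RHS]mxE.
apply: Ck_on_sum => // l; apply: Ck_onM => //.
  by apply: Ck_on_entry => //; exact: smooth_rsubmx.
apply: Ck_on_entry => //.
by apply: (Ck_on_comp_mx (g := fun y => 'd V y (delta_mx 0 l)) oB oA);
  [|exact: smooth_lsubmx|exact: (smooth_on_d (delta_mx 0 l) VA)].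
Qed.

Lemma is_derive_lin (V W : normedModType R) (L : {linear V -> W}) (u : R -> V)
    (t : R) (u' : V) :
  continuous L -> is_derive t 1 u u' -> is_derive t 1 (fun s => L (u s)) (L u').
Proof.
move=> Lc du; have [df dE] := derive_diff du.
have dL := linear_differentiable (u t) Lc.
apply: DeriveDef; first exact/diff_derivable/(differentiable_comp df dL).
rewrite deriveE; last exact: (differentiable_comp df dL).
rewrite (dcompE (f := u : R^o -> V) (1 : R^o) df dL) dE scale1r.
by rewrite diff_lin.
Qed.

Lemma is_derive_lsubmx d e (u : R -> 'rV[R]_(d + e)) (t : R) w :
  is_derive t 1 u w -> is_derive t 1 (fun s => lsubmx (u s)) (lsubmx w).
Proof. exact: (is_derive_lin (L := lsubmx) (@lsubmx_continuous d e)). Qed.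

Lemma is_derive_rsubmx d e (u : R -> 'rV[R]_(d + e)) (t : R) w :
  is_derive t 1 u w -> is_derive t 1 (fun s => rsubmx (u s)) (rsubmx w).
Proof. exact: (is_derive_lin (L := rsubmx) (@rsubmx_continuous d e)). Qed.

Lemma lin_comb_derive d (W W' : normedModType R) (a : 'I_d -> R) (L : {linear W -> W'})
    (u : 'I_d -> R -> W') (t : R) (w : 'I_d -> W) :
  (forall i, is_derive t 1 (u i) (L (w i))) ->
  is_derive t 1 (fun s => \sum_i a i *: u i s) (L (\sum_i a i *: w i)).
Proof.
move=> du; have -> : L (\sum_i a i *: w i) = \sum_i a i *: L (w i).
  by rewrite linear_sum; apply: eq_bigr => i _; rewrite linearZ.
have -> : (fun s => \sum_i a i *: u i s) = \sum_i (fun s => a i *: u i s).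
  by apply/funext => s; rewrite fct_sumE.
by apply: is_derive_sum => i; apply: is_deriveZ.
Qed.

Lemma norm_lsubmx d e (z : 'rV[R]_(d + e)) : `|lsubmx z| <= `|z|.
Proof.
by apply: mx_norm_le => // i j; rewrite mxE; exact: mx_norm_entry.
Qed.

Lemma norm_rsubmx d e (z : 'rV[R]_(d + e)) : `|rsubmx z| <= `|z|.
Proof.
by apply: mx_norm_le => // i j; rewrite mxE; exact: mx_norm_entry.
Qed.

Lemma norm_row_mx0 d e (x : 'rV[R]_d) : `|row_mx x (0 : 'rV[R]_e)| <= `|x|.
Proof.
apply: mx_norm_le => // i j; rewrite -(splitK j); case: (fintype.split j) => l /=.
  by rewrite row_mxEl; exact: mx_norm_entry.
by rewrite row_mxEr mxE normr0.
Qed.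

Lemma row_mxB d e (a c : 'rV[R]_d) (b b' : 'rV[R]_e) :
  row_mx a b - row_mx c b' = row_mx (a - c) (b - b').
Proof. by rewrite opp_row_mx add_row_mx. Qed.

(** In this way a Lipschitz constant of the lifted field bounds the variation of the derivative of
    [V] without second derivatives being mentioned. *)
Lemma lift_field_norm d (V : 'rV[R]_d -> 'rV[R]_d) (y a e : 'rV[R]_d) :
  `|'d V y e - 'd V a e| <=
  `|lift_field V (row_mx y e) - lift_field V (row_mx a e)|.
Proof.
have E b : lift_field V (row_mx b e) = row_mx (V b) ('d V b e).
  by rewrite /lift_field row_mxKl row_mxKr.
rewrite !E row_mxB; set w := _ - 'd V a e.
by rewrite -{1}(row_mxKr (V y - V a) w); exact: norm_rsubmx.
Qed.

Lemma norm_le_dist (W : normedModType R) (a b : W) : `|b| <= `|a| + `|b - a|.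
Proof. by have := ler_normD a (b - a); rewrite [a + _]addrC subrK. Qed.

Lemma diff_sub_lin (V W : normedModType R) (f : V -> W) (L : {linear V -> W}) y :
  continuous L -> differentiable f y ->
  differentiable (fun z => f z - L z) y /\
  forall w, 'd (fun z => f z - L z) y w = 'd f y w - L w.
Proof.
move=> Lc df; have dL := linear_differentiable y Lc.
have -> : (fun z => f z - L z) = f - (L : V -> W) by [].
split; first exact: differentiableB.
move=> w; apply: (etrans (congr1 (fun h : V -> W => h w) (diffB df dL))).
exact: (congr1 (fun h : V -> W => 'd f y w - h w) (diff_lin y Lc)).
Qed.

Lemma sub_lin_split (V W : normedModType R) (p q : W) (L : {linear V -> W}) a k :
  p - q - L k = p - L (a + k) - (q - L a).
Proof.
rewrite linearD /= opprD opprB !addrA -[RHS]addrA [L a - q]addrC addrA.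
by rewrite [RHS]addrAC [_ - L k + L a]addrAC subrK [RHS]addrAC.
Qed.

Lemma lin_sub_bound d (W : normedModType R) (L1 L2 : {linear 'rV[R]_d -> W}) k :
  `|L1 k - L2 k| <= `|k| * \sum_i `|L1 (delta_mx 0 i) - L2 (delta_mx 0 i)|.
Proof.
have -> : L1 k - L2 k = \sum_i k 0 i *: (L1 (delta_mx 0 i) - L2 (delta_mx 0 i)).
  have E (L : {linear 'rV[R]_d -> W}) : L k = \sum_i k 0 i *: L (delta_mx 0 i).
    rewrite {1}(row_sum_delta k) linear_sum; apply: eq_bigr => i _.
    by rewrite linearZ.
  by rewrite (E L1) (E L2) -sumrB; apply: eq_bigr => i _; rewrite scalerBr.
apply: (le_trans (ler_norm_sum _ _ _)); rewrite mulr_sumr; apply: ler_sum => i _.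
by rewrite normrZ ler_wpM2r// mx_norm_entry.
Qed.

Lemma exists_min_ord d (r : R) (ri : 'I_d -> R) : 0 < r -> (forall i, 0 < ri i) ->
  exists2 r', 0 < r' <= r & forall i, r' <= ri i.
Proof.
move=> r0 ri0; exists (\big[Num.min/r]_i ri i).
  by rewrite lt_bigmin// bigmin_le_id.
by move=> i; exact: bigmin_le.
Qed.

(** The derivative of the flow in the direction of a basis vector is the second half of the lifted
    trajectory that starts at that vector; the derivative in a general direction is their linear
    combination. *)
Lemma flow_step d (A : set 'rV[R]_d) V M x0 r c phi : smooth_on A V ->
  flow_on A V M x0 r c phi ->
  exists r' c' (Phi : 'I_d -> R -> 'rV[R]_(d + d) -> 'rV[R]_(d + d)),
  [/\ 0 < r' <= r, 0 < c' <= c,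
    forall i, exists B Mi, B `<=` lsubmx @^-1` A /\
      flow_on B (lift_field V) Mi (row_mx x0 (delta_mx 0 i)) r' c' (Phi i) &
    forall x (t : R), ball x0 r' x -> `|t| < c' ->
    [/\ forall i, lsubmx (Phi i t (row_mx x (delta_mx 0 i))) = phi t x,
      differentiable (phi t) x &
      forall v, 'd (phi t) x v =
        \sum_i v 0 i *: rsubmx (Phi i t (row_mx x (delta_mx 0 i)))]].
Proof.
move=> VA FL; have [oA rA lV [r0 c0 M0 cM] H] := FL.
have Ax0 : A x0 by apply: rA; exact: ballxx.
have [oB lVs] := smooth_lift oA VA.
pose e i : 'rV[R]_d := delta_mx 0 i.
have : forall i : 'I_d, exists q : (set 'rV[R]_(d + d) * R * R * R) *
    (R -> 'rV[R]_(d + d) -> 'rV[R]_(d + d)),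
    q.1.1.1.1 `<=` lsubmx @^-1` A /\ flow_on q.1.1.1.1 (lift_field V) q.1.1.1.2
      (row_mx x0 (e i)) q.1.1.2 q.1.2 q.2.
  move=> i; have [|B [Mi [ri [ci [Phi HB]]]]] :=
    local_flow oB (x0 := row_mx x0 (e i)) _ (lVs 1%N).
    by rewrite /= row_mxKl.
  by exists (B, Mi, ri, ci, Phi).
move=> /choice[q Hq].
pose B i := (q i).1.1.1.1; pose Mi i := (q i).1.1.1.2; pose ri i := (q i).1.1.2.
pose ci i := (q i).1.2; pose Phi i := (q i).2.
have HB i : B i `<=` lsubmx @^-1` A by have [] := Hq i.
have HF i : flow_on (B i) (lift_field V) (Mi i) (row_mx x0 (e i)) (ri i) (ci i) (Phi i).
  by have [] := Hq i.
have {Hq} _ := Hq.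
have ri0 i : 0 < ri i by have [_ _ _ []] := HF i.
have ci0 i : 0 < ci i by have [_ _ _ []] := HF i.
have Mi0 i : 0 <= Mi i by have [_ _ _ []] := HF i.
have [r1 /andP[r10 r1r] r1i] := exists_min_ord r0 ri0.
have [c1 /andP[c10 c1c] c1i] := exists_min_ord c0 ci0.
pose Mx := \sum_i Mi i.
have Mx0 : 0 <= Mx by apply: sumr_ge0.
pose S := \sum_i (`|'d V x0 (e i)| + Mi i * r1).
have S0 : 0 <= S by apply: sumr_ge0 => i _; rewrite addr_ge0// mulr_ge0// ltW.
pose K := `|V x0| + M * M.
have K0 : 0 <= K by rewrite addr_ge0// mulr_ge0.
(* The second term keeps trajectories from the half ball inside the ball of radius [r1]; the third
   gives [c' * S <= 1 / 2], with [S] a bound for the operator norm of ['d V] on that ball. *)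
pose c' := Num.min c1 (Num.min (r1 / (2 * (K + 1))) (1 / (2 * (S + 1)))).
have c'0 : 0 < c' by rewrite !lt_min c10 !divr_gt0// mulr_gt0// ltr_wpDl.
have c'c1 : c' <= c1 by rewrite ge_min lexx.
have c'K : K * c' <= r1 / 2.
  have : c' * (2 * (K + 1)) <= r1.
    rewrite -ler_pdivlMr ?mulr_gt0 ?ltr_wpDl// /c'.
    by rewrite ge_min; apply/orP; right; rewrite ge_min lexx.
  by nra.
have c'S : c' * S <= 1 / 2.
  have : c' * (2 * (S + 1)) <= 1.
    rewrite -ler_pdivlMr ?mulr_gt0 ?ltr_wpDl// /c'.
    by rewrite ge_min; apply/orP; right; rewrite ge_min lexx orbT.
  by nra.
have c'c : c' <= c by exact: le_trans c1c.
have r'r : r1 / 2 <= r by lra.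
have rp : 0 < r1 / 2 by rewrite divr_gt0.
exists (r1 / 2), c', Phi; split; [by rewrite rp | by rewrite c'0 | |].
  move=> i; exists (B i), (Mi i); split; first exact: HB.
  apply: flow_on_sub (HF i); rewrite ?rp ?c'0/=; first by have := r1i i; lra.
  exact: le_trans (c1i i).
have row_ball x y i (rr : R) : ball x rr y ->
    ball (row_mx x (e i)) rr (row_mx y (e i)).
  rewrite -!ball_normE /= => xy; rewrite opp_row_mx add_row_mx subrr.
  exact: le_lt_trans (norm_row_mx0 _ _) xy.
have inr1 x (t : R) : ball x0 (r1 / 2) x -> `|t| < c' -> ball x0 r1 (phi t x).
  move=> xr tc.
  have := flow_on_bound FL (le_ball r'r xr) (lt_le_trans tc c'c).
  move: xr; rewrite -!ball_normE /= => xr bd; rewrite -(subrKA x).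
  apply: (le_lt_trans (ler_normD _ _)); rewrite [`|x - phi t x|]distrC.
  have : K * `|t| <= K * c' by rewrite ler_wpM2l// ltW.
  by rewrite -/K in bd; lra.
have PhiP x i (t : R) : ball x0 (r1 / 2) x -> `|t| < c' ->
    [/\ Phi i 0 (row_mx x (e i)) = row_mx x (e i),
      B i (Phi i t (row_mx x (e i))) &
      is_derive t 1 ((Phi i)^~ (row_mx x (e i)))
       (lift_field V (Phi i t (row_mx x (e i))))].
  move=> xr tc; have [_ _ _ _ /(_ (row_mx x (e i)))] := HF i.
  have xr1 : ball x0 (ri i) x by apply: le_ball xr; have := r1i i; lra.
  move=> /(_ (row_ball _ _ _ _ _ xr1))[P0 /(_ t)] P12.
  have [|P1 P2] := P12; last by split.
  by apply: (lt_le_trans tc); apply: (le_trans c'c1).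
(* The first halves of the lifted trajectories solve the equation of [phi] with the same initial
   value, so Gronwall with zero data identifies them. *)
have lE x i (t : R) : ball x0 (r1 / 2) x -> `|t| < c' ->
    lsubmx (Phi i t (row_mx x (e i))) = phi t x.
  move=> xr tc; apply/eqP; rewrite -subr_eq0 -normr_le0.
  have [p0 pt] := H x (le_ball r'r xr).
  have := @short_gronwall R d (fun t => lsubmx (Phi i t (row_mx x (e i))) - phi t x)
    (fun t => V (lsubmx (Phi i t (row_mx x (e i)))) - V (phi t x)) c' M 0 M c'0 M0.
  have [P0 _ _] := PhiP x i t xr tc.
  rewrite P0 p0 row_mxKl subrr normr0 mulr0 addr0 mulr0; apply => // [|s sc|s sc|s sc].
  - by apply: le_trans cM; rewrite ler_wpM2r.
  - have [_ _ P2] := PhiP x i s xr sc; have [_ Q2] := pt s (lt_le_trans sc c'c).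
    apply: is_deriveB => //.
    by have := is_derive_lsubmx P2; rewrite /lift_field row_mxKl.
  - have [_ P1 _] := PhiP x i s xr sc; have [Q1 _] := pt s (lt_le_trans sc c'c).
    by have [] := lV _ _ (HB _ _ P1) Q1.
  - have [_ P1 _] := PhiP x i s xr sc; have [Q1 _] := pt s (lt_le_trans sc c'c).
    by have [] := lV _ _ (HB _ _ P1) Q1; rewrite addr0.
have dVlip y a i : ball x0 r1 y -> ball x0 r1 a ->
    `|'d V y (e i) - 'd V a (e i)| <= Mi i * `|y - a|.
  move=> yr ar; have [_ rB lB _ _] := HF i.
  have B1 : B i (row_mx y (e i)) by apply/rB/row_ball/(le_ball (r1i i)).
  have B2 : B i (row_mx a (e i)) by apply/rB/row_ball/(le_ball (r1i i)).
  have [L1 _] := lB _ _ B1 B2.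
  apply: (le_trans (lift_field_norm V y a (e i))); apply: (le_trans L1).
  by rewrite ler_wpM2l// row_mxB subrr; exact: norm_row_mx0.
have dVb a w : ball x0 r1 a -> `|'d V a w| <= S * `|w|.
  move=> ar; apply: (le_trans (lin_bound _ _)); rewrite mulrC ler_wpM2r//.
  apply: ler_sum => i _.
  apply: (le_trans (norm_le_dist ('d V x0 (e i)) _)); rewrite lerD2l.
  apply: (le_trans (dVlip _ _ _ ar (ballxx x0 r10))); rewrite ler_wpM2l//.
  by move: ar; rewrite -ball_normE /= distrC => /ltW.
move=> x t xr tc.
pose W (s : R) (h : 'rV[R]_d) := \sum_i h 0 i *: rsubmx (Phi i s (row_mx x (e i))).
have Wlin : linear (W t).
  move=> a u v; rewrite /W scaler_sumr -big_split; apply: eq_bigr => i _.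
  by rewrite !mxE scalerDl scalerA.
have Wc : continuous (mklin Wlin).
  pose C := \sum_i `|mklin Wlin (delta_mx 0 i)|.
  apply: (@lip_continuous _ _ _ _ C); first exact: sumr_ge0.
  by move=> u v; rewrite -linearB mulrC; exact: lin_bound.
suff [d1 d2] : differentiable (phi t) x /\ 'd (phi t) x = mklin Wlin :> (_ -> _).
  by split => // [i|v]; [exact: lE | rewrite d2].
pose Q := 8 * c' * Mx.
have Q0 : 0 <= Q by rewrite !mulr_ge0// ltW.
have quad h : ball x0 (r1 / 2) (x + h) ->
    `|phi t (x + h) - phi t x - W t h| <= Q * `|h| ^+ 2.
  move=> xhr.
  have [p0 pt] := H x (le_ball r'r xr); have [q0 qt] := H (x + h) (le_ball r'r xhr).
  have lip2 (s : R) : `|s| < c' -> `|phi s (x + h) - phi s x| <= 2 * `|h|.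
    move=> sc; have := flow_on_lip FL (le_ball r'r xhr) (le_ball r'r xr)
      (lt_le_trans sc c'c).
    by rewrite [x + h]addrC addrK.
  have cs (s : R) : `|s| < c' -> `|s| < c by move=> sc; exact: lt_le_trans sc c'c.
  (* The remainder of the first-order expansion vanishes at time 0 and solves the variational
     equation up to an error [e2] quadratic in [h]; Gronwall then makes the remainder quadratic in
     [h]. *)
  pose u s := phi s (x + h) - phi s x - W s h.
  pose u' s := V (phi s (x + h)) - V (phi s x) - 'd V (phi s x) (W s h).
  pose e2 := Mx * (2 * `|h|) ^+ 2.
  have e20 : 0 <= e2 by rewrite mulr_ge0// exprn_ge0// mulr_ge0.
  have := @short_gronwall R d u u' c' S e2
    (2 * `|h| + \sum_i `|h| * (`|row_mx x0 (e i)| + Mi i)) c'0 S0 c'S e20.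
  have -> : u 0 = 0.
    rewrite /u p0 q0 /W [x + h]addrC addrK [X in X - _](row_sum_delta h) -sumrB.
    by apply: big1 => i _; have [-> _ _] := PhiP x i t xr tc; rewrite row_mxKr subrr.
  rewrite normr0 add0r => G.
  have -> : Q * `|h| ^+ 2 = 2 * (c' * e2) by rewrite /Q /e2 exprMn; ring.
  apply: G => // s sc.
  - rewrite /u /u'; apply: is_deriveB.
      by have [[_ d1] [_ d2]] := (qt s (cs s sc), pt s (cs s sc)); exact: is_deriveB.
    apply: lin_comb_derive => i; have [_ _ P2] := PhiP x i s xr sc.
    by have := is_derive_rsubmx P2; rewrite /lift_field row_mxKr lE.
  - rewrite /u; apply: (le_trans (ler_normB _ _)); apply: lerD; first exact: lip2.
    apply: (le_trans (ler_norm_sum _ _ _)); apply: ler_sum => i _.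
    rewrite normrZ ler_pM//; first exact: mx_norm_entry.
    apply: (le_trans (norm_rsubmx _)); have [_ P1 _] := PhiP x i s xr sc.
    have [_ rB lB _ _] := HF i.
    have [_ B1] := lB _ _ P1 (rB _ (ballxx _ (ri0 i))).
    rewrite -[Phi i s _](subrK (row_mx x0 (e i))) addrC.
    by apply: (le_trans (ler_normD _ _)); rewrite lerD2l.
  - set a := phi s x; set k := phi s (x + h) - phi s x.
    have ar : ball x0 r1 a by exact: inr1.
    have akr : ball x0 r1 (a + k) by rewrite /k [a + _]addrC subrK; exact: inr1.
    have -> : u' s = (V (a + k) - V a - 'd V a k) + 'd V a (u s).
      have Lu : 'd V a (u s) = 'd V a k - 'd V a (W s h) by exact: linearB.
      rewrite Lu [RHS]addrA subrK /u' -/a.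
      by have -> : phi s (x + h) = a + k by rewrite /k /a [RHS]addrC subrK.
    apply: (le_trans (ler_normD _ _)); rewrite addrC; apply: lerD.
      exact: dVb.
    have dVd y : ball x0 r1 y -> differentiable V y.
      by move=> yr; apply: (smooth_on_diff VA); apply: rA; apply: le_ball yr.
    have dac : continuous ('d V a) by exact/diff_continuous/dVd.
    have dg y : ball x0 r1 y -> differentiable (fun y => V y - 'd V a y) y /\
        forall w, 'd (fun y => V y - 'd V a y) y w = 'd V y w - 'd V a w.
      by move=> /dVd dVy; exact: diff_sub_lin.
    have -> : V (a + k) - V a - 'd V a k =
        (V (a + k) - 'd V a (a + k)) - (V a - 'd V a a).
      exact: sub_lin_split.
    have seg (q' : R) : 0 <= q' <= 1 -> ball x0 r1 (a + q' *: k).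
      by move=> q01; have := ball_convex q01 ar akr; rewrite [a + k - a]addrC addKr.
    apply: (@MVI _ _ _ _ (fun y => V y - 'd V a y) a k).
      by move=> q' /seg /dg[].
    move=> q' /andP[q'0 q'1]; have q01 : 0 <= q' <= 1 by rewrite !ltW.
    have yr := seg q' q01; rewrite (dg _ yr).2.
    apply: (le_trans (lin_sub_bound _ _ k)).
    have k2 : `|k| <= 2 * `|h| by exact: lip2.
    have -> : e2 = 2 * `|h| * (Mx * (2 * `|h|)) by rewrite /e2 expr2; ring.
    apply: ler_pM => //; first exact: sumr_ge0.
    rewrite /Mx mulr_suml; apply: ler_sum => i _ /=.
    apply: (le_trans (dVlip _ _ _ yr ar)); rewrite ler_wpM2l//.
    rewrite addrC addKr normrZ ger0_norm ?(ltW q'0)//; apply: le_trans k2.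
    by rewrite ler_piMl// ltW.
apply: eps_diff => // eps eps0.
have n1 : \forall h \near (0 : 'rV[R]_d), ball x0 (r1 / 2) (x + h).
  apply/(near0_shift x (fun y => ball x0 (r1 / 2) y)).
  by apply: open_nbhs_nbhs; split => //; exact: ball_open.
have n2 : \forall h \near (0 : 'rV[R]_d), `|h| < eps / (Q + 1).
  by apply: near_norm_lt; rewrite normr0 divr_gt0// ltr_wpDl.
apply: filterS2 n1 n2 => h /quad h1 h2; apply: (le_trans h1).
rewrite expr2 mulrA ler_wpM2r//.
move: h2; rewrite ltr_pdivlMr ?ltr_wpDl// => h2.
by have := normr_ge0 h; nra.
Qed.

(** The derivative of the flow is built from flows of the lifted field, to which the induction
    hypothesis applies. The dimension doubles at each step, hence the quantification over [d] after
    [k]. *)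
Lemma flow_Ck k : forall d (A : set 'rV[R]_d) V M x0 r c phi, smooth_on A V ->
  flow_on A V M x0 r c phi ->
  exists r' c', [/\ 0 < r' <= r, 0 < c' <= c &
    forall t : R, `|t| < c' -> Ck_on k (ball x0 r') (phi t)].
Proof.
elim: k => [|k IH] d A V M x0 r c phi VA FL.
  have [oA rA lV [r0 c0 M0 cM] H] := FL.
  exists r, c; split; rewrite ?r0 ?c0 ?lexx// => t tc x xr.
  apply: (@lip_continuous_at _ _ _ (phi t) x 2) => //.
  have n1 : \forall y \near x, ball x0 r y.
    by apply: open_nbhs_nbhs; split => //; exact: ball_open.
  by apply: filterS n1 => y yr; exact: flow_on_lip FL xr yr tc.
have [r1 [c1 [Phi [/andP[r10 r1r] /andP[c10 c1c] HPhi HD]]]] := flow_step VA FL.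
have oA : open A by case: FL.
have [oB lVs] := smooth_lift oA VA.
have Hi i : exists rc : R * R, [/\ 0 < rc.1 <= r1, 0 < rc.2 <= c1 &
    forall t : R, `|t| < rc.2 ->
      Ck_on k (ball (row_mx x0 (delta_mx 0 i)) rc.1) (Phi i t)].
  have [B [Mi [BA FB]]] := HPhi i.
  have sB : smooth_on B (lift_field V).
    by move=> j; exact: (Ck_on_sub BA (lVs j)).
  by have [r' [c' H]] := IH _ _ _ _ _ _ _ _ sB FB; exists (r', c').
have [rc Hrc] := choice Hi.
have [|r2 /andP[r20 r2r] r2i] := exists_min_ord r10 (ri := fun i => (rc i).1).
  by move=> i; have [/andP[]] := Hrc i.
have [|c2 /andP[c20 c2c] c2i] := exists_min_ord c10 (ri := fun i => (rc i).2).
  by move=> i; have [_ /andP[]] := Hrc i.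
exists r2, c2; split; rewrite ?r20 ?c20 ?(le_trans r2r)// ?(le_trans c2c)//.
move=> t tc; have tc1 : `|t| < c1 by exact: lt_le_trans c2c.
have sb x : ball x0 r2 x -> ball x0 r1 x by exact: le_ball.
have ob : open (ball x0 r2 : set 'rV[R]_d) by exact: ball_open.
split=> [x /sb xr|v]; first by have [] := HD x t xr tc1.
apply: (@Ck_on_ext _ _ _ _ _
  (fun x => \sum_i v 0 i *: rsubmx (Phi i t (row_mx x (delta_mx 0 i))))) => //.
  by move=> x /sb xr; have [_ _ ->] := HD x t xr tc1.
apply: Ck_on_mx => // i j.
apply: (@Ck_on_ext _ _ _ _ _
  (fun x => \sum_l (v 0 l : R^o) *
    (rsubmx (Phi l t (row_mx x (delta_mx 0 l))) i j) : R^o)) => //.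
  by move=> x _; rewrite summxE; apply: eq_bigr => l _; rewrite [RHS]mxE.
apply: Ck_on_sum => // l; apply: Ck_onM => //; first exact: Ck_on_cst.
have [_ _ Hl] := Hrc l.
have obl : open (ball (row_mx x0 (delta_mx 0 l)) (rc l).1 : set 'rV[R]_(d + d)).
  exact: ball_open.
apply: (Ck_on_comp (f := fun x => row_mx x (delta_mx 0 l))
  (g := fun z => rsubmx (Phi l t z) i j) (B := ball (row_mx x0 (delta_mx 0 l)) (rc l).1)) => //.
- move=> x; rewrite -!ball_normE /= => xr.
  rewrite opp_row_mx add_row_mx subrr; apply: (le_lt_trans (norm_row_mx0 _ _)).
  exact: lt_le_trans xr (r2i l).
- by apply: Ck_on_row_mx => //; [exact: Ck_on_id | exact: Ck_on_cst].
- apply: Ck_on_entry => //; apply: (Ck_on_lin obl (@rsubmx_continuous d d)).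
  by apply: Hl; exact: lt_le_trans (c2i l).
Qed.

(** This is the variational equation: the differential of the flow evolves by the linearisation of
    [V] along the trajectory. *)
Lemma flow_d d (A : set 'rV[R]_d) V M x0 r c phi : smooth_on A V ->
  flow_on A V M x0 r c phi ->
  exists r' c', [/\ 0 < r' <= r, 0 < c' <= c &
    forall x v (t : R), ball x0 r' x -> `|t| < c' ->
      is_derive t 1 (fun s => 'd (phi s) x v) ('d V (phi t x) ('d (phi t) x v))].
Proof.
move=> VA FL; have [r1 [c1 [Phi [r1r c1c HPhi HD]]]] := flow_step VA FL.
exists r1, c1; split => // x v t xr tc.
have [lE _ dE] := HD x t xr tc.
have near1 : \forall s \near t, `|s| < c1 by exact: (@near_norm_lt R R^o).
have : is_derive t 1 (fun s => \sum_i v 0 i *: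
    rsubmx (Phi i s (row_mx x (delta_mx 0 i)))) ('d V (phi t x) ('d (phi t) x v)).
  apply: (@eq_ind_r _ _ (fun w => is_derive t 1 _ ('d V (phi t x) w)) _ _ (dE v)).
  apply: (@lin_comb_derive _ _ _ _ ('d V (phi t x))
    (fun i s => rsubmx (Phi i s (row_mx x (delta_mx 0 i))))) => i.
  have [B [Mi [BA [_ _ _ _ FB]]]] := HPhi i.
  have xr' : ball (row_mx x0 (delta_mx 0 i : 'rV[R]_d)) r1 (row_mx x (delta_mx 0 i)).
    move: xr; rewrite -!ball_normE /= => xr.
    by rewrite opp_row_mx add_row_mx subrr; apply: (le_lt_trans (norm_row_mx0 _ _)).
  have [_ /(_ t tc)[_ P2]] := FB _ xr'.
  by have := is_derive_rsubmx P2; rewrite /lift_field row_mxKr lE.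
apply: near_eq_is_derive => //.
by apply: filterS near1 => s sc; have [_ _ ->] := HD x s xr sc.
Qed.

End SmoothDependence.

Section Uniqueness.
Context {R : realType}.

Lemma is_derive_shiftl (W : normedModType R) (u : R -> W) (t0 s : R) w :
  is_derive (t0 + s) 1 u w -> is_derive s 1 (fun s => u (t0 + s)) w.
Proof.
move=> du; have [df dE] := derive_diff du.
have E (r : R^o) : t0 + r *: (1 : R^o) = t0 + r by rewrite /GRing.scale /= mulr1.
have df' : differentiable (u : R^o -> W) (t0 + (s : R) *: (1 : R^o)) by rewrite E.
have := line_derive df'; rewrite E dE scale1r.
by under eq_fun do rewrite E.
Qed.

Lemma ode_unique_near d (A : set 'rV[R]_d) (V : 'rV[R]_d -> 'rV[R]_d) (u v : R -> 'rV[R]_d) (t0 : R) :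
  open A -> Ck_on 1 A V -> A (u t0) -> u t0 = v t0 ->
  (\forall t \near (t0 : R^o), is_derive (t : R) 1 u (V (u t))) ->
  (\forall t \near (t0 : R^o), is_derive (t : R) 1 v (V (v t))) ->
  \forall t \near (t0 : R^o), u t = v t.
Proof.
move=> oA VA Au uv du dv.
have [r [M [r0 M0 rA lV bV]]] := local_lip oA Au VA.
have nb w : w t0 = u t0 -> (\forall t \near (t0 : R^o), is_derive (t : R) 1 w (V (w t))) ->
    \forall t \near (t0 : R^o), ball (u t0) r (w t).
  move=> wu dw; have [df _] := derive_diff (nbhs_singleton dw).
  have wc := differentiable_continuous df; apply: wc.
  by rewrite wu; apply: open_nbhs_nbhs; split; [exact: ball_open | exact: ballxx].
have [e /= e0 He] := (@nbhs_ballP _ _ _ _).1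
  (filterI (filterI du (nb u erefl du)) (filterI dv (nb v (esym uv) dv))).
pose c := Num.min e (1 / (2 * (M + 1))).
have c0 : 0 < c by rewrite lt_min e0 divr_gt0// mulr_gt0// ltr_wpDl.
have cM : c * M <= 1 / 2.
  have : c * (2 * (M + 1)) <= 1.
    by rewrite -ler_pdivlMr ?mulr_gt0 ?ltr_wpDl// /c ge_min lexx orbT.
  by move: c0 => c0; nra.
have inb (s : R) : `|s| < c -> ball (t0 : R^o) e (t0 + s).
  move=> sc; rewrite -ball_normE /= opprD addNKr normrN (lt_le_trans sc)//.
  by rewrite ge_min lexx.
have key (s : R) : `|s| < c -> u (t0 + s) = v (t0 + s).
  move=> sc; apply/eqP; rewrite -subr_eq0 -normr_le0.
  have := @short_gronwall R d (fun s => u (t0 + s) - v (t0 + s))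
    (fun s => V (u (t0 + s)) - V (v (t0 + s))) c M 0 (r + r) c0 M0 cM (lexx 0).
  rewrite addr0 uv subrr normr0 mulr0 addr0 mulr0; apply => // q qc.
  - have [[d1 _] [d2 _]] := He _ (inb q qc).
    by apply: is_deriveB; apply: is_derive_shiftl.
  - have [[_ b1] [_ b2]] := He _ (inb q qc); move: b1 b2; rewrite -!ball_normE /=.
    move=> b1 b2; rewrite -(subrKA (u t0)); apply: (le_trans (ler_normD _ _)).
    by rewrite [`|u (t0 + q) - _|]distrC lerD// ltW.
  - have [[_ b1] [_ b2]] := He _ (inb q qc); rewrite addr0; exact: lV.
apply/nbhs_ballP; exists c => //= t; rewrite -ball_normE /= => tc.
by rewrite -[t](subrK t0) addrC; apply: key; rewrite distrC.
Qed.

End Uniqueness.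

(** * Conjugation into a commutant *)

Section Inner.
Context {R : realType} {d : nat}.
Implicit Types x y z : 'rV[R]_d.

Lemma innerC x y : inner x y = inner y x.
Proof. by apply: eq_bigr => k _; rewrite mulrC. Qed.

Lemma inner_delta x k : inner x (delta_mx 0 k) = x 0 k.
Proof.
rewrite /inner (bigD1 k)//= !mxE !eqxx mulr1 big1 ?addr0// => j jk.
by rewrite !mxE eqxx (negbTE jk) mulr0.
Qed.

Lemma innerP a x y z : inner (a *: x + y) z = a * inner x z + inner y z.
Proof.
by rewrite /inner mulr_sumr -big_split; apply: eq_bigr => k _; rewrite !mxE /=; ring.
Qed.

Lemma inner0l x : inner 0 x = 0.
Proof. by apply: big1 => k _; rewrite mxE mul0r. Qed.

Lemma innerDl x y z : inner (x + y) z = inner x z + inner y z.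
Proof. by have := innerP 1 x y z; rewrite scale1r mul1r. Qed.

Lemma innerZl a x z : inner (a *: x) z = a * inner x z.
Proof. by have := innerP a x 0 z; rewrite inner0l !addr0. Qed.

Lemma innerNl x z : inner (- x) z = - inner x z.
Proof. by rewrite -scaleN1r innerZl mulN1r. Qed.

Lemma innerBl x y z : inner (x - y) z = inner x z - inner y z.
Proof. by rewrite innerDl innerNl. Qed.

Lemma innerDr x y z : inner z (x + y) = inner z x + inner z y.
Proof. by rewrite innerC innerDl ![inner _ z]innerC. Qed.

Lemma innerZr a x z : inner z (a *: x) = a * inner z x.
Proof. by rewrite innerC innerZl innerC. Qed.

Lemma innerNr x z : inner z (- x) = - inner z x.
Proof. by rewrite innerC innerNl innerC. Qed.

Lemma innerBr x y z : inner z (x - y) = inner z x - inner z y.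
Proof. by rewrite innerDr innerNr. Qed.

Lemma inner_suml (I : finType) (F : I -> 'rV[R]_d) z :
  inner (\sum_i F i) z = \sum_i inner (F i) z.
Proof.
elim/big_ind2: _ => //; first exact: inner0l.
by move=> x a y b; rewrite innerDl => -> ->.
Qed.

Lemma inner_ge0 x : 0 <= inner x x.
Proof. by apply: sumr_ge0 => k _; rewrite -expr2 sqr_ge0. Qed.

Lemma norm_le_inner x : `|x| ^+ 2 <= inner x x.
Proof.
have xi k : `|x 0 k| ^+ 2 <= inner x x.
  rewrite /inner (bigD1 k)//= -expr2 real_normK ?num_real// lerDl.
  by apply: sumr_ge0 => i _; rewrite -expr2 sqr_ge0.
rewrite -(sqr_sqrtr (inner_ge0 x)) ler_sqr ?nnegrE ?normr_ge0 ?sqrtr_ge0//.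
apply: mx_norm_le; first exact: sqrtr_ge0.
move=> i j; rewrite ord1.
by rewrite -ler_sqr ?nnegrE ?normr_ge0 ?sqrtr_ge0// sqr_sqrtr ?inner_ge0.
Qed.

Lemma inner_le x y : `|inner x y| <= d%:R * (`|x| * `|y|).
Proof.
apply: le_trans (ler_norm_sum _ _ _) _.
apply: (@le_trans _ _ (\sum_(k < d) `|x| * `|y|)).
  by apply: ler_sum => k _; rewrite normrM ler_pM// mx_norm_entry.
by rewrite sumr_const card_ord -[leLHS]mulr_natl.
Qed.

Lemma inner_eq0 x : inner x x = 0 -> x = 0.
Proof.
move=> x0; apply/eqP; rewrite -normr_eq0 -sqrf_eq0; apply/eqP/le_anti.
by rewrite -{1}x0 norm_le_inner sqr_ge0.
Qed.

Lemma inner_sq_continuous : continuous (fun y => inner y y : R^o).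
Proof.
suff H : Ck_on 0 setT (fun y : 'rV[R]_d => inner y y : R^o) by move=> y; exact: H.
have oT : open [set: 'rV[R]_d] by exact: openT.
have e j : Ck_on 0 [set: 'rV[R]_d] (fun y : 'rV[R]_d => y 0 j : R^o).
  exact: (Ck_on_entry 0 j oT (Ck_on_id 0 _)).
exact: (Ck_on_sum oT (fun j => Ck_onM oT (e j) (e j))).
Qed.

Lemma is_derive_inner (u v : R -> 'rV[R]_d) (t : R) u' v' :
  is_derive t 1 u u' -> is_derive t 1 v v' ->
  is_derive t 1 (fun s => inner (u s) (v s) : R) (inner u' (v t) + inner (u t) v').
Proof.
move=> du dv.
have ce k : continuous (fun A : 'rV[R]_d => A 0 k : R^o) by exact: entry_continuous.
have dk (w : R -> 'rV[R]_d) w' k : is_derive t 1 w w' -> is_derive t 1 (fun s => w s 0 k) (w' 0 k).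
  by move=> dw; apply: (is_derive_lin (L := mklin (entry_is_linear 0 k)) (ce k) dw).
have H k : is_derive t 1 (fun s => u s 0 k * v s 0 k)
    (u t 0 k *: v' 0 k + v t 0 k *: u' 0 k).
  by apply: is_deriveM; exact: dk.
have D := is_derive_sum H; rewrite fct_sumE in D; apply: (is_derive_eq D).
have ar (a b c e : R) : a * b + c * e = e * c + a * b by ring.
by rewrite /inner -big_split; apply: eq_bigr => k _; exact: ar.
Qed.

(** The rows of [kermx M^T] span the orthogonal complement of the row space of [M]: the two meet in
    0 and their ranks add up to [d]. *)
Lemma orth_decomp r (M : 'M[R]_(r, d)) x :
  exists h w, [/\ x = h + w, (h <= M)%MS & forall y, (y <= M)%MS -> inner y w = 0].
Proof.
pose K := (kermx M^T).
have KM y w : (y <= M)%MS -> (w <= K)%MS -> inner y w = 0.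
  move=> /submxP[a ->] /sub_kermxP wM.
  have e : (a *m M) *m w^T = 0 by rewrite -mulmxA -(trmxK M) -trmx_mul wM trmx0 mulmx0.
  have /matrixP/(_ 0 0) := e; rewrite mxE mxE => <-.
  by apply: eq_bigr => k _; rewrite [w^T _ _]mxE.
have cap0 : (M :&: K)%MS = 0.
  apply/eqP; rewrite -submx0; apply/row_subP => i.
  have : (row i (M :&: K) <= M :&: K)%MS by exact: row_sub.
  rewrite sub_capmx => /andP[a b].
  by rewrite (inner_eq0 (KM _ _ a b)) sub0mx.
have full : row_full (M + K)%MS.
  have := mxrank_sum_cap M K; rewrite cap0 mxrank0 addn0 mxrank_ker mxrank_tr => e.
  by rewrite /row_full e subnKC// rank_leq_col.
have /sub_addsmxP[[u v] /= e] : (x <= M + K)%MS by exact: submx_full.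
exists (u *m M), (v *m K); split => //; first exact: submxMl.
by move=> y yM; apply: KM => //; exact: submxMl.
Qed.

End Inner.

Section Subspace.
Context {R : realType} {d : nat}.

Lemma lin_continuous (W : normedModType R) (F : {linear 'rV[R]_d -> W}) :
  continuous F.
Proof.
apply: (@lip_continuous _ _ _ _ (\sum_i `|F (delta_mx 0 i)|)).
  by apply: sumr_ge0.
by move=> x y; rewrite -linearB mulrC lin_bound.
Qed.

Lemma subspace_closed r (M : 'M[R]_(r, d)) (x : 'rV[R]_d) :
  (forall e, 0 < e -> exists2 y : 'rV[R]_d, (y <= M)%MS & `|x - y| < e) ->
  (x <= M)%MS.
Proof.
move=> H; have [h [w [xE hM wM]]] := orth_decomp M x.
suff w0 : w = 0 by rewrite xE w0 addr0.
apply/eqP/negP => /negP w0.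
have wp : 0 < `|w| by rewrite normr_gt0.
have /H[y yM] : 0 < `|w| / d.+1%:R by rewrite divr_gt0.
rewrite ltr_pdivlMr// => xy.
have : inner (x - y) w = inner w w.
  by rewrite xE innerBl innerDl (wM h hM) (wM y yM) add0r subr0.
move=> e; have := norm_le_inner w; rewrite -e; apply/negP; rewrite -ltNge.
apply: le_lt_trans (ler_norm _) _; apply: le_lt_trans (inner_le _ _) _.
rewrite expr2 mulrA ltr_pM2r//; apply: le_lt_trans xy.
by rewrite mulrC ler_wpM2l// ler_nat.
Qed.

Lemma derive_subspace r (M : 'M[R]_(r, d)) (u : R -> 'rV[R]_d) (t : R) u' :
  is_derive t 1 u u' -> (\forall s \near (t : R^o), (u s <= M)%MS) -> (u' <= M)%MS.
Proof.
move=> du nM; have [h [w [uE hM wM]]] := orth_decomp M u'.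
suff w0 : w = 0 by rewrite uE w0 addr0.
apply: inner_eq0.
have d1 : is_derive t 1 (fun s => inner (u s) w) (inner u' w).
  have dc : is_derive t 1 (fun _ : R => w) 0 by exact: is_derive_cst.
  apply: (is_derive_eq (is_derive_inner du dc)).
  by rewrite [inner _ 0]innerC inner0l addr0.
have nE : {near (t : R^o), (fun s => inner (u s) w) =1 cst 0}.
  by apply: filterS nM => s sM; exact: wM.
have e : inner u' w = 0.
  have [_ <-] := d1.
  by rewrite (near_eq_derive _ nE) derive_cst.
by rewrite -e uE innerDl (wM h hM) add0r.
Qed.

End Subspace.

(** * Conjugation in a Lie algebra with an invariant inner product *)

Section Conjugacy.
Context {R : realType} {d : nat}.
Local Notation L := 'rV[R]_d.
Variable br : L -> L -> L.
Hypothesis brP : forall a x y z, br (a *: x + y) z = a *: br x z + br y z.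
Hypothesis brN : forall x y, br x y = - br y x.
Hypothesis brJ : forall x y z, br x (br y z) = br (br x y) z + br y (br x z).
Hypothesis brI : forall x y z, inner (br x y) z = inner x (br y z).
Variable gg : 'M[R]_d.
Variable GG : 'M[R]_d -> Prop.
Hypothesis GG1 : GG 1%:M.
Hypothesis GGM : forall u v, GG u -> GG v -> GG (u *m v).
Hypothesis GGmem : forall u (x : L), GG u -> (x <= gg)%MS -> (x *m u <= gg)%MS.
Hypothesis GGbr : forall u x y, GG u -> (x <= gg)%MS -> (y <= gg)%MS ->
  br x y *m u = br (x *m u) (y *m u).
Hypothesis GGflow : forall k, (k <= gg)%MS -> exists2 c : R, 0 < c &
  exists U : R -> 'M[R]_d, forall t : R, `|t| < c -> GG (U t) /\
    forall x, (x <= gg)%MS -> x *m U 0 = x /\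
      is_derive t 1 (fun s => x *m U s) (br k (x *m U t)).

Lemma brr x : br x x = 0.
Proof.
have := brN x x; move/eqP; rewrite -subr_eq0 opprK -mulr2n -scaler_nat scaler_eq0.
by rewrite pnatr_eq0 => /eqP.
Qed.

Lemma br0l x : br 0 x = 0.
Proof. by have := brP (-1) 0 0 x; rewrite scaler0 addr0 scaleN1r addrC subrr. Qed.

Lemma brPr a x y z : br z (a *: x + y) = a *: br z x + br z y.
Proof. by rewrite brN brP opprD -scalerN -!brN. Qed.

Lemma brDr x y z : br z (x + y) = br z x + br z y.
Proof. by have := brPr 1 x y z; rewrite !scale1r. Qed.

Lemma brBr x y z : br z (x - y) = br z x - br z y.
Proof. by have := brPr (-1) y x z; rewrite !scaleN1r addrC => ->; rewrite addrC. Qed.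

Lemma br_lin z : linear (br^~ z).
Proof. by move=> a x y; exact: brP. Qed.

Lemma br_linr z : linear (br z).
Proof. by move=> a x y; exact: brPr. Qed.

Lemma br_bound k : exists2 b, 0 <= b & forall x, `|br k x| <= b * `|x|.
Proof.
exists (\sum_i `|br k (delta_mx 0 i)|); first by apply: sumr_ge0.
by move=> x; rewrite mulrC; exact: (lin_bound (mklin (br_linr k))).
Qed.

(** The bracket is the velocity at time 0 of a flow that does not leave [gg]. *)
Lemma gg_br x y : (x <= gg)%MS -> (y <= gg)%MS -> (br x y <= gg)%MS.
Proof.
move=> xg yg; have [c c0 [U HU]] := GGflow xg.
have /HU[_ /(_ y yg)[U0 dU]] : `|0 : R| < c by rewrite normr0.
rewrite U0 in dU; apply: (derive_subspace dU).
have : \forall s \near (0 : R^o), `|s| < c by apply: near_norm_lt; rewrite normr0.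
by apply: filterS => s /HU[gu _]; exact: GGmem.
Qed.

Definition commutes (h : 'M[R]_d) (m : L) : Prop :=
  (m <= gg)%MS /\ forall x, (x <= h)%MS -> br x m = 0.

Definition subalg (h : 'M[R]_d) : Prop :=
  (h <= gg)%MS /\ forall x y, (x <= h)%MS -> (y <= h)%MS -> (br x y <= h)%MS.

Definition Gsub (h u : 'M[R]_d) : Prop :=
  [/\ GG u, forall x : L, (x <= gg)%MS -> inner (x *m u) (x *m u) = inner x x,
    forall x : L, (x <= h)%MS -> (x *m u <= h)%MS &
    forall m, commutes h m -> m *m u = m].

Lemma Gsub1 h : Gsub h 1%:M.
Proof. by split => // [x|x|m _]; rewrite mulmx1. Qed.

Lemma GsubM h u v : (h <= gg)%MS -> Gsub h u -> Gsub h v -> Gsub h (u *m v).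
Proof.
move=> hg [gu iu hu cu] [gv iv hv cv]; split; first exact: GGM.
- by move=> x xg; rewrite mulmxA iv ?iu//; exact: GGmem.
- by move=> x xh; rewrite mulmxA; apply: hv; exact: hu.
- by move=> m cm; rewrite mulmxA cu// cv.
Qed.

Lemma const_of_derive0 (f : R -> R) (c : R) : 0 < c ->
  (forall t : R, `|t| < c -> is_derive t 1 f 0) -> forall t, `|t| < c -> f t = f 0.
Proof.
move=> c0 df t tc.
have H (r : R) : `|r| < c -> is_derive r 1 (fun s => const_mx (f s) : 'rV[R]_1) 0.
  move=> rc; apply: derive_mx_entries => i; rewrite mxE.
  by have := df r rc; congr is_derive; apply/funext => s; rewrite mxE.
have : `|(const_mx (f t) : 'rV[R]_1) - const_mx (f 0)| <= 0 * `|t - 0|.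
  by apply: (curve_MVI (c := c) _ tc H) => [|r _]; rewrite normr0.
rewrite mul0r normr_le0 subr_eq0 => /eqP/matrixP/(_ 0 0).
by rewrite !mxE.
Qed.

Lemma flow_sub h k : subalg h -> (k <= h)%MS -> exists2 c : R, 0 < c &
  exists U : R -> 'M[R]_d, forall t : R, `|t| < c -> Gsub h (U t) /\
    forall x, (x <= gg)%MS -> x *m U 0 = x /\
      is_derive t 1 (fun s => x *m U s) (br k (x *m U t)).
Proof.
move=> [hg hbr] kh; have kg := submx_trans kh hg.
have [c c0 [U HU]] := GGflow kg.
exists c => //; exists U => t tc; split; last by have [] := HU t tc.
have dU x (s : R) : (x <= gg)%MS -> `|s| < c ->
    is_derive s 1 (fun s => x *m U s) (br k (x *m U s)).
  by move=> xg sc; have [_ /(_ x xg)[]] := HU s sc.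
have U0 (x : L) : (x <= gg)%MS -> x *m U 0 = x.
  by move=> xg; have [_ /(_ x xg)[]] := HU t tc.
split; first by have [] := HU t tc.
- move=> x xg.
  rewrite (const_of_derive0 (f := fun s => inner (x *m U s) (x *m U s)) c0 _ tc) ?U0//.
  move=> s sc; apply: (is_derive_eq (is_derive_inner (dU x s xg sc) (dU x s xg sc))).
  by rewrite [inner (x *m _) _]innerC -mulr2n brI brr innerC inner0l mul0rn.
- move=> x xh; have xg := submx_trans xh hg.
  (* [P] and [Q] are the matrices of the orthogonal projections onto [h] and its complement. The
     complementary part of the trajectory has constant norm, because the bracket by [k] is skew and
     preserves [h]; it vanishes initially, so the trajectory stays in [h]. *)
  have [P [Q [PQ Ph Qh]]] : exists P Q : 'M[R]_d, [/\ P + Q = 1%:M,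
      forall y : L, (y *m P <= h)%MS & forall y z : L, (z <= h)%MS -> inner z (y *m Q) = 0].
    pose D i := cid (orth_decomp h (delta_mx 0 i)).
    pose W i := cid (svalP (D i)).
    exists (\matrix_i sval (D i)), (\matrix_i sval (W i)); split.
    - apply/row_matrixP => i; rewrite rowE mulmxDr -!rowE !rowK row1.
      by have [] := svalP (W i).
    - move=> y; rewrite mulmx_sum_row; apply: summx_sub => i _.
      by rewrite scalemx_sub// rowK; have [] := svalP (W i).
    - move=> y z zh; rewrite mulmx_sum_row innerC inner_suml big1// => i _.
      rewrite innerZl rowK innerC; have [_ _ H] := svalP (W i).
      by rewrite H// mulr0.
  have xE (y : L) : y = y *m P + y *m Q by rewrite -mulmxDr PQ mulmx1.
  suff : inner (x *m U t *m Q) (x *m U t *m Q) = 0.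
    by move/inner_eq0 => q0; rewrite [x *m U t]xE q0 addr0.
  have dQ (s : R) : `|s| < c -> is_derive s 1 (fun s => x *m U s *m Q) (br k (x *m U s) *m Q).
    move=> sc; apply: (is_derive_lin (L := mulmxr Q) _ (dU x s xg sc)).
    exact: lin_continuous.
  rewrite (const_of_derive0 (f := fun s => inner (x *m U s *m Q) (x *m U s *m Q)) c0 _ tc).
    rewrite U0//; set q := x *m Q; have : inner x q = 0 by exact: Qh.
    rewrite {1}[x]xE innerDl Qh ?add0r//; exact: Ph.
  move=> s sc; apply: (is_derive_eq (is_derive_inner (dQ s sc) (dQ s sc))).
  set y := x *m U s; rewrite [inner (y *m Q) _]innerC -mulr2n.
  have e1 : inner (br k y) (y *m Q) = inner (br k y *m Q) (y *m Q).
    by rewrite {1}(xE (br k y)) innerDl (Qh y _ (Ph _)) add0r.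
  have e2 : br k y = br k (y *m P) + br k (y *m Q).
    exact: (etrans (congr1 (br k) (xE y)) (brDr _ _ _)).
  rewrite -e1 e2 innerDl (Qh y _ (hbr _ _ kh (Ph y))) add0r.
  by rewrite brI brr innerC inner0l mul0rn.
- move=> m [mg mh].
  (* The squared distance from the trajectory of [m] to [m] has derivative 0: the bracket by [k] is
     skew and annihilates [m]. *)
  apply/eqP; rewrite -subr_eq0; apply/eqP/inner_eq0.
  rewrite (const_of_derive0 (f := fun s => inner (m *m U s - m) (m *m U s - m)) c0 _ tc).
    by rewrite U0// subrr inner0l.
  move=> s sc.
  have dm : is_derive s 1 (fun s => m *m U s - m) (br k (m *m U s)).
    have dc : is_derive s 1 (fun _ : R => - m) 0 by exact: is_derive_cst.
    by apply: (is_derive_eq (is_deriveD (dU m s mg sc) dc)); rewrite addr0.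
  apply: (is_derive_eq (is_derive_inner dm dm)).
  rewrite [inner (_ - _) _]innerC -mulr2n innerBr brI brr [inner k 0]innerC inner0l sub0r.
  by rewrite brN innerNl brI mh// innerC inner0l oppr0 oppr0 mul0rn.
Qed.

Lemma deriv_max0 (f : R -> R) (t f' : R) : is_derive t 1 f f' ->
  (\forall s \near (t : R^o), f s <= f t) -> f' = 0.
Proof.
move=> df; move/near0_shift => nm; apply/eqP/negP => /negP f0.
have [dif dE] := derive_diff df.
have e0 : 0 < `|f'| / 2 by rewrite divr_gt0 ?normr_gt0.
have nd := diff_eps dif e0.
have [r /= r0 Hr] : \forall h \near (0 : R^o), f (t + h) <= f t /\
    `|f (t + h) - f t - h * f'| <= `|f'| / 2 * `|h|.
  by apply: filterS2 nm nd => h h1 h2; split => //; have := h2; rewrite dE.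
pose h := r / 2 * Num.sg f'.
have hn : `|h| = r / 2 by rewrite normrM normr_sg f0 mulr1 gtr0_norm// divr_gt0.
have /Hr[h1] : ball (0 : R^o) r h.
  by rewrite -ball_normE /= sub0r normrN hn ltr_pdivrMr// ltr_pMr// ltr1n.
have hf : h * f' = r / 2 * `|f'| by rewrite /h -mulrA -normrEsg.
rewrite hn hf => h2.
have p : 0 < r / 2 * `|f'| by rewrite mulr_gt0 ?divr_gt0 ?normr_gt0.
move: h2; rewrite ler_norml => /andP[h2 _]; nra.
Qed.

Section Product.
Variables (h : 'M[R]_d) (c b : R) (k : nat -> L) (U : nat -> R -> 'M[R]_d) (r0 : nat).
Hypotheses (hs : subalg h) (c0 : 0 < c) (b0 : 0 <= b).
Hypothesis kb : forall i x, (i < r0)%N -> `|br (k i) x| <= b * `|x|.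
Hypothesis kh : forall i, (i < r0)%N -> (k i <= h)%MS.
Hypothesis HU : forall i (t : R), (i < r0)%N -> `|t| < c -> Gsub h (U i t) /\
    forall x, (x <= gg)%MS -> x *m U i 0 = x /\
      is_derive t 1 (fun s => x *m U i s) (br (k i) (x *m U i t)).

(** Coordinates of the second kind: the product of the one-parameter families taken at independent
    times. *)
Fixpoint Psi (t : nat -> R) (r : nat) : 'M[R]_d :=
  if r is r'.+1 then Psi t r' *m U r' (t r') else 1%:M.

Local Notation N := (d%:R + 1 : R).

(** Elements of [Gsub] are isometries for [inner], while the norm is the sup norm; the two norms
    differ by a factor at most the square root of [d], majorised by [N]. *)
Lemma iso_norm (u : 'M[R]_d) (x : L) : Gsub h u -> (x <= gg)%MS ->
  `|x *m u| <= N * `|x|.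
Proof.
move=> [_ iu _ _] xg.
have N0 : 0 <= N by rewrite addr_ge0.
rewrite -ler_sqr ?nnegrE ?mulr_ge0//; apply: le_trans (norm_le_inner _) _.
rewrite iu//; apply: le_trans (ler_norm _) _; apply: le_trans (inner_le _ _) _.
rewrite exprMn -expr2 ler_wpM2r ?sqr_ge0//.
have : 0 <= d%:R :> R by []. nra.
Qed.

Lemma Gsub_Psi t r : (r <= r0)%N -> (forall i, (i < r)%N -> `|t i| < c) ->
  Gsub h (Psi t r).
Proof.
have [hg _] := hs.
elim: r => [|r IH] rr tc /=; first exact: Gsub1.
apply: GsubM => //; first by apply: IH => [|i ir]; [exact: ltnW | apply: tc; exact: ltnW].
by have [] := HU rr (tc r (ltnSn r)).
Qed.

Lemma Gsub_gg (u : 'M[R]_d) (x : L) : Gsub h u -> (x <= gg)%MS -> (x *m u <= gg)%MS.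
Proof. by move=> [gu _ _ _]; exact: GGmem. Qed.

Lemma U_lip i (x : L) s t : (i < r0)%N -> (x <= gg)%MS -> `|s| < c -> `|t| < c ->
  `|x *m U i t - x *m U i s| <= b * N * `|x| * `|t - s|.
Proof.
move=> ir xg sc tc.
apply: (curve_MVI (c := c) (u := fun s => x *m U i s)
  (u' := fun s => br (k i) (x *m U i s))) => // q qc.
  by have [_ /(_ x xg)[]] := HU ir qc.
have [gu _] := HU ir qc; apply: le_trans (kb _ ir) _.
by rewrite -mulrA ler_wpM2l// iso_norm.
Qed.

Lemma U_quad i (x : L) t : (i < r0)%N -> (x <= gg)%MS -> `|t| < c ->
  `|x *m U i t - x - t *: br (k i) x| <= 2 * b * (b * N * `|x|) * `|t| ^+ 2.
Proof.
move=> ir xg tc.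
have z0 : `|0 : R| < c by rewrite normr0.
have U0 : x *m U i 0 = x by have [_ /(_ x xg)[]] := HU ir z0.
have N0 : 0 <= N by rewrite addr_ge0.
have [->|tn0] := eqVneq t 0.
  by rewrite U0 subrr scale0r subr0 normr0 !mulr_ge0// sqr_ge0.
have tp : 0 < `|t| by rewrite normr_gt0.
(* An interval only slightly longer than needed: on it the derivative of the remainder is of the
   order of [|t|], which makes the remainder quadratic. *)
pose c1 := Num.min c (2 * `|t|).
have c1P (q : R) : `|q| < c1 -> `|q| < c /\ `|q| < 2 * `|t|.
  by rewrite lt_min => /andP[].
have tc1 : `|t| < c1 by rewrite lt_min tc ltr_pMl// ltr1n.
have zc1 : `|0 : R| < c1 by rewrite normr0 lt_min c0 mulr_gt0.
have H (q : R) : `|q| < c1 -> is_derive q 1 (fun s => x *m U i s - s *: br (k i) x)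
    (br (k i) (x *m U i q) - br (k i) x).
  move=> /c1P[qc _]; have [_ /(_ x xg)[_ dU]] := HU ir qc.
  exact: (is_deriveB dU (is_derive_scalel q (br (k i) x))).
have Hb (q : R) : `|q| < c1 -> `|br (k i) (x *m U i q) - br (k i) x| <=
    b * (b * N * `|x| * (2 * `|t|)).
  move=> /c1P[qc qt]; rewrite -brBr; apply: le_trans (kb _ ir) _.
  rewrite ler_wpM2l// -{2}U0; apply: le_trans (U_lip ir xg z0 qc) _.
  by rewrite subr0 ler_wpM2l ?mulr_ge0// ltW.
have := curve_MVI zc1 tc1 H Hb; rewrite U0 scale0r !subr0 addrAC => /le_trans; apply.
by rewrite le_eqVlt; apply/orP; left; apply/eqP; ring.
Qed.

Lemma Psi_lip r : (r <= r0)%N -> exists2 C, 0 <= C & forall t t' e (x : L), (x <= gg)%MS ->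
  (forall i, (i < r)%N -> [/\ `|t i| < c, `|t' i| < c & `|t i - t' i| <= e]) ->
  0 <= e -> `|x *m Psi t r - x *m Psi t' r| <= C * e * `|x|.
Proof.
have N0 : 0 <= N by rewrite addr_ge0.
have [hg _] := hs.
elim: r => [|r IH] rr.
  by exists 0 => // t t' e x _ _ _; rewrite subrr normr0 !mul0r.
have [C C0 HC] := IH (ltnW rr).
exists (N * C + b * N * N) => [|t t' e x xg tt e0 /=].
  by rewrite addr_ge0 ?mulr_ge0.
have tt1 i : (i < r)%N -> [/\ `|t i| < c, `|t' i| < c & `|t i - t' i| <= e].
  by move=> ir; apply: tt; exact: ltnW.
have [tr tr' trd] := tt r (ltnSn r).
have G1 : Gsub h (Psi t r) by apply: Gsub_Psi => [|i /tt1[]//]; exact: ltnW.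
have G2 : Gsub h (Psi t' r) by apply: Gsub_Psi => [|i /tt1[]//]; exact: ltnW.
have [gu _] := HU rr tr.
rewrite !mulmxA; set y := x *m Psi t r; set y' := x *m Psi t' r.
have yg : (y <= gg)%MS by exact: Gsub_gg.
have yg' : (y' <= gg)%MS by exact: Gsub_gg.
have -> : y *m U r (t r) - y' *m U r (t' r) =
  (y - y') *m U r (t r) + (y' *m U r (t r) - y' *m U r (t' r)).
  by rewrite mulmxBl addrA subrK.
apply: le_trans (ler_normD _ _) _.
have yyg : (y - y' <= gg)%MS by rewrite addmx_sub// eqmx_opp.
have h1 := iso_norm gu yyg.
have h2 := HC t t' e x xg tt1 e0.
have h3 := U_lip rr yg' tr' tr.
have h4 := iso_norm G2 xg.
have h5 : N * `|y - y'| <= N * (C * e * `|x|) by rewrite ler_wpM2l.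
have h6 : b * N * `|y'| * `|t r - t' r| <= b * N * (N * `|x|) * e.
  by rewrite ler_pM// ?mulr_ge0// ler_wpM2l// mulr_ge0.
have -> : (N * C + b * N * N) * e * `|x| = N * (C * e * `|x|) + b * N * (N * `|x|) * e by ring.
by apply: lerD; [exact: le_trans h1 h5 | exact: le_trans h3 h6].
Qed.

Lemma Psi0 (x : L) r : (r <= r0)%N -> (x <= gg)%MS -> x *m Psi (fun=> 0) r = x.
Proof.
have z0 : `|0 : R| < c by rewrite normr0.
elim: r => [|r IH] rr xg /=; first by rewrite mulmx1.
rewrite mulmxA IH//; last exact: ltnW.
by have [_ /(_ x xg)[]] := HU rr z0.
Qed.

Lemma Psi_quad r (x : L) : (r <= r0)%N -> (x <= gg)%MS -> exists2 C, 0 <= C & forall t e,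
  (forall i, (i < r)%N -> `|t i| <= e) -> 0 <= e -> e < c ->
  `|x *m Psi t r - x - \sum_(i < r) t i *: br (k i) x| <= C * e ^+ 2.
Proof.
have N0 : 0 <= N by rewrite addr_ge0.
have [hg _] := hs => + xg.
elim: r => [|r IH] rr.
  by exists 0 => // t e _ _ _; rewrite big_ord0 mulmx1 subrr subr0 normr0 mul0r.
have [C C0 HC] := IH (ltnW rr).
have [C' C'0 HC'] := Psi_lip (ltnW rr).
exists (2 * b * (b * N * (N * `|x|)) + b * (C' * `|x|) + C) => [|t e te e0 ec /=].
  by rewrite !addr_ge0 ?mulr_ge0.
have te1 i : (i < r)%N -> `|t i| <= e by move=> ir; apply: te; exact: ltnW.
have tc i : (i < r)%N -> `|t i| < c by move=> /te1 /le_lt_trans; apply.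
have ter := te r (ltnSn r); have tr := le_lt_trans ter ec.
have G1 : Gsub h (Psi t r) by apply: Gsub_Psi => //; exact: ltnW.
rewrite mulmxA big_ord_recr /=; set y := x *m Psi t r.
have yg : (y <= gg)%MS by exact: Gsub_gg.
set S := \sum_(i < r) _.
have -> : y *m U r (t r) - x - (S + t r *: br (k r) x) =
  (y *m U r (t r) - y - t r *: br (k r) y) + t r *: br (k r) (y - x) + (y - x - S).
  by rewrite brBr; apply/rowP => j; rewrite !mxE; ring.
have h1 := U_quad rr yg tr.
have h2 := HC t e te1 e0 ec.
have h3 : `|y - x| <= C' * e * `|x|.
  rewrite -{1}(Psi0 (ltnW rr) xg); apply: HC' => // i ir.
  by rewrite normr0 subr0; split; [exact: tc | | exact: te1].
have h4 : `|t r *: br (k r) (y - x)| <= e * (b * (C' * e * `|x|)).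
  rewrite normrZ ler_pM//; apply: le_trans (kb _ rr) _.
  by rewrite ler_wpM2l.
have h5 : 2 * b * (b * N * `|y|) * `|t r| ^+ 2 <= 2 * b * (b * N * (N * `|x|)) * e ^+ 2.
  rewrite ler_pM ?mulr_ge0 ?sqr_ge0//; last by rewrite ler_sqr ?nnegrE.
  by rewrite ler_wpM2l ?mulr_ge0// ler_wpM2l ?mulr_ge0// iso_norm.
have -> : (2 * b * (b * N * (N * `|x|)) + b * (C' * `|x|) + C) * e ^+ 2 =
  2 * b * (b * N * (N * `|x|)) * e ^+ 2 + e * (b * (C' * e * `|x|)) + C * e ^+ 2 by ring.
apply: le_trans (ler_normD _ _) _; apply: lerD => //.
apply: le_trans (ler_normD _ _) _; apply: lerD => //.
exact: le_trans h1 h5.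
Qed.

Definition upd (t : nat -> R) (j : nat) (s : R) : nat -> R :=
  fun i => if i == j then s else t i.

Lemma Psi_upd t j s r : (r <= j)%N -> Psi (upd t j s) r = Psi t r.
Proof.
elim: r => [//|r IH] rj /=; rewrite IH; last exact: ltnW.
by rewrite /upd (ltn_eqF rj).
Qed.

Lemma Psi_ext t t' r : (forall i, (i < r)%N -> t i = t' i) -> Psi t r = Psi t' r.
Proof.
elim: r => [//|r IH] H /=; rewrite IH => [|i ir]; last by apply: H; exact: ltnW.
by rewrite H.
Qed.

(** Differentiating in the [j]-th time inserts a bracket by [k j] before the later factors; carrying
    these through the bracket replaces [k j] by [k j *m tau], where [tau] is their product and
    differs from the identity by [O(e)]. *)
Lemma Psi_derive r : (r <= r0)%N -> exists2 C, 0 <= C & forall (t : nat -> R) (e : R),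
  (forall i, (i < r)%N -> `|t i| <= e) -> 0 <= e -> e < c -> forall j, (j < r)%N ->
  exists tau, [/\ Gsub h tau,
    forall y : L, (y <= gg)%MS -> `|y *m tau - y| <= C * e * `|y| &
    forall x : L, (x <= gg)%MS -> is_derive (t j) 1 (fun s => x *m Psi (upd t j s) r)
      (br (k j *m tau) (x *m Psi t r))].
Proof.
have N0 : 0 <= N by rewrite addr_ge0.
have [hg _] := hs.
elim: r => [|r IH] rr; first by exists 0.
have [C C0 HC] := IH (ltnW rr).
exists (b * N * N + C) => [|t e te e0 ec j]; first by rewrite addr_ge0 ?mulr_ge0.
have te1 i : (i < r)%N -> `|t i| <= e by move=> ir; apply: te; exact: ltnW.
have tc i : (i < r)%N -> `|t i| < c by move=> /te1 /le_lt_trans; apply.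
have ter := te r (ltnSn r); have tr := le_lt_trans ter ec.
have G1 : Gsub h (Psi t r) by apply: Gsub_Psi => //; exact: ltnW.
rewrite ltnS leq_eqVlt => /predU1P[->|jr].
  exists 1%:M; split; first exact: Gsub1.
    by move=> y _; rewrite mulmx1 subrr normr0 !mulr_ge0// addr_ge0 ?mulr_ge0.
  move=> x xg; rewrite mulmx1 /= mulmxA.
  have [_ /(_ (x *m Psi t r))] := HU rr tr; case; first exact: Gsub_gg.
  move=> _; congr is_derive; apply/funext => s.
  by rewrite Psi_upd// mulmxA /upd eqxx.
have [tau [gt tb td]] := HC t e te1 e0 ec j jr.
have [gu _] := HU rr tr.
exists (tau *m U r (t r)); split; first exact: GsubM.
  move=> y yg; rewrite mulmxA.
  have z0 : `|0 : R| < c by rewrite normr0.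
  have yt := Gsub_gg gt yg.
  have U0 : y *m tau *m U r 0 = y *m tau by have [_ /(_ _ yt)[]] := HU rr z0.
  have -> : y *m tau *m U r (t r) - y =
    (y *m tau *m U r (t r) - y *m tau *m U r 0) + (y *m tau - y).
    by rewrite U0 addrA subrK.
  have h1 := U_lip rr yt z0 tr; rewrite subr0 in h1.
  have h2 : b * N * `|y *m tau| * `|t r| <= b * N * (N * `|y|) * e.
    by rewrite ler_pM// ?mulr_ge0// ler_wpM2l ?mulr_ge0// iso_norm.
  have -> : (b * N * N + C) * e * `|y| = b * N * (N * `|y|) * e + C * e * `|y| by ring.
  apply: le_trans (ler_normD _ _) _; apply: lerD; last exact: tb.
  exact: le_trans h1 h2.
move=> x xg; rewrite /= !mulmxA.
have kg : (k j *m tau <= gg)%MS.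
  apply: Gsub_gg => //; apply: submx_trans hg; apply: kh; exact: ltn_trans jr rr.
have [gU _ _ _] := gu.
rewrite -(GGbr gU kg) ?Gsub_gg//.
have lc : continuous (mulmxr (U r (t r)) : L -> L) by exact: lin_continuous.
have := is_derive_lin (L := mulmxr (U r (t r))) lc (td x xg).
congr is_derive; apply/funext => s /=.
by rewrite mulmxA /upd (gtn_eqF jr).
Qed.

End Product.

Lemma row_free_bound r (M : 'M[R]_(r, d)) : row_free M ->
  exists2 C, 0 <= C & forall t : 'rV[R]_r, `|t| <= C * `|t *m M|.
Proof.
move=> fM; exists (\sum_i `|mulmxr (pinvmx M) (delta_mx 0 i : 'rV[R]_d)|).
  by apply: sumr_ge0.
move=> t; rewrite -{1}(mulmxKp fM t) mulrC.
exact: (lin_bound (mulmxr (pinvmx M))).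
Qed.

(** Minimise the distance from [A *m u] to [Ai] over products of flows in the directions of the
    image of the bracket by [Ai]. At an interior minimum the bracket of the optimal point with [Ai]
    is almost orthogonal to these directions; since it also lies in their span, it vanishes. *)
Lemma local_conj h (Ai : L) : subalg h -> (Ai <= h)%MS ->
  exists2 e, 0 < e & forall A : L, (A <= h)%MS -> `|A - Ai| < e ->
    exists2 u, Gsub h u & br (A *m u) Ai = 0.
Proof.
move=> hs Aih; have [hg hbr] := hs; have Aig := submx_trans Aih hg.
pose ad := lin1_mx (mklin (br_lin Ai)).
have adE x : x *m ad = br x Ai by rewrite mul_rV_lin1.
pose M := row_base (h *m ad); set r := \rank (h *m ad) in M.
have ME x : (x <= h)%MS -> (br x Ai <= M)%MS.
  by move=> xh; rewrite eq_row_base -adE submxMr.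
have MEx t : (t *m M : L) = t *m M -> exists2 x : L, (x <= h)%MS & t *m M = br x Ai.
  move=> _; have : (t *m M <= h *m ad)%MS by rewrite -(eq_row_base (h *m ad)) submxMl.
  by move=> /submxP[a ->]; exists (a *m h); rewrite ?submxMl// -adE mulmxA.
have Mh (t : 'rV[R]_r) : (t *m M <= h)%MS.
  by have [x xh ->] := MEx t erefl; exact: hbr.
(* The bracket by [Ai] is skew, hence injective on its own image. *)
have fMa : row_free (M *m ad).
  rewrite -kermx_eq0; apply/eqP/row_matrixP => i; rewrite row0.
  set t := row i _; have tM : t *m M *m ad = 0.
    by rewrite -mulmxA; apply/sub_kermxP; exact: row_sub.
  have [x xh xE] := MEx t erefl.
  have : inner (t *m M) (t *m M) = 0.
    by rewrite {1}xE brI brN -adE tM oppr0 innerC inner0l.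
  move/inner_eq0 => t0; have := row_base_free (h *m ad).
  by rewrite -kermx_eq0 => /eqP k0; apply/eqP; rewrite -submx0 -k0; apply/sub_kermxP.
have fM : row_free M by exact: row_base_free.
have [m' m'0 Hm'] := row_free_bound fMa.
have [C1 C10 HC1] := row_free_bound fM.
pose k (i : nat) : L := if insub i is Some j then row j M else 0.
have kE (i : 'I_r) : k i = row i M by rewrite /k valK.
have kh i : (k i <= h)%MS.
  by rewrite /k; case: insub => [j|]; rewrite ?sub0mx// rowE Mh.
have HF (i : 'I_r) := flow_sub hs (kh i).
have /choice[cU HcU] : forall i : 'I_r, exists cU : R * (R -> 'M[R]_d), 0 < cU.1 /\
    forall t : R, `|t| < cU.1 -> Gsub h (cU.2 t) /\
    forall x, (x <= gg)%MS -> x *m cU.2 0 = x /\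
      is_derive t 1 (fun s => x *m cU.2 s) (br (k i) (x *m cU.2 t)).
  by move=> i; have [c c0 [U HU]] := HF i; exists (c, U).
have [c /andP[c0 c1] Hc] := exists_min_ord ltr01 (fun i => (HcU i).1).
pose U (i : nat) : R -> 'M[R]_d := if insub i is Some j then (cU j).2 else fun=> 1%:M.
have HU i (t : R) : (i < r)%N -> `|t| < c -> Gsub h (U i t) /\
    forall x, (x <= gg)%MS -> x *m U i 0 = x /\
      is_derive t 1 (fun s => x *m U i s) (br (k i) (x *m U i t)).
  move=> ir tc; rewrite /U; case: insubP => [j _ ji|]; last by rewrite ir.
  rewrite -ji; apply: (HcU j).2; exact: lt_le_trans tc (Hc j).
have /choice[bb Hbb] : forall i : 'I_r, exists b, 0 <= b /\ forall x, `|br (k i) x| <= b * `|x|.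
  by move=> i; have [b b0 Hb] := br_bound (k i); exists b.
pose b := \sum_i bb i.
have b0 : 0 <= b by apply: sumr_ge0 => i _; exact: (Hbb i).1.
have kb i x : (i < r)%N -> `|br (k i) x| <= b * `|x|.
  move=> ir; apply: le_trans ((Hbb (Ordinal ir)).2 x) _; rewrite ler_wpM2r//.
  rewrite /b (bigD1 (Ordinal ir))//= lerDl; apply: sumr_ge0 => j _; exact: (Hbb j).1.
have kh' i : (i < r)%N -> (k i <= h)%MS by [].
have [Cq Cq0 HCq] := Psi_quad hs c0 b0 kb HU (leqnn r) Aig.
have [Cd Cd0 HCd] := Psi_derive hs c0 b0 kb kh' HU (leqnn r).
have [Cl Cl0 HCl] := Psi_lip hs b0 kb HU (leqnn r).
pose N : R := d%:R + 1.
have N0 : 1 <= N by rewrite lerDr.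
pose kk := \sum_(i < r) `|k i|.
have kk0 : 0 <= kk by apply: sumr_ge0.
(* The second term makes the quadratic error of [Psi_quad] smaller than half of the linear
   displacement of [Ai]; the third makes every [tau] of [Psi_derive] close enough to the identity
   for the final estimate to have a factor at most 1/2. *)
pose del := Num.min (c / 2) (Num.min (1 / (2 * (m' + 1) * (Cq + 1)))
  (1 / (2 * (C1 + 1) * N * (Cd + 1) * (kk + 1)))).
have del0 : 0 < del.
  rewrite !lt_min !divr_gt0//= ?mulr_gt0// ?ltr_wpDl//; exact: lt_le_trans ltr01 N0.
have delc : del < c.
  by rewrite /del gt_min ltr_pdivrMr// ltr_pMr// ltr1n.
have delq : 2 * (m' + 1) * (Cq + 1) * del <= 1.
  rewrite mulrC -ler_pdivlMr; last by rewrite !mulr_gt0// ltr_wpDl.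
  by rewrite /del !ge_min lexx orbT.
have deld : 2 * (C1 + 1) * N * (Cd + 1) * (kk + 1) * del <= 1.
  rewrite mulrC -ler_pdivlMr.
    by rewrite /del !ge_min lexx !orbT.
  by rewrite !mulr_gt0// ?ltr_wpDl//; exact: lt_le_trans ltr01 N0.
have N1 : 0 < N by exact: lt_le_trans ltr01 N0.
have m1 : 0 < m' + 1 by rewrite ltr_wpDl.
pose ee := del / (8 * (m' + 1) * N).
have eeE : (m' + 1) * (N * ee) = del / 8 by rewrite /ee; field; lra.
have ee0 : 0 < ee by rewrite divr_gt0// !mulr_gt0.
exists ee => // A Ah AAi; have Ag := submx_trans Ah hg.
have Dg : (A - Ai <= gg)%MS by rewrite addmx_sub// eqmx_opp.
pose T (t : 'rV[R]_r) (i : nat) : R := if insub i is Some j then t 0 j else 0.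
have TE t (i : 'I_r) : T t i = t 0 i by rewrite /T valK.
have TO t i (ir : (i < r)%N) : T t i = t 0 (Ordinal ir) by rewrite -TE.
pose E t := inner (A *m Psi U (T t) r - Ai) (A *m Psi U (T t) r - Ai).
pose box := [set t : 'rV[R]_r | forall i, `[- del, del]%classic (t 0 i)].
have boxP t i : box t -> `|t 0 i| <= del by move=> /(_ i) /=; rewrite in_itv /= ler_norml.
have Tc t i : box t -> (i < r)%N -> `|T t i| <= del by move=> bt ir; rewrite TO; exact: boxP.
have GP t : box t -> Gsub h (Psi U (T t) r).
  by move=> bt; apply: (Gsub_Psi hs HU (leqnn r)) => i ir; apply: le_lt_trans delc; exact: Tc.
have cbox : compact box.
  exact: (@rV_compact R r (fun=> `[- del, del]%classic) (fun=> @segment_compact R _ _)).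
have b00 : box 0 by move=> i /=; rewrite mxE in_itv /= oppr_le0 ltW.
have Ec : {within box, continuous E}.
  apply: continuous_in_subspaceT => t /set_mem bt.
  have c1' : {for t, continuous (fun t => A *m Psi U (T t) r - Ai)}.
    apply: (@lip_continuous_at _ _ _ _ _ (Cl * `|A|)); first by rewrite mulr_ge0.
    have nc : \forall t' \near (t : 'rV[R]_r), forall i : 'I_r, `|(t' : 'rV[R]_r) 0 i| < c.
      apply: near_forall_ord => i.
      have tic : `|t 0 i| < c by apply: le_lt_trans delc; exact: boxP.
      exact: (@entry_continuous R 1 r 0 i t _ (near_norm_lt (x := t 0 i : R^o) tic)).
    apply: filterS nc => t' t'c.
    rewrite opprB addrA subrK -mulrA [`|A| * _]mulrC mulrA.
    apply: HCl => // i ir; rewrite !TO; split; last 1 first.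
    - have := mx_norm_entry ((t : 'rV[R]_r) - t') 0 (Ordinal ir); rewrite !mxE; exact.
    - by apply: le_lt_trans delc; exact: boxP.
    - exact: t'c.
  exact: (continuous_comp c1' (@inner_sq_continuous R d _)).
have [ts /set_mem bts Hts] := compact_EVT_min (ex_intro _ _ b00) cbox Ec.
have Emin t : box t -> E ts <= E t by move=> bt; apply: Hts; exact/mem_set.
set B := A *m Psi U (T ts) r.
have Bh : (B <= h)%MS by have [_ _ H _] := GP ts bts; exact: H.
have Bg := submx_trans Bh hg.
have T0 : Psi U (T 0) r = Psi U (fun=> 0) r.
  have -> // : T 0 = (fun=> 0).
  by apply/funext => i; rewrite /T; case: insub => // j; rewrite mxE.
have upper : `|B - Ai| <= N * `|A - Ai|.
  have Nn : 0 <= N * `|A - Ai| by rewrite mulr_ge0// ltW.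
  rewrite -ler_sqr ?nnegrE//; apply: le_trans (norm_le_inner _) _.
  apply: le_trans (Emin 0 b00) _; rewrite /E T0 (Psi0 c0 HU)//.
  apply: le_trans (ler_norm _) _; apply: le_trans (inner_le _ _) _.
  rewrite exprMn -expr2 ler_wpM2r ?sqr_ge0// /N.
  have : 0 <= d%:R :> R by [].
  nra.
have sumE (t : 'rV[R]_r) x : \sum_(i < r) T t i *: br (k i) x = br (t *m M) x.
  rewrite mulmx_sum_row -[RHS]/(mklin (br_lin x) _) linear_sum.
  by apply: eq_bigr => i _; rewrite linearZ /= TE kE.
(* At a boundary point the linear term displaces [Ai] by at least [del / (m' + 1)], more than the
   quadratic error together with the [2 N ee] that minimality allows. *)
have interior (i : 'I_r) : `|ts 0 i| < del.
  rewrite ltNge; apply/negP => dli.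
  have q := HCq (T ts) del (fun i => Tc ts i bts) (ltW del0) delc.
  rewrite sumE -adE in q; set Y := _ *m ad in q.
  have Yb : del <= (m' + 1) * `|Y|.
    apply: le_trans dli _; apply: le_trans (mx_norm_entry _ _ _) _.
    apply: le_trans (Hm' ts) _; by rewrite mulmxA ler_wpM2r// lerDl.
  have i1 : `|Y| <= `|Ai *m Psi U (T ts) r - Ai| + Cq * del ^+ 2.
    apply: le_trans (norm_le_dist (Ai *m Psi U (T ts) r - Ai) Y) _.
    by rewrite lerD2l distrC.
  have i2 : `|Ai *m Psi U (T ts) r - Ai| <= `|B - Ai| + N * `|A - Ai|.
    have := iso_norm (GP ts bts) Dg; rewrite mulmxBl -/B => i3.
    have -> : Ai *m Psi U (T ts) r - Ai = (B - Ai) - (B - Ai *m Psi U (T ts) r).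
      by apply/rowP => q'; rewrite !mxE; ring.
    by apply: le_trans (ler_normB _ _) _; rewrite lerD2l.
  have i4 : N * `|A - Ai| < N * ee by rewrite ltr_pM2l.
  have i5 : (m' + 1) * `|Y| <= (m' + 1) * (N * ee + N * ee + Cq * del ^+ 2).
    rewrite ler_pM2l//; lra.
  have i6 : (m' + 1) * (Cq * del ^+ 2) <= del / 2.
    have : del * (2 * (m' + 1) * (Cq + 1) * del) <= del * 1 by rewrite ler_pM2l.
    have : 0 <= (m' + 1) * del ^+ 2 by rewrite mulr_ge0 ?sqr_ge0// ltW.
    nra.
  have : (m' + 1) * (N * ee + N * ee + Cq * del ^+ 2) = del / 8 + del / 8 + (m' + 1) * (Cq * del ^+ 2).
    by rewrite !mulrDr eeE.
  lra.
pose y := br B Ai.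
(* Stationarity in the [j]-th time gives orthogonality of [y] to the transported direction
   [k j *m tau], not to [k j] itself; the difference is small. *)
have crit (j : 'I_r) : exists tau : 'M[R]_d, `|k j *m tau - k j| <= Cd * del * `|k j| /\
    inner (k j *m tau) y = 0.
  have [tau [_ tb td]] := HCd (T ts) del (fun i => Tc ts i bts) (ltW del0) delc j (ltn_ord j).
  exists tau; split; first by apply: tb; exact: submx_trans (kh j) hg.
  have dA := td A Ag; rewrite -/B in dA.
  have dAi : is_derive (T ts j) 1 (fun s => A *m Psi U (upd (T ts) j s) r - Ai)
      (br (k j *m tau) B).
    have dc : is_derive (T ts j) 1 (fun _ : R => - Ai) 0 by exact: is_derive_cst.
    by apply: (is_derive_eq (is_deriveD dA dc)); rewrite addr0.
  have dE := is_deriveN (is_derive_inner dAi dAi).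
  have PU (s : R) : Psi U (upd (T ts) j s) r =
      Psi U (T (\row_i (if i == j then s else ts 0 i))) r.
    apply: Psi_ext => i ir; rewrite /upd !TO mxE -val_eqE /=.
    by [].
  have updts : Psi U (upd (T ts) j (T ts j)) r = Psi U (T ts) r.
    by apply: Psi_ext => i ir; rewrite /upd; case: eqP => // ->.
  have := deriv_max0 dE; rewrite updts -/B [inner (B - Ai) _]innerC -mulr2n => H.
  have /eqP : - (inner (br (k j *m tau) B) (B - Ai) *+ 2) = 0.
    apply: H; have nj : \forall s \near (T ts j : R^o), `|s| < del.
      by apply: near_norm_lt; rewrite TE.
    apply: filterS nj => s sd; rewrite lerN2 updts.
    have := Emin (\row_i (if i == j then s else ts 0 i)); rewrite /E -PU; apply.
    move=> i /=; rewrite in_itv /= -ler_norml mxE; case: ifP => _; first exact: ltW.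
    exact: boxP.
  rewrite oppr_eq0 mulrn_eq0 /= innerBr brI brr [inner _ 0]innerC inner0l sub0r oppr_eq0.
  by rewrite brI => /eqP.
exists (Psi U (T ts) r); first exact: GP.
rewrite -/B -/y; apply/eqP; rewrite -normr_eq0; apply/eqP/le_anti; rewrite normr_ge0 andbT.
have yM : (y <= M)%MS by exact: ME.
pose tau := y *m pinvmx M.
have ytau : y = tau *m M by rewrite mulmxKpV.
have taub : `|tau| <= C1 * `|y| by have := HC1 tau; rewrite -ytau.
have yy : inner y y <= (C1 * `|y|) * (d%:R * (Cd * del * kk * `|y|)).
  have -> : inner y y = inner (tau *m M) y by rewrite -ytau.
  rewrite mulmx_sum_row inner_suml.
  have -> : (C1 * `|y|) * (d%:R * (Cd * del * kk * `|y|)) =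
    \sum_(j < r) (C1 * `|y|) * (d%:R * (Cd * del * `|k j| * `|y|)).
    by rewrite -mulr_sumr -mulr_sumr -mulr_suml -mulr_sumr.
  apply: ler_sum => j _; rewrite innerZl -kE.
  have [ta [t1 t2]] := crit j.
  have -> : inner (k j) y = - inner (k j *m ta - k j) y.
    by rewrite innerBl t2 sub0r opprK.
  apply: le_trans (ler_norm _) _; rewrite normrM normrN ler_pM//.
    by apply: le_trans (mx_norm_entry _ _ _) taub.
  by apply: le_trans (inner_le _ _) _; rewrite ler_wpM2l// ler_wpM2r.
have y2 := norm_le_inner y.
have dN : d%:R <= N by rewrite lerDl.
have d0 : 0 <= d%:R :> R by [].
have f1 : C1 * d%:R * (Cd * del * kk) <= 1 / 2.
  have a1 : C1 * d%:R <= (C1 + 1) * N by apply: ler_pM => //; rewrite lerDl.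
  have a2 : Cd * del * kk <= (Cd + 1) * (kk + 1) * del.
    by rewrite mulrAC ler_wpM2r ?(ltW del0)//; apply: ler_pM => //; rewrite lerDl.
  have a3 : C1 * d%:R * (Cd * del * kk) <= (C1 + 1) * N * ((Cd + 1) * (kk + 1) * del).
    by apply: ler_pM; rewrite ?mulr_ge0// ltW.
  lra.
have : (C1 * `|y|) * (d%:R * (Cd * del * kk * `|y|)) <= 1 / 2 * `|y| ^+ 2.
  have -> : (C1 * `|y|) * (d%:R * (Cd * del * kk * `|y|)) =
    C1 * d%:R * (Cd * del * kk) * `|y| ^+ 2 by ring.
  by rewrite ler_wpM2r// sqr_ge0.
have := normr_ge0 y; nra.
Qed.

(** Induction on the rank of [h]. A maximiser [Ai] of [inner x D] over the closure of the orbit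
    commutes with [D], so [D] lies in the commutant [h'] of [Ai] in [h]; [local_conj] moves a point
    of the orbit there too. Elements commuting with [h] stay fixed, which [simultaneous]
    exploits. *)
Lemma conjugate_commute n h (A D : L) : (\rank h <= n)%N -> subalg h ->
  (A <= h)%MS -> (D <= h)%MS ->
  exists u, [/\ GG u, br (A *m u) D = 0 & forall m, commutes h m -> m *m u = m].
Proof.
elim: n h A => [|n IH] h A hn hs Ah Dh; have [hg hbr] := hs.
  have h0 : h = 0 by apply/eqP; rewrite -mxrank_eq0 -leqn0.
  exists 1%:M; split => // [|m _]; rewrite mulmx1//.
  by move: Ah; rewrite h0 submx0 => /eqP ->; exact: br0l.
have Ag := submx_trans Ah hg; have Dg := submx_trans Dh hg.
pose orb := [set A *m u | u in Gsub h].
have orbb x : orb x -> `|x| <= (d%:R + 1) * `|A|.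
  by move=> [u gu <-]; exact: (iso_norm gu).
have orb0 : closure orb !=set0.
  by exists A; apply: subset_closure; exists 1%:M; [exact: Gsub1 | rewrite mulmx1].
have cb : compact (closure orb).
  apply: bounded_closed_compact; last exact: closed_closure.
  exists ((d%:R + 1) * `|A|); split; first exact: num_real.
  move=> M AM x xc; apply: ltW; rewrite -subr_gt0.
  have [|z [oz]] := xc (ball x ((M - (d%:R + 1) * `|A|) / 2)).
    by apply: nbhsx_ballx; rewrite divr_gt0 ?subr_gt0.
  rewrite -ball_normE /= => zx; have := orbb z oz.
  have := ler_distD 0 x z; rewrite subr0 sub0r normrN => _.
  have : `|x| <= `|z| + `|x - z| by have := norm_le_dist z x; rewrite distrC (distrC z).
  lra.
have fc : {within closure orb, continuous (fun x : L => inner x D : R)}.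
  apply: continuous_subspaceT => x.
  have li : linear (fun x : L => inner x D : R^o) by move=> a p q; exact: innerP.
  exact: (@lin_continuous R d R^o (mklin li) x).
have [Ai /set_mem Aic Aimax] := compact_EVT_max orb0 cb fc.
have clo v : Gsub h v -> closure orb (Ai *m v).
  move=> gv B nB.
  have lc : continuous (mulmxr v : L -> L) by exact: lin_continuous.
  have [_ [[u gu <-] Bu]] := Aic _ (lc Ai B nB).
  by exists (A *m u *m v); split => //; exists (u *m v); [exact: GsubM | rewrite mulmxA].
have near_orb e : 0 < e -> exists2 u, Gsub h u & `|Ai - A *m u| < e.
  move=> e0; have [_ [[u gu <-]]] := Aic (ball Ai e) (nbhsx_ballx _ _ e0).
  by rewrite -ball_normE /= => H; exists u.
have Aih : (Ai <= h)%MS.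
  apply: subspace_closed => e /near_orb[u [_ _ hu _] ue].
  by exists (A *m u) => //; exact: hu.
have Aig := submx_trans Aih hg.
(* Flowing in the direction [k = br Ai D] changes [inner x D] at the rate [inner k k] up to sign, so
   stationarity forces [k = 0]. *)
have AiD : br Ai D = 0.
  apply: inner_eq0; set k := br Ai D; have kh : (k <= h)%MS by exact: hbr.
  have [c c0 [U HU]] := flow_sub hs kh.
  have z0 : `|0 : R| < c by rewrite normr0.
  have [_ /(_ Ai Aig)[U0 dU]] := HU 0 z0; rewrite U0 in dU.
  have dc : is_derive (0 : R) 1 (fun _ : R => D) 0 by exact: is_derive_cst.
  have := deriv_max0 (is_derive_inner dU dc).
  rewrite U0 [inner Ai 0]innerC inner0l addr0 brI; apply.
  have : \forall s \near (0 : R^o), `|s| < c by exact: near_norm_lt.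
  apply: filterS => s /HU[gs _]; rewrite innerC [leRHS]innerC ![inner D _]innerC.
  by apply: Aimax; apply/mem_set; exact: clo.
(* If [Ai] commutes with all of [h], it is fixed by [Gsub h]; isometries keep the orbit at constant
   distance from [Ai], and since the orbit approaches [Ai] this distance is 0. *)
have [cen|ncen] := pselect (forall x, (x <= h)%MS -> br x Ai = 0).
  suff -> : A = Ai by exists 1%:M; split => // [|m _]; rewrite mulmx1.
  apply/eqP; rewrite -subr_eq0 -normr_le0 leNgt; apply/negP => p.
  have N0 : 0 < (d%:R + 1 : R) by rewrite ltr_wpDl.
  have /near_orb[u gu ue] : 0 < `|A - Ai| / (d%:R + 1) by rewrite divr_gt0.
  have Dgg : (A - Ai <= gg)%MS by rewrite addmx_sub// eqmx_opp.
  have [gG iu _ cu] := gu.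
  have AA : Ai *m u = Ai by apply: cu; split.
  move: ue; rewrite ltr_pdivlMr// distrC -{1}AA -mulmxBl => ue.
  have e1 := iu _ Dgg.
  have e2 := norm_le_inner (A - Ai); rewrite -e1 in e2.
  have e3 := le_trans (ler_norm _) (inner_le ((A - Ai) *m u) ((A - Ai) *m u)).
  have d0 : 0 <= d%:R :> R by [].
  have := normr_ge0 ((A - Ai) *m u).
  set a := `|(A - Ai) *m u| in ue e3 *; set q := `|A - Ai| in p ue e2 *.
  move=> a0; have : q ^+ 2 <= d%:R * (a * a) by exact: le_trans e2 e3.
  have : (a * (d%:R + 1)) ^+ 2 < q ^+ 2.
    by rewrite ltr_sqr ?nnegrE ?mulr_ge0// ltW.
  rewrite exprMn => s1 s2; have : 0 <= a ^+ 2 by exact: sqr_ge0.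
  nra.
have [e e0 He] := local_conj hs Aih.
have [u1 gu1 u1e] := near_orb e e0; have [gG1 _ hu1 cu1] := gu1.
have [|u2 gu2 u2c] := He (A *m u1) (hu1 _ Ah); first by rewrite distrC.
have [gG2 _ hu2 cu2] := gu2.
pose ad := lin1_mx (mklin (br_lin Ai)).
have adE x : x *m ad = br x Ai by rewrite mul_rV_lin1.
pose h' := (h :&: kermx ad)%MS.
have h'P x : (x <= h')%MS = (x <= h)%MS && (br x Ai == 0).
  rewrite sub_capmx -adE; congr (_ && _); apply/sub_kermxP/eqP => //.
have h'h : (h' <= h)%MS by exact: capmxSl.
have rk : (\rank h' <= n)%N.
  rewrite -ltnS; apply: leq_trans hn; rewrite ltn_neqAle mxrankS// andbT.
  apply: contra_notN ncen => /eqP rke x xh.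
  have : (h' == h)%MS by rewrite /eqmx -(geq_leqif (mxrank_leqif_eq h'h)) rke.
  move=> /andP[_ /(submx_trans xh)]; rewrite h'P => /andP[_ /eqP//].
have hs' : subalg h'.
  split=> [|x y]; first exact: submx_trans hg.
  rewrite !h'P => /andP[xh /eqP x0] /andP[yh /eqP y0]; rewrite hbr//=.
  have := brJ x y Ai; rewrite x0 y0 => /esym/eqP; rewrite [br y 0]brN br0l oppr0 addr0.
  by rewrite [br x 0]brN br0l oppr0.
have [||u3 [gG3 u3D u3c]] := IH h' (A *m u1 *m u2) rk hs'.
- by rewrite h'P u2c eqxx andbT; apply: hu2; exact: hu1.
- by rewrite h'P Dh brN AiD oppr0 eqxx.
exists (u1 *m u2 *m u3); split; first by do 2?apply: GGM.
  by rewrite !mulmxA.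
move=> m cm; rewrite !mulmxA cu1// cu2// u3c//; case: cm => mg mh; split => // x.
by move=> xh; apply: mh; exact: submx_trans h'h.
Qed.

End Conjugacy.

(** * Kahler manifolds in charts *)

Opaque diff.

Lemma diff_near_comp {R : realType} (V W U : normedModType R) (f : V -> W)
    (g : W -> U) (h : V -> U) x v y : f x = y ->
  differentiable f x -> differentiable g y ->
  (\forall z \near x, g (f z) = h z) ->
  differentiable h x /\ 'd h x v = 'd g y ('d f x v).
Proof.
move=> <- df dg E; have [dh dhE] := near_eq_diff E (differentiable_comp df dg).
by split => //; rewrite dhE; exact: (dcompE v df dg).
Qed.

Section Charts.
Context {R : realType} {n : nat} {N : charted R (n + n)}.
Hypothesis hN : complex_manifold N.
Local Notation X := 'rV[R]_(n + n).
Local Notation chartN := (chart R N (n + n)).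

Lemma chart_atP (p : N) : atlas (chart_at p) /\ dom (chart_at p) p.
Proof.
have [_ _ /(_ p)[c ca cp] _ _] := hN.
rewrite /chart_at; apply: (@xgetPex _ _ [set c | atlas c /\ dom c p]).
by exists c.
Qed.

Lemma chart_good (c : chartN) : atlas c -> good_chart c.
Proof. by have [_ _ _ + _] := hN; apply. Qed.

Lemma chart_open (c : chartN) : atlas c -> open (dom c) /\ open (cimage c).
Proof. by move=> /chart_good[]. Qed.

Lemma fwdK (c : chartN) p : atlas c -> dom c p -> bwd c (fwd c p) = p.
Proof. by move=> /chart_good[_ _ _ _]; apply. Qed.

Lemma cimage_fwd (c : chartN) p : dom c p -> cimage c (fwd c p).
Proof. by move=> cp; exists p. Qed.

Lemma bwdK (c : chartN) x : atlas c -> cimage c x ->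
  dom c (bwd c x) /\ fwd c (bwd c x) = x.
Proof. by move=> ca [p cp <-]; rewrite fwdK. Qed.

(** Inverse charts, the covering of the free points by [TE], and their composites with automorphisms
    are all smooth maps of this kind, so a single chain rule serves for them. *)
Definition sparam e (A : set 'rV[R]_e) (Psi : 'rV[R]_e -> N) : Prop :=
  [/\ open A, forall u, A u -> {for u, continuous Psi} &
    forall c : chartN, atlas c -> smooth_on (A `&` Psi @^-1` dom c) (fwd c \o Psi)].

Lemma sparam_near e (A : set 'rV[R]_e) Psi (c : chartN) u : sparam A Psi ->
  atlas c -> A u -> dom c (Psi u) ->
  \forall y \near u, A y /\ dom c (Psi y).
Proof.
move=> [oA Pc _] ca Au cu; have [oc _] := chart_open ca.
have n1 : \forall y \near u, A y by apply: open_nbhs_nbhs.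
have n2 : \forall y \near u, dom c (Psi y).
  by apply: (Pc u Au); apply: open_nbhs_nbhs.
exact: filterI.
Qed.

Lemma sparam_open e (A : set 'rV[R]_e) Psi (c : chartN) : sparam A Psi ->
  atlas c -> open (A `&` Psi @^-1` dom c).
Proof.
move=> sP ca; rewrite openE => u [Au cu] /=.
by have := sparam_near sP ca Au cu; apply: filterS.
Qed.

Lemma bwd_sparam (c : chartN) : atlas c -> sparam (cimage c) (bwd c).
Proof.
move=> ca; have [_ oc _ bc _] := chart_good ca; split => // c' c'a.
by have [_ _ _ _ /(_ c c' ca c'a)[]] := hN.
Qed.

Lemma sparam_diff e (A : set 'rV[R]_e) Psi (c : chartN) u : sparam A Psi ->
  atlas c -> A u -> dom c (Psi u) -> differentiable (fwd c \o Psi) u.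
Proof. by move=> [_ _ sP] ca Au cu; apply: (smooth_on_diff (sP c ca)). Qed.

Lemma transition_diff (c c' : chartN) p : atlas c -> atlas c' -> dom c p ->
  dom c' p -> differentiable (fwd c' \o bwd c) (fwd c p).
Proof.
move=> ca c'a cp c'p; apply: (sparam_diff (bwd_sparam ca) c'a).
  exact: cimage_fwd.
by rewrite fwdK.
Qed.

Lemma sparam_chain e (A : set 'rV[R]_e) Psi (c c' : chartN) u v : sparam A Psi ->
  A u -> atlas c -> atlas c' -> dom c (Psi u) -> dom c' (Psi u) ->
  'd (fwd c' \o Psi) u v =
  'd (fwd c' \o bwd c) (fwd c (Psi u)) ('d (fwd c \o Psi) u v).
Proof.
move=> sP Au ca c'a cu c'u.
have d1 := sparam_diff sP ca Au cu.
have d2 := transition_diff ca c'a cu c'u.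
have E : \forall y \near u, (fwd c' \o bwd c) ((fwd c \o Psi) y) = (fwd c' \o Psi) y.
  by apply: filterS (sparam_near sP ca Au cu) => y [_ cy] /=; rewrite fwdK.
exact: (diff_near_comp v erefl d1 d2 E).2.
Qed.

Lemma transition_chain (c1 c2 c3 : chartN) p v : atlas c1 -> atlas c2 ->
  atlas c3 -> dom c1 p -> dom c2 p -> dom c3 p ->
  'd (fwd c3 \o bwd c2) (fwd c2 p) ('d (fwd c2 \o bwd c1) (fwd c1 p) v) =
  'd (fwd c3 \o bwd c1) (fwd c1 p) v.
Proof.
move=> a1 a2 a3 p1 p2 p3.
have d1 := transition_diff a1 a2 p1 p2; have d2 := transition_diff a2 a3 p2 p3.
have e : (fwd c2 \o bwd c1) (fwd c1 p) = fwd c2 p by rewrite /= fwdK.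
have p2' : dom c2 (bwd c1 (fwd c1 p)) by rewrite fwdK.
have E : \forall y \near fwd c1 p, (fwd c3 \o bwd c2) ((fwd c2 \o bwd c1) y) =
    (fwd c3 \o bwd c1) y.
  apply: filterS (sparam_near (bwd_sparam a1) a2 (cimage_fwd p1) p2') => y [_ cy].
  by rewrite /= fwdK.
exact: esym (diff_near_comp v e d1 d2 E).2.
Qed.

Definition dparam e (Psi : 'rV[R]_e -> N) (u v : 'rV[R]_e) : X :=
  'd (fwd (chart_at (Psi u)) \o Psi) u v.

(** Tangent vectors at [p] are stored by their components in [chart_at p]; [comp_in] and [comp_out]
    convert to and from components in another chart [c]. *)
Definition comp_in (c : chartN) (p : N) : X -> X :=
  'd (fwd c \o bwd (chart_at p)) (fwd (chart_at p) p).
Definition comp_out (c : chartN) (p : N) : X -> X :=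
  'd (fwd (chart_at p) \o bwd c) (fwd c p).

Lemma dparamE e (A : set 'rV[R]_e) Psi (c : chartN) u v : sparam A Psi ->
  A u -> atlas c -> dom c (Psi u) ->
  'd (fwd c \o Psi) u v = comp_in c (Psi u) (dparam Psi u v).
Proof.
move=> sP Au ca cu; have [aa ad] := chart_atP (Psi u).
exact: (sparam_chain v sP Au aa ca ad cu).
Qed.

Lemma transition_id (c : chartN) p v : atlas c -> dom c p ->
  'd (fwd c \o bwd c) (fwd c p) v = v.
Proof.
move=> ca cp; have [_ oc] := chart_open ca.
have E : \forall y \near fwd c p, y = (fwd c \o bwd c) y.
  have : \forall y \near fwd c p, cimage c y.
    by apply: open_nbhs_nbhs; split => //; exact: cimage_fwd.
  by apply: filterS => y cy /=; have [_ ->] := bwdK ca cy.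
have did : differentiable (fun y : X => y) (fwd c p) by exact: ex_diff.
have [_ ->] := near_eq_diff E did.
by have [_ ->] := is_diff_id (fwd c p).
Qed.

Lemma comp_outK (c : chartN) p v : atlas c -> dom c p ->
  comp_in c p (comp_out c p v) = v.
Proof.
move=> ca cp; have [aa ad] := chart_atP p.
rewrite -[RHS](@transition_id c p v ca cp) /comp_in /comp_out.
exact: transition_chain.
Qed.

Lemma comp_inK (c : chartN) p v : atlas c -> dom c p ->
  comp_out c p (comp_in c p v) = v.
Proof.
move=> ca cp; have [aa ad] := chart_atP p.
rewrite -[RHS](@transition_id (chart_at p) p v aa ad) /comp_in /comp_out.
exact: transition_chain.
Qed.

Lemma dparam_bwd (c : chartN) p v : atlas c -> dom c p ->
  dparam (bwd c) (fwd c p) v = comp_out c p v.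
Proof.
move=> ca cp; rewrite /dparam.
exact: (congr1 (fun q => 'd (fwd (chart_at q) \o bwd c) (fwd c p) v) (fwdK ca cp)).
Qed.

Lemma mulIK (v : X) : mulI (mulI v) = - v.
Proof.
rewrite /mulI row_mxKl row_mxKr -[in RHS](hsubmxK v) opp_row_mx.
by [].
Qed.

Fact mulI_is_linear : linear (@mulI R n).
Proof.
by move=> a u v; rewrite /mulI scale_row_mx add_row_mx !linearP.
Qed.

Lemma transition_mulI (c c' : chartN) p v : atlas c -> atlas c' -> dom c p ->
  dom c' p ->
  'd (fwd c' \o bwd c) (fwd c p) (mulI v) = mulI ('d (fwd c' \o bwd c) (fwd c p) v).
Proof.
move=> ca c'a cp c'p; have [_ _ _ _ /(_ c c' ca c'a)[_]] := hN; apply.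
by split; [exact: cimage_fwd | rewrite /= fwdK].
Qed.

Lemma comp_in_mulI (c : chartN) p v : atlas c -> dom c p ->
  comp_in c p (mulI v) = mulI (comp_in c p v).
Proof. by move=> ca cp; have [aa ad] := chart_atP p; exact: transition_mulI. Qed.

Lemma comp_out_mulI (c : chartN) p v : atlas c -> dom c p ->
  comp_out c p (mulI v) = mulI (comp_out c p v).
Proof. by move=> ca cp; have [aa ad] := chart_atP p; exact: transition_mulI. Qed.

Lemma field_inE (Y : vfield N) (c : chartN) p : atlas c -> dom c p ->
  field_in Y c (fwd c p) = comp_in c p (Y p).
Proof. by move=> ca cp; rewrite /field_in fwdK. Qed.

Lemma tensor_inE (g : tensor2 N) (c : chartN) p u v : atlas c -> dom c p ->
  tensor_in g c (fwd c p) u v = g p (comp_out c p u) (comp_out c p v).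
Proof. by move=> ca cp; rewrite /tensor_in fwdK. Qed.

Lemma dfunE e (W : normedModType R) (f : N -> W) (A : set 'rV[R]_e) Psi u v :
  smooth_fun f -> sparam A Psi -> A u ->
  differentiable (f \o Psi) u /\ 'd (f \o Psi) u v = dfun f (Psi u) (dparam Psi u v).
Proof.
move=> sf sP Au; have [aa ad] := chart_atP (Psi u).
have d1 := sparam_diff sP aa Au ad.
have d2 : differentiable (f \o bwd (chart_at (Psi u))) (fwd (chart_at (Psi u)) (Psi u)).
  by apply: (smooth_on_diff (sf _ aa)); exact: cimage_fwd.
have E : \forall y \near u, (f \o bwd (chart_at (Psi u)))
    ((fwd (chart_at (Psi u)) \o Psi) y) = (f \o Psi) y.
  by apply: filterS (sparam_near sP aa Au ad) => y [_ cy] /=; rewrite fwdK.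
exact: (diff_near_comp v erefl d1 d2 E).
Qed.

Lemma sparam_comp e (A : set 'rV[R]_e) Psi (phi : N -> N) :
  smooth_map_on setT phi -> sparam A Psi -> sparam A (phi \o Psi).
Proof.
move=> [phic phis] sP; have [oA Pc Ps] := sP; split => //.
  by move=> u Au; apply: continuous_comp; [exact: Pc | exact: phic].
move=> c ca k; apply: Ck_on_cover => u [Au cu].
have [aa ad] := chart_atP (Psi u); set c0 := chart_at (Psi u) in aa ad.
pose B := A `&` (Psi @^-1` dom c0 `&` (phi \o Psi) @^-1` dom c).
have oc0 := sparam_open sP aa.
have oB : open B.
  rewrite openE => y [Ay [cy dy]]; rewrite /interior /B.
  have n1 : \forall z \near y, A z by exact: open_nbhs_nbhs.
  have n2 : \forall z \near y, dom c0 (Psi z).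
    by apply: (Pc y Ay); apply: open_nbhs_nbhs; split => //; have [] := chart_open aa.
  have n3 : \forall z \near y, dom c (phi (Psi z)).
    apply: (continuous_comp (Pc y Ay) (phic (Psi y) I)).
    by apply: open_nbhs_nbhs; split => //; have [] := chart_open ca.
  exact: (filterI n1 (filterI n2 n3)).
exists B => //.
have tr := phis c0 c aa ca.
set D := (D in smooth_on D) in tr.
have oD : open D.
  have sb := bwd_sparam aa; have [ob bc _] := sb.
  rewrite openE => y [cy [_ dy]]; rewrite /interior /D.
  have n1 : \forall z \near y, cimage c0 z by exact: open_nbhs_nbhs.
  have n3 : \forall z \near y, dom c (phi (bwd c0 z)).
    apply: (continuous_comp (bc y cy) (phic _ I)).
    by apply: open_nbhs_nbhs; split => //; have [] := chart_open ca.
  by apply: filterS2 n1 n3 => z z1 z2; split.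
apply: (@Ck_on_ext _ _ _ _ _ (fun y => (fwd c \o phi \o bwd c0) ((fwd c0 \o Psi) y))) => //.
  by move=> y [_ [cy _]] /=; rewrite fwdK.
apply: (Ck_on_comp_mx oB oD) => //.
- move=> y [_ [cy dy]]; split; first exact: cimage_fwd.
  by split => //; rewrite /= fwdK.
apply: (Ck_on_sub (A := A `&` Psi @^-1` dom c0)); last exact: Ps.
by move=> y [Ay [cy _]].
Qed.

Lemma dparam_comp e (A : set 'rV[R]_e) Psi (phi : N -> N) u v :
  smooth_map_on setT phi -> sparam A Psi -> A u ->
  dparam (phi \o Psi) u v = dmap phi (Psi u) (dparam Psi u v).
Proof.
move=> sphi sP Au; have [aa ad] := chart_atP (Psi u).
have [ba bd] := chart_atP (phi (Psi u)).
rewrite /dparam /dmap /=; set c0 := chart_at (Psi u) in aa ad *.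
set c := chart_at (phi (Psi u)) in ba bd *.
have d1 := sparam_diff sP aa Au ad.
have d2 : differentiable (fwd c \o phi \o bwd c0) (fwd c0 (Psi u)).
  have [_ /(_ c0 c aa ba) tr] := sphi.
  apply: (smooth_on_diff tr); split; first exact: cimage_fwd.
  by split => //; rewrite /= fwdK.
have E : \forall y \near u, (fwd c \o phi \o bwd c0) ((fwd c0 \o Psi) y) =
    (fwd c \o (phi \o Psi)) y.
  by apply: filterS (sparam_near sP aa Au ad) => y [_ cy] /=; rewrite fwdK.
exact: (diff_near_comp v erefl d1 d2 E).2.
Qed.

End Charts.

Section Bilinear.
Context {R : realType}.

Lemma dsum (V : normedModType R) (I : finType) (f : I -> V -> R^o) x :
  (forall i, differentiable (f i) x) ->
  differentiable (fun y => \sum_i f i y : R^o) x /\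
  forall v, 'd (fun y => \sum_i f i y : R^o) x v = \sum_i 'd (f i) x v.
Proof.
move=> df; suff H (s : seq I) : differentiable (fun y => \sum_(i <- s) f i y : R^o) x /\
  forall v, 'd (fun y => \sum_(i <- s) f i y : R^o) x v = \sum_(i <- s) 'd (f i) x v.
  exact: H.
elim: s => [|i s [IH1 IH2]].
  have -> : (fun y => \sum_(i <- [::]) f i y : R^o) = cst 0.
    by apply/funext => y; rewrite big_nil.
  split; first exact: differentiable_cst.
  by move=> v; rewrite big_nil diff_cst.
have -> : (fun y => \sum_(i <- i :: s) f i y : R^o) =
    (fun y => f i y + \sum_(i <- s) f i y).
  by apply/funext => y; rewrite big_cons.
split; first exact: differentiableD.
by move=> v; rewrite big_cons -IH2; exact: (dD v (df i) IH1).
Qed.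

Lemma bilin_diff d (T : 'rV[R]_d -> 'rV[R]_d -> R^o) (W : 'rV[R]_d -> 'rV[R]_d) x :
  (forall y, linear (T y)) -> (forall w, differentiable (fun y => T y w) x) ->
  differentiable W x -> differentiable (fun y => T y (W y)) x /\
  forall u, 'd (fun y => T y (W y)) x u =
    'd (fun y => T y (W x)) x u + T x ('d W x u).
Proof.
move=> Tl dT dW.
pose e i : 'rV[R]_d := delta_mx 0 i.
have TE y w : T y w = \sum_i w 0 i * T y (e i).
  rewrite {1}(row_sum_delta w) -[T y _]/(mklin (Tl y) _) linear_sum.
  by apply: eq_bigr => i _; rewrite linearZ.
have dWi i := entry_diff 0 i dW.
have dp i : differentiable (fun y => W y 0 i * T y (e i) : R^o) x.
  by apply: differentiableM => //; have [] := dWi i.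
have -> : (fun y => T y (W y)) = (fun y => \sum_i W y 0 i * T y (e i)).
  by apply/funext => y; rewrite TE.
have [d1 d2] := dsum dp; split => // u; rewrite (d2 u).
have dq i : differentiable (fun y => W x 0 i * T y (e i) : R^o) x.
  by apply: differentiableM => //; exact: differentiable_cst.
have -> : (fun y => T y (W x)) = (fun y => \sum_i W x 0 i * T y (e i)).
  by apply/funext => y; rewrite TE.
have [_ d3] := dsum dq; apply: (etrans _ (esym (congr2 +%R (d3 u) (TE x ('d W x u))))).
rewrite -big_split.
apply: eq_bigr => i _ /=.
have [dwi dwE] := dWi i.
have dc : differentiable (fun _ : 'rV[R]_d => W x 0 i : R^o) x by exact: differentiable_cst.
have e1 := dM u dwi (dT (e i)); have e2 := dM u dc (dT (e i)).
have e3 : 'd (fun _ : 'rV[R]_d => W x 0 i : R^o) x u = 0.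
  by rewrite (diff_cst (W x 0 i : R^o) x).
have arith (a b c z q t : R) : z = 0 -> q = t -> a * b + c * q = a * b + c * z + t * c.
  by move=> -> ->; ring.
apply: (etrans e1); apply: (etrans _ (congr1 (fun z => z + _) (esym e2))).
exact: (arith _ _ _ _ _ _ e3 (dwE u)).
Qed.

End Bilinear.

(** * Hamiltonian fields: Killing is the same as holomorphic *)

Section HamiltonianKilling.
Context {R : realType} {n : nat}.
Local Notation X := 'rV[R]_(n + n).
Variables (A : set X) (G : X -> X -> X -> R) (W : X -> X) (F : X -> R^o).
Hypotheses (oA : open A) (dW : forall x, A x -> differentiable W x).
Hypothesis Gl : forall y v a u u', G y (a *: u + u') v = a * G y u v + G y u' v.
Hypothesis Gs : forall y u v, G y u v = G y v u.
Hypothesis Gp : forall y u, A y -> u != 0 -> 0 < G y u u.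
Hypothesis GI : forall y u v, A y -> G y (mulI u) (mulI v) = G y u v.
Hypothesis dG : forall u v x, A x -> differentiable (fun y => G y u v : R^o) x.
Hypothesis F2 : Ck_on 2 A F.
Hypothesis ham : forall y v, A y -> G y (mulI (W y)) v = 'd F y v.
Hypothesis clo : forall x u v w, A x ->
  'd (fun y => G y (mulI v) w : R^o) x u + 'd (fun y => G y (mulI w) u : R^o) x v
  + 'd (fun y => G y (mulI u) v : R^o) x w = 0.

Let Om y u v := G y (mulI u) v.

Lemma Om_anti y u v : A y -> Om y u v = - Om y v u.
Proof.
move=> Ay; rewrite /Om -(GI (mulI u) v Ay) mulIK -scaleN1r.
have G0 w : G y 0 w = 0.
  by have := @Gl y w (-1) 0 0; rewrite scaler0 addr0 mulN1r addrC subrr.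
by have := @Gl y (mulI v) (-1) u 0; rewrite addr0 G0 addr0 mulN1r => ->; rewrite Gs.
Qed.

(** This is the vanishing of the Lie derivative of [Om] along [W]. As in Cartan's formula it comes
    from the closedness of [Om] and from the closedness of [dF], the latter being [schwarz]. *)
Lemma ham_lie x u v : A x ->
  'd (fun y => Om y u v : R^o) x (W x) + Om x ('d W x u) v + Om x u ('d W x v) = 0.
Proof.
move=> Ax.
have nA : \forall y \near x, A y by exact: open_nbhs_nbhs.
have Tl v' y : linear (fun w => Om y w v' : R^o).
  by move=> a w w'; rewrite /Om -[mulI _]/(mklin mulI_is_linear _) linearP /= Gl.
have dT v' w : differentiable (fun y => Om y w v' : R^o) x by exact: dG.
have key u' v' : 'd (fun y => 'd F y v' : R^o) x u' =
    'd (fun y => Om y (W x) v' : R^o) x u' + Om x ('d W x u') v'.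
  have [d1 d2] := bilin_diff (T := fun y w => Om y w v') (Tl v') (dT v') (dW Ax).
  have E : \forall y \near x, Om y (W y) v' = 'd F y v'.
    by apply: filterS nA => y Ay; exact: ham.
  have [_ e] := near_eq_diff E d1.
  exact: (etrans (congr1 (fun z => z u') e) (d2 u')).
have sy := etrans (esym (key v u)) (etrans (schwarz u v oA Ax F2) (key u v)).
have antid w' w u' : 'd (fun y => Om y w w' : R^o) x u' =
    - 'd (fun y => Om y w' w : R^o) x u'.
  have E : \forall y \near x, -1 * Om y w' w = Om y w w' :> R^o.
    by apply: filterS nA => y Ay; rewrite (Om_anti w w' Ay) mulN1r.
  have dc : differentiable (fun _ : X => -1 : R^o) x by exact: differentiable_cst.
  have dw : differentiable (fun y => Om y w' w : R^o) x by exact: dG.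
  have d1 : differentiable (fun y => -1 * Om y w' w : R^o) x.
    exact: differentiableM.
  have [_ e] := near_eq_diff E d1; apply: (etrans (congr1 (fun z => z u') e)).
  apply: (etrans (dM u' dc dw)).
  have e3 : 'd (fun _ : X => -1 : R^o) x u' = 0 by rewrite (diff_cst (-1 : R^o) x).
  have arith (a b z : R) : z = 0 -> -1 * a + b * z = - a by move=> ->; ring.
  exact: arith.
have arith (a b b' d e f p q : R) : b + e = a + d -> b' + p + q = 0 -> b' = - a ->
    p = b -> f = - e -> q + d + f = 0 by move=> *; lra.
exact: (arith _ _ _ _ _ _ _ _ sy (clo u v (W x) Ax) (antid _ _ _) erefl
  (Om_anti u ('d W x v) Ax)).
Qed.

(** Since [Om u v = G (mulI u) v] and [Om] is invariant along [W], the Lie derivative of [G]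
    vanishes exactly when that of the complex structure does. *)
Lemma killing_hol x : A x ->
  (forall u v, 'd (fun y => G y u v : R^o) x (W x) + G x ('d W x u) v
     + G x u ('d W x v) = 0) <->
  (forall u, 'd W x (mulI u) = mulI ('d W x u)).
Proof.
move=> Ax; split => [kil u|hol u v].
  apply/eqP; rewrite -subr_eq0; apply/negP => /negP nz.
  set D := _ - _ in nz.
  suff D0 v : G x D v = 0 by have := Gp Ax nz; rewrite D0 ltxx.
  have h := ham_lie u v Ax; have k := kil (mulI u) v.
  rewrite -/(Om _ _ _) in k.
  have -> : D = (-1) *: mulI ('d W x u) + 'd W x (mulI u).
    by rewrite /D scaleN1r addrC.
  rewrite Gl; move: h k; rewrite /Om.
  by move: ('d _ x (W x)) (G _ _ _) (G _ _ _) (G _ _ _) => a b c d; lra.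
have [w ->] : exists w, u = mulI w.
  by exists (- mulI u); rewrite -scaleN1r -[mulI _]/(mklin mulI_is_linear _) linearZ
    /= mulIK scaleN1r opprK.
have := ham_lie w v Ax; rewrite /Om hol.
by [].
Qed.

End HamiltonianKilling.

Section LinearAlgebra.
Context {R : realType}.

Lemma lin_inj_surj d (L : {linear 'rV[R]_d -> 'rV[R]_d}) :
  (forall v, L v = 0 -> v = 0) -> forall w, exists v, L v = w.
Proof.
move=> Linj w; pose A := lin1_mx L.
have AE v : v *m A = L v by rewrite mul_rV_lin1.
have Au : A \in unitmx.
  rewrite -row_free_unit -kermx_eq0; apply/eqP/row_matrixP => i.
  rewrite row0; apply: Linj; rewrite -AE; apply/sub_kermxP; exact: row_sub.
by exists (w *m invmx A); rewrite -AE mulmxKV.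
Qed.

Lemma invmx_smooth (V : normedModType R) d k (A : set V) (B : V -> 'M[R]_d) : open A ->
  (forall x, A x -> B x \in unitmx) -> Ck_on k A B ->
  Ck_on k A (fun x => invmx (B x)).
Proof.
move=> oA Bu BA.
have sdet e (C : V -> 'M[R]_e) : (forall i j, Ck_on k A (fun x => C x i j : R^o)) ->
    Ck_on k A (fun x => \det (C x) : R^o).
  move=> CA; rewrite /determinant; apply: Ck_on_sum => // s.
  apply: Ck_onM => //; first exact: Ck_on_cst.
  by apply: Ck_on_prod => // i; exact: CA.
have Be i j := Ck_on_entry i j oA BA.
have d0 x : A x -> \det (B x) != 0.
  by move=> /Bu; rewrite unitmxE unitfE.
apply: (@Ck_on_ext _ _ _ _ _ (fun x => (\det (B x))^-1 *: \adj (B x))) => //.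
  by move=> x Ax; rewrite /invmx Bu.
apply: Ck_on_mx => // i j.
apply: (@Ck_on_ext _ _ _ _ _ (fun x => (\det (B x))^-1 * (\adj (B x)) i j : R^o)) => //.
  by move=> x _; rewrite [RHS]mxE.
apply: Ck_onM => //.
  apply: (Ck_on_comp1 (B := [set x : R^o | x != 0]) oA) => //; first exact: sdet.
  exact: smooth_inv.
apply: (@Ck_on_ext _ _ _ _ _ (fun x => cofactor (B x) j i : R^o)) => //.
  by move=> x _; rewrite [RHS]mxE.
apply: Ck_onM => //; first exact: Ck_on_cst.
apply: sdet => a b.
apply: (@Ck_on_ext _ _ _ _ _ (fun x => B x (lift j a) (lift i b) : R^o)) => //.
by move=> x _; rewrite !mxE.
Qed.

Lemma mulID n (p q : 'rV[R]_(n + n)) : mulI (p + q) = mulI p + mulI q.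
Proof. exact: (linearD (mklin (@mulI_is_linear R n))). Qed.

Lemma mulIZ n a (p : 'rV[R]_(n + n)) : mulI (a *: p) = a *: mulI p.
Proof. exact: (linearZZ (mklin (@mulI_is_linear R n)) a p). Qed.

Lemma mulIN n (p : 'rV[R]_(n + n)) : mulI (- p) = - mulI p.
Proof. by rewrite -scaleN1r mulIZ scaleN1r. Qed.

Lemma mulI_inj n : injective (@mulI R n).
Proof.
by move=> p q pq; apply: oppr_inj; rewrite -!mulIK pq.
Qed.

Lemma mulI_continuous n : continuous (@mulI R n).
Proof.
apply: (@lip_continuous R _ _ (@mulI R n) 1) => // p q.
rewrite mul1r -mulIN -mulID.
apply: mx_norm_le => // i j; rewrite /mulI -(splitK j).
case: (fintype.split j) => l /=.
  by rewrite row_mxEl !mxE normrN; have := mx_norm_entry (p - q) i (rshift n l); rewrite !mxE.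
by rewrite row_mxEr !mxE; have := mx_norm_entry (p - q) i (lshift n l); rewrite !mxE.
Qed.

Lemma bilin_sum d (B : 'rV[R]_d -> 'rV[R]_d -> R) :
  (forall w, linear (fun u => B u w : R^o)) -> (forall w, linear (B w : _ -> R^o)) ->
  forall u v, B u v =
    \sum_j (u *m \matrix_(i, j) B (delta_mx 0 i) (delta_mx 0 j)) 0 j * v 0 j.
Proof.
move=> l1 l2 u v; rewrite {1}(row_sum_delta v) -[LHS]/(mklin (l2 u) _) linear_sum.
apply: eq_bigr => j _; rewrite linearZ /= mulrC; congr (_ * _).
rewrite {1}(row_sum_delta u) -[LHS]/(mklin (l1 (delta_mx 0 j)) _) linear_sum mxE.
by apply: eq_bigr => i _; rewrite linearZ /= mxE.
Qed.

End LinearAlgebra.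

Section HolTransfer.
Context {R : realType} {n : nat}.
Local Notation X := 'rV[R]_(n + n).

Lemma bilin_diff_mx d m (T : 'rV[R]_d -> 'rV[R]_d -> 'rV[R]_m)
    (W : 'rV[R]_d -> 'rV[R]_d) x u :
  (forall y, linear (T y)) -> (forall w, differentiable (fun y => T y w) x) ->
  differentiable W x -> differentiable (fun y => T y (W y)) x /\
  'd (fun y => T y (W y)) x u = 'd (fun y => T y (W x)) x u + T x ('d W x u).
Proof.
move=> Tl dT dW.
have Tle i y : linear (fun w => T y w 0 i : R^o).
  by move=> a w w'; rewrite Tl !mxE.
have dTe i w : differentiable (fun y => T y w 0 i : R^o) x.
  by have [] := entry_diff 0 i (dT w).
have H i := bilin_diff (T := fun y w => T y w 0 i) (Tle i) (dTe i) dW.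
have d1 : differentiable (fun y => T y (W y)) x.
  by apply: mx_diff => i j; rewrite ord1; have [] := H j.
split => //; apply/rowP => i.
have [_ e1] := entry_diff 0 i d1; have [_ e2] := entry_diff 0 i (dT (W x)).
by rewrite -e1 [RHS]mxE -e2; have [_ ->] := H i.
Qed.

(* By symmetry the second derivative of [F] is complex linear in each argument. *)
Lemma hol_transfer (A : set X) (F V W : X -> X) x : open A -> A x ->
  smooth_on A F -> (forall y v, A y -> 'd F y (mulI v) = mulI ('d F y v)) ->
  differentiable V x -> differentiable W (F x) ->
  (forall y, A y -> W (F y) = 'd F y (V y)) -> forall w,
  'd W (F x) (mulI ('d F x w)) - mulI ('d W (F x) ('d F x w)) =
  'd F x ('d V x (mulI w) - mulI ('d V x w)).
Proof.
move=> oA Ax sF FI dV dW rel w.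
have nA : \forall y \near x, A y by exact: open_nbhs_nbhs.
have dF : differentiable F x by exact: smooth_on_diff sF Ax.
have dFd v : differentiable (fun y => 'd F y v) x.
  exact: (smooth_on_diff (smooth_on_d v sF) Ax).
have key u : 'd W (F x) ('d F x u) = 'd (fun y => 'd F y (V x)) x u + 'd F x ('d V x u).
  have Tl y : linear (fun w => 'd F y w) by move=> a p q; rewrite linearP.
  have [d1 e1] := bilin_diff_mx (T := fun y w => 'd F y w) u Tl dFd dV.
  have E : \forall y \near x, W (F y) = 'd F y (V y) by apply: filterS nA => y /rel.
  have [_ e2] := near_eq_diff E (differentiable_comp dF dW).
  apply: (etrans (esym (dcompE u dF dW))).
  exact: (etrans (congr1 (fun z => z u) (esym e2)) e1).
have sch u v : 'd (fun y => 'd F y u) x v = 'd (fun y => 'd F y v) x u.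
  apply/rowP => i.
  have [_ e1] := entry_diff 0 i (dFd u); have [_ e2] := entry_diff 0 i (dFd v).
  apply: (etrans (esym (e1 v))); apply: (etrans _ (e2 u)).
  have ck : Ck_on 2 A (fun y => F y 0 i : R^o) by apply: Ck_on_entry.
  have E u' : \forall y \near x, 'd (fun y => F y 0 i : R^o) y u' = 'd F y u' 0 i.
    apply: filterS nA => y Ay.
    by have [_ ->] := entry_diff 0 i (smooth_on_diff sF Ay).
  have de u' : differentiable (fun y => 'd (fun y => F y 0 i : R^o) y u' : R^o) x.
    by have [_ /(_ u')[+ _]] := ck; apply.
  have [_ e3] := near_eq_diff (E u) (de u); have [_ e4] := near_eq_diff (E v) (de v).
  apply: (etrans (congr1 (fun z => z v) e3)).
  exact: (etrans (schwarz u v oA Ax ck) (congr1 (fun z => z u) (esym e4))).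
have hI u : 'd (fun y => 'd F y (V x)) x (mulI u) = mulI ('d (fun y => 'd F y (V x)) x u).
  apply: (etrans (sch _ _)); apply: (etrans _ (congr1 mulI (sch _ _))).
  have E : \forall y \near x, mulI ('d F y u) = 'd F y (mulI u).
    by apply: filterS nA => y Ay; rewrite FI.
  pose L : {linear X -> X} := mklin (@mulI_is_linear R n).
  have Lc : continuous L by exact: mulI_continuous.
  have dL y := linear_differentiable y Lc.
  have [_ e] := near_eq_diff E (differentiable_comp (dFd u) (dL _)).
  apply: (etrans (congr1 (fun z => z (V x)) e)).
  apply: (etrans (dcompE (V x) (dFd u) (dL _))).
  exact: (congr1 (fun z => z _) (diff_lin _ Lc)).
have e1 : 'd W (F x) (mulI ('d F x w)) = mulI ('d (fun y => 'd F y (V x)) x w) +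
    'd F x ('d V x (mulI w)).
  apply: (etrans (congr1 ('d W (F x)) (esym (FI x w Ax)))).
  by apply: (etrans (key _)); congr (_ + _); exact: hI.
have mID (p q : X) : mulI (p + q) = mulI p + mulI q.
  exact: (linearD (mklin (@mulI_is_linear R n))).
have e2 : mulI ('d W (F x) ('d F x w)) = mulI ('d (fun y => 'd F y (V x)) x w) +
    'd F x (mulI ('d V x w)).
  apply: (etrans (congr1 mulI (key w))); apply: (etrans (mID _ _)).
  by congr (_ + _); exact/esym/FI.
have arith (p q r t a b : X) : a = p + q -> b = p + r -> t = q - r -> a - b = t.
  by move=> -> -> ->; rewrite opprD addrACA subrr add0r.
apply: (arith _ _ _ _ _ _ e1 e2); exact: linearB.
Qed.

End HolTransfer.

(** * Hamiltonian fields on a Kahler manifold *)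

Section KahlerCharts.
Context {R : realType} {n : nat} {N : charted R (n + n)} (g : tensor2 N).
Hypothesis hg : kahler_manifold g.
Local Notation X := 'rV[R]_(n + n).
Local Notation chartN := (chart R N (n + n)).

Let hN : complex_manifold N. Proof. by case: hg. Qed.

Lemma gl p v a u u' : g p (a *: u + u') v = a * g p u v + g p u' v.
Proof. by have [_ [+ _ _ _] _ _] := hg; apply. Qed.

Lemma gsym p u v : g p u v = g p v u.
Proof. by have [_ [_ + _ _] _ _] := hg; apply. Qed.

Lemma gpos p u : u != 0 -> 0 < g p u u.
Proof. by have [_ [_ _ + _] _ _] := hg; apply. Qed.

Lemma gI p u v : g p (mulI u) (mulI v) = g p u v.
Proof. by have [_ _ + _] := hg; apply. Qed.

Lemma g_eq p u u' : (forall v, g p u v = g p u' v) -> u = u'.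
Proof.
move=> H; apply/eqP; rewrite -subr_eq0; apply/negP => /negP nz.
have := gpos p nz; have -> : u - u' = (-1) *: u' + u by rewrite scaleN1r addrC.
by rewrite gl H mulN1r addrC subrr ltxx.
Qed.

Lemma comp_in_eq0 (c : chartN) p v : atlas c -> dom c p ->
  comp_in c p v = 0 -> v = 0.
Proof.
move=> ca cp v0; rewrite -(comp_inK hN v ca cp) v0.
exact: (linear0 ('d (fwd (chart_at p) \o bwd c) (fwd c p))).
Qed.

Lemma comp_out_eq0 (c : chartN) p v : atlas c -> dom c p ->
  comp_out c p v = 0 -> v = 0.
Proof.
move=> ca cp v0; rewrite -(comp_outK hN v ca cp) v0.
exact: (linear0 ('d (fwd c \o bwd (chart_at p)) (fwd (chart_at p) p))).
Qed.

Lemma ham_in (f : N -> R) (Y : vfield N) (c : chartN) y v :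
  smooth_fun (f : N -> R^o) -> hamiltonian g f Y -> atlas c -> cimage c y ->
  tensor_in g c y (mulI (field_in Y c y)) v = 'd ((f : N -> R^o) \o bwd c) y v.
Proof.
move=> sf hY ca [p cp <-]; rewrite tensor_inE// field_inE//.
have [_ e] := dfunE hN v sf (bwd_sparam hN ca) (cimage_fwd cp).
rewrite (comp_out_mulI hN)// (comp_inK hN)//; apply: (etrans (hY p _)).
apply: esym; apply: (etrans e).
apply: (etrans (congr1 (fun q => dfun (f : N -> R^o) q _) (fwdK hN ca cp))).
exact: (congr1 (dfun (f : N -> R^o) p) (dparam_bwd hN v ca cp)).
Qed.

Lemma killing_holE (f : N -> R) (Y : vfield N) :
  smooth_fun (f : N -> R^o) -> smooth_field Y -> hamiltonian g f Y ->
  killing g Y <-> forall (c : chartN) x u, atlas c -> cimage c x ->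
    'd (field_in Y c) x (mulI u) = mulI ('d (field_in Y c) x u).
Proof.
move=> sf sY hY.
have [_ [_ _ _ sg] _ clg] := hg.
suff H (c : chartN) x : atlas c -> cimage c x ->
  (forall u v, 'd (fun y => tensor_in g c y u v : R^o) x (field_in Y c x)
    + tensor_in g c x ('d (field_in Y c) x u) v
    + tensor_in g c x u ('d (field_in Y c) x v) = 0) <->
  (forall u, 'd (field_in Y c) x (mulI u) = mulI ('d (field_in Y c) x u)).
  split=> [kil c x u ca cx|hol c ca x cx u v]; first exact: ((H c x ca cx).1 (kil c ca x cx)).
  by apply: ((H c x ca cx).2 _ u v) => u'; exact: hol.
move=> ca cx; have [_ oc] := chart_open hN ca.
apply: (@killing_hol R n (cimage c) (tensor_in g c) (field_in Y c)
  ((f : N -> R^o) \o bwd c) oc _ _ _ _ _ _ _ _ _ x cx).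
- by move=> y cy; exact: (smooth_on_diff (sY c ca) cy).
- by move=> y v a u u'; rewrite /tensor_in linearP gl.
- by move=> y u v; rewrite /tensor_in gsym.
- move=> y u [p cp <-] u0; rewrite tensor_inE//; apply: gpos.
  by apply: contra_neq u0; exact: comp_out_eq0.
- by move=> y u v [p cp <-]; rewrite !tensor_inE// !(comp_out_mulI hN)// gI.
- by move=> u v y cy; exact: (smooth_on_diff (sg c ca u v) cy).
- exact: sf.
- by move=> y v cy; exact: ham_in.
- move=> y u v w cy; have := clg c ca y cy u v w.
  have E v' w' u' : 'd (fun y => tensor_in (kahler_form g) c y v' w' : R^o) y u' =
      'd (fun y => tensor_in g c y (mulI v') w' : R^o) y u'.
    have nE : \forall z \near y, tensor_in g c z (mulI v') w' =
        tensor_in (kahler_form g) c z v' w'.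
      have : \forall z \near y, cimage c z by exact: open_nbhs_nbhs.
      by apply: filterS => _ [p cp <-]; rewrite !tensor_inE// (comp_out_mulI hN).
    have [_ e] := near_eq_diff nE (smooth_on_diff (sg c ca (mulI v') w') cy).
    exact: (congr1 (fun z => z u') e).
  have arith (a b d a' b' d' : R) : a = a' -> b = b' -> d = d' ->
    a + b + d = 0 -> a' + b' + d' = 0 by move=> -> -> ->.
  exact: (arith _ _ _ _ _ _ (E _ _ _) (E _ _ _) (E _ _ _)).
Qed.

Definition gram (c : chartN) (x : X) : 'M[R]_(n + n) :=
  \matrix_(i, j) tensor_in g c x (mulI (delta_mx 0 i)) (delta_mx 0 j).

Lemma gramE (c : chartN) (x u v : X) :
  tensor_in g c x (mulI u) v = \sum_j (u *m gram c x) 0 j * v 0 j.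
Proof.
apply: (bilin_sum (B := fun u v => tensor_in g c x (mulI u) v)) => w a p q.
  by rewrite /tensor_in mulID mulIZ linearP gl.
by rewrite /tensor_in gsym linearP gl ![g _ _ ('d _ _ (mulI w))]gsym.
Qed.

Lemma gram_unit (c : chartN) x : atlas c -> cimage c x -> gram c x \in unitmx.
Proof.
move=> ca [p cp <-]; rewrite -row_free_unit -kermx_eq0; apply/eqP/row_matrixP => i.
rewrite row0; set u := row i _.
have uB : u *m gram c (fwd c p) = 0 by apply/sub_kermxP; exact: row_sub.
apply/eqP/negP => /negP u0.
have nz : comp_out c p u != 0 by apply: contra_neq u0; exact: comp_out_eq0.
have := gpos p nz; rewrite -(gI p) -(comp_out_mulI hN)// -tensor_inE// gramE uB.
by rewrite big1 ?ltxx// => j _; rewrite mxE mul0r.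
Qed.

Lemma hamiltonian_exists (f : N -> R) : smooth_fun (f : N -> R^o) ->
  exists2 Y : vfield N, smooth_field Y & hamiltonian g f Y.
Proof.
move=> sf; have [_ [_ _ _ sg] _ _] := hg.
pose b (c : chartN) (x : X) : X :=
  \row_j 'd ((f : N -> R^o) \o bwd c) x (delta_mx 0 j).
pose Wc (c : chartN) (x : X) : X := b c x *m invmx (gram c x).
have bE (c : chartN) x v : 'd ((f : N -> R^o) \o bwd c) x v = \sum_j b c x 0 j * v 0 j.
  rewrite {1}(row_sum_delta v) linear_sum; apply: eq_bigr => j _.
  by rewrite linearZ mxE mulrC.
have WcP (c : chartN) x v : atlas c -> cimage c x ->
    tensor_in g c x (mulI (Wc c x)) v = 'd ((f : N -> R^o) \o bwd c) x v.
  by move=> ca cx; rewrite gramE bE mulmxKV ?gram_unit.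
have WcU (c : chartN) x w : atlas c -> cimage c x ->
    (forall v, tensor_in g c x (mulI w) v = 'd ((f : N -> R^o) \o bwd c) x v) ->
    w = Wc c x.
  move=> ca cx H; have [p cp px] := cx; apply: mulI_inj.
  rewrite -(comp_outK hN (mulI w) ca cp) -(comp_outK hN (mulI (Wc c x)) ca cp).
  congr (comp_in c p _); apply: (@g_eq p) => v.
  rewrite -(comp_inK hN v ca cp) -!tensor_inE// px.
  exact: (etrans (H _) (esym (WcP c x _ ca cx))).
(* [chart_at p] may jump with [p], so this formula shows no smoothness; by the uniqueness [WcU] the
   field is given in every chart [c] by the smooth expression [Wc c]. *)
pose Y : vfield N := fun p => Wc (chart_at p) (fwd (chart_at p) p).
have hY : hamiltonian g f Y.
  move=> p v; have [aa ad] := chart_atP hN p.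
  have := WcP (chart_at p) (fwd (chart_at p) p) v aa (cimage_fwd ad).
  rewrite tensor_inE// /comp_out !(transition_id hN _ aa ad).
  by [].
exists Y => // c ca; have [_ oc] := chart_open hN ca.
have YE x : cimage c x -> Wc c x = field_in Y c x.
  by move=> cx; apply/esym/WcU => // v; exact: ham_in.
move=> k; apply: (Ck_on_ext oc YE).
have sb j : Ck_on k (cimage c) (fun x => b c x 0 j : R^o).
  apply: (Ck_on_ext oc _ (smooth_on_d (delta_mx 0 j) (sf c ca) k)) => x _.
  by rewrite mxE.
have sG : Ck_on k (cimage c) (fun x => invmx (gram c x)).
  apply: invmx_smooth => //; first by move=> x; exact: gram_unit.
  apply: Ck_on_mx => // i j.
  apply: (Ck_on_ext oc _ (sg c ca (mulI (delta_mx 0 i)) (delta_mx 0 j) k)) => x _.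
  by rewrite mxE.
apply: Ck_on_mx => // i j.
apply: (@Ck_on_ext _ _ _ _ _ (fun x => \sum_l b c x 0 l * (invmx (gram c x)) l j : R^o)) => //.
  by move=> x _; rewrite ord1 [RHS]mxE.
by apply: Ck_on_sum => // l; apply: Ck_onM => //; exact: Ck_on_entry.
Qed.

End KahlerCharts.

Section RelatedFields.
Context {R : realType} {n : nat} {N : charted R (n + n)} (g : tensor2 N).
Hypothesis hg : kahler_manifold g.
Local Notation X := 'rV[R]_(n + n).
Local Notation chartN := (chart R N (n + n)).

Let hN : complex_manifold N. Proof. by case: hg. Qed.

Definition hol_at (Y : vfield N) (p : N) : Prop :=
  forall (c : chartN) u, atlas c -> dom c p ->
    'd (field_in Y c) (fwd c p) (mulI u) = mulI ('d (field_in Y c) (fwd c p) u).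

Lemma killing_hol_at (f : N -> R) (Y : vfield N) :
  smooth_fun (f : N -> R^o) -> smooth_field Y -> hamiltonian g f Y ->
  killing g Y <-> forall p, hol_at Y p.
Proof.
move=> sf sY hY; rewrite (killing_holE hg sf sY hY).
split=> [H p c u ca cp|H c _ u ca [p cp <-]]; last exact: H.
by apply: H => //; exact: cimage_fwd.
Qed.

(** By [hol_transfer] the failure of complex linearity is carried from [V] to [Y] by the invertible
    differential of [Psi], so it vanishes on both sides or on neither. *)
Lemma hol_related (A : set X) (Psi : X -> N) (V : X -> X) (Y : vfield N) u :
  sparam A Psi -> A u -> smooth_field Y ->
  (forall y v, A y -> dparam Psi y (mulI v) = mulI (dparam Psi y v)) ->
  (forall y v, A y -> dparam Psi y v = 0 -> v = 0) ->
  differentiable V u -> (forall y, A y -> dparam Psi y (V y) = Y (Psi y)) ->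
  hol_at Y (Psi u) <-> forall w, 'd V u (mulI w) = mulI ('d V u w).
Proof.
move=> sP Au sY PI Pinj dV rel.
have key (c : chartN) : atlas c -> dom c (Psi u) ->
  (forall w, 'd (field_in Y c) (fwd c (Psi u)) (mulI w) =
    mulI ('d (field_in Y c) (fwd c (Psi u)) w)) <->
  forall w, 'd V u (mulI w) = mulI ('d V u w).
  move=> ca cu; pose B := A `&` Psi @^-1` dom c.
  have oB : open B by exact: sparam_open.
  have sF : smooth_on B (fwd c \o Psi) by have [_ _] := sP; apply.
  have FE y v : B y -> 'd (fwd c \o Psi) y v = comp_in c (Psi y) (dparam Psi y v).
    by move=> [Ay cy]; exact: (dparamE hN v sP Ay ca cy).
  have FI y v : B y -> 'd (fwd c \o Psi) y (mulI v) = mulI ('d (fwd c \o Psi) y v).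
    move=> By; have [Ay cy] := By.
    apply: (etrans (FE y _ By)); apply: (etrans _ (congr1 mulI (esym (FE y _ By)))).
    by rewrite PI// (comp_in_mulI hN).
  have dW : differentiable (field_in Y c) ((fwd c \o Psi) u).
    by apply: (smooth_on_diff (sY c ca)); exact: cimage_fwd.
  have rl y : B y -> field_in Y c ((fwd c \o Psi) y) = 'd (fwd c \o Psi) y (V y).
    move=> By; have [Ay cy] := By; apply: (etrans _ (esym (FE y _ By))).
    by rewrite rel// (field_inE hN).
  have tr := hol_transfer oB (conj Au cu) sF FI dV dW rl.
  have Finj v : 'd (fwd c \o Psi) u v = 0 -> v = 0.
    move=> v0; apply: (Pinj u v Au); apply: (comp_in_eq0 hg ca cu).
    exact: (etrans (esym (FE u v (conj Au cu))) v0).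
  split=> H w.
    apply/eqP; rewrite -subr_eq0; apply/eqP/Finj; apply: (etrans (esym (tr w))).
    by apply/eqP; rewrite subr_eq0; apply/eqP; exact: H.
  have [v <-] := lin_inj_surj Finj w.
  apply/eqP; rewrite -subr_eq0; apply/eqP; apply: (etrans (tr v)).
  have -> : 'd V u (mulI v) - mulI ('d V u v) = 0.
    by apply/eqP; rewrite subr_eq0; apply/eqP; exact: H.
  exact: linear0.
split=> H.
  by have [aa ad] := chart_atP hN (Psi u); apply: ((key _ aa ad).1) => w; exact: H.
by move=> c w ca cu; exact: ((key c ca cu).2 H w).
Qed.

(** In a fixed chart both sides of the equation defining [hol_at] are continuous, so the points
    where it holds form a closed set. *)
Lemma hol_at_dense (Y : vfield N) (D : set N) : smooth_field Y -> dense D ->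
  (forall p, D p -> hol_at Y p) -> forall p, hol_at Y p.
Proof.
move=> sY dD HD p c u ca cp; have [oc oi] := chart_open hN ca.
pose h x := 'd (field_in Y c) x (mulI u) - mulI ('d (field_in Y c) x u).
apply/eqP; rewrite -subr_eq0 -/(h (fwd c p)); apply/negPn/negP => nz.
have hc : {for fwd c p, continuous h}.
  have c1 v : {for fwd c p, continuous (fun x => 'd (field_in Y c) x v)}.
    apply: (smooth_on_continuous (smooth_on_d v (sY c ca))); exact: cimage_fwd.
  apply: continuousB; first exact: c1.
  by apply: continuous_comp; [exact: c1 | exact: mulI_continuous].
have n1 : \forall x \near fwd c p, h x != 0.
  have e0 : 0 < `|h (fwd c p)| by rewrite normr_gt0.
  have /cvgrPdist_lt/(_ _ e0) := hc; apply: filterS => x.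
  by apply: contraTneq => ->; rewrite subr0 ltxx.
have fc : {for p, continuous (fwd c)} by have [_ _ + _ _] := chart_good hN ca; apply.
have n2 : \forall q \near p, h (fwd c q) != 0 by exact: (fc _ n1).
have n3 : \forall q \near p, dom c q by exact: open_nbhs_nbhs.
have [U [[oU Up] HU]] : exists U, open_nbhs p U /\
    U `<=` [set q | h (fwd c q) != 0 /\ dom c q].
  have : nbhs p [set q | h (fwd c q) != 0 /\ dom c q] by apply: filterI.
  by rewrite nbhsE => -[U Up HU]; exists U.
have [q [Uq Dq]] := dD U (ex_intro _ p Up) oU.
have [hq cq] := HU q Uq; move: hq; apply/negP/negPn.
by rewrite /h subr_eq0; apply/eqP; exact: HD.
Qed.

Lemma Aut_dmap_surj (phi : N -> N) p : Aut g phi ->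
  (forall v, dmap phi p v = 0 -> v = 0) /\ forall w, exists v, dmap phi p v = w.
Proof.
move=> [_ iso _].
have inj v : dmap phi p v = 0 -> v = 0.
  move=> v0; apply/eqP/negP => /negP nz; have := gpos hg p nz.
  rewrite -iso v0.
  have := gl hg (phi p) (0 : X) (-1) 0 0; rewrite scaler0 addr0 mulN1r addrC subrr => ->.
  by rewrite ltxx.
by split => //; exact: (@lin_inj_surj R _
  ('d (fwd (chart_at (phi p)) \o phi \o bwd (chart_at p)) (fwd (chart_at p) p))).
Qed.

Lemma smooth_fun_comp (f : N -> R) (phi : N -> N) : smooth_map_on setT phi ->
  smooth_fun (f : N -> R^o) -> smooth_fun (f \o phi : N -> R^o).
Proof.
move=> sphi sf c ca k; apply: Ck_on_cover => x cx.
have sP := sparam_comp hN sphi (bwd_sparam hN ca).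
pose p := phi (bwd c x); have [aa ad] := chart_atP hN p.
pose B := cimage c `&` (phi \o bwd c) @^-1` dom (chart_at p).
have oB : open B by exact: sparam_open sP aa.
have [_ _ /(_ _ aa) sF] := sP; have [_ oi] := chart_open hN aa.
exists B => //.
apply: (@Ck_on_ext _ _ _ _ _ (fun y => ((f : N -> R^o) \o bwd (chart_at p))
  ((fwd (chart_at p) \o (phi \o bwd c)) y))) => //.
  by move=> y [_ cy] /=; rewrite (fwdK hN).
apply: (Ck_on_comp (B := cimage (chart_at p)) oB _ (sF k) (sf _ aa k)).
by move=> y [_ cy]; exact: cimage_fwd.
Qed.

Lemma dfun_comp (f : N -> R) (phi : N -> N) p v : smooth_map_on setT phi ->
  smooth_fun (f : N -> R^o) ->
  dfun ((f \o phi) : N -> R^o) p v = dfun (f : N -> R^o) (phi p) (dmap phi p v).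
Proof.
move=> sphi sf.
have [aa ad] := chart_atP hN p; have sb := bwd_sparam hN aa.
have sP := sparam_comp hN sphi sb.
have [_ e] := dfunE hN v sf sP (cimage_fwd ad).
have e1 := dparam_comp hN v sphi sb (cimage_fwd ad).
have bp := fwdK hN aa ad.
have dv : dparam (bwd (chart_at p)) (fwd (chart_at p) p) v = v.
  exact: (etrans (dparam_bwd hN v aa ad) (transition_id hN v aa ad)).
have e2 : dparam (phi \o bwd (chart_at p)) (fwd (chart_at p) p) v = dmap phi p v.
  apply: (etrans e1); apply: (etrans (congr1 (dmap phi _) dv)).
  exact: (congr1 (fun q => dmap phi q v) bp).
apply: (etrans e).
apply: (etrans (congr1 (dfun (f : N -> R^o) _) e2)).
exact: (congr1 (fun q => dfun (f : N -> R^o) (phi q) (dmap phi p v)) bp).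
Qed.

Lemma hamiltonian_comp (f : N -> R) (phi : N -> N) (Y Z : vfield N) p :
  Aut g phi -> smooth_fun (f : N -> R^o) -> hamiltonian g f Y ->
  hamiltonian g (f \o phi) Z -> dmap phi p (Z p) = Y (phi p).
Proof.
move=> aphi sf hY hZ; have [[sphi phiI] iso _] := aphi.
apply: mulI_inj; apply: (g_eq hg (p := phi p)) => w.
have [_ /(_ w)[v <-]] := Aut_dmap_surj p aphi.
rewrite -phiI iso; apply: (etrans (hZ p v)); apply: esym; apply: (etrans (hY _ _)).
exact: esym (dfun_comp p v sphi sf).
Qed.

(** The Hamiltonian field of [f \o phi] is related by [phi] to that of [f]; since [phi] is
    holomorphic, [hol_related] transfers holomorphy, which is the Killing property. *)
Lemma kahler_comp (f : N -> R) (phi : N -> N) : Aut g phi ->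
  kahler_function g f -> kahler_function g (f \o phi).
Proof.
move=> aphi [sf [Y [sY hY kY]]]; have [[sphi phiI] iso _] := aphi.
have sfp := smooth_fun_comp sphi sf; split => //.
have [Z sZ hZ] := hamiltonian_exists hg sfp.
exists Z; split; [exact: sZ | exact: hZ |].
apply/(killing_hol_at sfp sZ hZ) => p c u ca cp.
have sb := bwd_sparam hN ca.
have sP := sparam_comp hN sphi sb.
have Dp y v : cimage c y -> dparam (phi \o bwd c) y v =
    dmap phi (bwd c y) (comp_out c (bwd c y) v).
  move=> cy; apply: (etrans (dparam_comp hN v sphi sb cy)).
  apply: (congr1 (dmap phi (bwd c y))).
  have [dy e] := bwdK hN ca cy; apply: (etrans _ (dparam_bwd hN v ca dy)).
  exact: (congr1 (fun z => dparam (bwd c) z v) (esym e)).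
have [A1 A2] := bwdK hN ca (cimage_fwd cp).
have /(killing_hol_at sf sY hY) hol := kY.
have := hol_related (Psi := phi \o bwd c) (V := field_in Z c) sP (cimage_fwd cp) sY.
case=> [y v cy|y v cy|||H _]; last by apply: H; exact: hol.
- have [dy _] := bwdK hN ca cy.
  apply: (etrans (Dp y _ cy)); apply: (etrans _ (congr1 mulI (esym (Dp y _ cy)))).
  apply: (etrans _ (phiI _ _)); apply: (congr1 (dmap phi _)).
  exact: (comp_out_mulI hN).
- have [dy _] := bwdK hN ca cy => v0.
  apply: (comp_out_eq0 hg ca dy); apply: ((Aut_dmap_surj _ aphi).1).
  exact: (etrans (esym (Dp y _ cy)) v0).
- by apply: (smooth_on_diff (sZ c ca)); exact: cimage_fwd.
- move=> y cy; have [dy e] := bwdK hN ca cy; apply: (etrans (Dp y _ cy)).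
  apply: (etrans _ (hamiltonian_comp _ aphi sf hY hZ)).
  apply: (congr1 (dmap phi _)); apply: (etrans _ (comp_inK hN _ ca dy)).
  apply: (congr1 (comp_out c _)); apply: (etrans _ (field_inE hN Z ca dy)).
  exact: (congr1 (field_in Z c) (esym e)).
Qed.

End RelatedFields.

(** * Hermitian matrices of Kahler functions *)

Local Open Scope complex_scope.
Notation cRe := complex.Re.
Notation cIm := complex.Im.
Notation cj := conjc.

Section ComplexValued.
Context {R : realType} {V : normedModType R}.
Local Notation C := R[i].
Implicit Types f g : V -> C.

Lemma ReM (x y : C) : cRe (x * y) = cRe x * cRe y - cIm x * cIm y.
Proof. by case: x y => a b [c d]. Qed.
Lemma ImM (x y : C) : cIm (x * y) = cRe x * cIm y + cIm x * cRe y.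
Proof. by case: x y => a b [c d]. Qed.
Lemma ReD (x y : C) : cRe (x + y) = cRe x + cRe y.
Proof. by case: x y => a b [c d]. Qed.
Lemma ImD (x y : C) : cIm (x + y) = cIm x + cIm y.
Proof. by case: x y => a b [c d]. Qed.
Lemma cP (x y : C) : cRe x = cRe y -> cIm x = cIm y -> x = y.
Proof. by case: x y => a b [c d] /= -> ->. Qed.
Lemma conjcM (x y : C) : (cj (x * y)) = (cj x) * (cj y).
Proof. by case: x y => a b [c d]; apply: cP => /=; ring. Qed.
Lemma conjcD (x y : C) : (cj (x + y)) = (cj x) + (cj y).
Proof. by case: x y => a b [c d]; apply: cP => /=; ring. Qed.
Lemma conjc_sum (I : Type) (s : seq I) (F : I -> C) :
  (cj (\sum_(i <- s) F i)) = \sum_(i <- s) (cj (F i)).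
Proof.
elim: s => [|a s IH]; first by rewrite !big_nil; apply: cP => //=; rewrite oppr0.
by rewrite !big_cons -IH; exact: conjcD.
Qed.
Lemma conjcKc (x : C) : (cj (cj x)) = x.
Proof. by case: x => a b; apply: cP => //=; rewrite opprK. Qed.

Definition csm f : Prop :=
  smooth_on setT (fun x => cRe (f x) : R^o) /\ smooth_on setT (fun x => cIm (f x) : R^o).

Definition cd (w : V) f (x : V) : C :=
  ('d (fun x => cRe (f x) : R^o) x w) +i* ('d (fun x => cIm (f x) : R^o) x w).

Let oT : open [set: V]. Proof. exact: openT. Qed.

Lemma csm_diff f x : csm f -> differentiable (fun x => cRe (f x) : R^o) x /\
  differentiable (fun x => cIm (f x) : R^o) x.
Proof. by move=> [h1 h2]; split; [exact: (smooth_on_diff h1) | exact: (smooth_on_diff h2)]. Qed.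

Lemma csm_cst (a : C) : csm (fun=> a).
Proof. by split => k; exact: Ck_on_cst. Qed.

Lemma csm_ext f g : (forall x, f x = g x) -> csm f -> csm g.
Proof. by move=> /funext ->. Qed.

Lemma csmD f g : csm f -> csm g -> csm (fun x => f x + g x).
Proof.
move=> [f1 f2] [g1 g2]; split => k.
  by apply: (Ck_on_ext oT _ (Ck_onD oT (f1 k) (g1 k))) => x _; rewrite ReD.
by apply: (Ck_on_ext oT _ (Ck_onD oT (f2 k) (g2 k))) => x _; rewrite ImD.
Qed.

Lemma csmM f g : csm f -> csm g -> csm (fun x => f x * g x).
Proof.
move=> [f1 f2] [g1 g2]; split => k.
  have m1 : Ck_on k setT (fun x : V => (-1) * (cIm (f x) * cIm (g x)) : R^o).
    by apply: Ck_onM => //; [exact: Ck_on_cst | exact: Ck_onM].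
  apply: (Ck_on_ext oT _ (Ck_onD oT (Ck_onM oT (f1 k) (g1 k)) m1)) => x _.
  by rewrite ReM mulN1r.
apply: (Ck_on_ext oT _ (Ck_onD oT (Ck_onM oT (f1 k) (g2 k)) (Ck_onM oT (f2 k) (g1 k)))) => x _.
by rewrite ImM.
Qed.

Lemma csm_sum (I : Type) (s : seq I) (F : I -> V -> C) :
  (forall i, csm (F i)) -> csm (fun x => \sum_(i <- s) F i x).
Proof.
move=> sF; elim: s => [|a s IH].
  by apply: csm_ext (csm_cst 0) => x; rewrite big_nil.
by apply: csm_ext (csmD (sF a) IH) => x; rewrite big_cons.
Qed.

Lemma csm_conj f : csm f -> csm (fun x => (cj (f x))).
Proof.
move=> [f1 f2]; split => k.
  by apply: (Ck_on_ext oT _ (f1 k)) => x _; case: (f x).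
apply: (Ck_on_ext oT _ (Ck_onM oT (Ck_on_cst k setT (-1 : R^o)) (f2 k))) => x _.
by case: (f x) => a b /=; rewrite mulN1r.
Qed.

Lemma csm_cd w f : csm f -> csm (cd w f).
Proof. by move=> [f1 f2]; split => k; [exact: (smooth_on_d w f1) | exact: (smooth_on_d w f2)]. Qed.

Lemma cd_ext w f g x : (forall y, f y = g y) -> cd w f x = cd w g x.
Proof. by move=> /funext ->. Qed.

Lemma cd_cst w (a : C) x : cd w (fun=> a) x = 0.
Proof.
apply: cP => /=.
  by rewrite (diff_cst (cRe a : R^o) x).
by rewrite (diff_cst (cIm a : R^o) x).
Qed.

Lemma cdD w f g x : csm f -> csm g ->
  cd w (fun x => f x + g x) x = cd w f x + cd w g x.
Proof.
move=> sf sg; have [f1 f2] := csm_diff x sf; have [g1 g2] := csm_diff x sg.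
apply: cP; rewrite ?ReD ?ImD.
  apply: (etrans _ (dD w f1 g1)); congr ('d _ x w).
  by apply/funext => y; rewrite ReD.
apply: (etrans _ (dD w f2 g2)); congr ('d _ x w).
by apply/funext => y; rewrite ImD.
Qed.

Lemma cdM w f g x : csm f -> csm g ->
  cd w (fun x => f x * g x) x = cd w f x * g x + f x * cd w g x.
Proof.
move=> sf sg; have [f1 f2] := csm_diff x sf; have [g1 g2] := csm_diff x sg.
have dc : differentiable (fun _ : V => -1 : R^o) x by exact: differentiable_cst.
have p22 := differentiableM f2 g2.
apply: cP; rewrite ?ReD ?ImD ?ReM ?ImM /cd /=.
  have E : (fun y => cRe (f y * g y) : R^o) =
      (fun y => cRe (f y) * cRe (g y) + (-1) * (cIm (f y) * cIm (g y))).
    by apply/funext => y; rewrite ReM mulN1r.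
  have e0 : 'd (fun _ : V => -1 : R^o) x w = 0 by rewrite (diff_cst (-1 : R^o) x).
  have e1 := dD w (differentiableM f1 g1) (differentiableM dc p22).
  have e2 := dM w f1 g1; have e3 := dM w dc p22; have e4 := dM w f2 g2.
  apply: (etrans (congr1 (fun h => 'd h x w) E)); apply: (etrans e1).
  have ar (A B D G a b c d a' b' c' d' z : R) : A = a * c' + c * a' -> B = -1 * D + G * z ->
    D = b * d' + d * b' -> z = 0 ->
    A + B = a' * c - b' * d + (a * c' - b * d') by move=> -> -> -> ->; ring.
  exact: (ar _ _ _ _ _ _ _ _ _ _ _ _ _ e2 e3 e4 e0).
have E : (fun y => cIm (f y * g y) : R^o) =
    (fun y => cRe (f y) * cIm (g y) + cIm (f y) * cRe (g y)).
  by apply/funext => y; rewrite ImM.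
have e1 := dD w (differentiableM f1 g2) (differentiableM f2 g1).
have e2 := dM w f1 g2; have e3 := dM w f2 g1.
apply: (etrans (congr1 (fun h => 'd h x w) E)); apply: (etrans e1).
have ar (A B a b c d a' b' c' d' : R) : A = a * d' + d * a' -> B = b * c' + c * b' ->
  A + B = a' * d + b' * c + (a * d' + b * c') by move=> -> ->; ring.
exact: (ar _ _ _ _ _ _ _ _ _ _ e2 e3).
Qed.

Lemma cdZ w (a : C) f x : csm f -> cd w (fun x => a * f x) x = a * cd w f x.
Proof.
move=> sf; rewrite (cdM w x (csm_cst a) sf) cd_cst mul0r add0r.
by [].
Qed.

Lemma cd_sum w (I : Type) (s : seq I) (F : I -> V -> C) x :
  (forall i, csm (F i)) ->
  cd w (fun x => \sum_(i <- s) F i x) x = \sum_(i <- s) cd w (F i) x.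
Proof.
move=> sF; elim: s => [|a s IH].
  by rewrite big_nil -[RHS](cd_cst w 0 x); apply: cd_ext => y; rewrite big_nil.
rewrite big_cons -IH -(cdD w x (sF a) (csm_sum s sF)).
by apply: cd_ext => y; rewrite big_cons.
Qed.

Lemma cd_conj w f x : csm f -> cd w (fun x => (cj (f x))) x = (cj (cd w f x)).
Proof.
move=> sf; have [f1 f2] := csm_diff x sf.
have dc : differentiable (fun _ : V => -1 : R^o) x by exact: differentiable_cst.
apply: cP => /=.
  by congr ('d _ x w); apply/funext => y; case: (f y).
have e0 : 'd (fun _ : V => -1 : R^o) x w = 0 by rewrite (diff_cst (-1 : R^o) x).
have e := dM w dc f2.
have E : (fun y => cIm (cj (f y)) : R^o) = (fun y => -1 * cIm (f y)).
  by apply/funext => y; case: (f y) => a b; rewrite mulN1r.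
apply: (etrans (congr1 (fun h => 'd h x w) E)); apply: (etrans e).
have ar (a b z : R) : z = 0 -> -1 * a + b * z = - a by move=> ->; ring.
exact: ar.
Qed.

Lemma cd_comm u v f x : csm f -> cd u (cd v f) x = cd v (cd u f) x.
Proof.
move=> [f1 f2]; apply: cP.
  exact: (schwarz v u oT I (f1 2%N)).
exact: (schwarz v u oT I (f2 2%N)).
Qed.

Lemma cd_lin a (u v : V) f x : cd (a *: u + v) f x = (a%:C) * cd u f x + cd v f x.
Proof.
apply: cP; rewrite ?ReD ?ImD ?ReM ?ImM /cd /= linearP mul0r ?subr0 ?addr0//.
Qed.

Lemma cd0_cst f : csm f -> (forall w x, cd w f x = 0) -> forall x, f x = f 0.
Proof.
move=> [f1 f2] H x.
have K (h : V -> R^o) : smooth_on setT h -> (forall w x, 'd h x w = 0) -> h x = h 0.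
  move=> sh dh.
  have [t _] := @MVI_real _ _ h 0 x (fun t _ => smooth_on_diff sh I).
  by rewrite dh add0r => /eqP; rewrite subr_eq0 => /eqP.
apply: cP.
  by apply: (K (fun x => cRe (f x))) => // w y; have := H w y => /(congr1 (@cRe R)).
by apply: (K (fun x => cIm (f x))) => // w y; have := H w y => /(congr1 (@cIm R)).
Qed.

Lemma csm_real (f : V -> R^o) : smooth_on setT f -> csm (fun x => (f x)%:C : C).
Proof. by move=> sf; split => // k; exact: Ck_on_cst. Qed.

Lemma cd_real (f : V -> R^o) w x : cd w (fun x => (f x)%:C : C) x = ('d f x w)%:C.
Proof.
apply: cP => //=.
by rewrite (diff_cst (0 : R^o) x).
Qed.

Lemma Re_sum (I : Type) (s : seq I) (F : I -> C) :
  cRe (\sum_(i <- s) F i) = \sum_(i <- s) cRe (F i).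
Proof. by elim: s => [|a s IH]; rewrite ?big_nil// !big_cons ReD IH. Qed.

Lemma Im_sum (I : Type) (s : seq I) (F : I -> C) :
  cIm (\sum_(i <- s) F i) = \sum_(i <- s) cIm (F i).
Proof. by elim: s => [|a s IH]; rewrite ?big_nil// !big_cons ImD IH. Qed.

End ComplexValued.
Opaque cd.

(** * Holomorphic and antiholomorphic functions on [TE] *)

Section Dbar.
Context {R : realType} {n : nat}.
Local Notation C := R[i].
Local Notation X := 'rV[R]_(n + n).
Local Notation ii := (0 +i* 1 : C).
Implicit Types f g : X -> C.

(** [dbar] and [del] are twice the Wirtinger derivatives in the direction [w]. *)
Definition dbar (w : 'rV[R]_n) f (x : X) : C :=
  cd (row_mx w 0) f x + ii * cd (row_mx 0 w) f x.
Definition del (w : 'rV[R]_n) f (x : X) : C :=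
  cd (row_mx w 0) f x - ii * cd (row_mx 0 w) f x.

Definition hol f : Prop := csm f /\ forall w x, dbar w f x = 0.
Definition antihol f : Prop := csm f /\ forall w x, del w f x = 0.

Lemma iiM : ii * ii = -1.
Proof. by apply: cP => /=; ring. Qed.

Lemma dbar_ext w f g x : (forall y, f y = g y) -> dbar w f x = dbar w g x.
Proof. by move=> /funext ->. Qed.

Lemma dbarD w f g x : csm f -> csm g ->
  dbar w (fun x => f x + g x) x = dbar w f x + dbar w g x.
Proof.
move=> sf sg; rewrite /dbar !cdD//.
have ar (T : comNzRingType) (a b c d i : T) : a + b + i * (c + d) = a + i * c + (b + i * d) by ring.
exact: ar.
Qed.

Lemma dbarM w f g x : csm f -> csm g ->
  dbar w (fun x => f x * g x) x = dbar w f x * g x + f x * dbar w g x.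
Proof.
move=> sf sg; rewrite /dbar !cdM//.
have ar (T : comNzRingType) (a b c d i F G : T) :
  a * G + F * b + i * (c * G + F * d) = (a + i * c) * G + F * (b + i * d) by ring.
exact: ar.
Qed.

Lemma dbarZ w a f x : csm f -> dbar w (fun x => a * f x) x = a * dbar w f x.
Proof. by move=> sf; rewrite /dbar !cdZ// mulrDr mulrCA. Qed.

Lemma dbar_sum w (I : Type) (s : seq I) (F : I -> X -> C) x :
  (forall i, csm (F i)) ->
  dbar w (fun x => \sum_(i <- s) F i x) x = \sum_(i <- s) dbar w (F i) x.
Proof. by move=> sF; rewrite /dbar !cd_sum// mulr_sumr -big_split. Qed.

Lemma csm_dbar w f : csm f -> csm (dbar w f).
Proof.
move=> sf; apply: csmD; first exact: csm_cd.
by apply: csmM; [exact: csm_cst | exact: csm_cd].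
Qed.

Lemma dbar_conj w f x : csm f -> dbar w (fun x => (cj (f x))) x = (cj (del w f x)).
Proof.
move=> sf; rewrite /dbar /del !cd_conj//.
have ar (a b : C) : (cj a) + ii * (cj b) = (cj (a - ii * b)).
  by case: a b => a a' [b b']; apply: cP => /=; ring.
exact: ar.
Qed.

Lemma antihol_conj f : antihol f <-> hol (fun x => (cj (f x))).
Proof.
split=> -[sf H].
  split=> [|w x]; first exact: csm_conj.
  by rewrite dbar_conj// H; apply: cP => //=; rewrite oppr0.
have sf' : csm f by apply: csm_ext (csm_conj sf) => x; rewrite conjcKc.
split=> // w x; have := H w x; rewrite dbar_conj// => /(congr1 (@conjc R)).
by rewrite conjcKc => ->; apply: cP => //=; rewrite oppr0.
Qed.

Lemma del_dbar_comm u v f x : csm f -> del u (dbar v f) x = dbar v (del u f) x.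
Proof.
move=> sf; rewrite /del /dbar.
have cs w : csm (cd w f) by exact: csm_cd.
have ci w a : csm (fun y => a * cd w f y) by apply: csmM => //; exact: csm_cst.
have e1 z : cd z (fun y => cd (row_mx v 0) f y + ii * cd (row_mx 0 v) f y) x =
    cd z (cd (row_mx v 0) f) x + ii * cd z (cd (row_mx 0 v) f) x.
  by apply: (etrans (cdD z x (cs _) (ci _ _))); congr (_ + _); exact: cdZ.
have e2 z : cd z (fun y => cd (row_mx u 0) f y - ii * cd (row_mx 0 u) f y) x =
    cd z (cd (row_mx u 0) f) x - ii * cd z (cd (row_mx 0 u) f) x.
  have E : (fun y => cd (row_mx u 0) f y - ii * cd (row_mx 0 u) f y) =
      (fun y => cd (row_mx u 0) f y + - ii * cd (row_mx 0 u) f y).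
    by apply/funext => y; rewrite mulNr.
  rewrite E; apply: (etrans (cdD z x (cs _) (ci _ _))); congr (_ + _).
  by apply: (etrans (cdZ z (- ii) x (cs _))); rewrite mulNr.
rewrite (e1 (row_mx u 0)) (e1 (row_mx 0 u)) (e2 (row_mx v 0)) (e2 (row_mx 0 v)).
have ar (T : comNzRingType) (a b c d a' b' c' d' i : T) : a = a' -> b = b' -> c = c' ->
  d = d' -> a + i * b - i * (c + i * d) = a' - i * c' + i * (b' - i * d').
  by move=> -> -> -> ->; ring.
exact: (ar _ _ _ _ _ _ _ _ _ _ (cd_comm _ _ x sf) (cd_comm _ _ x sf)
  (cd_comm _ _ x sf) (cd_comm _ _ x sf)).
Qed.

Lemma hol_antihol_cst f : hol f -> antihol f -> forall x, f x = f 0.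
Proof.
move=> [sf H1] [_ H2]; apply: cd0_cst => // w x.
have dbl (z : C) : z + z = 0 -> z = 0.
  by move=> /eqP; rewrite -mulr2n mulrn_eq0 => /eqP.
have z1 v : cd (row_mx v 0) f x = 0.
  apply: dbl; have := H1 v x; have := H2 v x; rewrite /dbar /del => e1 e2.
  have ar (T : comNzRingType) (a b : T) : a - b = 0 -> a + b = 0 -> a + a = 0.
    by move=> h1 h2; have := addrACA a (- b) a b; rewrite h1 h2 addNr !addr0 => <-.
  exact: ar e1 e2.
have z2 v : cd (row_mx 0 v) f x = 0.
  have := H1 v x; rewrite /dbar z1 add0r => /(congr1 (fun z => - ii * z)).
  by rewrite mulr0 mulNr mulrA iiM mulN1r opprK.
have -> : w = 1 *: row_mx (lsubmx w) 0 + row_mx 0 (rsubmx w).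
  by rewrite scale1r add_row_mx addr0 add0r hsubmxK.
by rewrite cd_lin z1 z2 mulr0 addr0.
Qed.

Lemma holM f g : hol f -> hol g -> hol (fun x => f x * g x).
Proof.
move=> [sf f0] [sg g0]; split=> [|w x]; first exact: csmM.
by rewrite dbarM// f0 g0 mul0r mulr0 addr0.
Qed.

Lemma holD f g : hol f -> hol g -> hol (fun x => f x + g x).
Proof.
move=> [sf f0] [sg g0]; split=> [|w x]; first exact: csmD.
by rewrite dbarD// f0 g0 addr0.
Qed.

Lemma hol_cst a : hol (fun=> a).
Proof. by split=> [|w x]; [exact: csm_cst | rewrite /dbar !cd_cst mulr0 addr0]. Qed.

Lemma hol_ext f g : (forall x, f x = g x) -> hol f -> hol g.
Proof. by move=> /funext ->. Qed.

Lemma hol_sum (I : Type) (s : seq I) (F : I -> X -> C) :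
  (forall i, hol (F i)) -> hol (fun x => \sum_(i <- s) F i x).
Proof.
move=> hF; elim: s => [|a s IH].
  by apply: hol_ext (hol_cst 0) => x; rewrite big_nil.
by apply: hol_ext (holD (hF a) IH) => x; rewrite big_cons.
Qed.

Lemma antihol_ext f g : (forall x, f x = g x) -> antihol f -> antihol g.
Proof. by move=> /funext ->. Qed.

Lemma antiholM f g : antihol f -> antihol g -> antihol (fun x => f x * g x).
Proof.
move=> /antihol_conj hf /antihol_conj hg; apply/antihol_conj.
by apply: hol_ext (holM hf hg) => x; rewrite conjcM.
Qed.

Lemma antiholD f g : antihol f -> antihol g -> antihol (fun x => f x + g x).
Proof.
move=> /antihol_conj hf /antihol_conj hg; apply/antihol_conj.
by apply: hol_ext (holD hf hg) => x; rewrite conjcD.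
Qed.

Lemma antihol_cst a : antihol (fun=> a).
Proof. by apply/antihol_conj; exact: hol_cst. Qed.

Lemma antihol_sum (I : Type) (s : seq I) (F : I -> X -> C) :
  (forall i, antihol (F i)) -> antihol (fun x => \sum_(i <- s) F i x).
Proof.
move=> hF; elim: s => [|a s IH].
  by apply: antihol_ext (antihol_cst 0) => x; rewrite big_nil.
by apply: antihol_ext (antiholD (hF a) IH) => x; rewrite big_cons.
Qed.

Lemma antihol_dbar w f : antihol f -> antihol (dbar w f).
Proof.
move=> [sf f0]; split=> [|u x]; first exact: csm_dbar.
rewrite del_dbar_comm//.
have -> : del u f = fun=> 0 by apply/funext => y; exact: f0.
by have [_] := hol_cst 0; apply.
Qed.

Definition la (s : 'rV[R]_n) (x : X) : R^o := inner s (lsubmx x) / 2.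
Definition lb (s : 'rV[R]_n) (x : X) : R^o := inner s (rsubmx x) / 2.

Lemma la_linear s : linear (la s).
Proof.
move=> a x y; rewrite /la linearP /= innerC innerP ![inner _ s]innerC.
by rewrite mulrDl -mulrA.
Qed.

Lemma lb_linear s : linear (lb s).
Proof.
move=> a x y; rewrite /lb linearP /= innerC innerP ![inner _ s]innerC.
by rewrite mulrDl -mulrA.
Qed.

Lemma lin_smooth d (l : 'rV[R]_d -> R^o) : linear l ->
  smooth_on setT l /\ forall x w, 'd l x w = l w.
Proof.
move=> ll; have lc := @lin_continuous R d R^o (mklin ll).
split=> [k|x w]; first exact: (Ck_on_linear k openT lc).
by have := diff_lin x lc => /(congr1 (fun h => h w)).
Qed.

Lemma d_comp1 d (g : R -> R) (g' : R) (l : 'rV[R]_d -> R^o) (x w : 'rV[R]_d) :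
  is_derive (l x : R) 1 g g' -> differentiable l x ->
  'd (fun y => g (l y) : R^o) x w = 'd l x w * g'.
Proof.
move=> /derive_diff[dg dgE] dl.
exact: (etrans (dcompE w dl dg) (dgE _)).
Qed.

(** This is the exponential of [<s, z> / 2] with [z = theta + i theta']. The half makes its squared
    modulus a term of the partition function. *)
Definition es (s : 'rV[R]_n) (x : X) : C :=
  (expR (la s x) * cos (lb s x)) +i* (expR (la s x) * sin (lb s x)).

Lemma csm_es s : csm (es s).
Proof.
have [sa _] := lin_smooth (la_linear s); have [sb _] := lin_smooth (lb_linear s).
have oT : open [set: X] by exact: openT. have oR : open [set: R^o] by exact: openT.
have [sc ss] := smooth_trig oR.
split=> k; apply: Ck_onM => //.
- exact: (Ck_on_comp1 oT _ (sa k) (smooth_expR oR k)).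
- exact: (Ck_on_comp1 oT _ (sb k) (sc k)).
- exact: (Ck_on_comp1 oT _ (sa k) (smooth_expR oR k)).
- exact: (Ck_on_comp1 oT _ (sb k) (ss k)).
Qed.

Lemma cd_es s w x : cd w (es s) x = (la s w +i* lb s w) * es s x.
Proof.
have [sa da] := lin_smooth (la_linear s); have [sb db] := lin_smooth (lb_linear s).
have dla := smooth_on_diff sa (I : setT x); have dlb := smooth_on_diff sb (I : setT x).
have de : is_derive (la s x : R) 1 expR (expR (la s x)) by exact: is_derive_expR.
have dc : is_derive (lb s x : R) 1 cos (- sin (lb s x)) by exact: is_derive_cos.
have ds : is_derive (lb s x : R) 1 sin (cos (lb s x)) by exact: is_derive_sin.
have fe := differentiable_comp dla (derive_diff de).1.
have fc := differentiable_comp dlb (derive_diff dc).1.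
have fs := differentiable_comp dlb (derive_diff ds).1.
have e1 := d_comp1 w de dla; have e2 := d_comp1 w dc dlb; have e3 := d_comp1 w ds dlb.
have m1 := dM w fe fc; have m2 := dM w fe fs.
apply: cP; rewrite /es ?ReM ?ImM /=.
  apply: (etrans m1).
  have ar (E c s' a b A B P Q : R) : P = A * E -> A = a -> Q = B * - s' -> B = b ->
    E * Q + c * P = a * (E * c) - b * (E * s') by move=> -> -> -> ->; ring.
  exact: (ar _ _ _ _ _ _ _ _ _ e1 (da x w) e2 (db x w)).
apply: (etrans m2).
have ar (E c s' a b A B P Q : R) : P = A * E -> A = a -> Q = B * c -> B = b ->
  E * Q + s' * P = a * (E * s') + b * (E * c) by move=> -> -> -> ->; ring.
exact: (ar _ _ _ _ _ _ _ _ _ e1 (da x w) e3 (db x w)).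
Qed.

Lemma la_l s w : la s (row_mx w 0) = inner s w / 2.
Proof. by rewrite /la row_mxKl. Qed.
Lemma la_r s w : la s (row_mx 0 w) = 0.
Proof. by rewrite /la row_mxKl innerC inner0l mul0r. Qed.
Lemma lb_l s w : lb s (row_mx w 0) = 0.
Proof. by rewrite /lb row_mxKr innerC inner0l mul0r. Qed.
Lemma lb_r s w : lb s (row_mx 0 w) = inner s w / 2.
Proof. by rewrite /lb row_mxKr. Qed.

Lemma hol_es s : hol (es s).
Proof.
split=> [|w x]; first exact: csm_es.
rewrite /dbar !cd_es mulrA -mulrDl la_l la_r lb_l lb_r.
have -> : (inner s w / 2) +i* 0 + ii * (0 +i* (inner s w / 2)) = 0 :> C.
  by apply: cP => /=; ring.
by rewrite mul0r.
Qed.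

(** Conjugated exponentials are eigenfunctions of [dbar w]; distinct vectors [s] have distinct
    eigenvalues for generic [w], which drives the elimination below. *)
Lemma dbar_es_conj s w x : dbar w (fun x => (cj (es s x))) x = (inner s w)%:C * (cj (es s x)).
Proof.
rewrite dbar_conj; last exact: csm_es.
rewrite /del !cd_es mulrA -mulrBl conjcM la_l la_r lb_l lb_r; congr (_ * _).
by apply: cP => /=; field.
Qed.

Lemma es_conj s x : (cj (es s x)) * es s x = (expR (inner s (lsubmx x)))%:C.
Proof.
have e : expR (inner s (lsubmx x)) = expR (la s x) * expR (la s x).
  by rewrite -expRD; congr expR; rewrite /la; field.
have := cos2Dsin2 (lb s x); rewrite e /es => cs.
apply: cP => /=; last by ring.
rewrite mulNr opprK; set E := expR _; set c := cos _ in cs *; set d := sin _ in cs *.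
transitivity (E * E * (c ^+ 2 + d ^+ 2)); first by ring.
by rewrite cs mulr1.
Qed.

Lemma es_neq0 s x : es s x != 0.
Proof.
apply/eqP => e0; have := es_conj s x; rewrite e0 mulr0 => /(congr1 (@cRe R)) /= /eqP.
by rewrite eq_sym gt_eqF// expR_gt0.
Qed.

End Dbar.
Opaque dbar del.

(** * Independence of exponentials with holomorphic coefficients *)

Section ExpIndependence.
Context {R : realType} {n q : nat}.
Local Notation C := R[i].
Local Notation X := 'rV[R]_(n + n).
Variable sv : 'I_q -> 'rV[R]_n.
Hypothesis svI : injective sv.

Lemma generic_vector (vs : seq 'rV[R]_n) :
  exists xi, forall v, v \in vs -> v != 0 -> inner v xi != 0.
Proof.
elim: vs => [|v vs [xi H]]; first by exists 0.
have [v0|v0] := eqVneq v 0.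
  by exists xi => w; rewrite inE => /predU1P[->|/H//]; rewrite v0 eqxx.
(* [T] exceeds all ratios of [inner w v] to [inner w xi], so adding [T^-1 *: v] to [xi] cancels none
   of the products that are already nonzero. *)
pose T := 1 + \sum_(w <- vs) `|inner w v / inner w xi|.
have T1 : 1 <= T by rewrite lerDl; apply: sumr_ge0.
have [vxi|vxi] := eqVneq (inner v xi) 0; last first.
  by exists xi => w; rewrite inE => /predU1P[->|/H].
exists (xi + T^-1 *: v) => w; rewrite inE => /predU1P[->|wv] w0; rewrite innerDr innerZr.
  rewrite vxi add0r mulf_neq0 ?invr_eq0 ?gt_eqF//; first exact: lt_le_trans T1.
  rewrite lt_neqAle inner_ge0 andbT eq_sym; apply: contra_neq v0; exact: inner_eq0.
have wx := H w wv w0; apply/eqP => e.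
have : `|inner w v / inner w xi| = T.
  have T0 : T != 0 by rewrite gt_eqF// (lt_le_trans ltr01).
  have -> : inner w v / inner w xi = - T.
    apply/eqP; rewrite -(can_eq (mulfK wx)) divfK//; apply/eqP.
    have : T * (inner w xi + T^-1 * inner w v) = 0 by rewrite e mulr0.
    rewrite mulrDr mulrA divff// mul1r => /eqP; rewrite addr_eq0 => /eqP E.
    by rewrite mulNr E opprK.
  by rewrite normrN ger0_norm// (le_trans ler01).
rewrite /T (big_rem w wv)/= => e2; have : 0 <= \sum_(i <- rem w vs) `|inner i v / inner i xi|.
  by apply: sumr_ge0.
lra.
Qed.

Local Notation e i := (es (sv i)).

(** Subtracting from [dbar xi] its eigenvalue at index [j] removes the [j]-th term and multiplies
    the others by nonzero constants; holomorphic coefficients are constants for [dbar]. *)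
Lemma exp_indep (S : seq 'I_q) (u : 'I_q -> X -> C) : uniq S ->
  (forall i, hol (u i)) ->
  (forall x, \sum_(i <- S) u i x * cj (e i x) = 0) ->
  forall i x, i \in S -> u i x = 0.
Proof.
elim: S u => [//|j S IH] u /andP[jS uS] hu H i x.
have [xi Hxi] := generic_vector [seq sv i - sv j | i <- S].
have su k : csm (u k) by have [] := hu k.
have se k : csm (fun x => cj (e k x)) by apply: csm_conj; exact: csm_es.
have sue k : csm (fun x => u k x * cj (e k x)) by exact: csmM.
have key y : \sum_(k <- S) ((inner (sv k - sv j) xi)%:C * u k y) * cj (e k y) = 0.
  have d0 : \sum_(k <- j :: S) dbar xi (fun y => u k y * cj (e k y)) y = 0.
    apply: (etrans (esym (dbar_sum xi (j :: S) y sue))).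
    have [_ h0] := hol_cst (R := R) (n := n) 0.
    exact: (etrans (dbar_ext xi y H) (h0 xi y)).
  have de k : dbar xi (fun y => u k y * cj (e k y)) y =
      u k y * ((inner (sv k) xi)%:C * cj (e k y)).
    apply: (etrans (dbarM xi y (su k) (se k))).
    by rewrite dbar_es_conj; have [_ ->] := hu k; rewrite mul0r add0r.
  apply: esym; apply: (etrans (esym d0)); rewrite big_cons de.
  have -> : \sum_(k <- S) dbar xi (fun y => u k y * cj (e k y)) y =
      \sum_(k <- S) u k y * ((inner (sv k) xi)%:C * cj (e k y)).
    by apply: eq_bigr => k _; exact: de.
  have := H y; rewrite big_cons => /eqP; rewrite addr_eq0 => /eqP Hj.
  have -> : u j y * ((inner (sv j) xi)%:C * cj (e j y)) =
      (inner (sv j) xi)%:C * (u j y * cj (e j y)) by rewrite mulrCA.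
  rewrite Hj mulrN mulr_sumr -sumrN -big_split; apply: eq_bigr => k _ /=.
  have -> : (inner (sv k - sv j) xi)%:C = (inner (sv k) xi)%:C - (inner (sv j) xi)%:C :> C.
    by rewrite innerBl; apply: cP => /=; rewrite ?subr0.
  have ar (T : comNzRingType) (a b c d : T) : - (b * (c * d)) + c * (a * d) = (a - b) * c * d by ring.
  exact: ar.
have IHS k y : k \in S -> u k y = 0.
  move=> kS; have hk l : hol (fun y => (inner (sv l - sv j) xi)%:C * u l y).
    by apply: holM => //; exact: hol_cst.
  have := IH _ uS hk key k y kS => /eqP; rewrite mulf_eq0 => /orP[|/eqP//].
  have : inner (sv k - sv j) xi != 0.
    apply: Hxi; first by apply/mapP; exists k.
    by rewrite subr_eq0; apply: contraNneq jS => /svI <-.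
  by move=> nz /eqP[/eqP]; rewrite (negbTE nz).
rewrite inE => /predU1P[->|]; last exact: IHS.
have := H x; rewrite big_cons big1_seq ?addr0; last by move=> k /andP[_ kS]; rewrite IHS ?mul0r.
move/eqP; rewrite mulf_eq0 => /orP[/eqP//|/eqP /(congr1 (@cj R))].
rewrite conjcKc => e0; have := es_neq0 (sv j) x; rewrite e0.
by rewrite (_ : cj 0 = 0 :> C) ?eqxx//; apply: cP => //=; rewrite oppr0.
Qed.

Lemma exp_indep_conj (u : 'I_q -> X -> C) : (forall i, antihol (u i)) ->
  (forall x, \sum_i u i x * e i x = 0) -> forall i x, u i x = 0.
Proof.
move=> hu H i x.
have hc k : hol (fun x => cj (u k x)) by apply/antihol_conj.
have c0 : cj 0 = 0 :> C by apply: cP => //=; rewrite oppr0.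
have H' y : \sum_(k <- index_enum 'I_q) cj (u k y) * cj (e k y) = 0.
  have E := congr1 (@cj R) (H y); rewrite conjc_sum c0 in E.
  apply: (etrans _ E); apply: eq_bigr => k _.
  by rewrite conjcM.
have := exp_indep (index_enum_uniq _) hc H' x (mem_index_enum i).
by move/(congr1 (@cj R)); rewrite conjcKc c0.
Qed.

(** Division by the conjugated exponential makes [b] a combination of exponentials with
    antiholomorphic coefficients. Applying [dbar] and [exp_indep_conj] shows that these are also
    holomorphic, hence constant. *)
Lemma exp_coef1 (b : X -> C) (c : 'I_q -> X -> C) j : hol b -> (forall r, antihol (c r)) ->
  (forall x, b x * cj (e j x) = \sum_r c r x * e r x) ->
  exists a : 'I_q -> C, forall x, b x = \sum_r a r * e r x.
Proof.
move=> hb hc H.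
have eN x : es (- sv j) x * e j x = 1.
  have l1 : la (- sv j) x = - la (sv j) x by rewrite /la innerNl mulNr.
  have l2 : lb (- sv j) x = - lb (sv j) x by rewrite /lb innerNl mulNr.
  have E : expR (- la (sv j) x) * expR (la (sv j) x) = 1 by rewrite -expRD addNr expR0.
  have cs := cos2Dsin2 (lb (sv j) x).
  rewrite /es l1 l2 cosN sinN; move: E cs.
  set E1 := expR _; set E2 := expR _; set c1 := cos _; set d1 := sin _ => E cs.
  apply: cP => /=; last by ring.
  by transitivity ((E1 * E2) * (c1 ^+ 2 + d1 ^+ 2)); [ring | rewrite E cs mulr1].
pose u r x := cj (es (- sv j) x) * c r x.
have hu r : antihol (u r).
  apply: antiholM => //; apply/antihol_conj; apply: hol_ext (hol_es (- sv j)) => x.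
  by rewrite conjcKc.
have bE x : b x = \sum_r u r x * e r x.
  have -> : b x = cj (es (- sv j) x) * (b x * cj (e j x)).
    rewrite mulrCA -conjcM eN; have -> : cj 1 = 1 :> C by apply: cP => //=; rewrite oppr0.
    by rewrite mulr1.
  by rewrite H mulr_sumr; apply: eq_bigr => r _; rewrite mulrA.
have su r : csm (u r) by have [] := hu r.
have u0 w r x : dbar w (u r) x = 0.
  apply: (exp_indep_conj (u := fun r => dbar w (u r))) => [k|y]; first exact: antihol_dbar.
  have [_ /(_ w y) b0] := hb; rewrite -[RHS]b0.
  have sm k : csm (fun x => u k x * e k x) by apply: csmM => //; exact: csm_es.
  apply: esym; apply: (etrans (dbar_ext w y bE)).
  apply: (etrans (dbar_sum w _ y sm)); apply: eq_bigr => k _.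
  apply: (etrans (dbarM w y (su k) (csm_es (sv k)))).
  by have [_ ->] := hol_es (sv k); rewrite mulr0 addr0.
exists (fun r => u r 0) => x; rewrite bE; apply: eq_bigr => r _; congr (_ * _).
by apply: hol_antihol_cst; [split | exact: hu].
Qed.

(** The elimination of [exp_indep] shortens the left-hand side and keeps the right-hand side of the
    same form. Once the terms other than [j] are known to be combinations of exponentials, they are
    moved to the right and [exp_coef1] settles the last one. *)
Lemma exp_coef (S : seq 'I_q) (b : 'I_q -> X -> C) (c : 'I_q -> X -> C) : uniq S ->
  (forall i, hol (b i)) -> (forall r, antihol (c r)) ->
  (forall x, \sum_(i <- S) b i x * cj (e i x) = \sum_r c r x * e r x) ->
  forall i, i \in S -> exists a : 'I_q -> C, forall x, b i x = \sum_r a r * e r x.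
Proof.
elim: S b c => [//|j S IH] b c /andP[jS uS] hb hc H.
have [xi Hxi] := generic_vector [seq sv i - sv j | i <- S].
have sb k : csm (b k) by have [] := hb k.
have sc k : csm (c k) by have [] := hc k.
have se k : csm (fun x => cj (e k x)) by apply: csm_conj; exact: csm_es.
have sbe k : csm (fun x => b k x * cj (e k x)) by exact: csmM.
have sce k : csm (fun x => c k x * e k x) by apply: csmM => //; exact: csm_es.
pose c' r y := dbar xi (c r) y - (inner (sv j) xi)%:C * c r y.
have hc' r : antihol (c' r).
  apply: antiholD; first exact: antihol_dbar.
  apply: (@antihol_ext _ _ (fun y => - (inner (sv j) xi)%:C * c r y)).
    by move=> y; rewrite mulNr.
  by apply: antiholM => //; exact: antihol_cst.
have key y : \sum_(k <- S) ((inner (sv k - sv j) xi)%:C * b k y) * cj (e k y) =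
    \sum_r c' r y * e r y.
  have d0 := etrans (esym (dbar_sum xi (j :: S) y sbe))
    (etrans (dbar_ext xi y H) (dbar_sum xi (index_enum 'I_q) y sce)).
  have de k : dbar xi (fun y => b k y * cj (e k y)) y =
      b k y * ((inner (sv k) xi)%:C * cj (e k y)).
    apply: (etrans (dbarM xi y (sb k) (se k))).
    by rewrite dbar_es_conj; have [_ ->] := hb k; rewrite mul0r add0r.
  have dc k : dbar xi (fun y => c k y * e k y) y = dbar xi (c k) y * e k y.
    apply: (etrans (dbarM xi y (sc k) (csm_es (sv k)))).
    by have [_ ->] := hol_es (sv k); rewrite mulr0 addr0.
  have E : \sum_(k <- j :: S) dbar xi (fun y => b k y * cj (e k y)) y -
      (inner (sv j) xi)%:C * \sum_(k <- j :: S) b k y * cj (e k y) =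
      \sum_r dbar xi (fun y => c r y * e r y) y -
      (inner (sv j) xi)%:C * \sum_r c r y * e r y by rewrite d0 H.
  have -> : \sum_r c' r y * e r y = \sum_r dbar xi (fun y => c r y * e r y) y -
      (inner (sv j) xi)%:C * \sum_r c r y * e r y.
    rewrite mulr_sumr -sumrN -big_split; apply: eq_bigr => r _.
    by rewrite dc /c' mulrBl mulrA.
  rewrite -E !big_cons de mulrDr.
  have -> : \sum_(k <- S) dbar xi (fun y => b k y * cj (e k y)) y =
      \sum_(k <- S) b k y * ((inner (sv k) xi)%:C * cj (e k y)).
    by apply: eq_bigr => k _; exact: de.
  have ar (T : comNzRingType) (a v s t u : T) : v * (a * t) + s - (a * (v * t) + u) = s - u by ring.
  apply: esym; apply: (etrans (ar _ _ _ _ _ _)).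
  rewrite mulr_sumr -sumrN -big_split; apply: eq_bigr => k _ /=.
  have -> : (inner (sv k - sv j) xi)%:C = (inner (sv k) xi)%:C - (inner (sv j) xi)%:C :> C.
    by rewrite innerBl; apply: cP => /=; rewrite ?subr0.
  have ar2 (T : comNzRingType) (s t u v : T) : u * (s * v) - t * (u * v) = (s - t) * u * v by ring.
  exact: ar2.
have IHS k : k \in S -> exists a : 'I_q -> C, forall x, b k x = \sum_r a r * e r x.
  move=> kS; have hk l : hol (fun y => (inner (sv l - sv j) xi)%:C * b l y).
    by apply: holM => //; exact: hol_cst.
  have [a Ha] := IH _ _ uS hk hc' key k kS.
  set z := (inner (sv k - sv j) xi)%:C in Ha.
  have z0 : z != 0.
    have nz : inner (sv k - sv j) xi != 0.
      apply: Hxi; first by apply/mapP; exists k.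
      by rewrite subr_eq0; apply: contraNneq jS => /svI <-.
    by apply/eqP => /(congr1 (@cRe R)) /= /eqP; rewrite (negbTE nz).
  exists (fun r => z^-1 * a r) => x.
  under eq_bigr do rewrite -mulrA.
  by rewrite -mulr_sumr -Ha mulrA mulVf// mul1r.
move=> i; rewrite inE => /predU1P[->|]; last exact: IHS.
have /choice[A HA] : forall k, exists a : 'I_q -> C, k \in S ->
    forall x, b k x = \sum_r a r * e r x.
  by move=> k; case: (boolP (k \in S)) => [/IHS[a Ha]|_]; [exists a | exists (fun=> 0)].
apply: (@exp_coef1 (b j) (fun r x => c r x - \sum_(k <- S) A k r * cj (e k x)) j (hb j)).
  move=> r; apply: antiholD => //.
  apply: (@antihol_ext _ _ (fun y => \sum_(k <- S) - A k r * cj (e k y))).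
    by move=> y; rewrite -sumrN; apply: eq_bigr => k _; rewrite mulNr.
  apply: antihol_sum => k; apply: antiholM; first exact: antihol_cst.
  by apply/antihol_conj; apply: hol_ext (hol_es (sv k)) => x; rewrite conjcKc.
move=> x; have := H x; rewrite big_cons => /eqP; rewrite eq_sym -subr_eq => /eqP <-.
under [RHS]eq_bigr do rewrite mulrBl.
rewrite sumrB; congr (_ - _).
under [RHS]eq_bigr do rewrite mulr_suml.
rewrite exchange_big /=; apply: eq_big_seq => k kS.
rewrite HA// mulr_suml; apply: eq_bigr => r _.
by rewrite mulrAC.
Qed.

End ExpIndependence.

(** * Kahler functions on [TE] as Hermitian forms in the exponentials *)

Section TEKahler.
Context {R : realType} {n q : nat}.
Local Notation C := R[i].
Local Notation X := 'rV[R]_(n + n).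
Local Notation ii := (0 +i* 1 : C).
Variables (sv : 'I_q -> 'rV[R]_n) (W : 'I_q -> R).
Hypotheses (svI : injective sv) (W0 : forall i, 0 < W i) (q0 : 'I_q).

(** For an exponential family [Zf] will be the partition function, [prf] the law of the estimator,
    [eta] its mean, that is the dual coordinates, and [cov] its covariance, that is the Fisher
    metric. *)
Definition Zf (th : 'rV[R]_n) : R := \sum_i W i * expR (inner (sv i) th).
Definition prf (i : 'I_q) (th : 'rV[R]_n) : R := W i * expR (inner (sv i) th) / Zf th.
Definition eta (th : 'rV[R]_n) : 'rV[R]_n := \sum_i prf i th *: sv i.
Definition cov (th u v : 'rV[R]_n) : R :=
  \sum_i prf i th * (inner (sv i) u * inner (sv i) v) -
  inner (eta th) u * inner (eta th) v.

Lemma Zf_gt0 th : 0 < Zf th.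
Proof.
rewrite /Zf (bigD1 q0)//=; apply: ltr_pwDl; first by rewrite mulr_gt0 ?expR_gt0.
by apply: sumr_ge0 => i _; rewrite mulr_ge0 ?ltW ?expR_gt0.
Qed.

Lemma prf_sum th : \sum_i prf i th = 1.
Proof. by rewrite -mulr_suml divff// gt_eqF ?Zf_gt0. Qed.

Lemma prf_gt0 i th : 0 < prf i th.
Proof. by rewrite divr_gt0 ?Zf_gt0// mulr_gt0 ?expR_gt0. Qed.

Lemma inner_eta th u : inner (eta th) u = \sum_i prf i th * inner (sv i) u.
Proof. by rewrite inner_suml; apply: eq_bigr => i _; rewrite innerZl. Qed.

Let ex (i : 'I_q) (x : X) : R^o := expR (inner (sv i) (lsubmx x)).

Lemma exl_linear (s : 'rV[R]_n) : linear (fun x : X => inner s (lsubmx x) : R^o).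
Proof.
by move=> a x y; rewrite linearP /= innerC innerP ![inner _ s]innerC.
Qed.

Lemma ex_smooth i : smooth_on setT (ex i) /\
  forall x w, 'd (ex i) x w = inner (sv i) (lsubmx w) * ex i x.
Proof.
have [sl dl] := lin_smooth (exl_linear (sv i)).
have oR : open [set: R^o] by exact: openT.
split=> [k|x w].
  exact: (Ck_on_comp1 openT _ (sl k) (smooth_expR oR k)).
have de : is_derive (inner (sv i) (lsubmx x) : R) 1 expR (expR (inner (sv i) (lsubmx x))).
  exact: is_derive_expR.
apply: (etrans (d_comp1 w de (smooth_on_diff sl (I : setT x)))).
by congr (_ * _); exact: dl.
Qed.

Lemma wex_smooth i : smooth_on setT (fun x => W i * ex i x : R^o) /\
  forall x w, 'd (fun x => W i * ex i x : R^o) x w =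
    W i * (inner (sv i) (lsubmx w) * ex i x).
Proof.
have [se de] := ex_smooth i; split=> [k|x w].
  by apply: Ck_onM; [exact: openT | exact: Ck_on_cst | exact: se].
have dc : differentiable (fun _ : X => W i : R^o) x by exact: differentiable_cst.
have e0 : 'd (fun _ : X => W i : R^o) x w = 0 by rewrite (diff_cst (W i : R^o) x).
apply: (etrans (dM w dc (smooth_on_diff se (I : setT x)))).
have ar (a b c z : R) : z = 0 -> a = c -> W i * a + b * z = W i * c.
  by move=> -> ->; rewrite mulr0 addr0.
exact: (ar _ _ _ _ e0 (de x w)).
Qed.

Lemma Zf_smooth : smooth_on setT (fun x : X => Zf (lsubmx x) : R^o) /\
  forall x w, 'd (fun x : X => Zf (lsubmx x) : R^o) x w =
    inner (eta (lsubmx x)) (lsubmx w) * Zf (lsubmx x).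
Proof.
split=> [k|x w].
  by apply: Ck_on_sum => [|i]; [exact: openT | exact: (wex_smooth i).1].
have dw i := smooth_on_diff (wex_smooth i).1 (I : setT x).
have [_ ds] := dsum dw; apply: (etrans (ds w)).
rewrite inner_eta mulr_suml; apply: eq_bigr => i _; apply: (etrans ((wex_smooth i).2 x w)).
rewrite /prf /ex; have := Zf_gt0 (lsubmx x); set z := Zf _ => z0.
by field; rewrite gt_eqF.
Qed.

Lemma prf_smooth i : smooth_on setT (fun x : X => prf i (lsubmx x) : R^o) /\
  forall x w, 'd (fun x : X => prf i (lsubmx x) : R^o) x w =
    prf i (lsubmx x) * (inner (sv i) (lsubmx w) - inner (eta (lsubmx x)) (lsubmx w)).
Proof.
have [sZ dZ] := Zf_smooth; have [sw dw] := wex_smooth i.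
have nz (x : X) : Zf (lsubmx x) != 0 by rewrite gt_eqF ?Zf_gt0.
have sm : smooth_on setT (fun x : X => prf i (lsubmx x) : R^o).
  move=> k; apply: (Ck_onM openT (sw k)).
  by apply: (Ck_on_comp1 (B := [set x : R^o | x != 0]) openT _ (sZ k) (smooth_inv (R := R) k)) => x _; exact: nz.
split=> // x w.
have E : (fun x : X => W i * ex i x : R^o) =
    (fun x : X => prf i (lsubmx x) * Zf (lsubmx x)).
  by apply/funext => y; rewrite /prf divfK.
have e1 := dM w (smooth_on_diff sm (I : setT x)) (smooth_on_diff sZ (I : setT x)).
have e2 := etrans (esym (dw x w)) (etrans (congr1 (fun h => 'd h x w) E) e1).
have ar (a b c d e z w' u v : R) : z != 0 -> w' * (u * e) = a * b + z * d -> b = v * z ->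
   a = w' * e / z -> d = a * (u - v).
  move=> z0 h1 h2 h3; apply: (mulfI z0).
  have -> : z * d = w' * (u * e) - a * b by rewrite h1; ring.
  by rewrite h2 h3; field.
have e3 : prf i (lsubmx x) = W i * ex i x / Zf (lsubmx x) by [].
exact: (ar _ _ 0 _ _ _ _ _ _ (nz x) e2 (dZ x w) e3).
Qed.

Lemma eta_smooth u : smooth_on setT (fun x : X => inner (eta (lsubmx x)) u : R^o) /\
  forall x w, 'd (fun x : X => inner (eta (lsubmx x)) u : R^o) x w =
    cov (lsubmx x) (lsubmx w) u.
Proof.
have E : (fun x : X => inner (eta (lsubmx x)) u : R^o) =
    (fun x => \sum_i inner (sv i) u * prf i (lsubmx x)).
  by apply/funext => x; rewrite inner_eta; apply: eq_bigr => i _; rewrite mulrC.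
have si i : smooth_on setT (fun x : X => inner (sv i) u * prf i (lsubmx x) : R^o).
  by move=> k; apply: Ck_onM; [exact: openT | exact: Ck_on_cst | exact: (prf_smooth i).1].
rewrite E; split=> [k|x w]; first by apply: Ck_on_sum => [|i]; [exact: openT | exact: si].
have di i := smooth_on_diff (si i) (I : setT x).
have [_ ds] := dsum di; apply: (etrans (ds w)).
rewrite /cov [in RHS]mulrC [X in _ - X * _]inner_eta mulr_suml -sumrB; apply: eq_bigr => i _.
have dc : differentiable (fun _ : X => inner (sv i) u : R^o) x by exact: differentiable_cst.
have e0 : 'd (fun _ : X => inner (sv i) u : R^o) x w = 0.
  by rewrite (diff_cst (inner (sv i) u : R^o) x).
have e1 := dM w dc (smooth_on_diff (prf_smooth i).1 (I : setT x)).
apply: (etrans e1).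
have ar (a b c d e z : R) : z = 0 -> d = b * (c - e) ->
   a * d + b * z = b * (c * a) - b * a * e by move=> -> ->; ring.
exact: (ar _ _ _ _ _ _ e0 ((prf_smooth i).2 x w)).
Qed.

Lemma covC th u v : cov th u v = cov th v u.
Proof.
rewrite /cov [inner (eta th) u * _]mulrC; congr (_ - _).
by apply: eq_bigr => i _; rewrite [inner (sv i) u * _]mulrC.
Qed.

Lemma covP th a u u' v : cov th (a *: u + u') v = a * cov th u v + cov th u' v.
Proof.
rewrite /cov !innerDr !innerZr.
have -> : \sum_i prf i th * (inner (sv i) (a *: u + u') * inner (sv i) v) =
  a * (\sum_i prf i th * (inner (sv i) u * inner (sv i) v)) +
  \sum_i prf i th * (inner (sv i) u' * inner (sv i) v).
  rewrite mulr_sumr -big_split; apply: eq_bigr => i _ /=.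
  by rewrite innerDr innerZr; ring.
by ring.
Qed.

Lemma cov0l th v : cov th 0 v = 0.
Proof. by have := covP th (-1) 0 0 v; rewrite scaler0 addr0 mulN1r addrC subrr. Qed.

Lemma cov0r th v : cov th v 0 = 0. Proof. by rewrite covC cov0l. Qed.

Definition vc (V : X -> X) (u : 'rV[R]_n) (x : X) : C :=
  inner u (lsubmx (V x)) +i* inner u (rsubmx (V x)).

(** The third clause is the Hamiltonian equation for the block-diagonal metric with blocks [cov];
    the fourth, holomorphy of [V], replaces the Killing equation. *)
Definition kfield (f : X -> R^o) (V : X -> X) : Prop :=
  [/\ smooth_on setT f, smooth_on setT V,
    forall x w, 'd f x w = cov (lsubmx x) (lsubmx (V x)) (rsubmx w)
      - cov (lsubmx x) (rsubmx (V x)) (lsubmx w) &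
    forall x w, 'd V x (mulI w) = mulI ('d V x w)].

Lemma vcD V u v x : vc V (u + v) x = vc V u x + vc V v x.
Proof. by rewrite /vc !innerDl. Qed.

Lemma vcZ V a u x : vc V (a *: u) x = a%:C * vc V u x.
Proof. by rewrite /vc !innerZl; apply: cP => /=; ring. Qed.

Lemma vc_sum V (I : finType) (a : I -> R) (F : I -> 'rV[R]_n) x :
  vc V (\sum_i a i *: F i) x = \sum_i (a i)%:C * vc V (F i) x.
Proof.
elim/big_rec2: _ => [|i y z _ <-]; last by rewrite vcD vcZ.
by rewrite /vc !inner0l.
Qed.

Lemma vc_hol f V u : kfield f V -> hol (vc V u).
Proof.
move=> [_ sV _ VI].
have ll : linear (fun y : X => inner u (lsubmx y) : R^o).
  by move=> a p r; rewrite linearP /= innerC innerP ![inner _ u]innerC.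
have lr : linear (fun y : X => inner u (rsubmx y) : R^o).
  by move=> a p r; rewrite linearP /= innerC innerP ![inner _ u]innerC.
have [sl dl] := lin_smooth ll; have [sr dr] := lin_smooth lr.
have s1 : smooth_on setT (fun y : X => inner u (lsubmx (V y)) : R^o).
  by move=> k; exact: (Ck_on_comp (B := setT) openT _ (sV k) (sl k)).
have s2 : smooth_on setT (fun y : X => inner u (rsubmx (V y)) : R^o).
  by move=> k; exact: (Ck_on_comp (B := setT) openT _ (sV k) (sr k)).
split=> [|w x]; first by split.
have dV := smooth_on_diff sV (I : setT x).
have d1 z : 'd (fun y : X => inner u (lsubmx (V y)) : R^o) x z = inner u (lsubmx ('d V x z)).
  exact: (etrans (dcompE z dV (smooth_on_diff sl (I : setT (V x)))) (dl _ _)).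
have d2 z : 'd (fun y : X => inner u (rsubmx (V y)) : R^o) x z = inner u (rsubmx ('d V x z)).
  exact: (etrans (dcompE z dV (smooth_on_diff sr (I : setT (V x)))) (dr _ _)).
have cdE z : cd z (vc V u) x = inner u (lsubmx ('d V x z)) +i* inner u (rsubmx ('d V x z)).
  by apply: cP; [exact: d1 | exact: d2].
have wI : row_mx 0 w = mulI (row_mx w 0) :> X.
  by rewrite /mulI row_mxKl row_mxKr oppr0.
have dI : 'd V x (row_mx 0 w) = mulI ('d V x (row_mx w 0)) by rewrite wI; exact: VI.
have -> : dbar w (vc V u) x = cd (row_mx w 0) (vc V u) x + ii * cd (row_mx 0 w) (vc V u) x.
  by [].
rewrite !cdE dI /mulI row_mxKl row_mxKr innerNr.
by apply: cP => /=; ring.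
Qed.

Definition cc (f : X -> R^o) (V : X -> X) (x : X) : C :=
  (f x)%:C - ii * vc V (eta (lsubmx x)) x.

(** The Hamiltonian equation says that [dbar w f] is [i] times the complexified [cov] of [w] and
    [V]. As [V] is holomorphic and [dbar w] of [eta] is the covariance, this is also [dbar w] of
    [i <eta, V>], so the difference is holomorphic. *)
Lemma cc_hol f V : kfield f V -> hol (cc f V).
Proof.
move=> kf; have [sf sV df VI] := kf.
pose ek (k : 'I_n) : 'rV[R]_n := delta_mx 0 k.
have etaE (x : X) : eta (lsubmx x) = \sum_k inner (eta (lsubmx x)) (ek k) *: ek k.
  rewrite {1}(row_sum_delta (eta (lsubmx x))); apply: eq_bigr => k _; congr (_ *: _).
  by rewrite inner_delta.
pose g k x : C := (inner (eta (lsubmx x)) (ek k))%:C * vc V (ek k) x.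
have ccE : cc f V = fun x => (f x)%:C + - ii * \sum_k g k x.
  by apply/funext => x; rewrite /cc {1}etaE vc_sum mulNr.
have hv k := vc_hol (ek k) kf.
have sv' k : csm (vc V (ek k)) by have [] := hv k.
have se k : csm (fun x : X => (inner (eta (lsubmx x)) (ek k))%:C : C).
  exact: (csm_real (eta_smooth (ek k)).1).
have sg k : csm (g k) by exact: csmM.
have sS : csm (fun x => \sum_k g k x) by exact: csm_sum.
have sS' : csm (fun x => - ii * \sum_k g k x) by apply: csmM => //; exact: csm_cst.
have sF := csm_real sf.
rewrite ccE; split=> [|w x]; first exact: csmD.
apply: (etrans (dbarD w x sF sS')).
have e1 : dbar w (fun x => (f x)%:C) x = ('d f x (row_mx w 0)) +i* ('d f x (row_mx 0 w)).
  have -> : dbar w (fun x => (f x)%:C) x = cd (row_mx w 0) (fun x => (f x)%:C) x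
    + ii * cd (row_mx 0 w) (fun x => (f x)%:C) x by [].
  rewrite !cd_real; have ar (a b : R) : a%:C + ii * b%:C = a +i* b by apply: cP => /=; ring.
  exact: ar.
have e2 k : dbar w (g k) x = (cov (lsubmx x) w (ek k))%:C * vc V (ek k) x.
  apply: (etrans (dbarM w x (se k) (sv' k))).
  have [_ ->] := hv k; rewrite mulr0 addr0; congr (_ * _).
  have -> : dbar w (fun x => (inner (eta (lsubmx x)) (ek k))%:C) x =
    cd (row_mx w 0) (fun x => (inner (eta (lsubmx x)) (ek k))%:C) x
    + ii * cd (row_mx 0 w) (fun x => (inner (eta (lsubmx x)) (ek k))%:C) x by [].
  rewrite !cd_real.
  have -> : 'd (fun x : X => inner (eta (lsubmx x)) (ek k) : R^o) x (row_mx w 0) =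
    cov (lsubmx x) w (ek k).
    by apply: (etrans ((eta_smooth (ek k)).2 x _)); rewrite row_mxKl.
  have -> : 'd (fun x : X => inner (eta (lsubmx x)) (ek k) : R^o) x (row_mx 0 w) = 0.
    apply: (etrans ((eta_smooth (ek k)).2 x _)); rewrite row_mxKl.
    exact: cov0l.
  by rewrite mulr0 addr0.
have e3 : dbar w (fun x => - ii * \sum_k g k x) x =
    - ii * \sum_k (cov (lsubmx x) w (ek k))%:C * vc V (ek k) x.
  apply: (etrans (dbarZ w (- ii) x sS)); congr (_ * _).
  by apply: (etrans (dbar_sum w _ x sg)); apply: eq_bigr => k _; exact: e2.
rewrite e1 e3.
have covE v : cov (lsubmx x) w v = \sum_k cov (lsubmx x) w (ek k) * v 0 k.
  have cl : linear (fun v => cov (lsubmx x) w v : R^o).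
    by move=> a p r; rewrite covC covP ![cov _ _ w]covC.
  rewrite {1}(row_sum_delta v) -[LHS]/(mklin cl _) linear_sum.
  by apply: eq_bigr => k _; rewrite linearZ /= mulrC.
have -> : \sum_k (cov (lsubmx x) w (ek k))%:C * vc V (ek k) x =
  cov (lsubmx x) w (lsubmx (V x)) +i* cov (lsubmx x) w (rsubmx (V x)).
  have inE (v : 'rV[R]_n) k : inner (ek k) v = v 0 k by rewrite innerC inner_delta.
  rewrite !covE; apply: cP.
    rewrite Re_sum; apply: eq_bigr => k _; rewrite ReM /= inE; ring.
  rewrite Im_sum; apply: eq_bigr => k _; rewrite ImM /= inE; ring.
rewrite !df !row_mxKl !row_mxKr.
rewrite !cov0r ![cov _ w _]covC sub0r subr0.
have ar (a b : R) : (- b) +i* a + - ii * (a +i* b) = 0 :> C by apply: cP => /=; ring.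
exact: ar.
Qed.

(* The square roots of the weights make the matrix of a Kahler function Hermitian. *)
Definition et (i : 'I_q) (x : X) : C := (Num.sqrt (W i))%:C * es (sv i) x.

Definition qf (A : 'M[C]_q) (x : X) : C := \sum_i \sum_j A i j * et j x * cj (et i x).

Definition kmat (f : X -> R^o) (V : X -> X) (A : 'M[C]_q) : Prop :=
  forall i x, (ii * vc V (sv i) x + cc f V x) * et i x = \sum_j A i j * et j x.

Let om0 i : Num.sqrt (W i) != 0. Proof. by rewrite gt_eqF ?sqrtr_gt0. Qed.

Lemma et_conj i x : et i x * cj (et i x) = (W i * expR (inner (sv i) (lsubmx x)))%:C.
Proof.
have e1 := es_conj (sv i) x; rewrite /et conjcM.
have -> : cj (Num.sqrt (W i))%:C = (Num.sqrt (W i))%:C :> C by apply: cP => //=; rewrite oppr0.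
rewrite mulrACA [es _ _ * _]mulrC e1.
have -> : (Num.sqrt (W i))%:C * (Num.sqrt (W i))%:C = (W i)%:C :> C.
  by apply: cP => /=; rewrite -?expr2 ?sqr_sqrtr ?ltW//; ring.
by apply: cP => /=; ring.
Qed.

Lemma realM (a b : R) : a%:C * b%:C = (a * b)%:C :> C.
Proof. by apply: cP => /=; ring. Qed.

Lemma realD (a b : R) : a%:C + b%:C = (a + b)%:C :> C.
Proof. by apply: cP => /=; ring. Qed.

Lemma real_sum (I : finType) (F : I -> R) : \sum_i (F i)%:C = (\sum_i F i)%:C :> C.
Proof. by elim/big_rec2: _ => // i y z _ ->; rewrite realD. Qed.

(** The law [prf] has mean [eta], so averaging [i <s_i, V> + cc] over it cancels the term in [eta]
    of [cc] and leaves [f]. *)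
Lemma kahler_sum f V x :
  \sum_i ((ii * vc V (sv i) x + cc f V x) * et i x) * cj (et i x) =
  (f x * Zf (lsubmx x))%:C.
Proof.
have -> : \sum_i ((ii * vc V (sv i) x + cc f V x) * et i x) * cj (et i x) =
  (Zf (lsubmx x))%:C * \sum_i (prf i (lsubmx x))%:C * (ii * vc V (sv i) x + cc f V x).
  rewrite mulr_sumr; apply: eq_bigr => i _; rewrite -mulrA et_conj mulrA realM.
  by rewrite /prf mulrCA divff ?gt_eqF ?Zf_gt0// mulr1 mulrC.
have -> : \sum_i (prf i (lsubmx x))%:C * (ii * vc V (sv i) x + cc f V x) = (f x)%:C.
  have -> : (f x)%:C = ii * vc V (eta (lsubmx x)) x + cc f V x.
    by rewrite /cc addrC subrK.
  under eq_bigr do rewrite mulrDr.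
  rewrite big_split /= -mulr_suml real_sum prf_sum mul1r; congr (_ + _).
  by rewrite vc_sum mulr_sumr; apply: eq_bigr => i _; rewrite mulrCA.
by rewrite realM mulrC.
Qed.

(** The function [f Z] is real, so its expression by holomorphic [b i] against conjugated
    exponentials equals the conjugate expression; [exp_coef] then makes each [b i] a constant
    combination of exponentials. *)
Lemma kmat_exists f V : kfield f V -> exists A, kmat f V A.
Proof.
move=> kf.
pose b i x : C := (Num.sqrt (W i))%:C * ((ii * vc V (sv i) x + cc f V x) * et i x).
have het i : hol (et i) by apply: holM; [exact: hol_cst | exact: hol_es].
have hb i : hol (b i).
  apply: holM; first exact: hol_cst.
  apply: holM => //; apply: holD; last exact: cc_hol.
  by apply: holM; [exact: hol_cst | exact: (vc_hol _ kf)].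
pose c r x : C := cj (b r x).
have hc r : antihol (c r).
  by apply/antihol_conj; apply: hol_ext (hb r) => x; rewrite /c conjcKc.
have cjr (a : R) : cj a%:C = a%:C :> C by apply: cP => //=; rewrite oppr0.
have E x : \sum_(i <- index_enum 'I_q) b i x * cj (es (sv i) x) =
    \sum_r c r x * es (sv r) x.
  have L : \sum_(i <- index_enum 'I_q) b i x * cj (es (sv i) x) = (f x * Zf (lsubmx x))%:C.
    rewrite -(kahler_sum f V x); apply: eq_bigr => i _; rewrite /b.
    have -> : cj (et i x) = (Num.sqrt (W i))%:C * cj (es (sv i) x) by rewrite /et conjcM cjr.
    by rewrite [RHS]mulrA; congr (_ * _); exact: mulrC.
  rewrite L -cjr -L conjc_sum; apply: eq_bigr => i _.
  by rewrite conjcM conjcKc.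
have H i := exp_coef svI (index_enum_uniq _) hb hc E (mem_index_enum i).
have /choice[a Ha] := H.
exists (\matrix_(i, j) ((Num.sqrt (W i))%:C^-1 * a i j * (Num.sqrt (W j))%:C^-1)) => i x.
have omc k : (Num.sqrt (W k))%:C != 0 :> C.
  by apply/eqP => /(congr1 (@cRe R)) /= /eqP; rewrite (negbTE (om0 k)).
apply: (mulfI (omc i)); rewrite -/(b i x) Ha mulr_sumr; apply: eq_bigr => j _.
by rewrite mxE /et !mulrA mulfV// mul1r mulrVK// unitfE.
Qed.

Lemma kmat_qf f V A x : kmat f V A -> qf A x = (f x * Zf (lsubmx x))%:C.
Proof.
move=> kA; rewrite -(kahler_sum f V x); apply: eq_bigr => i _.
by rewrite kA mulr_suml.
Qed.

(** Independence is applied twice: to the conjugated exponentials with holomorphic coefficients,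
    then to the exponentials with constant coefficients. *)
Lemma qf_inj A B : (forall x, qf A x = qf B x) -> A = B.
Proof.
move=> AB; apply/matrixP => i j.
have omc k : (Num.sqrt (W k))%:C != 0 :> C.
  by apply/eqP => /(congr1 (@cRe R)) /= /eqP; rewrite (negbTE (om0 k)).
have cjr (a : R) : cj a%:C = a%:C :> C by apply: cP => //=; rewrite oppr0.
pose D k l : C := (A k l - B k l) * (Num.sqrt (W l))%:C.
pose u k x : C := (Num.sqrt (W k))%:C * \sum_l D k l * es (sv l) x.
have hu k : hol (u k).
  apply: holM; first exact: hol_cst.
  by apply: hol_sum => l; apply: holM; [exact: hol_cst | exact: hol_es].
have E x : \sum_(k <- index_enum 'I_q) u k x * cj (es (sv k) x) = 0.
  transitivity (qf A x - qf B x); last by rewrite AB subrr.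
  rewrite /qf -sumrB; apply: eq_bigr => k _; rewrite -sumrB.
  rewrite /u mulr_sumr mulr_suml; apply: eq_bigr => l _.
  rewrite -!mulrBl /D /et conjcM cjr -!mulrA mulrCA; congr (_ * _).
  by rewrite mulrCA; congr (_ * _); rewrite mulrCA.
have u0 k x : u k x = 0 := exp_indep svI (index_enum_uniq _) hu E x (mem_index_enum k).
have : D i j = 0.
  apply: (exp_indep_conj svI (u := fun l _ => D i l) _ _ j 0); first by move=> l; exact: antihol_cst.
  by move=> x; have /eqP := u0 i x; rewrite mulf_eq0 (negbTE (omc i)) => /eqP.
by move=> /eqP; rewrite mulf_eq0 (negbTE (omc j)) orbF subr_eq0 => /eqP.
Qed.

Definition herm (A : 'M[C]_q) : Prop := forall i j, cj (A i j) = A j i.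

Lemma kmat_herm f V A : kmat f V A -> herm A.
Proof.
move=> kA; suff E : A = \matrix_(i, j) cj (A j i) by move=> i j; rewrite [in RHS]E mxE.
apply: qf_inj => x; rewrite (kmat_qf x kA).
have -> : (f x * Zf (lsubmx x))%:C = cj (f x * Zf (lsubmx x))%:C :> C.
  by apply: cP => //=; rewrite oppr0.
rewrite -(kmat_qf x kA) /qf conjc_sum exchange_big; apply: eq_bigr => i _.
rewrite conjc_sum; apply: eq_bigr => j _.
by rewrite (conjcM (A i j * et j x)) (conjcM (A i j)) conjcKc [X in _ = X * _ * _]mxE; exact: mulrAC.
Qed.


Lemma cd_et V i x : cd (V x) (et i) x = (1 / 2)%:C * vc V (sv i) x * et i x.
Proof.
apply: (etrans (cdZ (V x) _ x (csm_es (sv i)))); rewrite cd_es /et.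
have -> : la (sv i) (V x) +i* lb (sv i) (V x) = (1 / 2)%:C * vc V (sv i) x.
  by rewrite /vc /la /lb; apply: cP => /=; field.
by rewrite mulrCA mulrA.
Qed.

Lemma cd_qf (w : X) A x : cd w (qf A) x =
  \sum_i \sum_j A i j * (cd w (et j) x * cj (et i x) + et j x * cj (cd w (et i) x)).
Proof.
have se i : csm (et i) by apply: csmM; [exact: csm_cst | exact: csm_es].
have sc i : csm (fun x => cj (et i x)) by exact: csm_conj.
have s1 i j : csm (fun x => A i j * et j x) by apply: csmM; [exact: csm_cst | exact: se].
have s2 i j : csm (fun x => A i j * et j x * cj (et i x)) by exact: csmM (s1 i j) (sc i).
apply: (etrans (cd_sum w _ x (fun i => csm_sum _ (s2 i)))); apply: eq_bigr => i _.
apply: (etrans (cd_sum w _ x (s2 i))); apply: eq_bigr => j _.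
apply: (etrans (cdM w x (s1 i j) (sc i))).
have e1 := cdZ w (A i j) x (se j); have e2 := cd_conj w x (se i).
have ar (T : comNzRingType) (a b c d e P Q : T) : P = a * b -> Q = d ->
  P * c + a * e * Q = a * (b * c + e * d) by move=> -> ->; ring.
exact: (ar _ _ _ _ _ _ _ _ e1 e2).
Qed.

Lemma qfD A B x : qf (A + B) x = qf A x + qf B x.
Proof.
rewrite /qf -big_split; apply: eq_bigr => i _; rewrite -big_split; apply: eq_bigr => j _.
by rewrite mxE !mulrDl.
Qed.

Lemma qfZ a A x : qf (a *: A) x = a * qf A x.
Proof.
rewrite /qf mulr_sumr; apply: eq_bigr => i _; rewrite mulr_sumr; apply: eq_bigr => j _.
by rewrite mxE !mulrA.
Qed.

Lemma qfM (A B : 'M[C]_q) x : qf (A *m B) x = \sum_i \sum_j A i j * (\sum_k B j k * et k x) * cj (et i x).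
Proof.
apply: eq_bigr => i _.
under eq_bigr do rewrite mxE !mulr_suml.
rewrite exchange_big; apply: eq_bigr => j _.
rewrite mulr_sumr mulr_suml; apply: eq_bigr => k _.
by rewrite !mulrA.
Qed.

Lemma qfM_herm (A B : 'M[C]_q) x : herm A ->
  qf (A *m B) x = \sum_i \sum_j B i j * et j x * cj (\sum_k A i k * et k x).
Proof.
move=> hA; rewrite /qf.
under eq_bigr => i _ do under eq_bigr => j _ do rewrite mxE !mulr_suml.
under eq_bigr => i _ do rewrite exchange_big.
rewrite exchange_big; apply: eq_bigr => i _.
rewrite exchange_big; apply: eq_bigr => j _.
rewrite conjc_sum mulr_sumr; apply: eq_bigr => k _.
rewrite (conjcM (A i k)) hA.
have ar (T : comNzRingType) (a b c d : T) : a * b * c * d = b * c * (a * d) by ring.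
exact: ar.
Qed.

Lemma qf1 x : qf 1%:M x = (Zf (lsubmx x))%:C.
Proof.
rewrite /qf -real_sum; apply: eq_bigr => i _.
rewrite (bigD1 i)//= mxE eqxx mul1r et_conj big1 ?addr0// => j ji.
by rewrite mxE eq_sym (negbTE ji) !mul0r.
Qed.

(* The Hamiltonian flow of [k] acts on the vector of exponentials by a multiple
   of [A] plus a scalar, whence the commutator. *)
Lemma kmat_bracket k V A g x B : kmat k V A -> smooth_on setT (g : X -> R^o) ->
  (forall y, qf B y = (g y * Zf (lsubmx y))%:C) ->
  (('d (g : X -> R^o) x (V x)) * Zf (lsubmx x))%:C =
  (0 +i* (1 / 2)) * qf (A *m B - B *m A) x.
Proof.
move=> kA sg gB; have hA := kmat_herm kA.
set c := cc k V x; set h := (1 / 2)%:C : C.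
have det i : cd (V x) (et i) x = - ii * h * (\sum_j A i j * et j x - c * et i x).
  rewrite cd_et -kA mulrDl addrK.
  have ar (T : comNzRingType) (i' a b d : T) : i' * i' = -1 ->
    b * a * d = - i' * b * (i' * a * d).
    move=> e; have -> : - i' * b * (i' * a * d) = - (i' * i') * (b * a * d) by ring.
    by rewrite e opprK mul1r.
  exact: ar (iiM (R := R)).
have key D : cd (V x) (qf D) x = ii * h * qf (A *m D - D *m A) x + ii * h * (c - cj c) * qf D x.
  have cjh : cj (- ii * h) = ii * h by rewrite /h; apply: cP => /=; ring.
  have -> : qf (A *m D - D *m A) x =
    \sum_i \sum_j D i j * et j x * cj (\sum_k A i k * et k x) -
    \sum_i \sum_j D i j * (\sum_k A j k * et k x) * cj (et i x).
    by rewrite qfD -scaleN1r qfZ (qfM D A) (qfM_herm D x hA) mulN1r.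
  rewrite cd_qf /qf mulrBr !mulr_sumr -sumrB -big_split; apply: eq_bigr => i _.
  rewrite !mulr_sumr -sumrB -big_split; apply: eq_bigr => j _.
  rewrite !det (conjcM (- ii * h)) cjh.
  set Sj := \sum_j0 A j j0 * _; set Si := \sum_j0 A i j0 * _.
  have -> : cj (Si - c * et i x) = cj Si - cj c * cj (et i x).
    by rewrite -(conjcM c) conjcD; congr (_ + _); case: (c * et i x) => a b; apply: cP.
  have ar (T : comNzRingType) (i' b' d sj si' c' cc' e cei : T) :
    d * (- i' * b' * (sj - c' * e) * cei + e * (i' * b' * (si' - cc' * cei))) =
    i' * b' * (d * e * si') - i' * b' * (d * sj * cei)
    + i' * b' * (c' - cc') * (d * e * cei) by ring.
  exact: ar.
have se i : csm (et i) by apply: csmM; [exact: csm_cst | exact: csm_es].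
have sZ : csm (fun y : X => (Zf (lsubmx y))%:C : C) by exact: (csm_real Zf_smooth.1).
have e1 : cd (V x) (qf B) x = ('d (g : X -> R^o) x (V x))%:C * (Zf (lsubmx x))%:C +
    (g x)%:C * cd (V x) (fun y : X => (Zf (lsubmx y))%:C : C) x.
  have -> : qf B = fun y => (g y)%:C * (Zf (lsubmx y))%:C.
    by apply/funext => y; rewrite gB realM.
  by apply: (etrans (cdM (V x) x (csm_real sg) sZ)); rewrite cd_real.
have e2 : cd (V x) (fun y : X => (Zf (lsubmx y))%:C : C) x = ii * h * (c - cj c) * (Zf (lsubmx x))%:C.
  have -> : (fun y : X => (Zf (lsubmx y))%:C : C) = qf 1%:M by apply/funext => y; rewrite qf1.
  rewrite key mulmx1 mul1mx subrr qf1.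
  have -> : qf 0 x = 0 by have := qfZ 0 0 x; rewrite scaler0 mul0r.
  by rewrite mulr0 add0r.
have := key B; rewrite e1 e2 gB -!realM => E.
have ar (T : comNzRingType) (i' d z g' q' c' : T) :
  d * z + g' * (i' * c' * z) = i' * q' + i' * c' * (g' * z) -> d * z = i' * q'.
  move=> e; have -> : d * z = d * z + g' * (i' * c' * z) - i' * c' * (g' * z) by ring.
  by rewrite e addrK.
have -> : 0 +i* (1 / 2) = ii * h by rewrite /h; apply: cP => /=; ring.
exact: ar E.
Qed.

(** For diagonal [A] each [i <s_i, V> + cc] is a constant, hence equal to its value at 0; averaging
    these values over [prf] leaves an affine function of [eta]. *)
Lemma kmat_diag f V A : kmat f V A -> (forall i j, i != j -> A i j = 0) ->
  forall x, f x = cRe (cc f V 0) - inner (eta (lsubmx x)) (rsubmx (V 0)).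
Proof.
move=> kA dA.
have etz i x : et i x != 0.
  rewrite mulf_neq0 ?es_neq0//.
  by apply/eqP => /(congr1 (@cRe R)) /= /eqP; rewrite (negbTE (om0 i)).
have AE i x : ii * vc V (sv i) x + cc f V x = A i i.
  apply: (mulIf (etz i x)); rewrite kA (bigD1 i)//= big1 ?addr0// => j ji.
  by rewrite dA ?mul0r// eq_sym.
move=> x; have := kahler_sum f V x.
have -> : \sum_i (ii * vc V (sv i) x + cc f V x) * et i x * cj (et i x) =
  \sum_i A i i * (W i * expR (inner (sv i) (lsubmx x)))%:C.
  by apply: eq_bigr => i _; rewrite AE -mulrA et_conj.
move=> /(congr1 (@cRe R)); rewrite Re_sum /=.
have -> : \sum_i cRe (A i i * (W i * expR (inner (sv i) (lsubmx x)))%:C) =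
  Zf (lsubmx x) * (cRe (cc f V 0) - inner (eta (lsubmx x)) (rsubmx (V 0))).
  rewrite inner_eta mulrBr [Zf _ * cRe _]mulrC {1}/Zf !mulr_sumr -sumrB.
  apply: eq_bigr => i _; rewrite ReM /= -(AE i 0) ReD ReM /= /prf.
  have := Zf_gt0 (lsubmx x); set z := Zf _ => z0.
  by field; rewrite gt_eqF.
move=> e; have z0 := Zf_gt0 (lsubmx x); apply: (mulIf (lt0r_neq0 z0)).
by rewrite -e mulrC.
Qed.

End TEKahler.

(** * The Lie algebra of Hermitian matrices in real coordinates *)

Section HermCoords.
Context {R : realType} {q : nat}.
Local Notation C := R[i].
Local Notation L := 'rV[R]_(q * q).
Local Notation hi := (0 +i* (1 / 2) : C).

(* A real matrix encodes the Hermitian matrix whose real and imaginary parts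
   are its symmetric and antisymmetric parts. *)
Definition cmx (x : L) : 'M[C]_q := \matrix_(i, j)
  (((vec_mx x i j + vec_mx x j i) / 2) +i* ((vec_mx x i j - vec_mx x j i) / 2)).
Definition enc (B : 'M[C]_q) : L := mxvec (\matrix_(i, j) (cRe (B i j) + cIm (B i j))).

Lemma cmx_herm x : herm (cmx x).
Proof. by move=> i j; rewrite !mxE; apply: cP => /=; field. Qed.

Lemma cmxK x : enc (cmx x) = x.
Proof.
rewrite /enc -[RHS]vec_mxK; congr mxvec; apply/matrixP => i j.
by rewrite !mxE /=; field.
Qed.

Lemma cmx_inj : injective cmx. Proof. exact: can_inj cmxK. Qed.

Lemma encK B : herm B -> cmx (enc B) = B.
Proof.
move=> hB; apply/matrixP => i j; rewrite /cmx /enc mxvecK !mxE -(hB i j).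
by case: (B i j) => a b; apply: cP => /=; field.
Qed.

Lemma cmxP a x y : cmx (a *: x + y) = a%:C *: cmx x + cmx y.
Proof.
by apply/matrixP => i j; rewrite !mxE; apply: cP => /=; field.
Qed.

Lemma inner_mxvec (A B : 'M[R]_q) : inner (mxvec A) (mxvec B) = \sum_i \sum_j A i j * B i j.
Proof.
rewrite /inner (reindex _ (curry_mxvec_bij _ _)) /= pair_bigA /=.
by apply: eq_bigr => -[i j] _ /=; rewrite !mxvecE.
Qed.

Lemma inner_tr x y : inner x y = cRe (\tr (cmx x *m cmx y)).
Proof.
rewrite -{1}(vec_mxK x) -{1}(vec_mxK y) inner_mxvec /mxtrace Re_sum.
have E : \sum_i cRe ((cmx x *m cmx y) i i) = \sum_i \sum_j
    (((vec_mx x i j + vec_mx x j i) / 2) * ((vec_mx y j i + vec_mx y i j) / 2)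
     - ((vec_mx x i j - vec_mx x j i) / 2) * ((vec_mx y j i - vec_mx y i j) / 2)).
  by apply: eq_bigr => i _; rewrite mxE Re_sum; apply: eq_bigr => j _; rewrite ReM !mxE.
rewrite E; set A := vec_mx x; set B := vec_mx y.
have -> : \sum_i \sum_j A i j * B i j =
  (\sum_i \sum_j A i j * B i j + \sum_i \sum_j A j i * B j i) / 2.
  rewrite [X in _ + X]exchange_big /=; set S := \sum_i _.
  by field.
rewrite -big_split mulr_suml; apply: eq_bigr => i _ /=.
rewrite -big_split mulr_suml; apply: eq_bigr => j _ /=.
by field.
Qed.

(** The factor [i / 2] keeps the commutator of Hermitian matrices Hermitian and is the one that
    appears in [kmat_bracket], so [hbr] is the Poisson bracket. *)
Definition hbr (x y : L) : L := enc (hi *: (cmx x *m cmx y - cmx y *m cmx x)).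

Lemma hermM (A B : 'M[C]_q) : herm A -> herm B -> herm (hi *: (A *m B - B *m A)).
Proof.
move=> hA hB i j; rewrite !mxE.
have cs (F : 'I_q -> C) : cj (\sum_k F k) = \sum_k cj (F k) by rewrite conjc_sum.
have cM (P Q : 'M[C]_q) k l : herm P -> herm Q ->
  cj (\sum_m P k m * Q m l) = \sum_m Q l m * P m k.
  by move=> hP hQ; rewrite cs; apply: eq_bigr => m _; rewrite conjcM hP hQ mulrC.
have cB (z w : C) : cj (hi * (z - w)) = hi * (cj w - cj z).
  by case: z w => a b [c d]; apply: cP => /=; ring.
by rewrite cB !cM.
Qed.

Lemma cmx_hbr x y : cmx (hbr x y) = hi *: (cmx x *m cmx y - cmx y *m cmx x).
Proof. by apply: encK; apply: hermM; exact: cmx_herm. Qed.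

Lemma commP (T : comNzRingType) (a h : T) (X Y Z : 'M[T]_q) :
  h *: ((a *: X + Y) *m Z - Z *m (a *: X + Y)) =
  a *: (h *: (X *m Z - Z *m X)) + h *: (Y *m Z - Z *m Y).
Proof.
rewrite mulmxDl mulmxDr -scalemxAl -scalemxAr opprD addrACA -scalerBr scalerDr !scalerA.
by rewrite [h * _]mulrC.
Qed.

Lemma commJ (T : comNzRingType) (h : T) (X Y Z : 'M[T]_q) :
  h *: (X *m (h *: (Y *m Z - Z *m Y)) - (h *: (Y *m Z - Z *m Y)) *m X) =
  1 *: (h *: ((h *: (X *m Y - Y *m X)) *m Z - Z *m (h *: (X *m Y - Y *m X)))) +
  h *: (Y *m (h *: (X *m Z - Z *m X)) - (h *: (X *m Z - Z *m X)) *m Y).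
Proof.
rewrite scale1r -!scalemxAl -!scalemxAr -!scalerBr -!scalerDr; congr (_ *: (_ *: _)).
rewrite !mulmxBl !mulmxBr !mulmxA.
move: (X *m Y *m Z) (X *m Z *m Y) (Y *m Z *m X) (Z *m Y *m X) (Y *m X *m Z)
  (Z *m X *m Y) => a b c d e f.
by apply/matrixP => i j; rewrite !mxE; ring.
Qed.

Lemma commT (T : comNzRingType) (h : T) (X Y Z : 'M[T]_q) :
  \tr ((h *: (X *m Y - Y *m X)) *m Z) = \tr (X *m (h *: (Y *m Z - Z *m Y))).
Proof.
rewrite -scalemxAl -scalemxAr !mxtraceZ; congr (_ * _); rewrite mulmxBl mulmxBr !raddfB /=.
congr (_ - _); first by rewrite mulmxA.
by rewrite -[in LHS]mulmxA mxtrace_mulC mulmxA.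
Qed.

Lemma hbrP a x y z : hbr (a *: x + y) z = a *: hbr x z + hbr y z.
Proof.
apply: cmx_inj; apply: (etrans (cmx_hbr _ _)); apply: (etrans _ (esym (cmxP a _ _))).
have e1 := cmxP a x y; have e2 := cmx_hbr x z; have e3 := cmx_hbr y z.
have ar (u v w : 'M[C]_q) : u = a%:C *: cmx x + cmx y ->
  v = hi *: (cmx x *m cmx z - cmx z *m cmx x) ->
  w = hi *: (cmx y *m cmx z - cmx z *m cmx y) ->
  hi *: (u *m cmx z - cmx z *m u) = a%:C *: v + w.
  by move=> -> -> ->; exact: commP.
exact: ar e1 e2 e3.
Qed.

Lemma hbrN x y : hbr x y = - hbr y x.
Proof.
have c0 : cmx 0 = 0.
  by apply/matrixP => i j; rewrite !mxE; apply: cP => /=; field.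
have cN z : cmx (- z) = - cmx z.
  by apply/matrixP => i j; rewrite !mxE; apply: cP => /=; field.
apply: cmx_inj; apply: (etrans (cmx_hbr _ _)); apply: (etrans _ (esym (cN _))).
apply: (etrans _ (congr1 -%R (esym (cmx_hbr _ _)))).
by rewrite -scalerN opprB.
Qed.

Lemma hbrJ x y z : hbr x (hbr y z) = hbr (hbr x y) z + hbr y (hbr x z).
Proof.
have ar (u v w U V W' : 'M[C]_q) :
  u = hi *: (cmx y *m cmx z - cmx z *m cmx y) -> U = hi *: (cmx x *m u - u *m cmx x) ->
  v = hi *: (cmx x *m cmx y - cmx y *m cmx x) -> V = hi *: (v *m cmx z - cmx z *m v) ->
  w = hi *: (cmx x *m cmx z - cmx z *m cmx x) -> W' = hi *: (cmx y *m w - w *m cmx y) ->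
  U = 1%:C *: V + W'.
  by move=> -> -> -> -> -> ->; exact: commJ.
apply: cmx_inj; apply: (etrans (ar _ _ _ _ _ _ (cmx_hbr y z) (cmx_hbr x (hbr y z))
  (cmx_hbr x y) (cmx_hbr (hbr x y) z) (cmx_hbr x z) (cmx_hbr y (hbr x z)))).
by rewrite -cmxP; congr cmx; rewrite scale1r.
Qed.

Lemma hbrI x y z : inner (hbr x y) z = inner x (hbr y z).
Proof.
have ar (u v : 'M[C]_q) : u = hi *: (cmx x *m cmx y - cmx y *m cmx x) ->
  v = hi *: (cmx y *m cmx z - cmx z *m cmx y) -> \tr (u *m cmx z) = \tr (cmx x *m v).
  by move=> -> ->; exact: commT.
apply: (etrans (inner_tr _ _)); apply: (etrans _ (esym (inner_tr _ _))).
exact: (congr1 (@cRe R) (ar _ _ (cmx_hbr x y) (cmx_hbr y z))).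
Qed.

End HermCoords.

Local Close Scope complex_scope.

(** * Torifications *)

Section ExpFamValues.
Context {R : realType} {m n : nat} (E : expfam R m n).

(** Sample points with equal estimator value are merged, with the sum of their weights, because
    independence of the exponentials requires distinct exponents and the estimator may fail to be
    injective. *)
Definition efvals : seq 'rV[R]_n := undup [seq estimator E x | x <- enum 'I_m].
Definition efq := size efvals.
Definition efsv (i : 'I_efq) : 'rV[R]_n := nth 0 efvals i.
Definition efW (i : 'I_efq) : R := \sum_(x | estimator E x == efsv i) expR (ef_C E x).

Lemma ef_svI : injective efsv.
Proof.
move=> i j /eqP; rewrite /efsv nth_uniq ?undup_uniq// => /eqP ij.
exact: val_inj.
Qed.

Lemma efvals_mem x : estimator E x \in efvals.
Proof. by rewrite mem_undup; apply: map_f; rewrite mem_enum. Qed.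

Lemma efidx_lt x : (index (estimator E x) efvals < efq)%N.
Proof. by rewrite index_mem efvals_mem. Qed.

Definition efidx (x : 'I_m) : 'I_efq := Ordinal (efidx_lt x).

Lemma efsv_idx x : efsv (efidx x) = estimator E x.
Proof. by rewrite /efsv nth_index// efvals_mem. Qed.

Lemma efidx_eq x i : (efidx x == i) = (estimator E x == efsv i).
Proof. by rewrite -efsv_idx (inj_eq ef_svI). Qed.

Lemma efsv_ex i : exists x, estimator E x = efsv i.
Proof.
have : efsv i \in efvals by apply: mem_nth.
by rewrite mem_undup => /mapP[x _ ->]; exists x.
Qed.

Lemma ef_W0 i : 0 < efW i.
Proof.
have [x xi] := efsv_ex i; rewrite /efW (bigD1 x) ?xi//=.
by apply: ltr_pwDl; [exact: expR_gt0 | apply: sumr_ge0 => y _; rewrite ltW ?expR_gt0].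
Qed.

Lemma efq_gt0 : (0 < efq)%N.
Proof.
have [m0|] := posnP m.
  have := ef_sum1 E 0; rewrite big1 => [/eqP|x _]; first by rewrite eq_sym oner_eq0.
  by have := ltn_ord x; rewrite {2}m0.
by move=> m0; exact: leq_ltn_trans (leq0n _) (efidx_lt (Ordinal m0)).
Qed.

Definition ef_q0 : 'I_efq := Ordinal efq_gt0.

Lemma ef_group (f : 'rV[R]_n -> R) :
  \sum_x expR (ef_C E x) * f (estimator E x) = \sum_i efW i * f (efsv i).
Proof.
rewrite (partition_big efidx xpredT)//=; apply: eq_bigr => i _.
rewrite /efW mulr_suml; apply: eq_big => [x|x]; first by rewrite efidx_eq.
by rewrite efidx_eq => /eqP ->.
Qed.

Lemma inner_est x th : inner (estimator E x) th = \sum_k th 0 k * ef_F E k x.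
Proof. by apply: eq_bigr => k _; rewrite mxE mulrC. Qed.

Local Notation Z := (Zf efsv efW).

Lemma ef_psiE th : expR (ef_psi E th) = Z th.
Proof.
rewrite /Zf -(ef_group (fun s => expR (inner s th))).
have := ef_sum1 E th; rewrite /exp_density => e.
rewrite -[LHS]mulr1 -e mulr_sumr; apply: eq_bigr => x _.
by rewrite inner_est -!expRD; congr expR; ring.
Qed.

Lemma dens_E th x : dens E th x =
  expR (ef_C E x) * expR (inner (estimator E x) th) / Z th.
Proof.
by rewrite -ef_psiE -expRN -!expRD inner_est.
Qed.

Lemma expect_est th (f : 'rV[R]_n -> R) :
  expect (dens E th) (fun x => f (estimator E x)) = \sum_i prf efsv efW i th * f (efsv i).
Proof.
have -> : \sum_i prf efsv efW i th * f (efsv i) =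
  \sum_i efW i * (expR (inner (efsv i) th) / Z th * f (efsv i)).
  by apply: eq_bigr => i _; rewrite /prf !mulrA.
rewrite -(ef_group (fun s => expR (inner s th) / Z th * f s)).
by apply: eq_bigr => x _; rewrite dens_E; ring.
Qed.

Lemma expect_affine th a0 (a : 'I_n -> R) :
  expect (dens E th) (fun x => a0 + \sum_k a k * ef_F E k x) =
  a0 + inner (eta efsv efW th) (\row_k a k).
Proof.
have -> : (fun x => a0 + \sum_k a k * ef_F E k x) =
    (fun x => a0 + inner (estimator E x) (\row_k a k)).
  by apply/funext => x; rewrite inner_est; congr (_ + _); apply: eq_bigr => k _; rewrite mxE.
rewrite (expect_est th (fun s => a0 + inner s (\row_k a k))) inner_eta.
under eq_bigr do rewrite mulrDr.
by rewrite big_split /= -mulr_suml (prf_sum efsv ef_W0 ef_q0) mul1r.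
Qed.

Lemma scoreE th k x : score E th k x = ef_F E k x - eta efsv efW th 0 k.
Proof.
pose l : 'rV[R]_n -> 'rV[R]_(n + n) := fun y => row_mx y 0.
have ll : linear (fun y : 'rV[R]_n => inner (estimator E x) y : R^o).
  by move=> a p r; rewrite innerC innerP ![inner _ (estimator _ _)]innerC.
have [sl dl] := lin_smooth ll.
have lp : linear l.
  move=> a p r; rewrite /l -[0 in LHS]addr0 -{1}(scaler0 _ a).
  by rewrite -add_row_mx -scale_row_mx.
have lc : continuous (mklin lp) by exact: lin_continuous.
have dl' : differentiable l th := (Ck_on_linear 1 (openT : open [set: 'rV[R]_n]) lc).1 th I.
have dlE w : 'd l th w = l w by have := diff_lin th lc => /(congr1 (fun h => h w)).
have [sZ dZ] := Zf_smooth efsv ef_W0 ef_q0.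
have Zp := Zf_gt0 efsv ef_W0 ef_q0.
pose w : 'rV[R]_n := delta_mx 0 k.
have dpsi : differentiable (fun y => ln (Z (lsubmx (l y))) : R^o) th /\
    'd (fun y => ln (Z (lsubmx (l y))) : R^o) th w = inner (eta efsv efW th) w.
  have dZl := differentiable_comp dl' (smooth_on_diff sZ (I : setT (l th))).
  have dln : is_derive (Z (lsubmx (l th)) : R) 1 (@ln R) (Z (lsubmx (l th)))^-1.
    exact: is_derive1_ln (Zp _).
  have e1 := d_comp1 (l := fun y => Z (lsubmx (l y))) w dln dZl.
  split; first exact: differentiable_comp dZl (derive_diff dln).1.
  apply: (etrans e1).
  have e2 := dcompE w dl' (smooth_on_diff sZ (I : setT (l th))).
  have e3 := dZ (l th) ('d l th w).
  have ar (a b c z : R) : z != 0 -> a = b -> b = c * z -> a * z^-1 = c.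
    by move=> z0 -> ->; rewrite mulfK.
  apply: (etrans (ar _ _ _ _ (lt0r_neq0 (Zp _)) e2 e3)).
  by rewrite dlE /l !row_mxKl.
have [dp dpE] := dpsi.
have FE : (fun y => ln (dens E y x) : R^o) =
    (fun y => (ef_C E x + inner (estimator E x) y) + (-1) * ln (Z (lsubmx (l y)))).
  apply/funext => y; rewrite dens_E /l row_mxKl lnM ?posrE ?divr_gt0 ?mulr_gt0 ?expR_gt0 ?invr_gt0//.
  by rewrite lnM ?posrE ?expR_gt0// !expRK lnV ?posrE// mulN1r.
have dc a : differentiable (fun _ : 'rV[R]_n => a : R^o) th by exact: differentiable_cst.
have d1 := differentiableD (dc (ef_C E x)) (smooth_on_diff sl (I : setT th)).
have d2 := differentiableM (dc (-1)) dp.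
rewrite /score FE; apply: (etrans (deriveE _ (differentiableD d1 d2))).
apply: (etrans (dD w d1 d2)).
have c0 a : 'd (fun _ : 'rV[R]_n => a : R^o) th w = 0 by rewrite (diff_cst (a : R^o) th).
have e1 := etrans (dD w (dc (ef_C E x)) (smooth_on_diff sl (I : setT th)))
  (congr1 (fun z => z + _) (c0 _)).
have e2 := dM w (dc (-1)) dp.
have ar (a b c d e z f g : R) : a = 0 + b -> b = f -> c = -1 * d + e * z -> z = 0 -> d = g ->
  a + c = f - g by move=> -> -> -> -> ->; ring.
apply: (etrans (ar _ _ _ _ _ _ _ _ e1 (dl th w) e2 (c0 _) dpE)).
by rewrite !inner_delta mxE.
Qed.

Lemma cov_center th u v : cov efsv efW th u v =
  \sum_i prf efsv efW i th *
    (inner (efsv i - eta efsv efW th) u * inner (efsv i - eta efsv efW th) v).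
Proof.
set et := eta efsv efW th; rewrite /cov -/et.
have e1 := prf_sum efsv ef_W0 ef_q0 th.
have e2 w : \sum_i prf efsv efW i th * inner (efsv i) w = inner et w by rewrite inner_eta.
apply: esym; transitivity (\sum_i (prf efsv efW i th * (inner (efsv i) u * inner (efsv i) v)
  - inner et v * (prf efsv efW i th * inner (efsv i) u)
  - inner et u * (prf efsv efW i th * inner (efsv i) v)
  + inner et u * inner et v * prf efsv efW i th)).
  by apply: eq_bigr => i _; rewrite !innerBl; ring.
rewrite big_split /= !sumrB -!mulr_sumr e1 !e2; ring.
Qed.

Lemma fisherE th u v : fisher E th u v = cov efsv efW th u v.
Proof.
set et := eta efsv efW th; have scE := scoreE th; rewrite /fisher.
move: (score E th) scE => sc scE.
have L (w : 'rV[R]_n) x : \sum_i w 0 i * sc i x = inner (estimator E x - et) w.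
  by apply: eq_bigr => i _; rewrite scE !mxE mulrC.
have -> : \sum_i \sum_j u 0 i * v 0 j * expect (dens E th) (fun x => sc i x * sc j x) =
    expect (dens E th) (fun x => inner (estimator E x - et) u * inner (estimator E x - et) v).
  rewrite /expect.
  under eq_bigr => i _ do under eq_bigr => j _ do rewrite mulr_sumr.
  under eq_bigr => i _ do rewrite exchange_big.
  rewrite exchange_big /=; apply: eq_bigr => x _.
  rewrite -!L mulr_suml mulr_suml; apply: eq_bigr => i _.
  rewrite mulr_sumr mulr_suml; apply: eq_bigr => j _; ring.
by rewrite (expect_est th (fun s => inner (s - et) u * inner (s - et) v)) cov_center.
Qed.

(** A direction of zero variance would make a nonzero combination of the [F_k] constant on the
    sample space, against [ef_indep]. *)
Lemma cov_pos th u : u != 0 -> 0 < cov efsv efW th u u.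
Proof.
move=> u0; set et := eta efsv efW th.
have -> : cov efsv efW th u u = \sum_i prf efsv efW i th * inner (efsv i - et) u ^+ 2 by exact: cov_center.
have P0 i := prf_gt0 efsv ef_W0 ef_q0 i th.
have t0 i : 0 <= prf efsv efW i th * inner (efsv i - et) u ^+ 2.
  by rewrite mulr_ge0 ?sqr_ge0// ltW.
rewrite lt_neqAle sumr_ge0 ?andbT// eq_sym; apply: contra_neq u0 => /eqP.
rewrite psumr_eq0// => /allP H.
have z i : inner (efsv i) u = inner et u.
  have := H i (mem_index_enum i); rewrite /= mulf_eq0 gt_eqF ?P0//= sqrf_eq0 innerBl subr_eq0.
  by move/eqP.
have [] := @ef_indep _ _ _ E (- inner et u) (fun k => u 0 k).
  by move=> x; rewrite -inner_est -efsv_idx z addNr.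
by move=> _ uk; apply/rowP => k; rewrite uk mxE.
Qed.

End ExpFamValues.

Arguments efvals {R m n} E.
Arguments efq {R m n} E.
Arguments efsv {R m n} E i.
Arguments efW {R m n} E i.

Local Open Scope quotient_scope.

(** * The quotient of [TE] by the lattice *)

Section Lattice.
Context {R : realType} {n : nat} (Y : 'I_n -> 'rV[R]_n -> 'rV[R]_n).
Hypothesis hY : parallel_frame Y.
Local Notation X := 'rV[R]_(n + n).

Definition Ymx : 'M[R]_n := \matrix_i Y i 0.

Lemma Ymx_unit : Ymx \in unitmx. Proof. by have [_] := hY; apply. Qed.

Lemma Y_const i th : Y i th = Y i 0.
Proof.
have [/(_ i)[sY dY] _] := hY.
rewrite -[th]add0r; apply: diff0_cst => t _; last exact: dY.
exact: (smooth_on_diff sY).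
Qed.

Lemma translateE t u : translate Y t u = u + row_mx 0 (t *m Ymx).
Proof.
have {2}-> : u = row_mx (lsubmx u) (rsubmx u) by rewrite hsubmxK.
rewrite /translate add_row_mx addr0; congr (row_mx _ (_ + _)).
rewrite mulmx_sum_row; apply: eq_bigr => i _; rewrite rowK; congr (_ *: _).
exact: Y_const.
Qed.

Lemma lsub_translate t u : lsubmx (translate Y t u) = lsubmx u.
Proof. by rewrite /translate row_mxKl. Qed.

Lemma qL_eq u u' : qL Y u = qL Y u' -> exists2 k, k \in intvec & u' = translate Y k u.
Proof. by move=> /eqmodP /asboolP. Qed.

Lemma int_lt1 (x : R) : x \is a Num.int -> `|x| < 1 -> x = 0.
Proof.
move=> /intrP[z ->]; rewrite -intr_norm -[1]/(1%:~R) ltr_int => z1.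
suff -> : z = 0 by [].
by apply/eqP; rewrite -normr_eq0 eq_le normr_ge0 andbT -ltzD1 add0r.
Qed.

Lemma intvec_small (k : 'rV[R]_n) : k \in intvec -> `|k| < 1 -> k = 0.
Proof.
move=> /forallP kZ k1; apply/rowP => i; rewrite mxE; apply: int_lt1; first exact: kZ.
by apply: le_lt_trans k1; exact: mx_norm_entry.
Qed.

Lemma lattice_discrete : exists2 r : R, 0 < r & forall u u', `|u - u'| < r ->
  qL Y u = qL Y u' -> u = u'.
Proof.
pose C := \sum_i `|mulmxr (invmx Ymx) (delta_mx 0 i : 'rV[R]_n)|.
have C0 : 0 <= C by apply: sumr_ge0.
have C1 : 0 < C + 1 by rewrite ltr_wpDl.
exists (C + 1)^-1; first by rewrite invr_gt0.
move=> u u' uu /qL_eq[k kZ u'E].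
suff k0 : k = 0 by rewrite u'E k0 translate0.
apply: intvec_small => //.
have -> : k = mulmxr (invmx Ymx) (rsubmx (u' - u)).
  by rewrite u'E translateE addrC addKr row_mxKr /= mulmxK// Ymx_unit.
apply: le_lt_trans (lin_bound (mulmxr (invmx Ymx)) _) _.
apply: (@le_lt_trans _ _ (`|u - u'| * (C + 1))).
  apply: ler_pM => //; last by rewrite lerDl.
  by rewrite distrC norm_rsubmx.
by rewrite -ltr_pdivlMr// div1r.
Qed.

Lemma qL_continuous : continuous (qL Y).
Proof. exact: pi_continuous. Qed.

Lemma qL_open (B : set X) : open B -> open (qL Y @` B).
Proof.
move=> oB.
have E : qL Y @^-1` (qL Y @` B) = \bigcup_(k in [set k | k \in intvec]) (translate Y k @^-1` B).
  apply/seteqP; split=> u /=.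
    by move=> [v Bv /esym /qL_eq[k kZ vE]]; exists k => //=; rewrite -vE.
  by move=> [k /= kZ Bk]; exists (translate Y k u) => //; exact: qL_translate.
suff : open (qL Y @^-1` (qL Y @` B)) by [].
rewrite E; apply: bigcup_open => k _.
have tc : continuous (translate Y k).
  have -> : translate Y k = fun u => u + row_mx 0 (k *m Ymx).
    by apply/funext => v; exact: translateE.
  by apply: (@lip_continuous _ _ _ _ 1) => // v w; rewrite mul1r opprD addrACA subrr addr0.
by move/continuousP: tc; apply.
Qed.

Lemma qL_surj x : qL Y (reprL x) = x.
Proof. exact: (@reprK _ (quotient_topology {eq_quot (lattice_equiv Y)})). Qed.

(** With [r] from [lattice_discrete], two points of a ball of radius [r / 2] are less than [r]
    apart, so [qL] is injective on it and its inverse there is a local section. *)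
Lemma EL_chart (u0 : X) : exists2 e : chart R (EL Y) (n + n), atlas e &
  [/\ dom e (qL Y u0), fwd e (qL Y u0) = u0 & bwd e = qL Y].
Proof.
have [r r0 Hr] := lattice_discrete.
pose B := ball u0 (r / 2).
have oB : open B by exact: ball_open.
have r20 : 0 < r / 2 by rewrite divr_gt0.
have Bu0 : B u0 by exact: ballxx.
pose fw (x : EL_space Y) : X := xget u0 [set u | B u /\ qL Y u = x].
have fwP u : B u -> fw (qL Y u) = u.
  move=> Bu; have /xgetPex : exists v, [set v | B v /\ qL Y v = qL Y u] v by exists u.
  move=> /(_ u0) [Bf qf]; apply: Hr => //.
  rewrite -/(fw (qL Y u)) in Bf qf *; move: (fw (qL Y u)) Bf => v Bf.
  have := Bu; have := Bf; rewrite /B -!ball_normE /= => h1 h2.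
  rewrite (splitr r); apply: le_lt_trans (ltrD h1 h2).
  by rewrite (distrC u0 v); exact: ler_distD.
pose e : chart R (EL Y) (n + n) := Chart (qL Y @` B) fw (qL Y).
exists e; last first.
  by split => //=; [exists u0 | exact: fwP].
split => //=; first exact: qL_open.
  move=> _ [u Bu <-] O nO.
  rewrite fwP// in nO.
  have [U [[oU Uu] UO]] : exists U, open_nbhs u U /\ U `<=` O.
    by move: nO; rewrite nbhsE => -[U Uu UO]; exists U.
  have oUB : open (qL Y @` (U `&` B)) by apply: qL_open; exact: openI.
  have : nbhs (qL Y u) (qL Y @` (U `&` B)).
    by apply: open_nbhs_nbhs; split => //; exists u.
  by apply: filterS => _ [v [Uv Bv] <-]; rewrite /= fwP//; exact: UO.
by move=> _ [u Bu <-]; rewrite fwP.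
Qed.

Lemma EL_chart_at (x : EL Y) : [/\ atlas (chart_at x), dom (chart_at x) x,
  bwd (chart_at x) = qL Y & qL Y (fwd (chart_at x) x) = x].
Proof.
have [u <-] : exists u, qL Y u = x by exists (reprL x); exact: qL_surj.
have [e ea [eu _ _]] := EL_chart u.
have [ca cd] : atlas (chart_at (qL Y u : EL Y)) /\ dom (chart_at (qL Y u : EL Y)) (qL Y u).
  apply: (@xgetPex _ _ [set c : chart R (EL Y) (n + n) | atlas c /\ dom c (qL Y u)]).
  by exists e.
by split => //; have [_ b _ f] := ca; [exact: b | exact: f].
Qed.

End Lattice.

Section OpenMap.
Context {R : realType} {d : nat}.

Lemma lin_inj_bound (L : {linear 'rV[R]_d -> 'rV[R]_d}) : (forall v, L v = 0 -> v = 0) ->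
  exists2 C, 0 < C & forall v, `|v| <= C * `|L v|.
Proof.
move=> Li; pose M := lin1_mx L.
have ME v : v *m M = L v by rewrite mul_rV_lin1.
have fM : row_free M.
  rewrite -kermx_eq0; apply/eqP/row_matrixP => i; rewrite row0; apply: Li.
  by rewrite -ME; apply/sub_kermxP; exact: row_sub.
have [C C0 HC] := row_free_bound fM.
exists (C + 1) => [|v]; first by rewrite ltr_wpDl.
by apply: le_trans (HC v) _; rewrite ME ler_wpM2r// lerDl.
Qed.

(* Minimise |F x - y| over a small box: an interior minimum is a solution. *)
Lemma open_map (F : 'rV[R]_d -> 'rV[R]_d) (x0 : 'rV[R]_d) (r : R) : 0 < r ->
  (forall x, ball x0 r x -> differentiable F x) ->
  (forall x v, ball x0 r x -> 'd F x v = 0 -> v = 0) ->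
  nbhs (F x0) (F @` ball x0 r).
Proof.
move=> r0 dF iF.
have [C C0 HC] := lin_inj_bound (iF x0^~ (ballxx x0 r0)).
have e0 : 0 < (2 * C)^-1 by rewrite invr_gt0 mulr_gt0.
have /nbhs_ballP[rho1 /= rho10 Hrho] := diff_eps (dF x0 (ballxx x0 r0)) e0.
pose rho := Num.min (rho1 / 2) (r / 2).
have rho0 : 0 < rho by rewrite lt_min !divr_gt0.
have rr : rho < r by rewrite gt_min [X in _ || X]ltr_pdivrMr// ltr_pMr// ltr1n orbT.
have rr1 : rho < rho1 by rewrite gt_min ltr_pdivrMr// ltr_pMr// ltr1n.
have low h : `|h| <= rho -> `|h| <= 2 * C * `|F (x0 + h) - F x0|.
  move=> hr; have /Hrho : ball (0 : 'rV[R]_d) rho1 h.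
    by rewrite -ball_normE /= sub0r normrN; exact: le_lt_trans hr rr1.
  set D := F (x0 + h) - F x0 => H.
  have h1 : `|'d F x0 h| <= `|D| + (2 * C)^-1 * `|h|.
    have -> : 'd F x0 h = D - (D - 'd F x0 h) by rewrite opprB addrC subrK.
    by apply: le_trans (ler_normB _ _) _; rewrite lerD2l.
  have h2 := HC h.
  have h3 : C * `|'d F x0 h| <= C * (`|D| + (2 * C)^-1 * `|h|) by rewrite ler_pM2l.
  have h4 : C * (`|D| + (2 * C)^-1 * `|h|) = C * `|D| + `|h| / 2 by field; rewrite gt_eqF.
  lra.
pose K := d%:R + 1 : R.
have K1 : 1 <= K by rewrite lerDr.
(* By [low], a boundary minimum would give [rho <= 2 C |F xs - F x0|], while the minimality bound
   and the choice of [eps] keep the right-hand side below [rho / 2]. *)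
pose eps := rho / (4 * C * (K + 1)).
have epsE : 2 * C * ((K + 1) * eps) = rho / 2 by rewrite /eps; field; lra.
have eps0 : 0 < eps by rewrite divr_gt0// !mulr_gt0//; lra.
apply/nbhs_ballP; exists eps => //= y; rewrite -ball_normE /= => yF.
pose box := [set x : 'rV[R]_d | forall i, `[x0 0 i - rho, x0 0 i + rho]%classic (x 0 i)].
have cbox : compact box.
  exact: (@rV_compact R d (fun i => `[x0 0 i - rho, x0 0 i + rho]%classic)
    (fun=> @segment_compact R _ _)).
have boxi x i : box x -> `|(x - x0) 0 i| <= rho.
  by move=> /(_ i) /=; rewrite in_itv /= !mxE ler_norml => /andP[h1 h2]; apply/andP; split; lra.
have boxn x : box x -> `|x - x0| <= rho.
  by move=> bx; apply: mx_norm_le => [|i j]; [exact: ltW | rewrite ord1; exact: boxi].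
have boxb x : box x -> ball x0 r x.
  by move=> /boxn bx; rewrite -ball_normE /= distrC; exact: le_lt_trans bx rr.
have b0 : box x0 by move=> i /=; rewrite in_itv /=; apply/andP; split; lra.
pose En x := inner (F x - y) (F x - y).
have Ec : {within box, continuous En}.
  apply: continuous_in_subspaceT => x /set_mem bx.
  have c1 : {for x, continuous (fun x => F x - y)}.
    apply: continuousB; last exact: cst_continuous.
    exact: (differentiable_continuous (dF x (boxb x bx))).
  exact: (continuous_comp c1 (@inner_sq_continuous R d _)).
have [xs /set_mem bxs Hxs] := compact_EVT_min (ex_intro _ _ b0) cbox Ec.
have Emin x : box x -> En xs <= En x by move=> bx; apply: Hxs; exact/mem_set.
have yF' : `|F x0 - y| < eps by [].
have upper : `|F xs - y| <= K * `|F x0 - y|.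
  have Kn : 0 <= K * `|F x0 - y| by rewrite mulr_ge0//; lra.
  rewrite -ler_sqr ?nnegrE//; apply: le_trans (norm_le_inner _) _.
  apply: le_trans (Emin x0 b0) _.
  apply: le_trans (ler_norm _) _; apply: le_trans (inner_le _ _) _.
  rewrite exprMn -expr2 ler_wpM2r ?sqr_ge0// /K.
  have : 0 <= d%:R :> R by []. 
  nra.
have int : `|xs - x0| < rho.
  rewrite ltNge; apply/negP => bd.
  have xsE : x0 + (xs - x0) = xs by rewrite addrC subrK.
  have lo := low (xs - x0) (boxn _ bxs); rewrite xsE in lo.
  have tr : `|F xs - F x0| <= `|F xs - y| + `|F x0 - y|.
    by rewrite (distrC (F x0)); exact: ler_distD.
  have k1 : K * `|F x0 - y| <= K * eps by rewrite ler_pM2l ?ltW//; lra.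
  have k2 : 2 * C * `|F xs - F x0| <= 2 * C * ((K + 1) * eps).
    rewrite ler_pM2l; last by rewrite mulr_gt0.
    by rewrite mulrDl mul1r; lra.
  lra.
exists xs; first by have := boxb _ bxs; rewrite -ball_normE.
apply/eqP; rewrite -subr_eq0; apply/eqP/inner_eq0.
have dxs := dF xs (boxb _ bxs).
(* Moving from the minimum in the direction [v] whose image is [F xs - y] gives the squared length
   of [F xs - y] as half of a derivative that vanishes. *)
have [v dv] := lin_inj_surj (iF xs^~ (boxb _ bxs)) (F xs - y).
have dxs0 : differentiable F (xs + 0 *: v) by rewrite scale0r addr0.
have l1 := line_derive dxs0; rewrite scale0r addr0 in l1.
have dc : is_derive (0 : R) 1 (fun _ : R => - y) 0 by exact: is_derive_cst.
have l2 := is_deriveD l1 dc.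
have l3 := is_deriveN (is_derive_inner l2 l2).
have := deriv_max0 l3 => H.
have : - (inner ('d F xs v + 0) (F (xs + 0 *: v) - y) +
     inner (F (xs + 0 *: v) - y) ('d F xs v + 0)) = 0.
  apply: H.
  have nb : \forall s \near (0 : R^o), `|xs + s *: v - x0| < rho.
    have lc : continuous (fun s : R^o => xs + s *: v - x0).
      apply: (@lip_continuous _ _ _ _ `|v|) => // a b.
      have -> : xs + a *: v - x0 - (xs + b *: v - x0) = (a - b) *: v.
        by rewrite scalerBl; apply/rowP => k; rewrite !mxE; ring.
      by rewrite normrZ mulrC.
    have i0 : `|xs + (0 : R^o) *: v - x0| < rho by rewrite scale0r addr0.
    exact: (lc 0 _ (near_norm_lt i0)).
  apply: filterS nb => s sr; rewrite lerN2.
  change (En (xs + (0 : R) *: v) <= En (xs + s *: v)).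
  have -> : xs + (0 : R) *: v = xs by rewrite scale0r addr0.
  apply: Emin => i /=.
  have := le_trans (mx_norm_entry (xs + s *: v - x0) 0 i) (ltW sr); rewrite in_itv /=.
  by rewrite ler_norml !mxE => /andP[h1 h2]; apply/andP; split; lra.
rewrite scale0r !addr0 dv => /eqP; rewrite oppr_eq0 -mulr2n mulrn_eq0 /= => /eqP.
by [].
Qed.

End OpenMap.

(** * The covering of the free points by [TE] *)

Section Torified.
Context {R : realType} {m n : nat} (E : expfam R m n) {N : charted R (n + n)}.
Variables (g : tensor2 N) (Phi : torus R n -> N -> N).
Variables (Y : 'I_n -> 'rV[R]_n -> 'rV[R]_n) (G : EL Y -> N).
Hypothesis hg : kahler_manifold g.
Hypothesis hT : torification_by E g Phi G.
Local Notation X := 'rV[R]_(n + n).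
Local Notation sv := (efsv E).
Local Notation W := (efW E).

Let hN : complex_manifold N. Proof. by case: hg. Qed.
Let hY : parallel_frame Y. Proof. by case: hT. Qed.

(** Composing [G] with the covering by [TE] gives one global parametrisation of the free points, so
    that most computations avoid the charts of [EL Y]. *)
Definition PP (u : X) : N := G (qL Y u).

Lemma PP_translate k u : k \in intvec -> PP (translate Y k u) = PP u.
Proof. by move=> kZ; rewrite /PP qL_translate. Qed.

Lemma PP_action t u : PP (translate Y t u) = Phi (to_torus t) (PP u).
Proof. by rewrite /PP -EL_actionE; have [_ _ _ _ ->] := hT. Qed.

Lemma PP_free p : free_points Phi p <-> exists u, PP u = p.
Proof.
have [_ _ <- _ _] := hT; split=> [[x _ <-]|[u <-]]; last by exists (qL Y u).
by exists (reprL x); rewrite /PP qL_surj.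
Qed.

Lemma PP_sparam : sparam (N := N) setT PP.
Proof.
have [_ [[[Gc Gs] _] _] _ _ _] := hT.
have Pc u : {for u, continuous PP}.
  by apply: continuous_comp; [exact: qL_continuous | exact: Gc].
split; [exact: openT | by move=> u _; exact: Pc |].
move=> c ca k; apply: Ck_on_cover => u [_ cu].
have [e ea [eu fe be]] := EL_chart hY u.
have := Gs e c ea ca k; rewrite be => H.
eexists; last exact: H.
by split; [exists (qL Y u) | split].
Qed.

(** The chart chosen at [qL Y u] may send it to another lift of the same point; the two lifts differ
    by a lattice translation, whose differential is the identity. *)
Lemma PP_dmap u w : dparam PP u w = dmap G (qL Y u) w.
Proof.
have [ea ed eb ef] := EL_chart_at hY (qL Y u : EL Y).
have [k kZ kE] := qL_eq (esym ef).
rewrite /dparam /dmap eb; set c := chart_at _; set u' := fwd _ _ in kE *.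
have sP := PP_sparam.
have [ca cu] := chart_atP hN (PP u).
have cu' : dom c (PP u') by rewrite kE PP_translate.
have d1 := sparam_diff sP ca (I : setT u') cu'.
pose tau := row_mx 0 (k *m Ymx Y) : X.
have u'E : u + tau = u' by rewrite kE translateE.
have dt : differentiable (fun y : X => y + tau) u.
  by apply: differentiableD => //; exact: differentiable_cst.
have e1 : \forall z \near u, (fwd c \o PP) (z + tau) = (fwd c \o PP) z.
  have nT : \forall z \near u, [set: X] z.
    by apply: open_nbhs_nbhs; split => //; exact: openT.
  by apply: filterS nT => z _ /=; rewrite -translateE// PP_translate.
have [_ e2] := diff_near_comp (f := fun y : X => y + tau) w u'E dt d1 e1.
apply: (etrans e2).
congr ('d _ u' _).
have did : differentiable (fun y : X => y) u by exact: ex_diff.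
have dcs : differentiable (fun _ : X => tau) u by exact: differentiable_cst.
apply: (etrans (dD w did dcs)).
have i1 : 'd (fun y : X => y) u w = w.
  by have [_ e3] := is_diff_id u; exact: (congr1 (fun h : X -> X => h w) e3).
have i2 : 'd (fun _ : X => tau) u w = 0.
  exact: (congr1 (fun h : X -> X => h w) (diff_cst tau u)).
have ar (a b : X) : a = w -> b = 0 -> a + b = w by move=> -> ->; rewrite addr0.
exact: ar i1 i2.
Qed.

Lemma PP_hol u w : dparam PP u (mulI w) = mulI (dparam PP u w).
Proof.
have [_ [[_ GI] _] _ _ _] := hT.
by rewrite !PP_dmap; exact: GI.
Qed.

Lemma PP_iso u v w : g (PP u) (dparam PP u v) (dparam PP u w) =
  cov sv W (lsubmx u) (lsubmx v) (lsubmx w) + cov sv W (lsubmx u) (rsubmx v) (rsubmx w).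
Proof.
have [_ [_ Gi] _ _ _] := hT; rewrite !PP_dmap Gi /EL_metric /TE_metric !fisherE.
have [_ _ _ ef] := EL_chart_at hY (qL Y u : EL Y).
have [k kZ ->] := qL_eq (esym ef).
by rewrite lsub_translate.
Qed.

Lemma PP_inj u v : dparam PP u v = 0 -> v = 0.
Proof.
move=> v0; have := PP_iso u v v; rewrite v0.
have := gl hg (PP u) (0 : X) (-1) 0 0; rewrite scaler0 addr0 mulN1r addrC subrr => ->.
have c0 w : 0 <= cov sv W (lsubmx u) w w.
  have [->|/cov_pos/ltW//] := eqVneq w 0.
  by rewrite cov0l.
have [l0|/(cov_pos E (lsubmx u)) l0] := eqVneq (lsubmx v) 0; last first.
  by have := c0 (rsubmx v) => r0 /eqP; rewrite eq_sym gt_eqF// ltr_pwDl.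
have [r0|/(cov_pos E (lsubmx u)) r0] := eqVneq (rsubmx v) 0; last first.
  by have := c0 (lsubmx v) => l1 /eqP; rewrite eq_sym gt_eqF// ltr_wpDl.
by move=> _; rewrite -(hsubmxK v) l0 r0 row_mx0.
Qed.

Local Notation P := PP.

Lemma PP_nbhs u r : 0 < r -> nbhs (P u) (P @` ball u r).
Proof.
move=> r0; have [ca cu] := chart_atP hN (P u); set c := chart_at (P u) in ca cu.
have sP := PP_sparam.
have /nbhs_ballP[r1 /= r10 Hr1] := sparam_near hN sP ca (I : setT u) cu.
pose r2 := Num.min r r1.
have r20 : 0 < r2 by rewrite lt_min r0.
have b1 x : ball u r2 x -> dom c (P x).
  have r21 : r2 <= r1 by rewrite ge_min lexx orbT.
  by move=> bx; have [_] := Hr1 x (le_ball r21 bx).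
have dF x : ball u r2 x -> differentiable (fwd c \o P) x.
  by move=> bx; exact: (sparam_diff sP ca (I : setT x) (b1 x bx)).
have iF x v : ball u r2 x -> 'd (fwd c \o P) x v = 0 -> v = 0.
  move=> bx v0; apply: (PP_inj (u := x)).
  apply: (comp_in_eq0 hg ca (b1 x bx)).
  exact: (etrans (esym (dparamE hN v sP (I : setT x) ca (b1 x bx))) v0).
have nF := open_map r20 dF iF.
have [_ _ fc _ _] := chart_good hN ca.
have n1 : \forall q \near P u, ((fwd c \o P) @` ball u r2) (fwd c q) := fc _ cu _ nF.
have n2 : \forall q \near P u, dom c q.
  by apply: open_nbhs_nbhs; split => //; have [] := chart_open hN ca.
have r2r : r2 <= r by rewrite ge_min lexx.
apply: filterS2 n1 n2 => q [x bx /= xq] cq; exists x; first exact: le_ball r2r _ bx.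
by rewrite -(fwdK hN ca cq) -xq (fwdK hN ca)//; exact: b1.
Qed.

Lemma free_open : open (free_points Phi).
Proof.
rewrite openE => p /(PP_free)[u <-].
apply: filterS (PP_nbhs u ltr01) => q [x _ <-]; apply/(PP_free).
by exists x.
Qed.

End Torified.

Local Close Scope quotient_scope.

(** * Density of the free points *)

Section ClosedSubgroup.
Context {R : realType} {n : nat}.
Local Notation L := 'rV[R]_n.

(** Simultaneous approximation by pigeonhole: among the first [K ^ n + 1] multiples of [w], two have
    all fractional parts in the same cells of length [1 / K]. *)
Lemma dirichlet (w : L) (e : R) : 0 < e ->
  exists q : nat, (0 < q)%N /\ exists2 z : L, z \in intvec & `|q%:R *: w - z| < e.
Proof.
move=> e0; pose K := (Num.truncn e^-1).+1.
have K0 : 0 < K%:R :> R by rewrite ltr0n.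
have Ke : K%:R^-1 < e by rewrite invf_plt ?posrE//; exact: truncnS_gt.
pose fr (x : R) := x - (Num.floor x)%:~R.
have fr0 x : 0 <= fr x < 1.
  have := floor_itv x; rewrite intrD /fr => /andP[h1 h2].
  by apply/andP; split; move: h1 h2; set y := _%:~R; lra.
have frK x : (Num.truncn (K%:R * fr x) < K)%N.
  have /andP[h1 h2] := fr0 x; rewrite truncn_lt_nat ?mulr_ge0//.
  by rewrite -[ltRHS]mulr1 ltr_pM2l.
pose cell (j : 'I_(K ^ n).+1) : {ffun 'I_n -> 'I_K} :=
  [ffun i => Ordinal (frK (j%:R * w 0 i))].
have [j [j' [jj cE]]] : exists j j' : 'I_(K ^ n).+1, (j < j')%N /\ cell j = cell j'.
  have : ~~ injectiveb cell.
    apply/negP => /injectiveP inj; have := leq_card cell inj.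
    by rewrite card_ffun !card_ord ltnn.
  move=> /injectivePn[j [j' jj' cE]].
  have [lt|] := ltnP j j'; first by exists j, j'.
  rewrite leq_eqVlt => /predU1P[/val_inj e1|lt]; first by rewrite e1 eqxx in jj'.
  by exists j', j.
exists (j' - j)%N; split; first by rewrite subn_gt0.
exists (\row_i (Num.floor (j'%:R * w 0 i) - Num.floor (j%:R * w 0 i))%:~R).
  by apply/forallP => i; rewrite mxE intr_int.
apply: le_lt_trans Ke; apply: mx_norm_le; first by rewrite invr_ge0 ltW.
move=> i0 i; rewrite ord1 !mxE natrB 1?ltnW// intrB.
have -> : (j'%:R - j%:R) * w 0 i - ((Num.floor (j'%:R * w 0 i))%:~R -
  (Num.floor (j%:R * w 0 i))%:~R) = fr (j'%:R * w 0 i) - fr (j%:R * w 0 i).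
  by rewrite /fr; ring.
have /ffunP/(_ i) := cE; rewrite !ffunE => /(congr1 val) /= tE.
have p k : 0 <= K%:R * fr (k%:R * w 0 i).
  by rewrite mulr_ge0//; have /andP[] := fr0 (k%:R * w 0 i).
have /andP[a1 a2] := truncn_itv (p j); have /andP[b1 b2] := truncn_itv (p j').
rewrite tE in a1 a2.
rewrite -(ler_pM2l K0) divff ?gt_eqF// -{1}(gtr0_norm K0) -normrM ler_norml mulrBr.
move: a1 a2 b1 b2; rewrite -natr1; set T := (Num.truncn _)%:R.
by move=> *; apply/andP; split; lra.
Qed.

Variable Ga : set L.
Hypotheses (Ga0 : Ga 0) (GaB : forall x y, Ga x -> Ga y -> Ga (x - y)).
Hypotheses (GaZ : forall z, z \in intvec -> Ga z) (GaC : closed Ga).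

Lemma GaN x : Ga x -> Ga (- x). Proof. by move=> h; rewrite -sub0r; exact: GaB. Qed.
Lemma GaD x y : Ga x -> Ga y -> Ga (x + y).
Proof. by move=> h1 h2; rewrite -(opprK y); apply: GaB => //; exact: GaN. Qed.
Lemma GaMn k x : Ga x -> Ga (k%:R *: x).
Proof.
move=> hx; elim: k => [|k IH]; first by rewrite scale0r.
by rewrite -natr1 scalerDl scale1r; exact: GaD.
Qed.
Lemma GaMz (k : int) x : Ga x -> Ga (k%:~R *: x).
Proof.
move=> hx; case: (intP k) => [|j|j]; first by rewrite scale0r.
  exact: GaMn.
by rewrite mulrNz scaleNr; apply: GaN; exact: GaMn.
Qed.

Lemma GaCl x : (forall e, 0 < e -> exists2 y, Ga y & `|x - y| < e) -> Ga x.
Proof.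
move=> H; apply: GaC => B /nbhs_ballP[e /= e0 He].
have [y gy xy] := H e e0; exists y; split => //; apply: He.
by rewrite -ball_normE.
Qed.

Definition inGa (M : 'M[R]_n) : Prop := forall x : L, (x <= M)%MS -> Ga x.

(* A limit of directions of short elements spans a line inside the closed subgroup. *)
Lemma line_in_Ga (M : 'M[R]_n) : inGa M ->
  (forall e, 0 < e -> exists w : L, [/\ Ga w, w != 0, `|w| < e &
     forall y, (y <= M)%MS -> inner y w = 0]) ->
  exists v : L, [/\ v != 0, (forall y, (y <= M)%MS -> inner y v = 0) &
    forall s : R, Ga (s *: v)].
Proof.
move=> GM H.
have /choice[w Hw] : forall k : nat, exists w : L, [/\ Ga w, w != 0, `|w| < k.+1%:R^-1 &
     forall y, (y <= M)%MS -> inner y w = 0].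
  by move=> k; apply: H; rewrite invr_gt0.
pose u k := `|w k|^-1 *: w k.
have un k : `|u k| = 1.
  have [_ w0 _ _] := Hw k.
  by rewrite normrZ normfV normr_id mulVf// normr_eq0.
pose A := [set x : L | forall i, `[-1, 1]%classic (x 0 i)].
have cA : compact A.
  exact: (@rV_compact R n (fun=> `[-1, 1]%classic) (fun=> @segment_compact R _ _)).
have uA k : A (u k).
  by move=> i /=; rewrite in_itv /= -ler_norml -(un k) mx_norm_entry.
have FA : (u @ \oo) A by exists 0%N => // k _; exact: uA.
have [v [Av cv]] := cA (u @ \oo) _ FA.
have cl e K : 0 < e -> exists2 k, (K <= k)%N & `|v - u k| < e.
  move=> e0.
  have FK : (u @ \oo) [set u k | k in [set k | (K <= k)%N]].
    by exists K => // k /= Kk; exists k.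
  have [_ [[k Kk <-]]] := cv _ _ FK (nbhsx_ballx (v : L) e e0).
  by rewrite -ball_normE /= => h; exists k.
exists v; split.
- apply/eqP => v0; have [k _] := cl 1 0%N ltr01.
  by rewrite v0 sub0r normrN un ltxx.
- move=> y yM; apply/eqP/negPn/negP => nz.
  have p : 0 < `|inner y v| by rewrite normr_gt0.
  have D0 : 0 < n%:R * `|y| + 1 by rewrite ltr_wpDl// mulr_ge0.
  have [k _ vk] := cl (`|inner y v| / (n%:R * `|y| + 1)) 0%N (divr_gt0 p D0).
  have [_ _ _ /(_ y yM) yw] := Hw k.
  have e1 : inner y v = inner y (v - u k) by rewrite innerBr innerZr yw mulr0 subr0.
  have := inner_le y (v - u k); rewrite -e1; apply/negP; rewrite -ltNge mulrA.
  move: vk; rewrite ltr_pdivlMr// mulrC => vk; apply: le_lt_trans vk.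
  by rewrite ler_wpM2r// lerDl.
move=> s; apply: GaCl => e e0.
have s1 : 0 < `|s| + 1 by rewrite ltr_wpDl.
have [K HK] : exists K : nat, K.+1%:R^-1 < e / 2.
  exists (Num.truncn (e / 2)^-1); rewrite invf_plt ?posrE ?divr_gt0//; exact: truncnS_gt.
have [k Kk vk] := cl (e / 2 / (`|s| + 1)) K (divr_gt0 (divr_gt0 e0 (ltr0Sn R 1)) s1).
have [gw w0 ws _] := Hw k; have wp : 0 < `|w k| by rewrite normr_gt0.
pose j := Num.floor (s / `|w k|).
exists (j%:~R *: w k); first exact: GaMz.
have wk2 : `|w k| < e / 2.
  apply: lt_trans ws _; apply: le_lt_trans HK.
  by rewrite lef_pV2 ?posrE// ler_nat ltnS.
have -> : s *: v - j%:~R *: w k = s *: (v - u k) + (s / `|w k| - j%:~R) *: w k.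
  by rewrite scalerBr scalerBl /u scalerA addrA subrK.
apply: le_lt_trans (ler_normD _ _) _; rewrite !normrZ.
have f1 : `|s / `|w k| - j%:~R| <= 1.
  have := floor_itv (s / `|w k|); rewrite -/j intrD => /andP[h1 h2].
  by rewrite ler_norml; move: h1 h2; set y := j%:~R; set z := s / _ => *; apply/andP; split; lra.
have f2 : `|s / `|w k| - j%:~R| * `|w k| <= `|w k| by rewrite -[leRHS]mul1r ler_wpM2r.
have f3 : `|s| * `|v - u k| < e / 2.
  move: vk; rewrite ltr_pdivlMr// mulrC => vk; apply: le_lt_trans vk.
  by rewrite ler_wpM2r// lerDl.
lra.
Qed.

(** Near 0 a closed subgroup is a linear subspace: take one of largest dimension inside [Ga]. If
    elements outside it were arbitrarily short, their orthogonal parts would supply a further line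
    by [line_in_Ga]. *)
Lemma Ga_local : exists M, inGa M /\ exists2 e, 0 < e & forall x, Ga x -> `|x| < e -> (x <= M)%MS.
Proof.
pose Q r := `[< exists2 M, inGa M & \rank M = r >].
have Q0 : exists r, Q r.
  exists 0%N; apply/asboolP; exists 0; last exact: mxrank0.
  by move=> x; rewrite submx0 => /eqP ->.
have Qn r : Q r -> (r <= n)%N by move=> /asboolP[M _ <-]; exact: rank_leq_row.
have [r /asboolP[M GM Mr] max] := ex_maxnP Q0 Qn.
exists M; split => //; apply: contrapT => nE.
have Hs e : 0 < e -> exists w : L, [/\ Ga w, w != 0, `|w| < e &
     forall y, (y <= M)%MS -> inner y w = 0].
  move=> e0; apply: contrapT => nw; apply: nE.
  have N0 : 0 < n%:R + 1 :> R by rewrite ltr_wpDl.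
  exists (e / (n%:R + 1)); first by rewrite divr_gt0.
  move=> x gx; rewrite ltr_pdivlMr// => xe.
  have [h [w [xE hM wM]]] := orth_decomp M x.
  have [w0|w0] := eqVneq w 0; first by rewrite xE w0 addr0.
  exfalso; apply: nw; exists w; split => //.
    by have -> : w = x - h; [rewrite xE addrC addKr | apply: GaB => //; exact: GM].
  suff : `|w| <= `|x| * (n%:R + 1) by move=> /le_lt_trans; apply.
  have xn : 0 <= `|x| * (n%:R + 1) by rewrite mulr_ge0// ltW.
  rewrite -(ler_sqr (normr_ge0 _) xn).
  apply: le_trans (norm_le_inner _) _.
  have : inner w w <= inner x x.
    rewrite xE innerDl !innerDr (wM h hM) [inner w h]innerC (wM h hM) addr0 add0r lerDr.
    exact: inner_ge0.
  move=> /le_trans; apply; apply: le_trans (ler_norm _) _; apply: le_trans (inner_le _ _) _.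
  rewrite exprMn -expr2 mulrC ler_wpM2l ?sqr_ge0//.
  have : 0 <= n%:R :> R by [].
  nra.
have [v [v0 vM vG]] := line_in_Ga GM Hs.
have GM' : inGa (M + <<v>>)%MS.
  move=> x /sub_addsmxP[[a b] /= ->]; apply: GaD; first by apply: GM; exact: submxMl.
  have : (b *m <<v>> <= v)%MS by rewrite -(genmxE v) submxMl.
  by move=> /sub_rVP[s ->].
have := max (\rank (M + <<v>>)%MS); rewrite -Mr => H.
have : (\rank (M + <<v>>)%MS <= \rank M)%N.
  by apply: H; apply/asboolP; exists (M + <<v>>)%MS.
have sM : (M <= M + <<v>>)%MS by exact: addsmxSl.
rewrite (geq_leqif (mxrank_leqif_sup sM)) addsmx_sub => /andP[_]; rewrite genmxE => vMM.
by have := vM v vMM => /inner_eq0 /eqP; rewrite (negbTE v0).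
Qed.

(** If [Ga] is discrete, a multiple of [t] close to an integer vector must equal it. Otherwise [Ga]
    contains a line, and approximation of its direction yields a nonzero integer vector all of whose
    real multiples belong to [Ga]. *)
Lemma torsion_exists t : Ga t -> t \notin intvec ->
  exists a : L, [/\ Ga a, a \notin intvec & exists q : nat, (0 < q)%N /\ q%:R *: a \in intvec].
Proof.
move=> gt tZ; have [M [GM [e e0 He]]] := Ga_local.
have [M0|M0] := eqVneq M 0.
  have [q [q0 [z zZ qz]]] := dirichlet t e0.
  exists t; split => //; exists q; split => //.
  have : (q%:R *: t - z <= M)%MS.
    by apply: He => //; apply: GaB; [exact: GaMn | exact: GaZ].
  by rewrite M0 submx0 subr_eq0 => /eqP ->.
have [w wM w0] : exists2 w : L, (w <= M)%MS & w != 0.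
  by exists (nz_row M); rewrite ?nz_row_sub// nz_row_eq0.
pose w1 := `|w|^-1 *: w.
have w1n : `|w1| = 1 by rewrite normrZ normfV normr_id mulVf// normr_eq0.
have w1M : (w1 <= M)%MS by exact: scalemx_sub.
(* The bound [e] places [z] in the subspace; the bound [1 / 2] keeps it nonzero, since the multiple
   of the unit vector [w1] has norm at least 1. *)
pose e1 := Num.min e (1 / 2).
have e10 : 0 < e1 by rewrite lt_min e0 divr_gt0.
have [q [q0 [z zZ qz]]] := dirichlet w1 e10.
have qze : `|q%:R *: w1 - z| < e by move: qz; rewrite lt_min => /andP[].
have qz2 : `|q%:R *: w1 - z| < 1 / 2 by move: qz; rewrite lt_min => /andP[].
have zM : (z <= M)%MS.
  have d : (q%:R *: w1 - z <= M)%MS.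
    by apply: He => //; apply: GaB; [apply: GaMn; exact: GM | exact: GaZ].
  have -> : z = q%:R *: w1 - (q%:R *: w1 - z) by rewrite opprB addrC subrK.
  by rewrite addmx_sub ?scalemx_sub// eqmx_opp.
have z0 : z != 0.
  apply/eqP => z0; move: qz2; rewrite z0 subr0 normrZ w1n mulr1 normr_nat.
  have : 1 <= q%:R :> R by rewrite ler1n.
  lra.
have [j zj] : exists j, z 0 j != 0.
  apply: contrapT => H; move/negP: z0; apply; apply/eqP/rowP => j; rewrite mxE.
  by apply/eqP; apply: contrapT => h; apply: H; exists j; apply/negP.
have /forallP/(_ j) := zZ; move=> /intrP[k kE].
(* Its [j]-th coordinate is 1/2, hence not an integer, while multiplication by twice the absolute
   value of [z 0 j] gives [z] or its opposite. *)
exists ((2 * z 0 j)^-1 *: z); split.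
- by apply: GM; exact: scalemx_sub.
- apply/negP => /forallP/(_ j); rewrite mxE.
  have -> : (2 * z 0 j)^-1 * z 0 j = 1 / 2 :> R by field.
  move=> /int_lt1 H; have : (1 / 2 : R) = 0 by apply: H; rewrite ger0_norm; lra.
  lra.
exists (absz (2%:Z * k)); split.
  rewrite absz_gt0 mulf_neq0//; apply: contraNneq zj => k0.
  by rewrite kE k0.
rewrite scalerA natr_absz intr_norm intrM kE.
have -> : (2%:Z)%:~R = 2 :> R by [].
have zj' : (k%:~R : R) != 0 by rewrite -kE.
have [kp|kn] := leP 0 (k%:~R : R).
  by rewrite ger0_norm ?mulr_ge0// divff ?scale1r ?mulf_neq0.
by rewrite ltr0_norm ?pmulr_rlt0// mulNr divff ?scaleN1r ?rpredN ?mulf_neq0.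
Qed.

End ClosedSubgroup.

Lemma cont_nbhs (T U : topologicalType) (f : T -> U) x (A : set U) :
  {for x, continuous f} -> open A -> A (f x) -> nbhs x (f @^-1` A).
Proof. by move=> c oA Ax; apply: (c A); exact: open_nbhs_nbhs. Qed.

Lemma cont_pre (T U : topologicalType) (f : T -> U) x (A : set U) :
  {for x, continuous f} -> nbhs (f x) A -> nbhs x (f @^-1` A).
Proof. by move=> c; apply: c. Qed.

HB.instance Definition _ (R : realType) (m n : nat) := Complete.on 'M[R]_(m, n).

Section Density.
Context {R : realType} {n : nat} {N : charted R (n + n)}.
Variables (g : tensor2 N) (Phi : torus R n -> N -> N).
Hypothesis hK : kahler_toric g Phi.
Local Notation X := 'rV[R]_(n + n).

Let hg : kahler_manifold g. Proof. by case: hK. Qed.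
Let hN : complex_manifold N. Proof. by case: hg. Qed.
Let hH : hausdorff_space N. Proof. by case: hN. Qed.

Lemma Phi0 p : Phi 0 p = p. Proof. by have [_ _ [[H _ _ _] _] _ _] := hK. Qed.
Lemma PhiD a b p : Phi (a + b) p = Phi a (Phi b p).
Proof. by have [_ _ [[_ H _ _] _] _ _] := hK. Qed.
Lemma Phi_smooth a : smooth_map_on setT (Phi a).
Proof. by have [_ _ [_ /(_ a)[[H _] _ _]] _ _] := hK. Qed.
Lemma Phi_cont a : continuous (Phi a).
Proof. by move=> p; have [+ _] := Phi_smooth a; apply. Qed.

Lemma to_torusB (s t : 'rV[R]_n) : to_torus (s - t) = to_torus s - to_torus t.
Proof.
apply: (etrans (Quotient.pi_add (@intvec R n : zmodClosed 'rV[R]_n) s (- t))).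
congr (_ + _); exact: (Quotient.pi_opp (@intvec R n : zmodClosed 'rV[R]_n) t).
Qed.

Lemma to_torus0 : to_torus 0 = 0 :> torus R n.
Proof. by have := to_torusB 0 0; rewrite !subrr. Qed.

Lemma to_torus_eq0 (t : 'rV[R]_n) : (to_torus t == 0) = (t \in intvec).
Proof.
by rewrite -to_torus0 -[t in RHS]subr0 (@Quotient.idealrBE _ (@intvec R n)).
Qed.

Lemma eq_closed (T : topologicalType) (f1 f2 : T -> N) : continuous f1 -> continuous f2 ->
  closed [set x | f1 x = f2 x].
Proof.
move=> c1 c2 x cx; apply: hH => A B nA nB.
have n1 : nbhs x (f1 @^-1` A) := c1 x A nA; have n2 : nbhs x (f2 @^-1` B) := c2 x B nB.
have [y [/= e [Ay By]]] := cx _ (filterI n1 n2).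
by exists (f1 y); split => //; rewrite e.
Qed.

Lemma torus_ind (a : torus R n) : exists t, a = to_torus t.
Proof. by exists (torus_repr a); rewrite /to_torus /torus_repr reprK. Qed.

(** The lifted stabiliser is a closed subgroup properly containing the integer vectors. Elements of
    finite order are wanted because there are only countably many of them. *)
Lemma stab_torsion p : ~ free_points Phi p -> exists t : 'rV[R]_n,
  [/\ t \notin intvec, Phi (to_torus t) p = p & exists q : nat, (0 < q)%N /\ q%:R *: t \in intvec].
Proof.
move=> nf; pose Ga := [set t : 'rV[R]_n | Phi (to_torus t) p = p].
have [t tG tZ] : exists2 t, Ga t & t \notin intvec.
  apply: contrapT => H; apply: nf => a ap; have [t aE] := torus_ind a.
  apply/eqP; rewrite aE to_torus_eq0; apply/negPn/negP => tZ; apply: H; exists t => //.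
  by rewrite /Ga /= -aE.
have Gc : closed Ga.
  apply: (@eq_closed _ (fun t => Phi (to_torus t) p) (fun=> p)); last exact: cst_continuous.
  have [_ _ [[_ _ c _] _] _ _] := hK => x.
  apply: (@continuous_comp _ _ _ (fun t : 'rV[R]_n => (t, p)) _ x _ (c (x, p))).
  move=> B [[B1 B2] /= [n1 n2] sub]; apply: filterS n1 => s Bs; apply: sub.
  by split => //=; exact: nbhs_singleton.
have G0 : Ga 0.
  by rewrite /Ga /= to_torus0 Phi0.
have GN x : Ga x -> Phi (- to_torus x) p = p.
  by move=> h; rewrite -{1}h -PhiD addNr Phi0.
have GB x y : Ga x -> Ga y -> Ga (x - y).
  by move=> hx hy; rewrite /Ga /= to_torusB PhiD GN.
have GZ z : z \in intvec -> Ga z.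
  by rewrite -to_torus_eq0 /Ga /= => /eqP ->; exact: Phi0.
by have [a [aG aZ aq]] := torsion_exists G0 GB GZ Gc tG tZ; exists a.
Qed.

Lemma Phi_mulrn a j p : Phi (a *+ j.+1) p = Phi (a *+ j) (Phi a p).
Proof. by rewrite mulrSr PhiD. Qed.

(* For [a] of finite order [q], the average of the [Phi (a *+ j)] in a chart is
   invariant under [Phi a] and has derivative [q] wherever they all have
   derivative the identity, so it is injective there. *)
Lemma fix_interior_closed (a : torus R n) (q : nat) : (0 < q)%N -> a *+ q = 0 ->
  closed [set p | \forall p' \near p, Phi a p' = p'].
Proof.
move=> q0 aq p cp.
set S := [set p | \forall p' \near p, Phi a p' = p'] in cp *.
have SF p' : S p' -> Phi a p' = p' by exact: nbhs_singleton.
have cF : closed [set p' | Phi a p' = p'].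
  by apply: eq_closed; [exact: Phi_cont | move=> x; exact: cvg_id].
have Fp : Phi a p = p.
  by apply: cF => B nB; have [p' [Sp' Bp']] := cp B nB; exists p'; split => //; exact: SF.
have Fj j : Phi (a *+ j) p = p.
  by elim: j => [|j IH]; [rewrite mulr0n Phi0 | rewrite Phi_mulrn Fp].
have [ca cd] := chart_atP hN p; set c := chart_at p in ca cd.
pose x := fwd c p; pose psi j := fwd c \o Phi (a *+ j) \o bwd c.
pose A j := cimage c `&` bwd c @^-1` (setT `&` Phi (a *+ j) @^-1` dom c).
have spsi j : smooth_on (A j) (psi j) by have [_] := Phi_smooth (a *+ j); apply.
have Ax j : A j x.
  by split; [exact: cimage_fwd | rewrite /x /= (fwdK hN)// Fj].
have [oc oi] := chart_open hN ca.
have bx : bwd c x = p by rewrite /x (fwdK hN).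
have sb := bwd_sparam hN ca.
have bc : {for x, continuous (bwd c)} by have [_ + _] := sb; apply; exact: cimage_fwd.
have fc : {for p, continuous (fwd c)} by have [_ _ + _ _] := chart_good hN ca; apply.
have ni : \forall y \near x, cimage c y by apply: open_nbhs_nbhs; split => //; exact: cimage_fwd.
have nA j : \forall y \near x, A j y.
  have n1 : \forall y \near x, dom c (Phi (a *+ j) (bwd c y)).
    have n0 : nbhs (bwd c x) (Phi (a *+ j) @^-1` dom c).
      by apply: cont_nbhs => //; [exact: Phi_cont | rewrite bx Fj].
    exact: (bc _ n0).
  by apply: filterS2 ni n1 => y y1 y2; split.
(* Near points of [S] the maps [psi j] are the identity; their derivatives are the identity there,
   and by continuity also at the limit point [x]. *)
have dpsi j v : 'd (psi j) x v = v.
  apply: contrapT => /eqP nz; rewrite -subr_eq0 in nz.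
  have hc : {for x, continuous (fun y => 'd (psi j) y v)}.
    exact: (smooth_on_continuous (smooth_on_d v (spsi j)) (Ax j)).
  have n1 : \forall y \near x, 'd (psi j) y v - v != 0.
    have e0 : 0 < `|'d (psi j) x v - v| by rewrite normr_gt0.
    have ar (b1 b2 b3 : X) : `|b1 - b2| < `|b1 - b3| -> b2 - b3 != 0.
      by apply: contraTneq => /eqP; rewrite subr_eq0 => /eqP ->; rewrite ltxx.
    have /cvgrPdist_lt/(_ _ e0) := hc; apply: filterS => y; exact: ar.
  have n2 : \forall p' \near p, 'd (psi j) (fwd c p') v - v != 0 by exact: (fc _ n1).
  have n3 : \forall p' \near p, dom c p' by exact: open_nbhs_nbhs.
  have n4 : nbhs p [set p' | 'd (psi j) (fwd c p') v - v != 0 /\ dom c p'] by exact: filterI.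
  have [p' [Sp' [/eqP h1 h2]]] := cp _ n4; apply: h1.
  have e1 : \forall y \near fwd c p', y = psi j y.
    have sb' : {for fwd c p', continuous (bwd c)}.
      by have [_ + _] := sb; apply; exact: cimage_fwd.
    have m1 : \forall y \near fwd c p', Phi a (bwd c y) = bwd c y.
      have m0 : nbhs (bwd c (fwd c p')) [set p1 | Phi a p1 = p1] by rewrite (fwdK hN).
      exact: (sb' _ m0).
    have m2 : \forall y \near fwd c p', cimage c y.
      by apply: open_nbhs_nbhs; split => //; exact: cimage_fwd.
    apply: filterS2 m1 m2 => y y1 y2; rewrite /psi /=.
    have -> : Phi (a *+ j) (bwd c y) = bwd c y.
      by elim: (j) => [|j' IH]; [rewrite mulr0n Phi0 | rewrite Phi_mulrn y1].
    by have [_ ->] := bwdK hN ca y2.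
  have did : differentiable (fun y : X => y) (fwd c p') by exact: ex_diff.
  have [_ e2] := near_eq_diff e1 did.
  have e3 : 'd (psi j) (fwd c p') v = v.
    apply: (etrans (congr1 (fun h : X -> X => h v) e2)).
    by have [_ e4] := is_diff_id (fwd c p'); exact: (congr1 (fun h : X -> X => h v) e4).
  exact: etrans (congr1 (fun z => z - v) e3) (subrr v).
(* The constant is chosen so that the sum over all [n + n] basis directions is below 1/2, which
   makes [psi j] minus the identity a contraction. *)
have lipj j : \forall y \near x, forall i : 'I_(n + n),
    `|'d (psi j) y (delta_mx 0 i) - delta_mx 0 i| <= (2 * ((n + n)%:R + 1))^-1.
  apply: near_forall_ord => i.
  have hc : {for x, continuous (fun y => 'd (psi j) y (delta_mx 0 i))}.
    exact: (smooth_on_continuous (smooth_on_d _ (spsi j)) (Ax j)).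
  have e0 : 0 < (2 * ((n + n)%:R + 1))^-1 :> R by rewrite invr_gt0 mulr_gt0// ltr_wpDl.
  have ar (b1 b2 b3 : X) M : b1 = b3 -> `|b1 - b2| <= M -> `|b2 - b3| <= M.
    by move=> ->; rewrite distrC.
  have /cvgrPdist_le/(_ _ e0) := hc; apply: filterS => y; apply: ar; exact: dpsi.
have nall : \forall y \near x, forall j : 'I_q, A j y /\ forall i : 'I_(n + n),
    `|'d (psi j) y (delta_mx 0 i) - delta_mx 0 i| <= (2 * ((n + n)%:R + 1))^-1.
  by apply: near_forall_ord => j; apply: filterS2 (nA j) (lipj j) => y; split.
have /nbhs_ballP[r /= r0 Hr] := nall.
have lip (j : 'I_q) y y' : ball x r y -> ball x r y' ->
    `|(psi j y' - y') - (psi j y - y)| <= 1 / 2 * `|y' - y|.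
  move=> by_ by'.
  have yE : y + (y' - y) = y' by rewrite addrC subrK.
  have seg t : 0 <= t <= 1 -> ball x r (y + t *: (y' - y)) by move=> t01; exact: ball_convex.
  have did z : differentiable (fun z : X => z) z by exact: ex_diff.
  have dz t : 0 <= t <= 1 -> differentiable (fun z => psi j z - z) (y + t *: (y' - y)).
    move=> t01; have [Aj _] := Hr _ (seg t t01) j.
    by apply: differentiableB => //; exact: (smooth_on_diff (spsi j)).
  have := MVI (f := fun z => psi j z - z) (M := 1 / 2 * `|y' - y|) dz; rewrite yE; apply => t t01.
  have t01' : 0 <= t <= 1 by have /andP[? ?] := t01; rewrite !ltW.
  have [Aj bj] := Hr _ (seg t t01') j; set z := y + t *: _ in Aj bj *.
  have dj := smooth_on_diff (spsi j) Aj.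
  pose Lz v := 'd (psi j) z v - v.
  have idl : linear (fun z : X => z) by [].
  have Ll : linear Lz by move=> b u v; rewrite /Lz linearP scalerBr opprD addrACA.
  have eL v : 'd (fun z => psi j z - z) z v = Lz v.
    have [_ e4] := is_diff_id z.
    have iL : continuous (mklin (idl)).
      by move=> u; exact: cvg_id.
    have [_ e5] := diff_sub_lin (L := mklin idl) iL dj.
    exact: e5.
  apply: (le_trans (_ : _ <= `|mklin Ll (y' - y)|)).
    by rewrite le_eqVlt; apply/orP; left; apply/eqP; congr (`|_|); exact: eL.
  apply: le_trans (lin_bound _ _) _; rewrite mulrC ler_wpM2r//.
  have D0 : 0 < (n + n)%:R + 1 :> R by rewrite ltr_wpDl.
  apply: (@le_trans _ _ (\sum_(i < n + n) (2 * ((n + n)%:R + 1))^-1)).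
    by apply: ler_sum => i _; exact: bj.
  rewrite sumr_const card_ord -[leLHS]mulr_natl invfM mulrA ler_pdivrMr// mulrC.
  have : 0 <= (n + n)%:R :> R by [].
  lra.
(* The sum is [q] times the average; each summand differs from the identity by a contraction of
   factor 1/2, so the sum is injective on the ball. *)
pose Lq y := \sum_(j < q) psi j y.
have Linj y y' : ball x r y -> ball x r y' -> Lq y = Lq y' -> y = y'.
  move=> hy hy' LL; apply/eqP; rewrite -subr_eq0 -normr_le0.
  have E : \sum_(j < q) ((psi j y' - y') - (psi j y - y)) = q%:R *: (y - y').
    have -> : \sum_(j < q) ((psi j y' - y') - (psi j y - y)) =
        (Lq y' - Lq y) + \sum_(j < q) (y - y').
      rewrite /Lq -sumrB -big_split; apply: eq_bigr => j _ /=.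
      by rewrite !opprD !opprK addrACA; congr (_ + _); rewrite addrC.
    by rewrite LL subrr add0r sumr_const card_ord scaler_nat.
  have b1 : `|q%:R *: (y - y')| <= \sum_(j < q) 1 / 2 * `|y' - y|.
    by rewrite -E; apply: le_trans (ler_norm_sum _ _ _) _; apply: ler_sum => j _; exact: lip.
  move: b1; rewrite normrZ normr_nat sumr_const card_ord -[leRHS]mulr_natl ler_pM2l ?ltr0n//.
  by rewrite distrC; lra.
have n1 : \forall y \near x, ball x r (psi 1%N y).
  have pc : {for x, continuous (psi 1%N)} := smooth_on_continuous (spsi 1%N) (Ax 1%N).
  have psx : psi 1%N x = x by rewrite /psi /= bx Fj.
  have m0 : nbhs (psi 1%N x) (ball x r) by rewrite psx; exact: nbhsx_ballx.
  exact: (pc _ m0).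
have n2 : \forall y \near x, ball x r y by exact: nbhsx_ballx.
have n3 : \forall y \near x, psi 1%N y = y.
  apply: filterS (filterI (filterI n1 n2) (nA 1%N)) => y [[y1 y2] [ciy [_ dy]]].
  apply: Linj => //; rewrite /Lq.
  have ps j : psi j (psi 1%N y) = psi j.+1 y.
    by rewrite /psi /= (fwdK hN)// mulr1n Phi_mulrn.
  under eq_bigr do rewrite ps.
  (* Composition with [psi 1] shifts the index by one, and the term [psi q] that enters equals the
     term [psi 0] that leaves, because [a *+ q = 0]. *)
  have pq : psi q y = psi 0%N y by rewrite /psi /= aq mulr0n.
  case: (q) pq q0 => // q' pq _.
  rewrite big_ord_recr [RHS]big_ord_recl /= pq addrC; congr (_ + _).
have m1 : \forall p' \near p, psi 1%N (fwd c p') = fwd c p' by exact: (fc _ n3).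
have m2 : \forall p' \near p, A 1%N (fwd c p') by exact: (fc _ (nA 1%N)).
have m3 : \forall p' \near p, dom c p' by exact: open_nbhs_nbhs.
apply: filterS (filterI (filterI m1 m2) m3) => p' [[h1 [_ [_ h2]]] h3].
have e1 : bwd c (psi 1%N (fwd c p')) = Phi a p'.
  rewrite /psi /= (fwdK hN)//; first by rewrite (fwdK hN)// mulr1n.
by rewrite -e1 h1 (fwdK hN).
Qed.

Lemma open_closed_full (A : set N) : A !=set0 -> open A -> closed A -> forall p, A p.
Proof.
move=> A0 oA cA p; have [_ [cN _] _ _ _] := hK.
have -> : A = setT by apply: cN => //; [exists A | exists A] => //; rewrite setTI.
by [].
Qed.

Lemma to_torusMn (t : 'rV[R]_n) k : to_torus t *+ k = to_torus (k%:R *: t).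
Proof.
elim: k => [|k IH]; first by rewrite mulr0n scale0r to_torus0.
rewrite mulrSr IH -natr1 scalerDl scale1r.
have -> : k%:R *: t + t = k%:R *: t - (0 - t) by rewrite sub0r opprK.
by rewrite !to_torusB to_torus0 sub0r opprK.
Qed.

(** An open set without free points is covered by the fixed sets of countably many nontrivial
    torsion elements. By Baire one of these has interior; connectedness and [fix_interior_closed]
    make it all of [N], against effectiveness. *)
Theorem free_points_dense : dense (free_points Phi).
Proof.
apply: contrapT => /denseNE[U [[p0 [oU Up0]] UE]].
have nf p : U p -> ~ free_points Phi p.
  by move=> Up fp; have : (U `&` free_points Phi) p by []; rewrite UE.
have [ca cd] := chart_atP hN p0; set c := chart_at p0 in ca cd.
have [oc oi] := chart_open hN ca; have sb := bwd_sparam hN ca.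
have bc y : cimage c y -> {for y, continuous (bwd c)} by have [_ + _] := sb; apply.
pose x := fwd c p0; have cx : cimage c x by exact: cimage_fwd.
have n1 : nbhs x [set y | cimage c y /\ U (bwd c y)].
  apply: filterI; first exact: open_nbhs_nbhs.
  by apply: cont_nbhs => //; [exact: bc | rewrite /x (fwdK hN)].
have /nbhs_ballP[r /= r0 Hr] := n1.
have r2 : 0 < r / 2 by rewrite divr_gt0.
have sub y : `|x - y| <= r / 2 -> cimage c y /\ U (bwd c y).
  move=> yb; apply: Hr; rewrite -ball_normE /=; apply: le_lt_trans yb _; lra.
(* A countable index for rational vectors: numerators [s.2] over the common denominator [s.1.+1],
   which is never 0. *)
pose T := (nat * {ffun 'I_n -> int})%type.
pose vec (s : T) : 'rV[R]_n := s.1.+1%:R^-1 *: \row_i (s.2 i)%:~R.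
pose fx t : set X := [set y | `|x - y| <= r / 2 /\ Phi (to_torus t) (bwd c y) = bwd c y].
have fxc t : closed (fx t).
  move=> y cy.
  have yb : `|x - y| <= r / 2.
    apply: (@closed_closed_ball_ _ _ x (r / 2)) => B nB.
    by have [z [[z1 _] z2]] := cy B nB; exists z.
  have [ciy _] := sub y yb; split => //; apply: hH => A B nA nB.
  have m1 : nbhs (bwd c y) (Phi (to_torus t) @^-1` A) by apply: cont_pre => //; exact: Phi_cont.
  have m2 : nbhs y (bwd c @^-1` (Phi (to_torus t) @^-1` A)) by exact: (bc y ciy _ m1).
  have m3 : nbhs y (bwd c @^-1` B) by exact: (bc y ciy _ nB).
  have [z [[_ zf] [zA zB]]] := cy _ (filterI m2 m3).
  by exists (bwd c z); split => //; rewrite -[X in A X]zf.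
(* Codes of integer vectors, which act trivially, and codes of nothing give the whole space, so a
   [F k] that is not dense comes from a nontrivial element. *)
pose F k : set X := if (unpickle k : option T) is Some s then
   (if vec s \in intvec then setT else ~` fx (vec s)) else setT.
have Fo k : open (F k).
  rewrite /F; case: (unpickle k) => [s|]; last exact: openT.
  by case: ifP => _; [exact: openT | exact: closed_openC].
have [k nk] : exists k, ~ dense (F k).
  apply: contrapT => H.
  have dF k : open (F k) /\ dense (F k).
    by split => //; apply: contrapT => h; apply: H; exists k.
  have [y [yb0 yF]] := Baire dF (ex_intro _ x (ballxx x r2)) (ball_open x (r / 2)).
  have yb : `|x - y| < r / 2 by have : ball (x : X) (r / 2) y by []; rewrite -ball_normE.
  have [ciy Uy] := sub y (ltW yb).
  have [t [tZ tf [q [q0 qt]]]] := stab_torsion (nf _ Uy).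
  pose s : T := (q.-1, [ffun i => Num.floor ((q%:R *: t) 0 i)]).
  have vs : vec s = t.
    apply/rowP => i; rewrite /vec /= !mxE ffunE prednK//.
    have /forallP/(_ i) := qt; rewrite mxE => /floorK ->.
    by rewrite mulKf// pnatr_eq0 -lt0n.
  have := yF (pickle s) I; rewrite /F pickleK vs (negbTE tZ); apply.
  by split => //; exact: ltW.
move: nk; rewrite /F; case: (unpickle k) => [s|]; last first.
  by move=> /(_ _)[]; move=> O0 [z Oz] _; exists z.
case: ifP => [_|vZ].
  by move=> /(_ _)[]; move=> O0 [z Oz] _; exists z.
move=> /denseNE[W1 [[x1 [oW Wx1]] OE]].
have Ofx y : W1 y -> fx (vec s) y.
  by move=> Oy; apply: contrapT => h; have : (W1 `&` ~` fx (vec s)) y by []; rewrite OE.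
pose a := to_torus (vec s).
have aq : a *+ s.1.+1 = 0.
  apply/eqP; rewrite /a to_torusMn to_torus_eq0 /vec scalerA divff// scale1r.
  by apply/forallP => i; rewrite mxE intr_int.
have [b1 _] := Ofx x1 Wx1; have [ci1 _] := sub x1 b1.
have S0 : [set p : N | \forall p' \near p, Phi a p' = p'] !=set0.
  exists (bwd c x1) => /=.
  have [d1 e1] := bwdK hN ca ci1.
  have fc : {for bwd c x1, continuous (fwd c)} by have [_ _ + _ _] := chart_good hN ca; apply.
  have m1 : nbhs (bwd c x1) (fwd c @^-1` W1) by apply: cont_nbhs => //; rewrite e1.
  have m2 : nbhs (bwd c x1) (dom c) by exact: open_nbhs_nbhs.
  apply: filterS2 m1 m2 => p' /Ofx[_ h] dp; move: h; by rewrite (fwdK hN).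
have aF p : Phi a p = p.
  apply: (@nbhs_singleton _ p [set p | Phi a p = p]).
  apply: (open_closed_full S0); last exact: (fix_interior_closed (ltn0Sn s.1) aq).
  exact: open_interior.
have [_ _ _ /(_ a aF) a0 _] := hK.
by move: vZ; rewrite -to_torus_eq0 -/a a0 eqxx.
Qed.

End Density.

Lemma diff_addc {R : realType} (V W : normedModType R) (f : V -> W) a x :
  differentiable f x -> differentiable (fun y => a + f y) x /\
  forall v, 'd (fun y => a + f y) x v = 'd f x v.
Proof.
move=> df; have [da db] := is_diffD (is_diff_cst a x) (differentiableP df).
split=> [|v]; first exact: da.
apply: (etrans (congr1 (fun h : V -> W => h v) db)).
by rewrite /= add0r.
Qed.

Section SmoothFun.
Context {R : realType} {n : nat} {N : charted R (n + n)}.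
Hypothesis hN : complex_manifold N.

Lemma smooth_fun_sparam e (A : set 'rV[R]_e) Psi (f : N -> R) :
  smooth_fun (f : N -> R^o) -> sparam (N := N) A Psi ->
  smooth_on A (f \o Psi : _ -> R^o).
Proof.
move=> sf sP k; have [oA Pc Ps] := sP; apply: Ck_on_cover => u Au.
have [ca cd] := chart_atP hN (Psi u); set c := chart_at (Psi u) in ca cd.
have oB := sparam_open hN sP ca.
exists (A `&` Psi @^-1` dom c) => //.
have H := Ck_on_comp oB (B := cimage c) _ (Ps c ca k) (sf c ca k).
apply: (Ck_on_ext oB _ (H _)) => x [Ax cx] /=; first by rewrite (fwdK hN).
exact: cimage_fwd.
Qed.

Lemma smooth_fun_continuous (f : N -> R) : smooth_fun (f : N -> R^o) -> continuous (f : N -> R^o).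
Proof.
move=> sf p; have [ca cd] := chart_atP hN p; set c := chart_at p in ca cd.
have [oc oi] := chart_open hN ca.
have fc : {for p, continuous (fwd c)} by have [_ _ + _ _] := chart_good hN ca; apply.
have bc := smooth_on_continuous (sf c ca) (cimage_fwd cd).
have H : {for p, continuous ((f : N -> R^o) \o bwd c \o fwd c)} by exact: continuous_comp fc bc.
apply: cvg_trans; last first.
  have -> : f p = ((f \o bwd c) \o fwd c) p by rewrite /= (fwdK hN).
  exact: H.
apply: near_eq_cvg; have : \forall q \near p, dom c q by exact: open_nbhs_nbhs.
by apply: filterS => q cq /=; rewrite (fwdK hN).
Qed.

Lemma smooth_fun_lin (W : normedModType R) (J : N -> W) (L : {linear W -> R^o}) (b : R) :
  continuous L -> smooth_fun J -> smooth_fun ((fun q => b + L (J q)) : N -> R^o).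
Proof.
move=> cL sJ c ca k; have [_ oi] := chart_open hN ca.
apply: (Ck_onD oi); first exact: Ck_on_cst.
exact: (Ck_on_lin oi cL (sJ c ca k)).
Qed.

Lemma dense_eq (D : set N) (f1 f2 : N -> R) : dense D ->
  continuous (f1 : N -> R^o) -> continuous (f2 : N -> R^o) ->
  (forall p, D p -> f1 p = f2 p) -> forall p, f1 p = f2 p.
Proof.
move=> dD c1 c2 H p; apply/eqP; rewrite -subr_eq0; apply/negPn/negP => nz.
have cB : continuous (fun q => f1 q - f2 q : R^o).
  by move=> q; apply: continuousB; [exact: c1 | exact: c2].
have oB : open ((fun q => f1 q - f2 q : R^o) @^-1` [set~ 0]).
  by apply: open_comp => [q _|]; [exact: cB | exact/closed_openC/closed_eq].
have [q [q1 q2]] := dD _ (ex_intro _ p (elimN eqP nz)) oB.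
by apply: q1; rewrite /= H// subrr.
Qed.

End SmoothFun.

(** * Kahler functions pulled back to [TE] *)

Section Pullback.
Context {R : realType} {m n : nat} (E : expfam R m n) {N : charted R (n + n)}.
Variables (g : tensor2 N) (Phi : torus R n -> N -> N).
Variables (Y : 'I_n -> 'rV[R]_n -> 'rV[R]_n) (G : EL Y -> N).
Hypothesis hK : kahler_toric g Phi.
Hypothesis hT : torification_by E g Phi G.
Local Notation X := 'rV[R]_(n + n).
Local Notation P := (PP G).
Local Notation sv := (efsv E).
Local Notation W := (efW E).
Local Notation cv := (cov sv W).
Let hg : kahler_manifold g. Proof. by case: hK. Qed.
Let hN : complex_manifold N. Proof. by case: hg. Qed.
Let hY : parallel_frame Y. Proof. by case: hT. Qed.

Definition covmx (th : 'rV[R]_n) : 'M[R]_n := \matrix_(i, j) cv th (delta_mx 0 i) (delta_mx 0 j).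

Lemma covmxE th u v : cv th u v = \sum_j (u *m covmx th) 0 j * v 0 j.
Proof.
apply: (bilin_sum (B := cv th)) => w a p q; first exact: covP.
by rewrite ![cv th w _]covC covP.
Qed.

Lemma covmx_unit th : covmx th \in unitmx.
Proof.
rewrite -row_free_unit -kermx_eq0; apply/eqP/row_matrixP => i.
rewrite row0; set u := row i _.
have uB : u *m covmx th = 0 by apply/sub_kermxP; exact: row_sub.
apply/eqP/negP => /negP u0.
have := cov_pos E th u0; rewrite covmxE uB.
by rewrite big1 ?ltxx// => j _; rewrite mxE mul0r.
Qed.

Lemma covmx_smooth i j k : Ck_on k setT (fun x : X => covmx (lsubmx x) i j : R^o).
Proof.
have [s d] := eta_smooth sv (@ef_W0 _ _ _ E) (ef_q0 E) (delta_mx 0 j).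
apply: (Ck_on_ext openT _ (smooth_on_d (row_mx (delta_mx 0 i) 0) s k)) => x _.
by apply: (etrans (d _ _)); rewrite row_mxKl mxE.
Qed.

Lemma cov_inj th u u' : (forall v, cv th u v = cv th u' v) -> u = u'.
Proof.
move=> H; apply/eqP; rewrite -subr_eq0; apply/negPn/negP => nz.
have := cov_pos E th nz; have -> : u - u' = (-1) *: u' + u by rewrite scaleN1r addrC.
by rewrite covP H mulN1r addrC subrr ltxx.
Qed.

Lemma covNl th u v : cv th (- u) v = - cv th u v.
Proof. by rewrite -[- u]addr0 -scaleN1r covP cov0l addr0 mulN1r. Qed.

Lemma ham_pull (f : N -> R) (Xf : vfield N) : smooth_fun (f : N -> R^o) ->
  hamiltonian g f Xf -> exists V : X -> X,
  [/\ smooth_on setT V, forall u, dparam P u (V u) = Xf (P u) &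
    forall x w, 'd (f \o P : X -> R^o) x w = cv (lsubmx x) (lsubmx (V x)) (rsubmx w)
      - cv (lsubmx x) (rsubmx (V x)) (lsubmx w)].
Proof.
move=> sf hX; have sP := PP_sparam hT.
have /choice[V HV] : forall u, exists v, dparam P u v = Xf (P u).
  by move=> u; apply: lin_inj_surj => v; exact: (PP_inj hg hT).
have dV x w : 'd (f \o P : X -> R^o) x w = cv (lsubmx x) (lsubmx (V x)) (rsubmx w)
      - cv (lsubmx x) (rsubmx (V x)) (lsubmx w).
  have [_ e] := dfunE hN w sf sP (I : setT x); apply: (etrans e).
  apply: (etrans (esym (hX (P x) _))); rewrite /kahler_form -HV -(PP_hol hg hT) (PP_iso hg hT).
  rewrite /mulI row_mxKl row_mxKr addrC; congr (_ + _).
  exact: covNl.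
exists V; split => //.
have sfP := smooth_fun_sparam hN sf sP.
(* [V] was chosen pointwise, so its smoothness has to be recovered: the Hamiltonian equation
   expresses both halves of it by derivatives of the function and the inverse covariance matrix. *)
pose b1 (x : X) : 'rV[R]_n := \row_j 'd (f \o P : X -> R^o) x (row_mx (delta_mx 0 j) 0).
pose b2 (x : X) : 'rV[R]_n := \row_j 'd (f \o P : X -> R^o) x (row_mx 0 (delta_mx 0 j)).
have cE x u j : cv x u (delta_mx 0 j) = (u *m covmx x) 0 j.
  by rewrite covmxE -[LHS]/(inner _ _) inner_delta.
have e2 x : lsubmx (V x) = b2 x *m invmx (covmx (lsubmx x)).
  rewrite -[LHS](mulmxK (covmx_unit (lsubmx x))); congr (_ *m _); apply/rowP => j.
  rewrite [RHS]mxE -cE; apply: esym; apply: (etrans (dV x _)).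
  by rewrite row_mxKl row_mxKr cov0r subr0.
have e1 x : - rsubmx (V x) = b1 x *m invmx (covmx (lsubmx x)).
  rewrite -[LHS](mulmxK (covmx_unit (lsubmx x))); congr (_ *m _); apply/rowP => j.
  rewrite [RHS]mxE mulNmx [LHS]mxE -cE; apply: esym; apply: (etrans (dV x _)).
  by rewrite row_mxKl row_mxKr cov0r sub0r.
move=> k; pose iv := fun x : X => invmx (covmx (lsubmx x)).
have siv : Ck_on k setT iv.
  apply: invmx_smooth; [exact: openT | by move=> x _; exact: covmx_unit |].
  by apply: Ck_on_mx => [|i j]; [exact: openT | exact: covmx_smooth].
have sb (w : 'I_n -> X) : Ck_on k setT (fun x : X =>
    (\row_j 'd (f \o P : X -> R^o) x (w j) : 'rV[R]_n) *m iv x).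
  apply: Ck_on_mx => [|i j]; first exact: openT.
  apply: (@Ck_on_ext _ _ _ _ _ (fun x => \sum_l 'd (f \o P : X -> R^o) x (w l) * iv x l j : R^o)).
  - exact: openT.
  - by move=> x _; rewrite ord1 [RHS]mxE; apply: eq_bigr => l _; rewrite mxE.
  apply: Ck_on_sum => [|l]; first exact: openT.
  apply: (Ck_onM openT); first exact: smooth_on_d.
  by apply: Ck_on_entry => //; exact: openT.
apply: (@Ck_on_ext _ _ _ _ _ (fun x => row_mx (b2 x *m iv x) ((-1) *: (b1 x *m iv x)))).
- exact: openT.
- by move=> x _; rewrite -e2 -e1 scaleN1r opprK hsubmxK.
apply: Ck_on_row_mx; [exact: openT | exact: sb |].
have ll : linear (fun x : 'rV[R]_n => (-1) *: x) by move=> a x y; rewrite scalerDr !scalerA mulrC.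
have cl : continuous (mklin ll) by exact: scaler_continuous.
exact: (Ck_on_lin openT cl (sb _)).
Qed.

Lemma kahler_pull (f : N -> R) (Xf : vfield N) : smooth_fun (f : N -> R^o) ->
  smooth_field Xf -> hamiltonian g f Xf -> killing g Xf ->
  exists2 V, kfield sv W (f \o P) V & forall u, dparam P u (V u) = Xf (P u).
Proof.
move=> sf sX hX kX; have [V [sV relV dV]] := ham_pull sf hX.
exists V => //; split => //; first exact: smooth_fun_sparam sf (PP_sparam hT).
move=> x; apply/(hol_related hg (PP_sparam hT) (I : setT x) sX) => //.
- by move=> y v _; exact: (PP_hol hg hT).
- by move=> y v _; exact: (PP_inj hg hT).
- exact: (smooth_on_diff sV).
exact: ((killing_hol_at hg sf sX hX).1 kX).
Qed.

(** On [TE] the Hamiltonian field of an affine function of [eta] is the constant field [(0, -a)],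
    which is holomorphic; density of the free points extends this to [N]. *)
Lemma kahler_of_affine (f : N -> R) (a0 : R) a : smooth_fun (f : N -> R^o) ->
  (forall u, f (P u) = a0 + inner (eta sv W (lsubmx u)) a) -> kahler_function g f.
Proof.
move=> sf fE; split => //; have [Xf sX hX] := hamiltonian_exists hg sf.
exists Xf; split => //; apply/(killing_hol_at hg sf sX hX).
apply: (hol_at_dense hg sX (free_points_dense hK)) => p /(PP_free hT)[u <-].
have [V [sV relV dV]] := ham_pull sf hX.
have [se de] := eta_smooth sv (@ef_W0 _ _ _ E) (ef_q0 E) a.
have dE x w : cv (lsubmx x) (lsubmx w) a = cv (lsubmx x) (lsubmx (V x)) (rsubmx w)
      - cv (lsubmx x) (rsubmx (V x)) (lsubmx w).
  rewrite -dV.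
  have -> : (f \o P : X -> R^o) = (fun x : X => a0 + (inner (eta sv W (lsubmx x)) a : R^o)).
    by apply/funext => y; rewrite /= fE.
  have dd : differentiable (fun x : X => inner (eta sv W (lsubmx x)) a : R^o) x.
    exact: (smooth_on_diff se).
  have [_ e] := diff_addc a0 dd.
  by apply: esym; apply: (etrans (e w)); exact: de.
have VE x : V x = row_mx 0 (- a).
  rewrite -(hsubmxK (V x)); congr row_mx; apply: (@cov_inj (lsubmx x)) => v.
    by have := dE x (row_mx 0 v); rewrite row_mxKl row_mxKr !cov0l cov0r subr0.
  have := dE x (row_mx v 0); rewrite row_mxKl row_mxKr cov0r sub0r => /(congr1 -%R).
  by rewrite opprK => <-; rewrite covNl covC.
apply/(hol_related hg (PP_sparam hT) (I : setT u) sX (V := V)) => //.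
- by move=> y v _; exact: (PP_hol hg hT).
- by move=> y v _; exact: (PP_inj hg hT).
- exact: (smooth_on_diff sV).
move=> w; have -> : V = (fun=> row_mx 0 (- a)) by apply/funext.
have e0 v : 'd (fun _ : X => row_mx 0 (- a) : X) u v = 0 by rewrite diff_cst.
by apply: (etrans (e0 _)); apply: esym; apply: (etrans (congr1 mulI (e0 w)));
  exact: (linear0 (mklin (@mulI_is_linear R n))).
Qed.

Lemma fundamental_PP xi u :
  fundamental_field Phi xi (P u) = dparam P u (row_mx 0 (xi *m Ymx Y)).
Proof.
rewrite /fundamental_field /dparam; set c := chart_at (P u).
have [ca cu] := chart_atP hN (P u).
have d : differentiable (fwd c \o P) u.
  exact: (sparam_diff (PP_sparam hT) ca (I : setT u) cu).
have -> : (fun t : R => fwd c (Phi (to_torus (t *: xi)) (P u))) =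
    (fun t : R => (fwd c \o P) (u + t *: row_mx 0 (xi *m Ymx Y))).
  apply/funext => t /=; rewrite -(PP_action hT) (translateE hY) scale_row_mx scaler0.
  by rewrite -scalemxAl.
have d' : differentiable (fwd c \o P) (u + 0 *: row_mx 0 (xi *m Ymx Y)).
  by rewrite scale0r addr0.
have [_ e] := line_derive d'; rewrite derive1E; apply: (etrans e).
by apply: (congr1 (fun z => 'd (fwd c \o P) z _)); rewrite scale0r addr0.
Qed.

(** The fundamental fields are constant on [TE], so the component of [J] and the negative of a
    component of [eta] have the same differential. *)
Lemma momentum_PP J xi : momentum_map g Phi J -> exists b, forall u,
  inner (J (P u)) xi = b - inner (eta sv W (lsubmx u)) (xi *m Ymx Y).
Proof.
move=> [sJ _ mJ].
have ll : linear (fun x : 'rV[R]_n => inner x xi : R^o) by move=> a x y; rewrite innerP.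
have cl : continuous (mklin ll) := @lin_continuous R n R^o (mklin ll).
have sf0 := smooth_fun_lin hN 0 cl sJ.
have sf : smooth_fun ((fun q => inner (J q) xi) : N -> R^o).
  by move=> c ca k; have := sf0 c ca k; congr (Ck_on _ _ _); apply/funext => y; rewrite /= add0r.
have sP := PP_sparam hT; set a := xi *m Ymx Y.
pose F (u : X) : R^o := inner (J (P u)) xi; pose Ga (u : X) : R^o := inner (eta sv W (lsubmx u)) a.
have [se de] := eta_smooth sv (@ef_W0 _ _ _ E) (ef_q0 E) a.
have dF x : differentiable F x by have [] := dfunE hN 0 sf sP (I : setT x).
have dG x : differentiable Ga x by exact: (smooth_on_diff se).
have dFE x w : 'd F x w = - cv (lsubmx x) a (lsubmx w).
  have [_ e] := dfunE hN w sf sP (I : setT x); apply: (etrans e).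
  apply: (etrans (esym (mJ xi (P x) _))); rewrite /kahler_form fundamental_PP -(PP_hol hg hT).
  rewrite (PP_iso hg hT) /mulI !row_mxKl !row_mxKr.
  by rewrite cov0l addr0 covNl.
have dS x : differentiable (F + Ga) x by exact: differentiableD.
have dSE x w : 'd (F + Ga) x w = 0.
  apply: (etrans (congr1 (fun h : X -> R^o => h w) (diffD (dF x) (dG x)))) => /=.
  apply: (etrans (congr2 +%R (dFE x w) (de x w))).
  by rewrite [cv _ a _]covC addrC subrr.
exists (F 0 + Ga 0) => u.
have [t _ H] := @MVI_real _ _ (F + Ga) 0 u (fun t _ => dS _).
have {H} : (F + Ga) (0 + u) - (F + Ga) 0 = 0 := etrans H (dSE _ _).
rewrite add0r /= => /eqP; rewrite subr_eq0 => /eqP H.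
by apply/eqP; rewrite eq_sym subr_eq eq_sym; apply/eqP.
Qed.

(** The momentum map supplies the extension to all of [N]: up to a constant, the given function of
    [eta] is the component of [J] in the direction [xi], found by inverting the matrix of the
    lattice generator. *)
Lemma affine_kahler a0 a : exists2 f : N -> R, kahler_function g f &
  forall u, f (P u) = a0 + inner (eta sv W (lsubmx u)) a.
Proof.
have [_ _ _ _ [J hJ]] := hK; have [sJ _ _] := hJ.
pose xi := - (a *m invmx (Ymx Y)).
have [b bE] := momentum_PP xi hJ.
have ll : linear (fun x : 'rV[R]_n => inner x xi : R^o) by move=> c x y; rewrite innerP.
have cl : continuous (mklin ll) := @lin_continuous R n R^o (mklin ll).
have fE u : (a0 - b) + inner (J (P u)) xi = a0 + inner (eta sv W (lsubmx u)) a.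
  rewrite bE /xi mulNmx mulmxKV ?(Ymx_unit hY)// innerC innerNl [inner a _]innerC.
  ring.
exists (fun q => (a0 - b) + mklin ll (J q)) => //.
exact: (kahler_of_affine (smooth_fun_lin hN (a0 - b) cl sJ) fE).
Qed.

End Pullback.

(** * Automorphisms from Killing fields *)

Section IntegralCurves.
Context {R : realType} {n : nat} {N : charted R (n + n)}.
Hypothesis hN : complex_manifold N.
Local Notation chartN := (chart R N (n + n)).

Lemma fwd_cont (c : chartN) p : atlas c -> dom c p -> {for p, continuous (fwd c)}.
Proof. by move=> /(chart_good hN)[_ _ + _ _] cp; apply. Qed.

Lemma bwd_cont (c : chartN) x : atlas c -> cimage c x -> {for x, continuous (bwd c)}.
Proof. by move=> /(chart_good hN)[_ _ _ + _] cx; apply. Qed.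

Lemma near_dom (c : chartN) p : atlas c -> dom c p -> \forall q \near p, dom c q.
Proof. by move=> /(chart_open hN)[oc _] cp; apply: open_nbhs_nbhs. Qed.

Lemma near_cimage (c : chartN) x : atlas c -> cimage c x -> \forall y \near x, cimage c y.
Proof. by move=> /(chart_open hN)[_ oc] cp; apply: open_nbhs_nbhs. Qed.

(** Only one pair of charts and some neighbourhood are asked for; [Ck_at_charts] passes to any other
    pair. This form composes well along a chain of short flows. *)
Definition Ck_at k (phi : N -> N) (p : N) := exists c c' : chartN,
  [/\ atlas c, atlas c', dom c p, dom c' (phi p) &
    exists B, [/\ open B, B (fwd c p), (forall x, B x -> cimage c x /\ dom c' (phi (bwd c x))) &
      Ck_on k B (fwd c' \o phi \o bwd c)]].

Lemma Ck_at_charts k phi p (c c' : chartN) : continuous phi -> Ck_at k phi p ->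
  atlas c -> atlas c' -> dom c p -> dom c' (phi p) ->
    exists B, [/\ open B, B (fwd c p), (forall x, B x -> cimage c x /\ dom c' (phi (bwd c x))) &
      Ck_on k B (fwd c' \o phi \o bwd c)].
Proof.
move=> cphi [c1 [c1' [a1 a1' d1 d1' [B1 [oB1 B1p B1c CkB]]]]] ca ca' cp cp'.
pose B := [set x | [/\ cimage c x, dom c' (phi (bwd c x)), dom c1 (bwd c x) & B1 (fwd c1 (bwd c x))]].
have oB : open B.
  rewrite openE => x [x1 x2 x3 x4]; rewrite /interior.
  have bc := bwd_cont ca x1.
  have m1 := near_cimage ca x1.
  have m2 : nbhs x (bwd c @^-1` (phi @^-1` dom c')).
    apply: cont_pre => //; apply: cont_nbhs => //; first exact: cphi.
    by have [] := chart_open hN ca'.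
  have m3 : nbhs x (bwd c @^-1` dom c1) by apply: cont_pre => //; exact: near_dom.
  have m4 : nbhs x (bwd c @^-1` (fwd c1 @^-1` B1)).
    by apply: cont_pre => //; apply: cont_nbhs => //; exact: fwd_cont.
  by apply: filterS (filterI (filterI m1 m2) (filterI m3 m4)) => y [[? ?] [? ?]]; split.
exists B; split => //.
- by split; rewrite ?(fwdK hN)//; exact: cimage_fwd.
- by move=> x [].
have s1 := bwd_sparam hN ca; have [_ _ /(_ c1 a1 k) C1] := s1.
have s2 := bwd_sparam hN a1'; have [_ _ /(_ c' ca' k) C2] := s2.
have C1B : Ck_on k B (fwd c1 \o bwd c).
  by apply: Ck_on_sub C1 => x [x1 _ x3 _].
have C3 := Ck_on_comp_mx oB oB1 (f := fwd c1 \o bwd c) (fun x (Bx : B x) => let: And4 _ _ _ h := Bx in h) C1B CkB.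
have oD := sparam_open hN s2 ca'.
have E2 x : B x -> phi (bwd c1 (fwd c1 (bwd c x))) = phi (bwd c x).
  by move=> [_ _ x3 _]; rewrite (fwdK hN).
have H x : B x -> (cimage c1' `&` bwd c1' @^-1` dom c')
    ((fwd c1' \o phi \o bwd c1) ((fwd c1 \o bwd c) x)).
  move=> Bx; have [x1 x2 x3 x4] := Bx; have [_ x5] := B1c _ x4; rewrite E2// in x5.
  rewrite /= E2//; split; first exact: cimage_fwd.
  by rewrite /= (fwdK hN).
apply: (Ck_on_ext oB _ (Ck_on_comp_mx oB oD H C3 C2)) => x Bx.
have [x1 x2 x3 x4] := Bx; have [_ x5] := B1c _ x4; rewrite E2// in x5.
by rewrite /= E2// (fwdK hN).
Qed.

Lemma Ck_at_smooth phi : continuous phi -> (forall k p, Ck_at k phi p) -> smooth_map_on setT phi.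
Proof.
move=> cphi H; split=> [p _|c c' ca ca' k]; first exact: cphi.
apply: Ck_on_cover => x [cx [_ dx]].
have [dp fx] := bwdK hN ca cx.
have [B [oB Bx _ CB]] := Ck_at_charts cphi (H k (bwd c x)) ca ca' dp dx.
exists B; [by rewrite fx in Bx | exact: CB].
Qed.

Lemma Ck_at_comp k phi1 phi2 p : continuous phi1 -> continuous phi2 ->
  Ck_at k phi1 p -> Ck_at k phi2 (phi1 p) -> Ck_at k (phi2 \o phi1) p.
Proof.
move=> c1 c2 H1 H2.
have [a0 d0] := chart_atP hN p; have [a1 d1] := chart_atP hN (phi1 p).
have [a2 d2] := chart_atP hN (phi2 (phi1 p)).
set c := chart_at p in a0 d0; set c' := chart_at (phi1 p) in a1 d1.
set c'' := chart_at _ in a2 d2.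
have [B1 [oB1 B1p B1c C1]] := Ck_at_charts c1 H1 a0 a1 d0 d1.
have [B2 [oB2 B2p B2c C2]] := Ck_at_charts c2 H2 a1 a2 d1 d2.
exists c, c''; split => //.
pose B := [set x | B1 x /\ B2 (fwd c' (phi1 (bwd c x)))].
have oB : open B.
  rewrite openE => x [x1 x2]; have [cx dx] := B1c x x1.
  have m1 : nbhs x B1 by exact: open_nbhs_nbhs.
  have m2 : nbhs x (bwd c @^-1` (phi1 @^-1` (fwd c' @^-1` B2))).
    apply: cont_pre; first exact: bwd_cont.
    apply: cont_pre; first exact: c1.
    by apply: cont_nbhs => //; exact: fwd_cont.
  exact: filterI m1 m2.
exists B; split => //.
- by split; rewrite ?(fwdK hN).
- move=> x [x1 x2]; have [cx dx] := B1c x x1; split => //.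
  by have [_] := B2c _ x2; rewrite (fwdK hN).
have C1B : Ck_on k B (fwd c' \o phi1 \o bwd c) by apply: Ck_on_sub C1 => x [].
apply: (Ck_on_ext oB _ (Ck_on_comp_mx oB oB2 _ C1B C2)) => x [x1 x2] //=.
by have [_ dx] := B1c x x1; rewrite (fwdK hN).
Qed.

Lemma compact_unif (Q : R -> N -> Prop) : compact [set: N] ->
  (forall c c' p, 0 < c' <= c -> Q c p -> Q c' p) ->
  (forall p : N, exists2 c, 0 < c & nbhs p (Q c)) ->
  exists2 c, 0 < c & forall p, Q c p.
Proof.
move=> /compact_near_coveringP cN mono loc.
have H : \forall c \near (0:R)^'+, [set: N] `<=` Q c.
  apply: cN => p _; have [c c0 Hc] := loc p.
  have n1 : \forall c' \near (0:R)^'+, 0 < c' <= c.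
    near=> c'; apply/andP; split; near: c'; first exact: nbhs_right_gt.
    exact: nbhs_right_le.
  exists (Q c, [set c' | 0 < c' <= c]) => //= -[p' c'] /= [qp cc].
  exact: mono cc qp.
have H2 : \forall c \near (0:R)^'+, 0 < c by exact: nbhs_right_gt.
have [c [c0 Hc]] := filter_ex (filterI H2 H).
by exists c => // p; exact: Hc.
Unshelve. all: by end_near. Qed.

Lemma compact_unif_time (Q : R -> N -> Prop) : compact [set: N] ->
  (forall p : N, exists2 c, 0 < c & nbhs p [set q | forall t : R, `|t| < c -> Q t q]) ->
  exists2 c, 0 < c & forall p (t : R), `|t| < c -> Q t p.
Proof.
move=> cN; apply: compact_unif => // c c' p /andP[_ cc] H t tc.
by apply: H; exact: lt_le_trans cc.
Qed.

Variable Z : vfield N.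
Hypothesis sZ : smooth_field Z.
Local Notation X := 'rV[R]_(n + n).
Let hH : hausdorff_space N. Proof. by case: hN. Qed.

Definition icurve (ga : R -> N) (T : R) := forall t : R, `|t| < T ->
  {for (t : R^o), continuous (ga : R^o -> N)} /\ forall c : chartN, atlas c -> dom c (ga t) ->
    is_derive t 1 (fwd c \o ga) (field_in Z c (fwd c (ga t))).

Lemma diff_derive (W : normedModType R) (f : R -> W) (x : R) :
  differentiable (f : R^o -> W) x -> is_derive x 1 f ('d (f : R^o -> W) x 1).
Proof.
move=> df; apply: DeriveDef; first exact: diff_derivable.
by rewrite deriveE.
Qed.

Lemma derive_comp_near (V W : normedModType R) (u : R -> V) (F : V -> W) (h : R -> W) (t : R) u' :
  is_derive t 1 u u' -> differentiable F (u t) ->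
  (\forall s \near (t : R^o), F (u s) = h s) -> is_derive t 1 h ('d F (u t) u').
Proof.
move=> du dF E; have [d1 d2] := derive_diff du.
have [dh dhE] := diff_near_comp (f := u : R^o -> V) (h := h : R^o -> W) 1 erefl d1 dF E.
have := diff_derive dh; congr (is_derive _ _ _ _).
by apply: (etrans dhE); congr ('d F _ _); apply: (etrans (d2 1)); rewrite scale1r.
Qed.

Lemma icurve_chart (c : chartN) (x : R -> X) T : atlas c ->
  (forall t : R, `|t| < T -> cimage c (x t) /\ is_derive t 1 x (field_in Z c (x t))) ->
  icurve (fun t => bwd c (x t)) T.
Proof.
move=> ca H t tT; have [cx dx] := H t tT; have [dfx _] := derive_diff dx.
have xc : {for (t : R^o), continuous (x : R^o -> X)} by exact: differentiable_continuous.
split; first exact: continuous_comp xc (bwd_cont ca cx).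
move=> c' ca' dc'; have [dp fx] := bwdK hN ca cx.
have sb := bwd_sparam hN ca.
have dF : differentiable (fwd c' \o bwd c) (x t) by exact: (sparam_diff sb ca' cx dc').
have E : \forall s \near (t : R^o), (fwd c' \o bwd c) (x s) = (fwd c' \o (fun t => bwd c (x t))) s.
  exact: filterE.
have := derive_comp_near dx dF E; congr (is_derive _ _ _ _).
have [aa ad] := chart_atP hN (bwd c (x t)); set p := bwd c (x t) in dp fx dc' aa ad *.
have e2 : field_in Z c (x t) = comp_in c p (Z p) by rewrite -fx (field_inE hN).
apply: (etrans (congr1 ('d (fwd c' \o bwd c) (x t)) e2)).
apply: (etrans (congr1 (fun z => 'd (fwd c' \o bwd c) z (comp_in c p (Z p))) (esym fx))).
apply: (etrans _ (esym (field_inE hN Z ca' dc'))).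
exact: (transition_chain hN (Z p) aa ca ca' ad dp dc').
Qed.

(** The times of agreement form a set that is open by local uniqueness, closed since [N] is
    Hausdorff, and contains 0, in a connected interval. *)
Lemma icurve_unique ga ga' T : icurve ga T -> icurve ga' T -> ga 0 = ga' 0 ->
  forall t : R, `|t| < T -> ga t = ga' t.
Proof.
move=> H1 H2 e0 t tT.
have T0 : 0 < T by apply: le_lt_trans tT.
pose A := `]-T, T[%classic : set R^o.
have AE s : A s <-> `|s| < T by rewrite /A /= in_itv /= ltr_norml.
have oA : open A by exact: interval_open.
have cA : connected A by exact/connected_intervalP/interval_is_interval.
pose B := [set s : R^o | A s /\ ga s = ga' s].
suff : B t by case.
have -> : B = A; last by apply/AE.
apply: cA.
- by exists 0; split => //; apply/AE; rewrite normr0.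
- exists B; last by apply/seteqP; split=> s; [move=> [? ?]; split | case].
  rewrite openE => s [As es]; have As' := (AE s).1 As.
  have [aa ad] := chart_atP hN (ga s); set c := chart_at (ga s) in aa ad.
  have [_ oi] := chart_open hN aa.
  have nn (g1 : R -> N) : icurve g1 T -> g1 s = ga s ->
      \forall r \near (s : R^o), dom c (g1 r) /\
        is_derive (r : R) 1 (fwd c \o g1) (field_in Z c ((fwd c \o g1) r)).
    move=> H es1; have [gc _] := H s As'.
    have m1 : nbhs (s : R^o) (g1 @^-1` dom c).
      apply: (cont_nbhs (f := g1 : R^o -> N)) => //; last by rewrite es1.
      by have [] := chart_open hN aa.
    have m2 : nbhs (s : R^o) A by exact: open_nbhs_nbhs.
    apply: filterS2 m1 m2 => r r1 /AE r2; split => //.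
    by have [_] := H r r2; apply.
  have n1 := nn _ H1 erefl; have n2 := nn _ H2 (esym es).
  have e : \forall r \near (s : R^o), (fwd c \o ga) r = (fwd c \o ga') r.
    apply: (ode_unique_near oi (sZ aa 1%N)).
    - exact: cimage_fwd.
    - by rewrite /= es.
    - by apply: filterS n1 => r [].
    - by apply: filterS n2 => r [].
  have m2 : nbhs (s : R^o) A by exact: open_nbhs_nbhs.
  apply: filterS (filterI (filterI n1 n2) (filterI e m2)) => r [[[r1 _] [r2 _]] [/= r3 r4]].
  by split => //; rewrite -(fwdK hN aa r1) r3 (fwdK hN).
exists (closure B); first exact: closed_closure.
apply/seteqP; split=> [s Bs|s [As cs]]; first by split; [case: Bs | exact: subset_closure].
split => //; apply: hH => C1 C2 n1 n2; have As' := (AE s).1 As.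
have [gc1 _] := H1 s As'; have [gc2 _] := H2 s As'.
have m1 : nbhs (s : R^o) (ga @^-1` C1) by exact: (cont_pre (f := ga : R^o -> N)).
have m2 : nbhs (s : R^o) (ga' @^-1` C2) by exact: (cont_pre (f := ga' : R^o -> N)).
have [r [[_ er] [r1 r2]]] := cs _ (filterI m1 m2).
by exists (ga r); split => //; rewrite er.
Qed.

Lemma icurve_le ga T T' : T' <= T -> icurve ga T -> icurve ga T'.
Proof. by move=> TT H t tT; apply: H; exact: lt_le_trans TT. Qed.

Lemma icurve_shift ga T (s : R) : icurve ga T -> icurve (fun t => ga (s + t)) (T - `|s|).
Proof.
move=> H t tT; have st : `|s + t| < T.
  by apply: le_lt_trans (ler_normD _ _) _; rewrite addrC -ltrBrDr.
have [gc gd] := H (s + t) st; split.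
  apply: (@continuous_comp R^o R^o N (fun t : R^o => s + t) ga) => //.
  apply: continuousD; [exact: cst_continuous | exact: cvg_id].
move=> c ca dc; exact: is_derive_shiftl (gd c ca dc).
Qed.

Definition lflow (c : chartN) (x0 : X) (A : set X) (M r tau : R) (F : R -> X -> X) :=
  [/\ atlas c, cimage c x0, A `<=` cimage c & flow_on A (field_in Z c) M x0 r tau F].

Lemma lflow_exists p : exists A M r tau F, lflow (chart_at p) (fwd (chart_at p) p) A M r tau F.
Proof.
have [aa ad] := chart_atP hN p; have [_ oi] := chart_open hN aa.
have [A [M [r [tau [F [AA FF]]]]]] := local_flow oi (cimage_fwd ad) (sZ aa 1%N).
by exists A, M, r, tau, F; split => //; exact: cimage_fwd.
Qed.

Lemma lflow_curve c x0 A M r tau F p : lflow c x0 A M r tau F -> dom c p -> ball x0 r (fwd c p) ->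
  bwd c (F 0 (fwd c p)) = p /\ icurve (fun t => bwd c (F t (fwd c p))) tau.
Proof.
move=> [ca cx0 AA FF] cp pr; have [oA rA lV [r0 c0 M0 cM] H] := FF.
have [F0 Ft] := H _ pr; split; first by rewrite F0 (fwdK hN).
apply: (icurve_chart (x := fun t => F t (fwd c p)) ca) => t tt.
by have [Ax dx] := Ft t tt; split => //; exact: AA.
Qed.

Lemma lflow_near p c A M r tau F : atlas c -> dom c p ->
  lflow c (fwd c p) A M r tau F -> \forall q \near p, dom c q /\ ball (fwd c p) r (fwd c q).
Proof.
move=> ca cp [_ _ _ [_ _ _ [r0 _ _ _] _]].
have m1 := near_dom ca cp.
have m2 : nbhs p (fwd c @^-1` ball (fwd c p) r).
  by apply: cont_pre; [exact: fwd_cont | exact: nbhsx_ballx].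
exact: filterI m1 m2.
Qed.

End IntegralCurves.

Section KillingConst.
Context {R : realType} {n : nat} {N : charted R (n + n)} (g : tensor2 N).
Hypothesis hg : kahler_manifold g.
Variable Z : vfield N.
Hypothesis kZ : killing g Z.
Local Notation X := 'rV[R]_(n + n).
Local Notation chartN := (chart R N (n + n)).

Definition gmx (c : chartN) (x : X) : 'M[R]_(n + n) :=
  \matrix_(i, j) tensor_in g c x (delta_mx 0 i) (delta_mx 0 j).

Lemma gmxE (c : chartN) (x u v : X) : tensor_in g c x u v = inner (u *m gmx c x) v.
Proof.
apply: (bilin_sum (B := tensor_in g c x)) => w a p q.
  by rewrite /tensor_in linearP (gl hg).
by rewrite /tensor_in (gsym hg) linearP (gl hg) ![g _ _ ('d _ _ w)](gsym hg).
Qed.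

(** Along a trajectory of [Z], with [a] and [b] solving the variational equation, the derivative of
    the product is the left-hand side of the Killing equation. *)
Lemma killing_const (c : chartN) (x a b : R -> X) T : 0 < T -> atlas c ->
  (forall t : R, `|t| < T -> cimage c (x t) /\ is_derive t 1 x (field_in Z c (x t))) ->
  (forall t : R, `|t| < T -> is_derive t 1 a ('d (field_in Z c) (x t) (a t))) ->
  (forall t : R, `|t| < T -> is_derive t 1 b ('d (field_in Z c) (x t) (b t))) ->
  forall t : R, `|t| < T ->
  tensor_in g c (x t) (a t) (b t) = tensor_in g c (x 0) (a 0) (b 0).
Proof.
move=> T0 ca Hx Ha Hb; have [_ [_ _ _ sg] _ _] := hg.
apply: (@const_of_derive0 R (fun t => tensor_in g c (x t) (a t) (b t)) T T0) => t tT.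
have [cx dx] := Hx t tT; have da := Ha t tT; have db := Hb t tT.
pose V := field_in Z c (x t); pose D := lin1_mx ('d (field_in Z c) (x t)).
have DE v : 'd (field_in Z c) (x t) v = v *m D by rewrite mul_rV_lin1.
pose gij i j : X -> R^o := fun y => tensor_in g c y (delta_mx 0 i) (delta_mx 0 j).
have dgij i j : differentiable (gij i j) (x t) by exact: (smooth_on_diff (sg c ca _ _)).
pose G' : 'M[R]_(n + n) := \matrix_(i, j) 'd (gij i j) (x t) V.
have dgx i j : is_derive t 1 (fun s => gij i j (x s)) (G' i j).
  rewrite mxE; apply: (derive_comp_near dx (dgij i j)); exact: filterE.
have G'E : G' = - (D *m gmx c (x t)) - gmx c (x t) *m D^T.
  apply/matrixP => i j; rewrite !mxE.
  have := kZ ca cx (delta_mx 0 i) (delta_mx 0 j).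
  set d := 'd _ _ _ => /eqP; rewrite -addrA addr_eq0 => /eqP -> {d}.
  rewrite opprD; congr (- _ - _).
    rewrite gmxE (DE (delta_mx 0 i)) -rowE -row_mul.
    by rewrite inner_delta !mxE.
  rewrite gmxE (DE (delta_mx 0 j)) -!rowE /inner.
  by apply: eq_bigr => l _; rewrite !mxE.
have du : is_derive t 1 (fun s => a s *m gmx c (x s)) (a t *m D *m gmx c (x t) + a t *m G').
  apply: derive_mx_entries => j.
  have dcol : is_derive t 1 (fun s => \row_i gij i j (x s) : X) (\row_i G' i j).
    apply: derive_mx_entries => i; rewrite mxE.
    by under eq_fun do rewrite mxE.
  have di := is_derive_inner da dcol; rewrite DE in di.
  have -> : (fun s => (a s *m gmx c (x s)) 0 j) = (fun s => inner (a s) (\row_i gij i j (x s))).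
    by apply/funext => s; rewrite mxE; apply: eq_bigr => i _; rewrite !mxE.
  apply: (is_derive_eq di); rewrite !mxE; congr (_ + _); apply: eq_bigr => i _; rewrite !mxE//.
have dt := is_derive_inner du db.
have -> : (fun t => tensor_in g c (x t) (a t) (b t)) = (fun s => inner (a s *m gmx c (x s)) (b s)).
  by apply/funext => s; rewrite gmxE.
apply: (is_derive_eq dt); rewrite DE G'E mulmxBr mulmxN !mulmxA addrA subrr add0r innerNl.
have -> : inner (a t *m gmx c (x t) *m D^T) (b t) = inner (a t *m gmx c (x t)) (b t *m D).
  have ie (u v : X) : inner u v = (u *m v^T) 0 0 by rewrite mxE; apply: eq_bigr => i _; rewrite mxE.
  by rewrite !ie trmx_mul mulmxA.
by rewrite addrC subrr.
Qed.

End KillingConst.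

Lemma cont_pair (T U V : topologicalType) (f : T -> U) (h : T -> V) x :
  {for x, continuous f} -> {for x, continuous h} -> {for x, continuous (fun t => (f t, h t))}.
Proof.
move=> cf ch B [[B1 B2] /= [n1 n2] sub].
have m1 : nbhs x (f @^-1` B1) by exact: cont_pre.
have m2 : nbhs x (h @^-1` B2) by exact: cont_pre.
by apply: filterS2 m1 m2 => t t1 t2; apply: sub.
Qed.

(** * Flows of holomorphic Killing fields on a compact manifold *)

Section Flow.
Context {R : realType} {n : nat} {N : charted R (n + n)} (g : tensor2 N).
Hypothesis hg : kahler_manifold g.
Hypothesis cN : compact [set: N].
Variable Z : vfield N.
Hypotheses (sZ : smooth_field Z) (kZ : killing g Z) (hZ : forall p, hol_at Z p).
Local Notation X := 'rV[R]_(n + n).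
Let hN : complex_manifold N. Proof. by case: hg. Qed.

Lemma flow_time : exists2 T, 0 < T & forall p, exists ga : R -> N, ga 0 = p /\ icurve Z ga T.
Proof.
apply: (compact_unif cN) => [c c' p /andP[_ cc] [ga [g0 gI]]|p].
  by exists ga; split => //; exact: icurve_le cc gI.
have [A [M [r [tau [F lf]]]]] := lflow_exists hN sZ p.
have [aa ad] := chart_atP hN p; have [_ _ _ [_ _ _ [_ tau0 _ _] _]] := lf.
exists tau => //; apply: filterS (lflow_near hN aa ad lf) => q [dq bq].
by have [h1 h2] := lflow_curve hN lf dq bq; exists (fun t => bwd (chart_at p) (F t (fwd (chart_at p) q))).
Qed.

Variables (T : R) (phi : R -> N -> N).
Hypotheses (T0 : 0 < T) (phi0 : forall p, phi 0 p = p).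
Hypothesis phiI : forall p, icurve Z (phi^~ p) T.

Lemma phiD s t p : `|s| + `|t| < T -> phi (t + s) p = phi s (phi t p).
Proof.
move=> st; apply: (icurve_unique hN sZ (ga := fun s => phi (t + s) p) (ga' := fun s => phi s (phi t p))
   (T := T - `|t|)).
- exact: (icurve_shift (ga := phi^~ p)).
- by apply: icurve_le (phiI (phi t p)); rewrite lerBlDr lerDl.
- by rewrite addr0 phi0.
by rewrite ltrBrDr.
Qed.

Lemma phi_local c x0 A M r tau F q (t : R) : lflow Z c x0 A M r tau F -> dom c q ->
  ball x0 r (fwd c q) -> `|t| < tau -> `|t| < T -> phi t q = bwd c (F t (fwd c q)).
Proof.
move=> lf dq bq tt tT; have [h1 h2] := lflow_curve hN lf dq bq.
apply: (icurve_unique hN sZ (ga := phi^~ q) (ga' := fun t => bwd c (F t (fwd c q)))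
   (T := Num.min tau T)).
- by apply: icurve_le (phiI q); rewrite ge_min lexx orbT.
- by apply: icurve_le h2; rewrite ge_min lexx.
- by rewrite phi0 h1.
by rewrite lt_min tt.
Qed.

Lemma phi_continuous : exists2 c, 0 < c & forall p (t : R), `|t| < c ->
  {for ((t : R^o), p), continuous (fun z : R^o * N => phi z.1 z.2)}.
Proof.
apply: (compact_unif_time cN) => p.
have [A [M [r [tau [F lf]]]]] := lflow_exists hN sZ p.
have [aa ad] := chart_atP hN p; set c := chart_at p in aa ad lf *.
have [_ _ AA FF] := lf; have [oA rA lV [r0 tau0 M0 cM] HF] := FF.
exists (Num.min tau T); first by rewrite lt_min tau0.
apply: filterS (lflow_near hN aa ad lf) => q [dq bq] t.
rewrite lt_min => /andP[tt tT].
have n1 : \forall z \near ((t : R^o), q), `|z.1 : R| < tau /\ `|z.1 : R| < T.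
  have m1 := near_norm_lt (V := R^o) tt; have m2 := near_norm_lt (V := R^o) tT.
  exists ([set s : R^o | `|s| < tau /\ `|s| < T], setT) => /=; last by move=> z [].
  by split; [exact: filterI m1 m2 | exact: filterT].
have n2 : \forall z \near ((t : R^o), q), dom c z.2 /\ ball (fwd c p) r (fwd c z.2).
  have m1 := near_dom hN aa dq.
  have m2 : nbhs q (fwd c @^-1` ball (fwd c p) r).
    by apply: cont_nbhs; [exact: fwd_cont | exact: ball_open | exact: bq].
  exists (setT, [set q' | dom c q' /\ ball (fwd c p) r (fwd c q')]) => /=; last by move=> z [].
  by split; [exact: filterT | exact: filterI m1 m2].
have [_ Ft] := HF _ bq; have [At dFt] := Ft t tt.
have Fc : {for ((t : R^o), q), continuous (fun z : R^o * N => F z.1 (fwd c z.2))}.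
  have [dft _] := derive_diff dFt.
  have c1 : {for (t : R^o), continuous (fun s : R^o => F s (fwd c q))}.
    exact: differentiable_continuous.
  have c2 := fwd_cont hN aa dq.
  apply/cvgrPdist_lt => e e0.
  have e2 : 0 < e / 2 by rewrite divr_gt0.
  have e4 : 0 < e / 4 by rewrite divr_gt0.
  have /cvgrPdist_lt/(_ _ e2) m1 := c1; have /cvgrPdist_lt/(_ _ e4) m2 := c2.
  have n3 : \forall z \near ((t : R^o), q), `|F t (fwd c q) - F z.1 (fwd c q)| < e / 2
      /\ `|fwd c q - fwd c z.2| < e / 4.
    exists ([set s : R^o | `|F t (fwd c q) - F s (fwd c q)| < e / 2],
            [set q' | `|fwd c q - fwd c q'| < e / 4]) => /=; first by split.
    by move=> z [].
  apply: filterS (filterI (filterI n1 n2) n3) => z [[[z1 _] [_ z2]] [z3 z4]].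
  have z5 := flow_on_lip FF bq z2 z1.
  have -> : F t (fwd c q) - F z.1 (fwd c z.2) = (F t (fwd c q) - F z.1 (fwd c q)) +
     (F z.1 (fwd c q) - F z.1 (fwd c z.2)) by rewrite addrA subrK.
  apply: le_lt_trans (ler_normD _ _) _; lra.
have Bc := continuous_comp Fc (bwd_cont hN aa (AA _ At)).
have E : \forall z \near ((t : R^o), q), bwd c (F z.1 (fwd c z.2)) = phi z.1 z.2.
  apply: filterS (filterI n1 n2) => z [[z1 z2] [z3 z4]].
  by rewrite (phi_local lf z3 z4).
apply: cvg_trans; first exact: (near_eq_cvg E).
by rewrite (phi_local lf dq bq).
Qed.

Lemma phi_Ck k : exists2 c, 0 < c & forall p (t : R), `|t| < c -> Ck_at k (phi t) p.
Proof.
apply: (compact_unif_time cN) => p.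
have [A [M [r [tau [F lf]]]]] := lflow_exists hN sZ p.
have [aa ad] := chart_atP hN p; set c := chart_at p in aa ad lf *.
have [_ cx0 AA FF] := lf; have [oA rA lV [r0 tau0 M0 cM] HF] := FF.
have sV : smooth_on A (field_in Z c) by move=> j; apply: (Ck_on_sub AA (sZ aa j)).
have [r' [c' [/andP[r'0 rr] /andP[c'0 cc] HC]]] := flow_Ck k sV FF.
exists (Num.min c' T); first by rewrite lt_min c'0.
have lf' : lflow Z c (fwd c p) A M r' c' F.
  by split => //; apply: flow_on_sub FF; apply/andP.
apply: filterS (lflow_near hN aa ad lf') => q [dq bq] t.
rewrite lt_min => /andP[tt tT].
have HA x : ball (fwd c p) r' x -> cimage c x /\ cimage c (F t x).
  move=> bx; have bx' : ball (fwd c p) r x by exact: le_ball rr _ bx.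
  have [_ /(_ t (lt_le_trans tt cc))[h _]] := HF x bx'.
  by split; apply: AA => //; exact: rA.
have pE x : ball (fwd c p) r' x -> phi t (bwd c x) = bwd c (F t x).
  move=> bx; have [cx _] := HA x bx; have [dx fx] := bwdK hN aa cx.
  by rewrite (phi_local lf' dx) ?fx.
exists c, c; split => //.
  rewrite -(fwdK hN aa dq) pE//; have [_ cF] := HA _ bq.
  by have [] := bwdK hN aa cF.
exists (ball (fwd c p) r'); split => //; first exact: ball_open.
  move=> x bx; have [cx cF] := HA x bx; split => //; rewrite pE//.
  by have [] := bwdK hN aa cF.
apply: (Ck_on_ext (ball_open _ _) _ (HC t tt)) => x bx /=.
by rewrite pE//; have [_ cF] := HA x bx; have [_ ->] := bwdK hN aa cF.
Qed.


Lemma phi_dmap : exists2 c, 0 < c & forall p (t : R), `|t| < c -> forall u v,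
  dmap (phi t) p (mulI u) = mulI (dmap (phi t) p u) /\
  g (phi t p) (dmap (phi t) p u) (dmap (phi t) p v) = g p u v.
Proof.
apply: (compact_unif_time cN) => p.
have [A [M [r [tau [F lf]]]]] := lflow_exists hN sZ p.
have [aa ad] := chart_atP hN p; set c := chart_at p in aa ad lf *.
have [_ cx0 AA FF] := lf; have [oA rA lV [r0 tau0 M0 cM] HF] := FF.
have sV : smooth_on A (field_in Z c) by move=> j; apply: (Ck_on_sub AA (sZ aa j)).
have [r1 [c1 [/andP[r10 rr1] /andP[c10 cc1] HC]]] := flow_Ck 1 sV FF.
have [r2 [c2 [/andP[r20 rr2] /andP[c20 cc2] HD]]] := flow_d sV FF.
pose c3 := Num.min (Num.min c1 c2) T; pose r3 := Num.min r1 r2.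
have c30 : 0 < c3 by rewrite !lt_min c10 c20 T0.
have r30 : 0 < r3 by rewrite !lt_min r10 r20.
have r3r : r3 <= r by rewrite ge_min rr1.
have c3t : c3 <= tau by rewrite !ge_min cc1.
exists c3 => //.
have lf' : lflow Z c (fwd c p) A M r3 c3 F.
  by split => //; apply: flow_on_sub FF; apply/andP.
apply: filterS (lflow_near hN aa ad lf') => q [dq bq].
set x := fwd c q in bq; have bx : ball (fwd c p) r x by exact: le_ball r3r _ bq.
have [F0 Ft] := HF x bx.
have tc (s : R) : `|s| < c3 -> [/\ `|s| < c1, `|s| < c2 & `|s| < T].
  by rewrite !lt_min => /andP[/andP[-> ->] ->].
have dF s : `|s| < c3 -> differentiable (F s) x.
  move=> /tc[s1 _ _]; have [+ _] := HC s s1; apply.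
  by move: bq; apply: le_ball; rewrite ge_min lexx.
have dD v (s : R) : `|s| < c3 -> is_derive s 1 (fun s => 'd (F s) x v) ('d (field_in Z c) (F s x) ('d (F s) x v)).
  move=> /tc[_ s2 _]; apply: HD => //.
  by move: bq; apply: le_ball; rewrite ge_min lexx orbT.
have Hx (s : R) : `|s| < c3 -> cimage c (F s x) /\ is_derive s 1 (fun s => F s x) (field_in Z c (F s x)).
  by move=> s3; have [h1 h2] := Ft s (lt_le_trans s3 c3t); split => //; exact: AA.
have d0 v : 'd (F 0) x v = v.
  have E : \forall y \near x, y = F 0 y.
    have : nbhs x (ball (fwd c p) r) by apply: open_nbhs_nbhs; split => //; exact: ball_open.
    by apply: filterS => y by_; have [->] := HF y by_.
  have did : differentiable (fun y : X => y) x by exact: ex_diff.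
  have [_ e2] := near_eq_diff E did; apply: (etrans (congr1 (fun h : X -> X => h v) e2)).
  by have [_ e4] := is_diff_id x; exact: (congr1 (fun h : X -> X => h v) e4).
have iso (s : R) u v : `|s| < c3 ->
    tensor_in g c (F s x) ('d (F s) x u) ('d (F s) x v) = tensor_in g c x u v.
  move=> s3; have e := killing_const hg kZ (a := fun s => 'd (F s) x u) (b := fun s => 'd (F s) x v)
    c30 aa Hx (dD u) (dD v) s3.
  apply: (etrans e); apply: (etrans (congr1 (fun z => tensor_in g c z _ _) F0)).
  exact: (congr2 (tensor_in g c x) (d0 u) (d0 v)).
(* The defect [w] of complex linearity solves the variational equation, because the field is
   holomorphic, and vanishes at time 0; [killing_const] keeps its length equal to 0. *)
have hol (s : R) u : `|s| < c3 -> 'd (F s) x (mulI u) = mulI ('d (F s) x u).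
  move=> s3; pose w (s : R) := 'd (F s) x (mulI u) - mulI ('d (F s) x u).
  have VI (r' : R) v : `|r'| < c3 -> 'd (field_in Z c) (F r' x) (mulI v) = mulI ('d (field_in Z c) (F r' x) v).
    move=> r3'; have [cF _] := Hx r' r3'; have [dF' fF] := bwdK hN aa cF.
    have H := @hZ (bwd c (F r' x)) c v aa dF'.
    apply: (etrans (congr1 (fun z => 'd (field_in Z c) z (mulI v)) (esym fF))).
    exact: (etrans H (congr1 (fun z => mulI ('d (field_in Z c) z v)) fF)).
  have dw (r' : R) : `|r'| < c3 -> is_derive r' 1 w ('d (field_in Z c) (F r' x) (w r')).
    move=> r3'; have d1 := dD (mulI u) r' r3'; have d2 := dD u r' r3'.
    have d3 := is_derive_lin (L := mklin (@mulI_is_linear R n)) (@mulI_continuous R n) d2.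
    apply: (is_derive_eq (is_deriveB d1 d3)) => /=.
    apply: (etrans (congr1 (fun z => 'd (field_in Z c) (F r' x) ('d (F r') x (mulI u)) - z)
      (esym (VI r' ('d (F r') x u) r3')))).
    exact: (esym (raddfB ('d (field_in Z c) (F r' x)) _ _)).
  have := killing_const hg kZ (a := w) (b := w) c30 aa Hx dw dw s3.
  have w00 : w 0 = 0 := etrans (congr2 (fun a b => a - mulI b) (d0 _) (d0 _)) (subrr _).
  rewrite w00.
  rewrite (gmxE hg c (F 0 x) 0) mul0mx inner0l.
  have [cF _] := Hx s s3; have [dF' fF] := bwdK hN aa cF.
  have ee := tensor_inE hN g (w s) (w s) aa dF'.
  have e2 : tensor_in g c (F s x) (w s) (w s) = tensor_in g c (fwd c (bwd c (F s x))) (w s) (w s).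
    exact: (congr1 (fun z => tensor_in g c z (w s) (w s)) (esym fF)).
  rewrite e2 ee => w0.
  apply/eqP; rewrite -subr_eq0 -/(w s); apply/negPn/negP => nz.
  have nz' : comp_out c (bwd c (F s x)) (w s) != 0.
    by apply: contra_neq nz; exact: (comp_out_eq0 hg).
  by have := gpos hg (bwd c (F s x)) nz'; rewrite w0 ltxx.
move=> t t3 u v.
have [_ _ tT] := tc t t3.
have pE : phi t q = bwd c (F t x) by exact: (phi_local lf' dq bq t3 tT).
have [cF _] := Hx t t3; have [dF' fF] := bwdK hN aa cF.
have dm w : dmap (phi t) q w = comp_out c (phi t q) ('d (F t) x (comp_in c q w)).
  have [a0 b0] := chart_atP hN q; have [a1 b1] := chart_atP hN (phi t q).
  rewrite /dmap; set e0 := chart_at q in a0 b0 *; set e1 := chart_at (phi t q) in a1 b1 *.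
  have dA : differentiable (fwd c \o bwd e0) (fwd e0 q) by exact: (transition_diff hN).
  have fq : (fwd c \o bwd e0) (fwd e0 q) = x by rewrite /= (fwdK hN).
  have dB : differentiable (fwd e1 \o bwd c) (F t x).
    by rewrite -fF -pE; apply: (transition_diff hN) => //; rewrite pE.
  have dBF := differentiable_comp (dF t t3) dB.
  have E : \forall y \near fwd e0 q, ((fwd e1 \o bwd c) \o F t) ((fwd c \o bwd e0) y) =
      (fwd e1 \o phi t \o bwd e0) y.
    have bc := bwd_cont hN a0 (cimage_fwd b0).
    have m0 : nbhs q [set q' | dom c q' /\ ball (fwd c p) r3 (fwd c q')].
      apply: filterI; first exact: near_dom.
      by apply: cont_nbhs; [exact: fwd_cont | exact: ball_open | exact: bq].
    have m1 : nbhs (fwd e0 q) (bwd e0 @^-1` [set q' | dom c q' /\ ball (fwd c p) r3 (fwd c q')]).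
      by apply: cont_pre => //; rewrite (fwdK hN).
    apply: filterS m1 => y [y1 y2] /=.
    by rewrite (phi_local lf' y1 y2 t3 tT).
  have [_ e] := diff_near_comp w fq dA dBF E; apply: (etrans e).
  apply: (etrans (congr1 (fun h : X -> X => h _) (diff_comp (dF t t3) dB))).
  rewrite /comp_out /comp_in /=; apply: (congr1 (fun z => 'd (fwd e1 \o bwd c) z _)).
  by rewrite pE fF.
have dp : dom c (phi t q) by rewrite pE.
rewrite !dm; split.
  by rewrite (comp_in_mulI hN)// hol// (comp_out_mulI hN).
rewrite -(tensor_inE hN g _ _ aa dp) pE fF iso// (tensor_inE hN g _ _ aa dq).
by rewrite !(comp_inK hN).
Qed.

Variable c : R.
Hypotheses (c0 : 0 < c) (cT : c <= T / 2).
Hypothesis Hc : forall p (t : R), `|t| < c ->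
    {for ((t : R^o), p), continuous (fun z : R^o * N => phi z.1 z.2)}.
Hypothesis Hd : forall p (t : R), `|t| < c -> forall u v,
  dmap (phi t) p (mulI u) = mulI (dmap (phi t) p u) /\
  g (phi t p) (dmap (phi t) p u) (dmap (phi t) p v) = g p u v.

Lemma phi_add (s t : R) p : `|s| < c -> `|t| < c -> phi (t + s) p = phi s (phi t p).
Proof.
move=> sc tc; apply: phiD.
by have := cT; move: sc tc; lra.
Qed.

Lemma phi_cont (s : R) : `|s| < c -> continuous (phi s).
Proof.
move=> sc p.
have cp : {for p, continuous (fun p : N => ((s : R^o), p))}.
  by apply: cont_pair; [exact: cst_continuous | exact: cvg_id].
have H := continuous_comp cp (@Hc p s sc).
by move=> B nB; exact: (H B nB).
Qed.

(** The time interval of [phi_Ck] shrinks with [k], whereas [t] is fixed: [phi t] is therefore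
    written as a composite of [j] flows of duration [t / j], with [j] depending on [k]. *)
Lemma phi_smooth (t : R) : `|t| < c -> smooth_map_on setT (phi t).
Proof.
move=> tc; apply: (Ck_at_smooth hN); first exact: phi_cont.
move=> k p; have [ck ck0 Hk] := phi_Ck k.
pose j := (Num.truncn (`|t| / ck)).+1.
have j0 : 0 < j%:R :> R by rewrite ltr0n.
have tj : `|t / j%:R| < ck.
  rewrite normrM normfV normr_nat ltr_pdivrMr// mulrC -ltr_pdivrMr//.
  exact: truncnS_gt.
have tjc i : (i <= j)%N -> `|i%:R * (t / j%:R)| < c.
  move=> ij; rewrite mulrCA normrM; apply: le_lt_trans tc.
  by rewrite [`|_ / _|]ger0_norm ?divr_ge0// ler_piMr// ler_pdivrMr// mul1r ler_nat.
have tj1 : `|t / j%:R| < c by have := tjc 1%N isT; rewrite mul1r.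
have st i : (i <= j)%N -> Ck_at k (phi (i%:R * (t / j%:R))) p.
  elim: i => [_|i IH ij].
    by rewrite mul0r; apply: Hk; rewrite normr0.
  have e : phi (i.+1%:R * (t / j%:R)) = phi (t / j%:R) \o phi (i%:R * (t / j%:R)).
    apply/funext => q; rewrite -natr1 mulrDl mul1r /= phi_add//.
    by apply: tjc; exact: ltnW.
  rewrite e; apply: (Ck_at_comp hN).
  - by apply: phi_cont; apply: tjc; exact: ltnW.
  - exact: phi_cont.
  - by apply: IH; exact: ltnW.
  exact: Hk.
by have := st j (leqnn j); rewrite mulrC divfK ?gt_eqF.
Qed.

Lemma phi_holomorphic (t : R) : `|t| < c -> holomorphic_map (phi t).
Proof.
move=> tc; split; first exact: phi_smooth.
by move=> p v; have [] := Hd p tc v v.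
Qed.

Lemma phiK (t : R) : `|t| < c -> cancel (phi t) (phi (- t)).
Proof.
move=> tc p; rewrite -phi_add ?normrN//; by rewrite subrr phi0.
Qed.

Lemma phi_Aut (t : R) : `|t| < c -> Aut g (phi t).
Proof.
move=> tc; have tc' : `|- t| < c by rewrite normrN.
split; [exact: phi_holomorphic | by move=> p u v; have [] := Hd p tc u v |].
exists (phi (- t)); split; [exact: phiK | | exact: phi_holomorphic].
by have := phiK tc'; rewrite opprK.
Qed.

(** The derivative at time [t] is that of [f \o phi t] at time 0, where the trajectory is known to
    have velocity [Z p]. *)
Lemma phi_derive (f : N -> R) p (t : R) : smooth_fun (f : N -> R^o) -> `|t| < c ->
  is_derive t 1 (fun s => f (phi s p)) (dfun ((f \o phi t) : N -> R^o) p (Z p)).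
Proof.
move=> sf tc; have sfp := smooth_fun_comp hg (phi_smooth tc) sf.
have [aa ad] := chart_atP hN p; set e := chart_at p in aa ad *.
have [_ /(_ e aa)] := phiI p (t := 0) ltac:(by rewrite normr0).
rewrite phi0 => /(_ ad) d0.
have dF : differentiable ((f \o phi t : N -> R^o) \o bwd e) ((fwd e \o phi^~ p) 0).
  by rewrite /= phi0; apply: (smooth_on_diff (sfp e aa)); exact: cimage_fwd.
have E : \forall s \near (0 : R^o), ((f \o phi t : N -> R^o) \o bwd e) ((fwd e \o phi^~ p) s) =
    f (phi (t + s) p).
  have m1 : nbhs (0 : R^o) ((phi^~ p : R^o -> N) @^-1` dom e).
    apply: cont_nbhs; [by have [] := phiI p (t := 0) ltac:(by rewrite normr0) | | by rewrite phi0].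
    by have [] := chart_open hN aa.
  have m2 : nbhs (0 : R^o) [set s : R^o | `|s| < c] by apply: (near_norm_lt (V := R^o)); rewrite normr0.
  apply: filterS2 m1 m2 => s s1 s2 /=; rewrite (fwdK hN)//.
  by rewrite addrC phi_add.
have d1 := derive_comp_near d0 dF E.
have d2 : is_derive (- t + t) 1 (fun s => f (phi (t + s) p))
   (dfun ((f \o phi t) : N -> R^o) p (Z p)).
  rewrite addNr; apply: (is_derive_eq d1).
  have e1 : field_in Z e (fwd e p) = Z p.
    exact: (etrans (field_inE hN Z aa ad) (transition_id hN (Z p) aa ad)).
  apply: (etrans (congr1 ('d ((f \o phi t : N -> R^o) \o bwd e) ((fwd e \o phi^~ p) 0)) e1)).
  apply: (congr1 (fun q => 'd ((f \o phi t : N -> R^o) \o bwd e) (fwd e q) (Z p))); exact: phi0.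
have := is_derive_shiftl d2.
by have -> : (fun s : R => f (phi (t + (- t + s)) p)) = (fun s => f (phi s p))
  by apply/funext => s; rewrite addrA subrr add0r.
Qed.

End Flow.

(** * Automorphisms joined to the identity by a path *)

Section PathAut.
Context {R : realType} {n : nat} {N : charted R (n + n)} (g : tensor2 N).
Hypothesis hg : kahler_manifold g.
Let hN : complex_manifold N. Proof. by case: hg. Qed.

Lemma smooth_map_comp (phi psi : N -> N) : smooth_map_on setT phi -> smooth_map_on setT psi ->
  smooth_map_on setT (phi \o psi).
Proof.
move=> s1 s2; split=> [p _|c c' ca ca'].
  by apply: continuous_comp; [have [+ _] := s2; apply | have [+ _] := s1; apply].
have [_ _ /(_ c' ca')] := sparam_comp hN s1 (sparam_comp hN s2 (bwd_sparam hN ca)).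
by move=> H k; apply: (Ck_on_sub _ (H k)) => x [x1 [_ x2]]; split.
Qed.

Lemma dmap_comp (phi psi : N -> N) p v : smooth_map_on setT phi -> smooth_map_on setT psi ->
  dmap (phi \o psi) p v = dmap phi (psi p) (dmap psi p v).
Proof.
move=> s1 s2; have [aa ad] := chart_atP hN p.
have sP := sparam_comp hN s2 (bwd_sparam hN aa).
have := dparam_comp hN v s1 sP (cimage_fwd ad).
rewrite /dparam /= (fwdK hN aa ad).
exact.
Qed.

Lemma Aut_comp (phi psi : N -> N) : Aut g phi -> Aut g psi -> Aut g (phi \o psi).
Proof.
move=> [[s1 I1] i1 [phi' [K1 K1' h1]]] [[s2 I2] i2 [psi' [K2 K2' h2]]].
have hc (a b : N -> N) : holomorphic_map a -> holomorphic_map b -> holomorphic_map (a \o b).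
  move=> [sa Ia] [sb Ib]; split; first exact: smooth_map_comp.
  by move=> p v; rewrite !(dmap_comp _ _ sa sb) Ib Ia.
split; [exact: (hc _ _ (conj s1 I1) (conj s2 I2)) | |].
  move=> p u v; apply: (etrans (congr2 (g _) (dmap_comp p u s1 s2) (dmap_comp p v s1 s2))).
  exact: (etrans (i1 _ _ _) (i2 _ _ _)).
exists (psi' \o phi'); split; [exact: can_comp | exact: can_comp | exact: hc].
Qed.

Lemma dmap_id p v : dmap (id : N -> N) p v = v.
Proof.
have [aa ad] := chart_atP hN p.
exact: (transition_id hN v aa ad).
Qed.

Lemma Aut_id : Aut g (id : N -> N).
Proof.
have hid : holomorphic_map (id : N -> N).
  split; last by move=> p v; rewrite !dmap_id.
  split=> [p _|c c' ca ca']; first exact: cvg_id.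
  have [_ _ /(_ c' ca')] := bwd_sparam hN ca.
  by move=> H k; apply: (Ck_on_sub _ (H k)) => x [x1 [_ x2]]; split.
split => //; first by move=> p u v; rewrite !dmap_id.
by exists id; split.
Qed.

Lemma Aut_inv (phi psi : N -> N) : Aut g phi -> cancel phi psi -> cancel psi phi -> Aut g psi.
Proof.
move=> [[s1 I1] i1 [psi' [K1 K1' [h1 h2]]]] K K'.
have e : psi' = psi by apply/funext => p; rewrite -{1}(K' p) K1.
rewrite {}e in K1 K1' h1 h2.
split; [by split | | by exists phi; split].
move=> p u v; rewrite -i1 K' -!(dmap_comp _ _ s1 h1).
have -> : phi \o psi = id by apply/funext => q /=; rewrite K'.
by rewrite !dmap_id.
Qed.

(** A jointly continuous path of automorphisms from the identity. Such paths compose pointwise, and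
    currying makes them continuous for the compact-open topology, so they stay in [Aut0]. *)
Definition Paut (phi : N -> N) := exists F : R^o * N -> N,
  [/\ continuous F, (forall s, Aut g (fun p => F (s, p))),
    forall p, F (0, p) = p & forall p, F (1, p) = phi p].

Lemma Paut_Aut phi : Paut phi -> Aut g phi.
Proof.
move=> [F [_ /(_ 1) FA _ F1]].
by have -> : phi = (fun p => F (1, p)) by apply/funext => p; rewrite F1.
Qed.

Lemma Paut_id : Paut id.
Proof.
exists (fun z => z.2); split => // [z|s]; first exact: cvg_snd.
exact: Aut_id.
Qed.

Lemma Paut_comp phi psi : Paut phi -> Paut psi -> Paut (phi \o psi).
Proof.
move=> [F [cF FA F0 F1]] [G [cG GA G0 G1]].
exists (fun z => F (z.1, G z)); split.
- move=> z; apply: (@continuous_comp _ _ _ (fun z : R^o * N => (z.1, G z)) F z) => //.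
    by apply: cont_pair; [exact: cvg_fst | exact: cG].
  exact: cF.
- move=> s; exact: (Aut_comp (phi := fun p => F (s, p)) (psi := fun p => G (s, p)) (FA s) (GA s)).
- by move=> p /=; rewrite F0 G0.
by move=> p /=; rewrite F1 G1.
Qed.

Lemma Paut_Aut0 phi : Paut phi -> Aut0 g phi.
Proof.
move=> [F [cF FA F0 F1]].
have cc := continuous_curry_fun cF.
pose S := (curry F : R^o -> {compact-open, N -> N}) @` `[0, 1]%classic.
have S0 : S id.
  exists 0; first by rewrite /= in_itv /= lexx ler01.
  by apply/funext => p; rewrite /curry F0.
have S1 : S phi.
  exists 1; first by rewrite /= in_itv /= lexx ler01.
  by apply/funext => p; rewrite /curry F1.
have SA : S `<=` Aut g by move=> _ [s _ <-]; exact: FA.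
have cS : connected S.
  apply: connected_continuous_connected; first exact: segment_connected.
  by apply: continuous_subspaceT; exact: cc.
exact: (connected_component_max S0 SA cS).
Qed.

End PathAut.

Section KahlerFlow.
Context {R : realType} {n : nat} {N : charted R (n + n)} (g : tensor2 N).
Hypothesis hg : kahler_manifold g.
Hypothesis cN : compact [set: N].

Theorem kahler_flow (k : N -> R) (Z : vfield N) : smooth_fun (k : N -> R^o) ->
  smooth_field Z -> hamiltonian g k Z -> killing g Z ->
  exists (c : R) (phi : R -> N -> N), [/\ 0 < c, forall p, phi 0 p = p,
    forall t : R, `|t| < c -> [/\ Paut g (phi t), Paut g (phi (- t)), cancel (phi t) (phi (- t))
       & cancel (phi (- t)) (phi t)] &
    forall (f : N -> R) p (t : R), smooth_fun (f : N -> R^o) -> `|t| < c ->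
      is_derive t 1 (fun s => f (phi s p)) (dfun ((f \o phi t) : N -> R^o) p (Z p))].
Proof.
move=> sk sZ hZ kZ; have holZ := (killing_hol_at hg sk sZ hZ).1 kZ.
have [T T0 /choice[ph Hph]] := flow_time hg cN sZ.
pose phi t p := ph p t.
have phi0 p : phi 0 p = p by have [] := Hph p.
have phiI p : icurve Z (phi^~ p) T by have [] := Hph p.
have [c1 c10 H1] := phi_continuous hg cN sZ T0 phi0 phiI.
have [c2 c20 H2] := phi_dmap hg cN sZ kZ holZ T0 phi0 phiI.
pose c := Num.min (T / 2) (Num.min c1 c2).
have c0 : 0 < c by rewrite !lt_min divr_gt0// c10 c20.
have cT : c <= T / 2 by rewrite ge_min lexx.
have cc1 (t : R) : `|t| < c -> `|t| < c1 by rewrite !lt_min => /andP[_ /andP[]].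
have cc2 (t : R) : `|t| < c -> `|t| < c2 by rewrite !lt_min => /andP[_ /andP[]].
have Hc p (t : R) (tc : `|t| < c) := H1 p t (cc1 t tc).
have Hd p (t : R) (tc : `|t| < c) := H2 p t (cc2 t tc).
have pA := phi_Aut hg cN sZ T0 phi0 phiI cT Hc Hd.
have pP (t : R) : `|t| < c -> Paut g (phi t).
  (* The path must be defined for every real [s] while the flow is controlled only for short times:
     clamping [s * t] keeps all times bounded by [|t|] and equals 0 and [t] at the two ends. *)
  move=> tc; pose cl (s : R) := Num.max (- `|t|) (Num.min `|t| (s * t)).
  have clb s : `|cl s| < c.
    apply: le_lt_trans tc; rewrite ler_norml /cl le_max lexx /= ge_max ge_min lexx /= andbT.
    by have := normr_ge0 t; lra.
  have cl1 : cl 1 = t by rewrite /cl mul1r; exact: clamp_id.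
  have cl0 : cl 0 = 0 by rewrite /cl mul0r; apply: clamp_id; rewrite normr0.
  have clc : continuous (cl : R^o -> R^o).
    apply: (@lip_continuous R R^o R^o cl `|t|) => // s s'.
    apply: le_trans (clamp_lip _ _ (normr_ge0 t)) _.
    by rewrite -mulrBl normrM mulrC.
  exists (fun z => phi (cl z.1) z.2); split.
  - move=> z; have cz : {for z, continuous (fun z : R^o * N => ((cl z.1 : R^o), z.2))}.
      apply: cont_pair; last exact: cvg_snd.
      by apply: (@continuous_comp _ _ _ (fun z : R^o * N => z.1) (cl : R^o -> R^o)); [exact: cvg_fst | exact: clc].
    have H := continuous_comp cz (Hc z.2 (cl z.1) (clb z.1)).
    by move=> B nB; exact: (H B nB).
  - by move=> s /=; apply: pA.
  - by move=> p /=; rewrite cl0 phi0.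
  by move=> p /=; rewrite cl1.
exists c, phi; split => //.
  move=> t tc; have tc' : `|- t| < c by rewrite normrN.
  split; [exact: pP | exact: pP | exact: (phiK hg sZ phi0 phiI cT tc) |].
  by have := phiK hg sZ phi0 phiI cT tc'; rewrite opprK.
by move=> f p t sf tc; exact: (phi_derive hg cN sZ T0 phi0 phiI c0 cT Hc p sf tc).
Qed.

End KahlerFlow.

Lemma subspace_mx {R : realType} {d : nat} (S : set 'rV[R]_d) : S 0 ->
  (forall a x y, S x -> S y -> S (a *: x + y)) ->
  exists M : 'M[R]_d, forall x : 'rV[R]_d, S x <-> (x <= M)%MS.
Proof.
move=> S0 SP.
pose Q r := `[< exists2 M : 'M[R]_d, (forall x : 'rV[R]_d, (x <= M)%MS -> S x) & \rank M = r >].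
have Q0 : exists r, Q r.
  exists 0%N; apply/asboolP; exists 0; last exact: mxrank0.
  by move=> x; rewrite submx0 => /eqP ->.
have Qn r : Q r -> (r <= d)%N by move=> /asboolP[M _ <-]; exact: rank_leq_row.
have [r /asboolP[M SM Mr] max] := ex_maxnP Q0 Qn.
exists M => x; split; last exact: SM.
move=> Sx; have SM' (y : 'rV[R]_d) : (y <= (M + <<x>>)%MS)%MS -> S y.
  move=> /sub_addsmxP[[a b] /= ->].
  have : (b *m <<x>> <= x)%MS by rewrite -(genmxE x) submxMl.
  move=> /sub_rVP[s ->]; rewrite addrC; apply: SP => //; apply: SM; exact: submxMl.
have : (\rank (M + <<x>>)%MS <= \rank M)%N.
  by rewrite Mr; apply: max; apply/asboolP; exists (M + <<x>>)%MS.
have sM : (M <= M + <<x>>)%MS by exact: addsmxSl.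
by rewrite (geq_leqif (mxrank_leqif_sup sM)) addsmx_sub genmxE => /andP[].
Qed.

Section KahlerLinear.
Context {R : realType} {n : nat} {N : charted R (n + n)} (g : tensor2 N).
Hypothesis hg : kahler_manifold g.
Local Notation X := 'rV[R]_(n + n).
Local Notation chartN := (chart R N (n + n)).
Let hN : complex_manifold N. Proof. by case: hg. Qed.

Lemma smooth_funP (f f' : N -> R) a : smooth_fun (f : N -> R^o) -> smooth_fun (f' : N -> R^o) ->
  smooth_fun ((fun p => a * f p + f' p) : N -> R^o).
Proof.
move=> sf sf' c ca k; have [_ oi] := chart_open hN ca.
apply: (Ck_onD oi); last exact: sf'.
by apply: (Ck_onM oi); [exact: Ck_on_cst | exact: sf].
Qed.

Lemma diffP (V W : normedModType R) (f f' : V -> W) (a : R) x :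
  differentiable f x -> differentiable f' x ->
  differentiable (fun y => a *: f y + f' y) x /\
  forall v, 'd (fun y => a *: f y + f' y) x v = a *: 'd f x v + 'd f' x v.
Proof.
move=> df df'; have [d1 e1] := is_diffD (is_diffZ a (differentiableP df)) (differentiableP df').
split=> [|v]; first exact: d1.
exact: (congr1 (fun h : V -> W => h v) e1).
Qed.

Lemma kahlerP (f f' : N -> R) a : kahler_function g f -> kahler_function g f' ->
  kahler_function g (fun p => a * f p + f' p).
Proof.
move=> [sf [Y [sY hY kY]]] [sf' [Z [sZ hZ kZ]]].
have s := smooth_funP a sf sf'; split => //.
pose U : vfield N := fun p => a *: Y p + Z p.
have UE (c : chartN) x : field_in U c x = a *: field_in Y c x + field_in Z c x.
  by rewrite /field_in /U linearP.
have sU : smooth_field U.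
  move=> c ca k; have [_ oi] := chart_open hN ca.
  apply: (@Ck_on_ext _ _ _ _ _ (fun x => a *: field_in Y c x + field_in Z c x)) => //.
  have ll : linear (fun x : X => a *: x) by move=> b x y; rewrite scalerDr !scalerA mulrC.
  have cl : continuous (mklin ll) by exact: scaler_continuous.
  by apply: (Ck_onD oi); [exact: (Ck_on_lin oi cl (sY c ca k)) | exact: sZ].
have hU : hamiltonian g (fun p => a * f p + f' p) U.
  move=> p v; rewrite /kahler_form /U mulID mulIZ (gl hg).
  have [aa ad] := chart_atP hN p.
  have d1 : differentiable ((f : N -> R^o) \o bwd (chart_at p)) (fwd (chart_at p) p).
    exact: (smooth_on_diff (sf _ aa) (cimage_fwd ad)).
  have d2 : differentiable ((f' : N -> R^o) \o bwd (chart_at p)) (fwd (chart_at p) p).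
    exact: (smooth_on_diff (sf' _ aa) (cimage_fwd ad)).
  have [_ e] := diffP a d1 d2; apply: esym; apply: (etrans (e v)).
  by apply: (congr2 (fun x y => a * x + y)); [exact: (esym (hY p v)) | exact: (esym (hZ p v))].
exists U; split; [exact: sU | exact: hU |].
apply/(killing_hol_at hg s sU hU) => p c u ca cp.
have h1 := (killing_hol_at hg sf sY hY).1 kY p c u ca cp.
have h2 := (killing_hol_at hg sf' sZ hZ).1 kZ p c u ca cp.
have d1 : differentiable (field_in Y c) (fwd c p) by exact: (smooth_on_diff (sY _ ca) (cimage_fwd cp)).
have d2 : differentiable (field_in Z c) (fwd c p) by exact: (smooth_on_diff (sZ _ ca) (cimage_fwd cp)).
have -> : field_in U c = (fun x => a *: field_in Y c x + field_in Z c x) by apply/funext.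
have [_ e] := diffP a d1 d2.
apply: (etrans (e (mulI u))); apply: (etrans (congr2 (fun x y => a *: x + y) h1 h2)).
apply: (etrans _ (congr1 mulI (esym (e u)))).
by rewrite mulID mulIZ.
Qed.

Lemma dfun_field_continuous (f : N -> R) (Z : vfield N) : smooth_fun (f : N -> R^o) ->
  smooth_field Z -> continuous ((fun p => dfun (f : N -> R^o) p (Z p)) : N -> R^o).
Proof.
move=> sf sZ p; have [ca cp] := chart_atP hN p; set c := chart_at p in ca cp.
have [oc oi] := chart_open hN ca; have sb := bwd_sparam hN ca.
pose h (x : X) : R^o := \sum_i (field_in Z c x) 0 i * 'd ((f : N -> R^o) \o bwd c) x (delta_mx 0 i).
have hE q : dom c q -> h (fwd c q) = dfun (f : N -> R^o) q (Z q).
  move=> cq; have [_ e] := dfunE hN (field_in Z c (fwd c q)) sf sb (cimage_fwd cq).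
  have bq := fwdK hN ca cq.
  have e1 : h (fwd c q) = 'd ((f : N -> R^o) \o bwd c) (fwd c q) (field_in Z c (fwd c q)).
    rewrite /h; move: (field_in Z c (fwd c q)) => v.
    rewrite [v in RHS]row_sum_delta linear_sum.
    by apply: eq_bigr => i _; rewrite linearZ.
  apply: (etrans e1); apply: (etrans e).
  have e2 : dparam (bwd c) (fwd c q) (field_in Z c (fwd c q)) = Z q.
    apply: (etrans (dparam_bwd hN _ ca cq)).
    apply: (etrans (congr1 (comp_out c q) (field_inE hN Z ca cq))).
    exact: (comp_inK hN).
  apply: (etrans (congr1 (dfun (f : N -> R^o) _) e2)).
  exact: (congr1 (fun r => dfun (f : N -> R^o) r (Z q)) bq).
have hc : {for fwd c p, continuous h}.
  have : Ck_on 0 (cimage c) h.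
    apply: Ck_on_sum => // i; apply: Ck_onM => //.
      by apply: Ck_on_entry => //; exact: sZ.
    exact: (smooth_on_d _ (sf c ca)).
  by apply; exact: cimage_fwd.
have H := continuous_comp (fwd_cont hN ca cp) hc.
have E : \forall q \near p, (h \o fwd c) q = dfun (f : N -> R^o) q (Z q).
  by apply: filterS (near_dom hN ca cp) => q cq /=; exact: hE.
apply: cvg_trans; first exact: (near_eq_cvg E).
by rewrite -hE.
Qed.

End KahlerLinear.

(** * Permutations from affine maps *)

Section LocalExponentials.
Context {R : realType}.

Lemma is_derive_near_eq (W : normedModType R) (f h : R -> W) (t : R) w :
  is_derive t 1 f w -> (\forall s \near (t : R^o), f s = h s) -> is_derive t 1 h w.
Proof.
move=> df fh; have [d1 d2] := derive_diff df.
have [dh dhE] := near_eq_diff (f := f : R^o -> W) (g := h : R^o -> W) fh d1.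
apply: (is_derive_eq (diff_derive dh)).
by apply: (etrans (congr1 (fun z : R^o -> W => z 1) dhE)); apply: (etrans (d2 1)); rewrite scale1r.
Qed.

Lemma is_derive_expl (l t : R) : is_derive t 1 (fun s => expR (l * s)) (l * expR (l * t)).
Proof.
have h : is_derive t 1 (fun s : R => l * s) l.
  by apply: (is_derive_eq (is_deriveZ l (is_derive_id t 1))); rewrite /GRing.scale /= mulr1.
by apply: (is_derive_eq (is_derive1_comp (is_derive_expR (l * t)) h)); rewrite mulrC.
Qed.

(** Dividing by the [j]-th exponential and differentiating removes the [j]-th term and leaves the
    others with factors [l i - l j] that are nonzero. *)
Lemma exp_indep1 (I : eqType) (S : seq I) (l c : I -> R) (r : R) : 0 < r -> uniq S ->
  {in S &, injective l} ->
  (forall t : R, `|t| < r -> \sum_(i <- S) c i * expR (l i * t) = 0) ->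
  forall i, i \in S -> c i = 0.
Proof.
move=> r0; elim: S c => [//|j S IH] c /= /andP[jS uS] lI H.
have lj i : i \in S -> l i - l j != 0.
  move=> iS; rewrite subr_eq0; apply/eqP => /lI e.
  by move: jS; rewrite -e ?iS ?inE ?iS ?eqxx ?orbT.
have dS (t : R) : is_derive t 1 (fun s => \sum_(i <- S) c i * expR ((l i - l j) * s))
    (\sum_(i <- S) c i * ((l i - l j) * expR ((l i - l j) * t))).
  elim: (S) => [|i S' IHs].
    by under eq_fun do rewrite big_nil; rewrite big_nil; exact: is_derive_cst.
  under eq_fun do rewrite big_cons; rewrite big_cons.
  apply: is_deriveD; exact: (is_deriveZ (c i) (is_derive_expl _ _)).
have H2 (t : R) : `|t| < r -> \sum_(i <- S) c i * expR ((l i - l j) * t) = - c j.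
  move=> tr; have := H t tr; rewrite big_cons => /(congr1 (fun z => z * expR (- (l j * t)))).
  rewrite mul0r mulrDl -mulrA -expRD subrr expR0 mulr1 => /eqP; rewrite addrC addr_eq0 => /eqP <-.
  rewrite mulr_suml; apply: eq_bigr => i _; rewrite -mulrA -expRD; congr (_ * expR _).
  by rewrite mulrBl.
have cS i : i \in S -> c i = 0.
  move=> iS; suff : c i * (l i - l j) = 0.
    by move=> /eqP; rewrite mulf_eq0 (negbTE (lj i iS)) orbF => /eqP.
  apply: (IH (fun i => c i * (l i - l j))) => //.
    by move=> a b aS bS; apply: lI; rewrite inE ?aS ?bS orbT.
  move=> t tr.
  have nt : \forall s \near (t : R^o), \sum_(i <- S) c i * expR ((l i - l j) * s) = - c j.
    by apply: filterS (near_norm_lt (V := R^o) tr) => s; exact: H2.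
  have d0 := is_derive_near_eq (dS t) nt.
  have e0 : \sum_(i <- S) c i * ((l i - l j) * expR ((l i - l j) * t)) = 0.
    by rewrite -(@derive_val _ _ _ _ _ _ _ d0) derive_cst.
  have e1 := congr1 (fun z => z * expR (l j * t)) e0; rewrite mul0r in e1.
  rewrite -[RHS]e1 mulr_suml; apply: eq_bigr => k _; rewrite -!mulrA -expRD; congr (_ * (_ * expR _)).
  by rewrite mulrBl subrK.
move=> i; rewrite inE => /predU1P[->|/cS//].
have z0 : `|0 : R| < r by rewrite normr0.
have := H2 0 z0; rewrite big_seq big1 => [/esym/eqP|k kS]; last by rewrite cS// mul0r.
by rewrite oppr_eq0 => /eqP.
Qed.

(** Restriction to a line in a generic direction keeps the exponents distinct and reduces to one
    variable. *)
Lemma exp_indep_loc n (S : seq 'rV[R]_n) (c : 'rV[R]_n -> R) (th0 : 'rV[R]_n) (r : R) : 0 < r ->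
  uniq S -> (forall th, `|th - th0| < r -> \sum_(v <- S) c v * expR (inner v th) = 0) ->
  forall v, v \in S -> c v = 0.
Proof.
move=> r0 uS H v vS.
have [xi Hxi] := generic_vector [seq p.1 - p.2 | p <- [seq (a, b) | a <- S, b <- S]].
have D0 : 0 < `|xi| + 1 by rewrite ltr_wpDl.
suff : c v * expR (inner v th0) = 0.
  by move=> /eqP; rewrite mulf_eq0 (gt_eqF (expR_gt0 _)) orbF => /eqP.
apply: (@exp_indep1 _ S (fun v => inner v xi) (fun v => c v * expR (inner v th0)) (r / (`|xi| + 1))) => //.
- by rewrite divr_gt0.
- move=> a b aS bS ab; apply/eqP; rewrite -subr_eq0; apply/negPn/negP => nz.
  have mm : a - b \in [seq p.1 - p.2 | p <- [seq (a, b) | a <- S, b <- S]].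
    by apply/mapP; exists (a, b) => //; apply/allpairsP; exists (a, b).
  by have := Hxi _ mm nz; rewrite innerBl ab subrr eqxx.
move=> t tr; rewrite -[RHS](H (th0 + t *: xi)).
  by apply: eq_bigr => w _; rewrite innerDr innerZr -mulrA -expRD [t * _]mulrC.
rewrite addrC addKr normrZ; move: tr; rewrite ltr_pdivlMr// => tr; apply: le_lt_trans tr.
by rewrite ler_wpM2l// lerDl.
Qed.

(** Coefficients of equal exponentials agree. On each side the exponents are distinct and the
    weights positive, so each exponent of one side occurs exactly once on the other. *)
Lemma exp_match m n (A A' : 'I_m -> 'rV[R]_n) (w w' : 'I_m -> R) (th0 : 'rV[R]_n) (r : R) :
  0 < r -> injective A -> injective A' -> (forall x, 0 < w x) -> (forall x, 0 < w' x) ->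
  (forall th, `|th - th0| < r ->
     \sum_x w x * expR (inner (A x) th) = \sum_x w' x * expR (inner (A' x) th)) ->
  exists s : 'S_m, forall x, A (s x) = A' x /\ w (s x) = w' x.
Proof.
move=> r0 AI AI' w0 w0' H.
pose S := undup ([seq A x | x <- enum 'I_m] ++ [seq A' x | x <- enum 'I_m]).
pose c v := \sum_(x | A x == v) w x - \sum_(x | A' x == v) w' x.
have grp (B : 'I_m -> 'rV[R]_n) (z : 'I_m -> R) th : (forall x, B x \in S) ->
    \sum_x z x * expR (inner (B x) th) = \sum_(v <- S) (\sum_(x | B x == v) z x) * expR (inner v th).
  move=> BS.
  have -> : \sum_(v <- S) (\sum_(x | B x == v) z x) * expR (inner v th) =
      \sum_(v <- S) \sum_x (if B x == v then z x * expR (inner v th) else 0).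
    by apply: eq_bigr => v _; rewrite mulr_suml big_mkcond.
  rewrite exchange_big; apply: eq_bigr => x _ /=.
  rewrite (bigD1_seq (B x)) ?undup_uniq//= eqxx big1 ?addr0// => v vB.
  by rewrite eq_sym (negbTE vB).
have AS x : A x \in S by rewrite mem_undup mem_cat map_f ?mem_enum.
have AS' x : A' x \in S by rewrite mem_undup mem_cat orbC map_f ?mem_enum.
have c0 : forall v, v \in S -> c v = 0.
  apply: (@exp_indep_loc n S c th0 r r0 (undup_uniq _)) => th tr.
  have := H th tr; rewrite (grp A w th AS) (grp A' w' th AS') => /eqP; rewrite -subr_eq0 => /eqP e.
  by rewrite -[RHS]e -sumrB; apply: eq_bigr => v _; rewrite mulrBl.
have single (B : 'I_m -> 'rV[R]_n) (z : 'I_m -> R) x : injective B ->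
    \sum_(y | B y == B x) z y = z x.
  by move=> BI; rewrite (eq_bigl (pred1 x)) ?big_pred1_eq// => y; rewrite (inj_eq BI).
have /choice[h Hh] : forall x, exists y, A y = A' x /\ w y = w' x.
  move=> x; have := c0 _ (AS' x); rewrite /c single// => /eqP; rewrite subr_eq0 => /eqP e.
  have [y Ay] : exists y, A y = A' x.
    apply: contrapT => nE; have := w0' x; rewrite -e big_pred0 ?ltxx// => y.
    by apply/eqP => Ay; apply: nE; exists y.
  by exists y; split => //; rewrite -e -Ay single.
have hI : injective h.
  by move=> x y xy; apply: AI'; have [<- _] := Hh x; have [<- _] := Hh y; rewrite xy.
by exists (perm hI) => x; rewrite permE.
Qed.

End LocalExponentials.

Section ZLine.
Context {R : realType} {n q : nat}.
Variables (sv : 'I_q -> 'rV[R]_n) (W : 'I_q -> R).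
Hypotheses (W0 : forall i, 0 < W i) (q0 : 'I_q).
Local Notation Z := (Zf sv W).
Local Notation eta := (eta sv W).

Lemma Zf_line (p v : 'rV[R]_n) (t : R) : is_derive t 1 (fun s : R => Z (p + s *: v))
  (inner (eta (p + t *: v)) v * Z (p + t *: v)).
Proof.
have [sZ dZ] := Zf_smooth sv W0 q0.
have d : differentiable (fun x : 'rV[R]_(n + n) => Z (lsubmx x) : R^o) (row_mx p 0 + t *: row_mx v 0).
  exact: (smooth_on_diff sZ).
have e s : row_mx p 0 + s *: row_mx v 0 = row_mx (p + s *: v) 0 :> 'rV[R]_(n + n).
  by rewrite scale_row_mx scaler0 add_row_mx addr0.
have dl := line_derive d.
have -> : (fun s : R => Z (p + s *: v)) = (fun s : R => Z (lsubmx (row_mx p 0 + s *: row_mx v 0 : 'rV[R]_(n + n)))).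
  by apply/funext => s; rewrite e row_mxKl.
apply: (is_derive_eq dl); apply: (etrans (dZ _ _)).
by rewrite e !row_mxKl.
Qed.

(** [eta] is the gradient of the logarithm of the partition function, so its equivariance is
    integrated along the segment from [th0] to [th]. *)
Lemma Zf_affine (B Bi : 'M[R]_n) (al b th0 : 'rV[R]_n) (r : R) : Bi *m B^T = 1%:M ->
  (forall th, `|th - th0| < r -> eta (th *m Bi + b) = eta th *m B + al) ->
  exists2 k : R, 0 < k & forall th, `|th - th0| < r ->
    Z (th *m Bi + b) = k * expR (inner (al *m Bi^T) th) * Z th.
Proof.
move=> BB H; pose a' := al *m Bi^T.
have Zp th := Zf_gt0 sv W0 q0 th.
have ie d (u v : 'rV[R]_d) : inner u v = (u *m v^T) 0 0.
  by rewrite mxE; apply: eq_bigr => i _; rewrite mxE.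
exists (Z (th0 *m Bi + b) / Z th0 * expR (- inner a' th0)).
  by rewrite !mulr_gt0 ?invr_gt0 ?expR_gt0.
move=> th tr; pose v := th - th0.
have thE : th = th0 + 1 *: v by rewrite scale1r /v addrC subrK.
have v1 : 0 < `|v| + 1 by rewrite ltr_wpDl.
pose a1 := inner al (v *m Bi).
have a1E : a1 = inner a' v.
  by rewrite /a1 !ie trmx_mul mulmxA.
(* The times at which [th0 + t *: v] stays in the ball. This interval must contain 1 in its
   interior; for [v = 0] every time is allowed and 2 is a convenient choice. *)
pose c := if v == 0 then 2 else r / `|v|.
have c1 : 1 < c.
  rewrite /c; case: eqVneq => [_|v0]; first lra.
  by rewrite ltr_pdivlMr ?normr_gt0// mul1r.
have tb (t : R) : `|t| < c -> `|(th0 + t *: v) - th0| < r.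
  rewrite /c addrC addKr normrZ; case: eqVneq => [->|v0].
    by rewrite normr0 mulr0 (le_lt_trans _ tr).
  by rewrite ltr_pdivlMr ?normr_gt0.
pose g1 (t : R) := Z ((th0 *m Bi + b) + t *: (v *m Bi)); pose g0 (t : R) := Z (th0 + t *: v).
have g1E t : (th0 *m Bi + b) + t *: (v *m Bi) = (th0 + t *: v) *m Bi + b.
  by rewrite (mulmxDl th0) -(scalemxAl t v) addrAC.
have dg1 (t : R) : `|t| < c -> is_derive t 1 g1 ((inner (eta (th0 + t *: v)) v + a1) * g1 t).
  move=> tc; apply: (is_derive_eq (Zf_line _ _ t)); congr (_ * _).
  rewrite g1E (H _ (tb t tc)) innerDl; congr (_ + _).
  by rewrite !ie trmx_mul mulmxA -[_ *m B *m _]mulmxA -[B]trmxK -trmx_mul BB trmx1 mulmx1.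
have dg0 (t : R) : is_derive t 1 g0 (inner (eta (th0 + t *: v)) v * g0 t) by exact: Zf_line.
have g0n t : g0 t != 0 by rewrite gt_eqF// Zp.
have dq (t : R) : `|t| < c -> is_derive t 1 (fun s => (g1 s * expR (- a1 * s)) * (g0 s)^-1) 0.
  move=> tc; have d1 := is_deriveM (dg1 t tc) (is_derive_expl (- a1) t).
  have d0 := is_deriveV (g0n t) (dg0 t).
  apply: (is_derive_eq (is_deriveM d1 d0)); rewrite /GRing.scale /=.
  have ar (x y e i a : R) : y != 0 -> (x * e) * (- y ^- 2 * (i * y)) +
    y^-1 * (x * (- a * e) + e * ((i + a) * x)) = 0 by move=> ?; field.
  exact: ar.
have c0 : 0 < c by apply: lt_trans c1.
have one : `|1 : R| < c by rewrite normr1.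
have := const_of_derive0 c0 dq one.
rewrite /g1 /g0 g1E -thE !scale0r !addr0 mulr0 expR0 !mulr1 => e.
have en : Z th != 0 by rewrite gt_eqF// Zp.
have ->: Z (th *m Bi + b) = (Z (th *m Bi + b) * expR (- a1) / Z th) * expR a1 * Z th.
  have : expR (- a1) * expR a1 = 1 by rewrite -expRD addNr expR0.
  by move: (expR _) (expR _) => x y xy; field: xy.
rewrite e; congr (_ * _); rewrite -[RHS]mulrA -expRD; congr (_ * expR _).
by rewrite a1E /v innerBr addrC.
Qed.

End ZLine.

Section PermutationOfE.
Context {R : realType} {m n : nat} (E : expfam R m n).
Local Notation sv := (efsv E).
Local Notation W := (efW E).
Local Notation W0 := (@ef_W0 _ _ _ E).
Local Notation q0 := (ef_q0 E).
Local Notation Z := (Zf sv W).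
Local Notation eta := (eta sv W).
Local Notation F := (estimator E).

Lemma inner_mulr (x y : 'rV[R]_n) (M : 'M[R]_n) : inner x (y *m M) = inner (x *m M^T) y.
Proof.
have ie (u v : 'rV[R]_n) : inner u v = (u *m v^T) 0 0.
  by rewrite mxE; apply: eq_bigr => i _; rewrite mxE.
by rewrite !ie trmx_mul mulmxA.
Qed.

Lemma Z_sum th : Z th = \sum_x expR (ef_C E x) * expR (inner (F x) th).
Proof. by rewrite (ef_group E (fun s => expR (inner s th))). Qed.

Lemma affine_perm (B Bi : 'M[R]_n) (al b th0 : 'rV[R]_n) (r : R) : 0 < r -> injective F ->
  Bi *m B^T = 1%:M ->
  (forall th, `|th - th0| < r -> eta (th *m Bi + b) = eta th *m B + al) ->
  exists s : 'S_m, [/\ PermE E s, forall x, F (s x) *m Bi^T = F x + al *m Bi^T &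
    forall th x, dens E (th *m Bi + b) (s x) = dens E th x].
Proof.
move=> r0 FI BB H; have [k k0 Hk] := Zf_affine W0 q0 BB H.
have BB2 : B^T *m Bi = 1%:M by rewrite mulmx1C.
pose a' := al *m Bi^T.
have [s Hs] : exists s : 'S_m, forall x, F (s x) *m Bi^T = F x + a' /\
    expR (ef_C E (s x)) * expR (inner (F (s x)) b) = k * expR (ef_C E x).
  apply: (exp_match (A := fun x => F x *m Bi^T) (A' := fun x => F x + a')
    (w := fun x => expR (ef_C E x) * expR (inner (F x) b)) (w' := fun x => k * expR (ef_C E x))
    (th0 := th0) r0) => //.
  - move=> x y /(congr1 (fun z => z *m B)); rewrite -!mulmxA.
    have -> : Bi^T *m B = 1%:M by rewrite -[B]trmxK -trmx_mul BB2 trmx1.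
    by rewrite !mulmx1 => /FI.
  - by move=> x y /addIr/FI.
  - by move=> x; rewrite mulr_gt0 ?expR_gt0.
  - by move=> x; rewrite mulr_gt0 ?expR_gt0.
  move=> th tr; have := Hk th tr; rewrite !Z_sum => e.
  transitivity (\sum_x expR (ef_C E x) * expR (inner (F x) (th *m Bi + b))).
    by apply: eq_bigr => x _; rewrite innerDr inner_mulr addrC expRD mulrA.
  rewrite e mulr_sumr; apply: eq_bigr => x _; rewrite innerDl expRD -/a'.
  ring.
have Zp th := Zf_gt0 sv W0 q0 th.
have dE th x : dens E (th *m Bi + b) (s x) = dens E th x.
  (* The permuted density is proportional to the original one by a factor independent of the sample
     point; both have total mass 1, so the factor is 1. *)
  have prop y : dens E (th *m Bi + b) (s y) =
      (k * expR (inner a' th) * Z th / Z (th *m Bi + b)) * dens E th y.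
    rewrite !dens_E innerDr inner_mulr; have [-> w] := Hs y.
    rewrite innerDl !expRD.
    have -> : expR (ef_C E (s y)) * (expR (inner (F y) th) * expR (inner a' th) * expR (inner (F (s y)) b)) =
      k * expR (ef_C E y) * (expR (inner (F y) th) * expR (inner a' th)).
      by rewrite -w; ring.
    have z1 : Z th != 0 by rewrite gt_eqF.
    have z2 : Z (th *m Bi + b) != 0 by rewrite gt_eqF.
    by field; rewrite z1 z2.
  have s1 th' : \sum_y dens E th' y = 1 by exact: (ef_sum1 E).
  have s2 : \sum_y dens E (th *m Bi + b) (s y) = 1.
    by rewrite -[RHS](s1 (th *m Bi + b)) [RHS](reindex_inj (@perm_inj _ s)).
  have c1 : k * expR (inner a' th) * Z th / Z (th *m Bi + b) = 1.
    have := s2; under eq_bigr do rewrite prop.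
    by rewrite -mulr_sumr s1 mulr1.
  by rewrite prop c1 mul1r.
exists s; split => //; last by move=> x; have [] := Hs x.
have sm (M : 'M[R]_n) (c : 'rV[R]_n) : smooth_on setT (fun th : 'rV[R]_n => th *m M + c).
  move=> j; have ll : linear (fun th : 'rV[R]_n => th *m M).
    by move=> a x y; rewrite mulmxDl scalemxAl.
  have cl : continuous (mklin ll) := @lin_continuous R n _ (mklin ll).
  apply: (Ck_onD openT); last exact: Ck_on_cst.
  exact: (Ck_on_linear j openT cl).
exists (fun th => th *m Bi + b), (fun th => th *m B^T + (- (b *m B^T))); split.
- exact: sm.
- exact: sm.
- by move=> th; rewrite mulmxDl -mulmxA BB mulmx1 addrK.
- by move=> th; rewrite mulmxDl mulNmx -!mulmxA BB2 !mulmx1 subrK.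
by move=> th; apply/funext => x; rewrite /permute -(dE th (s^-1 x)%g) permKV.
Qed.

End PermutationOfE.

(** * Automorphisms acting affinely on the mean coordinates *)

Section ThetaAffine.
Context {R : realType} {m n : nat} (E : expfam R m n) {N : charted R (n + n)}.
Variables (g : tensor2 N) (Phi : torus R n -> N -> N).
Variables (Y : 'I_n -> 'rV[R]_n -> 'rV[R]_n) (G : EL Y -> N).
Hypothesis hK : kahler_toric g Phi.
Hypothesis hT : torification_by E g Phi G.
Local Notation X := 'rV[R]_(n + n).
Local Notation P := (PP G).
Local Notation sv := (efsv E).
Local Notation W := (efW E).
Local Notation cv := (cov sv W).
Local Notation eta := (eta sv W).
Let hg : kahler_manifold g. Proof. by case: hK. Qed.
Let hN : complex_manifold N. Proof. by case: hg. Qed.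
Let hY : parallel_frame Y. Proof. by case: hT. Qed.
Variables (w : N -> N) (B : 'M[R]_n) (al : 'rV[R]_n).
Hypothesis aw : Aut g w.
Hypothesis HB : forall u u', P u' = w (P u) -> eta (lsubmx u') = eta (lsubmx u) *m B + al.

(** The free points and their preimage by [w] are open, the former dense and the latter nonempty, so
    they meet. Near a common point [w \o P] stays in the domain of one chart of [EL Y], that is a
    local section of the covering, and this gives the lift. *)
Lemma local_lift : exists (u0 : X) (r : R) (ka : X -> X), 0 < r /\
  forall u, ball u0 r u -> differentiable ka u /\ P (ka u) = w (P u).
Proof.
have [[[wc ws] _] _ [psi [K1 K2 _]]] := aw.
have sw : smooth_map_on setT w by split.
have oF := free_open hg hT; have dF := free_points_dense hK.
have wcont : continuous w by move=> p; exact: wc.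
have oW : open (w @^-1` free_points Phi) by apply: open_comp => // p _; exact: wcont.
have [p1 fp1] : free_points Phi !=set0.
  by exists (P 0); apply/(PP_free hT); exists 0.
have W0 : w @^-1` free_points Phi !=set0 by exists (psi p1); rewrite /= K2.
have [p0 [wp0 /(PP_free hT)[u0 u0E]]] := dF _ W0 oW.
rewrite -u0E in wp0; set q0 := w (P u0) in wp0.
have /(PP_free hT)[u1 u1E] := wp0.
have [_ _ rG [H GK [Hc Hs]] _] := hT.
have GH q : free_points Phi q -> G (H q) = q.
  by rewrite -rG => -[x _ <-]; rewrite GK.
have Hq0 : H q0 = qL Y u1 by rewrite /q0 -u1E /PP GK.
have [e ea [e1 e2 e3]] := EL_chart hY u1; have [oe _ _ eK] := ea.
have [ca cd] := chart_atP hN q0; set c := chart_at q0 in ca cd.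
have sP := PP_sparam hT; have sPw := sparam_comp hN sw sP.
have nq : nbhs q0 [set q | dom c q /\ (free_points Phi q /\ dom e (H q))].
  apply: filterI; first exact: near_dom.
  apply: filterI; first exact: open_nbhs_nbhs.
  by apply: cont_nbhs => //; [exact: Hc | rewrite Hq0].
have cPw : {for u0, continuous (w \o P)} by have [_ + _] := sPw; apply.
have nu : nbhs u0 ((w \o P) @^-1` [set q | dom c q /\ (free_points Phi q /\ dom e (H q))]).
  exact: cont_pre.
have /nbhs_ballP[r /= r0 Hr] := nu.
exists u0, r, (fun u => fwd e (H (w (P u)))); split => // u ur.
have [dc [fq de]] := Hr u ur; split; last by rewrite /PP eK// GH.
have d1 : differentiable (fwd c \o (w \o P)) u by exact: (sparam_diff sPw ca (I : setT u) dc).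
have d2 : differentiable (fwd e \o H \o bwd c) ((fwd c \o (w \o P)) u).
  apply: (smooth_on_diff (Hs c e ca ea)); split; first exact: cimage_fwd.
  by split; rewrite /= (fwdK hN).
have Ee : \forall z \near u, (fwd e \o H \o bwd c) ((fwd c \o (w \o P)) z) = fwd e (H (w (P z))).
  by apply: filterS (sparam_near hN sPw ca (I : setT u) dc) => z [_ cz] /=; rewrite (fwdK hN).
exact: (diff_near_comp 0 erefl d1 d2 Ee).1.
Qed.

(** The lift is holomorphic and isometric. Differentiating the affine law of [eta] gives a second
    identity for [cov], of a different weight in ['d ka]; comparing it with the isometry isolates
    ['d ka] itself. *)
Lemma lift_d (u0 u : X) (r : R) (ka : X -> X) :
  (forall u, ball u0 r u -> differentiable ka u /\ P (ka u) = w (P u)) -> ball u0 r u ->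
  forall a, lsubmx ('d ka u a) *m B^T = lsubmx a.
Proof.
move=> Hk ur; have [dk Pk] := Hk u ur.
have [sw iw _] := aw; have [sw1 wI] := sw.
have sP := PP_sparam hT.
have nb : \forall z \near u, ball u0 r z by apply: open_nbhs_nbhs; split => //; exact: ball_open.
have ch a : dparam P (ka u) ('d ka u a) = dmap w (P u) (dparam P u a).
  have [c1a c1d] := chart_atP hN (P (ka u)).
  rewrite -(dparam_comp hN a sw1 sP (I : setT u)) /dparam /= -Pk.
  set c1 := chart_at (P (ka u)) in c1a c1d *.
  have d1 : differentiable (fwd c1 \o P) (ka u) by exact: (sparam_diff sP c1a (I : setT (ka u)) c1d).
  have Ee : \forall z \near u, (fwd c1 \o P) (ka z) = (fwd c1 \o (w \o P)) z.
    by apply: filterS nb => z /Hk[_ /= ->].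
  by apply: esym; exact: (diff_near_comp a erefl dk d1 Ee).2.
have DI a : 'd ka u (mulI a) = mulI ('d ka u a).
  apply/eqP; rewrite -subr_eq0; apply/eqP; apply: (PP_inj hg hT (u := ka u)).
  apply: (etrans (raddfB ('d (fwd (chart_at (P (ka u))) \o P) (ka u)) _ _)).
  apply/eqP; rewrite subr_eq0; apply/eqP.
  apply: (etrans (ch (mulI a))); rewrite (PP_hol hg hT) wI -ch.
  by apply: esym; exact: (PP_hol hg hT).
have Diso a b : cv (lsubmx (ka u)) (lsubmx ('d ka u a)) (lsubmx ('d ka u b)) +
    cv (lsubmx (ka u)) (rsubmx ('d ka u a)) (rsubmx ('d ka u b)) =
    cv (lsubmx u) (lsubmx a) (lsubmx b) + cv (lsubmx u) (rsubmx a) (rsubmx b).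
  apply: (etrans (esym (PP_iso hg hT (ka u) ('d ka u a) ('d ka u b)))).
  apply: (etrans _ (PP_iso hg hT u a b)).
  apply: (etrans (congr2 (g _) (ch a) (ch b))); rewrite Pk; exact: iw.
have Deta a xi : cv (lsubmx (ka u)) (lsubmx ('d ka u a)) xi = cv (lsubmx u) (lsubmx a) (xi *m B^T).
  have [s1 e1] := eta_smooth sv (@ef_W0 _ _ _ E) (ef_q0 E) xi.
  have [s2 e2] := eta_smooth sv (@ef_W0 _ _ _ E) (ef_q0 E) (xi *m B^T).
  have d1 : differentiable (fun x : X => inner (eta (lsubmx x)) xi : R^o) (ka u) by exact: (smooth_on_diff s1).
  have d2 : differentiable (fun x : X => inner (eta (lsubmx x)) (xi *m B^T) : R^o) u by exact: (smooth_on_diff s2).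
  have [d3 e3] := diff_addc (inner al xi) d2.
  have Ee : \forall z \near u, (inner al xi + inner (eta (lsubmx z)) (xi *m B^T) : R^o) =
      inner (eta (lsubmx (ka z))) xi.
    apply: filterS nb => z /Hk[_ Pz]; rewrite (HB Pz) innerDl addrC; congr (_ + _).
    by rewrite inner_mulr trmxK.
  have [d4 e4] := near_eq_diff Ee d3.
  apply: (etrans (esym (e1 (ka u) ('d ka u a)))).
  apply: (etrans (esym (dcompE (f := ka) a dk d1))).
  apply: (etrans (congr1 (fun h : X -> R^o => h a) e4)).
  exact: (etrans (e3 a) (e2 u a)).
(* [eta] depends on [theta] only, so fibre directions remain fibre directions; by complex linearity
   the differential of the lift is then block diagonal. *)
have D0 a : lsubmx ('d ka u (row_mx 0 a)) = 0.
  apply: (@cov_inj _ _ _ E (lsubmx (ka u))) => xi.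
  by rewrite Deta row_mxKl !cov0l.
have Da a : rsubmx ('d ka u (row_mx a 0)) = 0.
  have := D0 a; have -> : row_mx 0 a = mulI (row_mx a 0) :> X.
    by rewrite /mulI row_mxKl row_mxKr oppr0.
  by rewrite DI /mulI row_mxKl => /eqP; rewrite oppr_eq0 => /eqP.
have key a : lsubmx ('d ka u (row_mx a 0)) *m B^T = a.
  apply: (@cov_inj _ _ _ E (lsubmx u)) => b.
  have := Diso (row_mx b 0) (row_mx a 0); rewrite !Da cov0l !row_mxKl !row_mxKr cov0l !addr0.
  by rewrite Deta row_mxKl => e; rewrite covC e covC.
move=> a; have aE : a = row_mx (lsubmx a) 0 + row_mx 0 (rsubmx a).
  by rewrite add_row_mx addr0 add0r hsubmxK.
have e0 : lsubmx ('d ka u a) = lsubmx ('d ka u (row_mx (lsubmx a) 0)) + lsubmx ('d ka u (row_mx 0 (rsubmx a))).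
  rewrite -raddfD; congr lsubmx; apply: (etrans (congr1 ('d ka u) aE)).
  exact: (raddfD ('d ka u)).
by rewrite e0 D0 addr0 key.
Qed.

(** By [lift_d] the derivative of the [theta] part of the lift is everywhere the inverse of the
    transpose of [B], a constant. *)
Lemma theta_affine : exists (u0 : X) (r : R) (ka : X -> X) (Bi : 'M[R]_n) (b : 'rV[R]_n),
  [/\ 0 < r, Bi *m B^T = 1%:M &
    forall u, ball u0 r u -> P (ka u) = w (P u) /\ lsubmx (ka u) = lsubmx u *m Bi + b].
Proof.
have [u0 [r [ka [r0 Hk]]]] := local_lift.
have kd u := lift_d Hk (u := u).
have u0r : ball u0 r u0 by exact: ballxx.
pose Bi : 'M[R]_n := \matrix_i lsubmx ('d ka u0 (row_mx (delta_mx 0 i) 0)).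
have BB : Bi *m B^T = 1%:M.
  apply/row_matrixP => i; rewrite row_mul rowK kd// row_mxKl.
  by rewrite rowE mulmx1.
have BB2 : B^T *m Bi = 1%:M by rewrite mulmx1C.
exists u0, r, ka, Bi, (lsubmx (ka u0) - lsubmx u0 *m Bi); split => // u ur.
have [_ Pu] := Hk u ur; split => //.
have kd2 v a : ball u0 r v -> lsubmx ('d ka v a) = lsubmx a *m Bi.
  by move=> vr; rewrite -(kd v vr a) -mulmxA BB2 mulmx1.
pose L1 (x : X) : 'rV[R]_n := lsubmx x *m Bi.
have l1 : linear L1 by move=> a x y; rewrite /L1 linearP mulmxDl scalemxAl.
have c1 : continuous (mklin l1) := @lin_continuous R _ _ (mklin l1).
have ll : linear (fun x : X => lsubmx x : 'rV[R]_n) by move=> a x y; rewrite linearP.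
have cl : continuous (mklin ll) := @lin_continuous R _ _ (mklin ll).
pose h (x : X) : 'rV[R]_n := mklin ll (ka x) - mklin l1 x.
have dlk v : ball u0 r v -> differentiable (fun x => mklin ll (ka x)) v /\
    forall a, 'd (fun x => mklin ll (ka x)) v a = lsubmx ('d ka v a).
  move=> vr; have [dk _] := Hk v vr; have dl := linear_differentiable (ka v) cl.
  split; first exact: (differentiable_comp dk dl).
  move=> a; apply: (etrans (dcompE (f := ka) a dk dl)).
  exact: (congr1 (fun h : X -> 'rV[R]_n => h ('d ka v a)) (diff_lin (ka v) cl)).
have dh v : ball u0 r v -> differentiable h v /\ forall a, 'd h v a = 0.
  move=> vr; have [d1 e1] := dlk v vr; have [d2 e2] := diff_sub_lin c1 d1.
  split; [exact: d2 | move=> a].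
  apply: (etrans (e2 a)); apply: (etrans (congr1 (fun z => z - L1 a) (e1 a))).
  by rewrite kd2// subrr.
have seg t : 0 <= t <= 1 -> ball u0 r (u0 + t *: (u - u0)) by move=> t01; exact: ball_convex.
have hE : h (u0 + (u - u0)) = h u0.
  apply: diff0_cst => t t01; first by have [] := dh _ (seg t t01).
  have t01' : 0 <= t <= 1 by move: t01 => /andP[? ?]; rewrite !ltW.
  by have [_ ->] := dh _ (seg t t01').
move: hE; rewrite addrC subrK /h /= /L1 => <-.
by rewrite addrC subrK.
Qed.

End ThetaAffine.

Section Simultaneous.
Context {R : realType} {d : nat}.
Local Notation L := 'rV[R]_d.
Variable br : L -> L -> L.
Hypothesis brP : forall a x y z, br (a *: x + y) z = a *: br x z + br y z.
Hypothesis brN : forall x y, br x y = - br y x.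
Hypothesis brJ : forall x y z, br x (br y z) = br (br x y) z + br y (br x z).
Hypothesis brI : forall x y z, inner (br x y) z = inner x (br y z).
Variable gg : 'M[R]_d.
Variable GG : 'M[R]_d -> Prop.
Hypothesis GG1 : GG 1%:M.
Hypothesis GGM : forall u v, GG u -> GG v -> GG (u *m v).
Hypothesis GGmem : forall u (x : L), GG u -> (x <= gg)%MS -> (x *m u <= gg)%MS.
Hypothesis GGbr : forall u x y, GG u -> (x <= gg)%MS -> (y <= gg)%MS ->
  br x y *m u = br (x *m u) (y *m u).
Hypothesis GGflow : forall k, (k <= gg)%MS -> exists2 c : R, 0 < c &
  exists U : R -> 'M[R]_d, forall t : R, `|t| < c -> GG (U t) /\
    forall x, (x <= gg)%MS -> x *m U 0 = x /\
      is_derive t 1 (fun s => x *m U s) (br k (x *m U t)).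

(* Elements already brought into the commutant of [D] are kept fixed by
   conjugating inside their common commutant. *)
Lemma simultaneous (D : L) (l ms : seq L) : (D <= gg)%MS ->
  (forall z, z \in ms -> (z <= gg)%MS /\ br z D = 0) ->
  (forall x, x \in l -> (x <= gg)%MS) ->
  (forall x y, x \in l ++ ms -> y \in l ++ ms -> br x y = 0) ->
  exists u, [/\ GG u, forall z, z \in ms -> z *m u = z & forall x, x \in l -> br (x *m u) D = 0].
Proof.
move=> Dg; have [k lk] : exists k, (size l <= k)%N by exists (size l).
elim: k l ms lk => [|k IH] [|x l] ms // lk Hm Hl Hc; try by exists 1%:M; split => // z _; rewrite mulmx1.
have b0l y : br 0 y = 0 by have := brP (-1) 0 0 y; rewrite scaler0 addr0 scaleN1r addrC subrr.
have b0r y : br y 0 = 0 by rewrite brN b0l oppr0.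
(* The common commutant of [ms]: conjugators built inside it fix [ms], and it contains both [x] and
   [D]. *)
have [h Hh] : exists h : 'M[R]_d, forall y : L,
    ((y <= gg)%MS /\ forall z, z \in ms -> br y z = 0) <-> (y <= h)%MS.
  apply: (subspace_mx (S := [set y : L | (y <= gg)%MS /\ forall z, z \in ms -> br y z = 0])).
    by split; [exact: sub0mx | move=> z _; exact: b0l].
  move=> a y y' [yg yz] [yg' yz']; split; first by rewrite addmx_sub ?scalemx_sub.
  by move=> z zm; rewrite brP yz// yz'// scaler0 addr0.
have sh : subalg br gg h.
  split; first by apply/row_subP => i; have /Hh[] := row_sub i h.
  move=> y y' /Hh[yg yz] /Hh[yg' yz']; apply/Hh; split; first exact: (gg_br GGmem GGflow).
  move=> z zm; rewrite brN brJ [br z y]brN yz// [br z y']brN yz'// oppr0 b0l b0r.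
  by rewrite addr0 oppr0.
have xh : (x <= h)%MS.
  apply/Hh; split; first by apply: Hl; rewrite inE eqxx.
  by move=> z zm; apply: Hc; rewrite ?inE ?eqxx// mem_cat zm !orbT.
have Dh : (D <= h)%MS.
  by apply/Hh; split => // z zm; rewrite brN (Hm z zm).2 oppr0.
have [u1 [G1 x1 f1]] := conjugate_commute brP brN brJ brI GG1 GGM GGmem GGbr GGflow
  (leqnn _) sh xh Dh.
have fz z : z \in ms -> z *m u1 = z.
  move=> zm; apply: f1; split; first exact: (Hm z zm).1.
  by move=> y /Hh[_]; apply.
have tr y : y \in l ++ (x :: ms) -> (y <= gg)%MS.
  rewrite mem_cat inE => /or3P[yl|/eqP ->|ym]; last exact: (Hm y ym).1.
    by apply: Hl; rewrite inE yl orbT.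
  by apply: Hl; rewrite inE eqxx.
have mv y : y \in [seq z *m u1 | z <- l] ++ (x *m u1 :: ms) ->
    exists2 z, z \in l ++ (x :: ms) & y = z *m u1.
  rewrite mem_cat inE => /or3P[/mapP[z zl ->]|/eqP ->|ym].
  - by exists z => //; rewrite mem_cat zl.
  - by exists x => //; rewrite mem_cat inE eqxx orbT.
  by exists y; [rewrite mem_cat inE ym !orbT | rewrite fz].
have perm y : y \in l ++ (x :: ms) -> y \in (x :: l) ++ ms.
  by rewrite !mem_cat !inE => /or3P[->|->|->]; rewrite ?orbT.
have [u2 [G2 f2 x2]] : exists u, [/\ GG u, forall z, z \in x *m u1 :: ms -> z *m u = z &
    forall y, y \in [seq z *m u1 | z <- l] -> br (y *m u) D = 0].
  apply: IH; first by rewrite size_map.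
  - move=> z; rewrite inE => /predU1P[->|zm]; last exact: Hm.
    by split => //; apply: GGmem => //; apply: Hl; rewrite inE eqxx.
  - by move=> y /mapP[z zl ->]; apply: GGmem => //; apply: Hl; rewrite inE zl orbT.
  move=> y y' /mv[z zl ->] /mv[z' zl' ->].
  by rewrite -GGbr ?tr// Hc ?mul0mx// perm.
exists (u1 *m u2); split; first exact: GGM.
  by move=> z zm; rewrite mulmxA fz// f2// inE zm orbT.
move=> y; rewrite inE mulmxA => /predU1P[->|yl]; first by rewrite f2 ?inE ?eqxx.
by apply: x2; apply: map_f.
Qed.

End Simultaneous.

(** * Kahler functions on [N] as a Lie algebra of Hermitian matrices *)

Section Coordinates.
Context {R : realType} {m n : nat} (E : expfam R m n) {N : charted R (n + n)}.
Variables (g : tensor2 N) (Phi : torus R n -> N -> N).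
Variables (Y : 'I_n -> 'rV[R]_n -> 'rV[R]_n) (G : EL Y -> N).
Hypothesis hK : kahler_toric g Phi.
Hypothesis hT : torification_by E g Phi G.
Local Notation X := 'rV[R]_(n + n).
Local Notation P := (PP G).
Local Notation sv := (efsv E).
Local Notation W := (efW E).
Local Notation q := (efq E).
Local Notation L := 'rV[R]_(q * q).
Local Notation W0 := (@ef_W0 _ _ _ E).
Local Notation q0 := (ef_q0 E).
Local Notation svI := (@ef_svI _ _ _ E).
Local Notation Z u := (Zf sv W (lsubmx u)).
Let hg : kahler_manifold g. Proof. by case: hK. Qed.
Let hN : complex_manifold N. Proof. by case: hg. Qed.

Definition Lam (u : X) (y : L) : R := cRe (qf sv W (cmx y) u).

Lemma qf_real (A : 'M[R[i]]_q) (u : X) : herm A -> qf sv W A u = (cRe (qf sv W A u))%:C%C.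
Proof.
move=> hA; have e : cj (qf sv W A u) = qf sv W A u.
  rewrite /qf conjc_sum exchange_big; apply: eq_bigr => i _.
  rewrite conjc_sum; apply: eq_bigr => j _.
  rewrite (conjcM (A i j * et sv W j u)) (conjcM (A i j)) conjcKc hA.
  have ar (T : comNzRingType) (a b c : T) : a * b * c = a * c * b by ring.
  exact: ar.
apply: cP => //=; have := congr1 (@cIm R) e; case: (qf _ _ _ _) => a b /= h.
have : b + b = 0 by rewrite -{1}h addNr.
lra.
Qed.

Lemma LamE u y : qf sv W (cmx y) u = (Lam u y)%:C%C.
Proof. by apply: qf_real; exact: cmx_herm. Qed.

Lemma LamP u a x y : Lam u (a *: x + y) = a * Lam u x + Lam u y.
Proof.
rewrite /Lam cmxP qfD qfZ ReD ReM; congr (_ + _).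
by rewrite /= mul0r subr0.
Qed.

Lemma Lam_inj x y : (forall u, Lam u x = Lam u y) -> x = y.
Proof.
move=> H; apply: cmx_inj; apply: (qf_inj svI W0) => u.
by rewrite !LamE H.
Qed.

(** The vector [x] encodes the Hermitian matrix of [f]. The relation is stated on the free points
    only, where by density it determines a continuous [f]. *)
Definition crd (f : N -> R) (x : L) := forall u, Lam u x = f (P u) * Z u.

Lemma crd_unique f x y : crd f x -> crd f y -> x = y.
Proof. by move=> h1 h2; apply: Lam_inj => u; rewrite h1 h2. Qed.

Lemma crd_fun f f' x : continuous (f : N -> R^o) -> continuous (f' : N -> R^o) ->
  crd f x -> crd f' x -> forall p, f p = f' p.
Proof.
move=> c1 c2 h1 h2; apply: (dense_eq (free_points_dense hK) c1 c2) => p /(PP_free hT)[u <-].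
have := h1 u; rewrite h2 => /mulIf -> //.
by rewrite gt_eqF// (Zf_gt0 sv W0 q0).
Qed.

Lemma kahler_continuous f : kahler_function g f -> continuous (f : N -> R^o).
Proof. by move=> [sf _]; exact: smooth_fun_continuous. Qed.

Lemma crdP f f' x y a : crd f x -> crd f' y -> crd (fun p => a * f p + f' p) (a *: x + y).
Proof. by move=> h1 h2 u; rewrite LamP h1 h2 mulrDl mulrA. Qed.

Lemma crd0 : crd (fun=> 0) 0.
Proof. by move=> u; rewrite -[0 in LHS](scaler0 _ 0) -[_ *: 0]addr0 LamP mul0r; have := LamP u (-1) 0 0; rewrite scaler0 addr0; lra. Qed.

Lemma kahler0 : kahler_function g (fun=> 0).
Proof.
have [f kf _] := affine_kahler hK hT 0 0.
have := kahlerP hg (-1) kf kf; congr (kahler_function _ _).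
by apply/funext => p; rewrite mulN1r addNr.
Qed.

Lemma kahler_kmat f (Xf : vfield N) x : smooth_fun (f : N -> R^o) -> smooth_field Xf ->
  hamiltonian g f Xf -> killing g Xf -> crd f x ->
  exists2 V, kmat sv W (f \o P) V (cmx x) & forall u, dparam P u (V u) = Xf (P u).
Proof.
move=> sf sX hX kX cx; have [V kV rV] := kahler_pull hK hT sf sX hX kX.
exists V => //; have [A kA] := kmat_exists svI W0 q0 kV.
have -> : cmx x = A => //.
by apply: (qf_inj svI W0) => u; rewrite LamE cx (kmat_qf W0 q0 _ kA).
Qed.

Lemma crd_exists f : kahler_function g f -> exists x, crd f x.
Proof.
move=> [sf [Xf [sX hX kX]]]; have [V kV rV] := kahler_pull hK hT sf sX hX kX.
have [A kA] := kmat_exists svI W0 q0 kV; have hA := kmat_herm svI W0 q0 kA.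
exists (enc A) => u; rewrite /Lam (encK hA) (kmat_qf W0 q0 _ kA).
by [].
Qed.

(** This transports [kmat_bracket] to [N]: [hbr] encodes the derivative of one function along the
    Hamiltonian field of the other. *)
Lemma Lam_br k f (Xk : vfield N) x y u : smooth_fun (k : N -> R^o) -> smooth_field Xk ->
  hamiltonian g k Xk -> killing g Xk -> crd k x -> smooth_fun (f : N -> R^o) -> crd f y ->
  Lam u (hbr x y) = dfun (f : N -> R^o) (P u) (Xk (P u)) * Z u.
Proof.
move=> sk sX hX kX cx sf cy; have [V kV rV] := kahler_kmat sk sX hX kX cx.
have sfP := smooth_fun_sparam hN sf (PP_sparam hT).
have B y' : qf sv W (cmx y) y' = ((f \o P) y' * Z y')%:C%C by rewrite LamE cy.
have e := kmat_bracket svI W0 q0 u kV sfP B.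
have [_ e2] := dfunE hN (V u) sf (PP_sparam hT) (I : setT u).
rewrite /Lam cmx_hbr qfZ.
apply: (etrans (congr1 (@cRe R) (esym e))) => /=.
by rewrite (_ : 'd _ u (V u) = dfun (f : N -> R^o) (P u) (Xk (P u))) // -rV.
Qed.


Lemma gg_exists : exists M : 'M[R]_(q * q), forall x : L,
  (exists2 f, kahler_function g f & crd f x) <-> (x <= M)%MS.
Proof.
apply: (subspace_mx (S := [set x | exists2 f, kahler_function g f & crd f x])).
  by exists (fun=> 0); [exact: kahler0 | exact: crd0].
move=> a x y [f kf cf] [f' kf' cf'].
by exists (fun p => a * f p + f' p); [exact: kahlerP | exact: crdP].
Qed.

Definition gg : 'M[R]_(q * q) := projT1 (cid gg_exists).

Lemma ggP (x : L) : (exists2 f, kahler_function g f & crd f x) <-> (x <= gg)%MS.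
Proof. exact: (projT2 (cid gg_exists)). Qed.

Definition acts (phi : N -> N) (M : 'M[R]_(q * q)) := forall f x,
  kahler_function g f -> crd f x -> crd (f \o phi) (x *m M).

Lemma kahler_crd_sum I (s : seq I) (c : I -> R) (f : I -> N -> R) (x : I -> L) :
  (forall i, kahler_function g (f i)) -> (forall i, crd (f i) (x i)) ->
  kahler_function g (fun p => \sum_(i <- s) c i * f i p) /\
  crd (fun p => \sum_(i <- s) c i * f i p) (\sum_(i <- s) c i *: x i).
Proof.
move=> kf cf; elim: s => [|i s [k1 c1]].
  have -> : (fun p => \sum_(i <- [::]) c i * f i p) = (fun=> 0) by apply/funext => p; rewrite big_nil.
  by rewrite big_nil; split; [exact: kahler0 | exact: crd0].
have -> : (fun p => \sum_(j <- i :: s) c j * f j p) =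
    (fun p => c i * f i p + \sum_(j <- s) c j * f j p) by apply/funext => p; rewrite big_cons.
by rewrite big_cons; split; [exact: (kahlerP hg _ (kf i) k1) | exact: crdP].
Qed.

(** The matrix is prescribed by the images of the rows of [gg] and extended through a
    pseudo-inverse; only its effect on [gg] is determined by [phi]. *)
Lemma acts_exists phi : Aut g phi -> exists M, acts phi M.
Proof.
move=> aphi.
have /choice[f Hf] : forall i, exists f, kahler_function g f /\ crd f (row i gg).
  by move=> i; have [f k c] := (ggP (row i gg)).2 (row_sub i gg); exists f.
have /choice[y Hy] : forall i, exists y, crd (f i \o phi) y.
  by move=> i; apply: crd_exists; exact: (kahler_comp hg aphi (Hf i).1).
exists (pinvmx gg *m \matrix_i y i) => h x kh ch.
have xg : (x <= gg)%MS by apply/ggP; exists h.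
pose c := x *m pinvmx gg.
have cx : x = \sum_i c 0 i *: row i gg by rewrite -mulmx_sum_row mulmxKpV.
have [k1 c1] := kahler_crd_sum (index_enum _) (c 0) (fun i => (Hf i).1) (fun i => (Hf i).2).
rewrite -cx in c1.
have hE p : h p = \sum_i c 0 i * f i p.
  by apply: (crd_fun (kahler_continuous kh) (kahler_continuous k1) ch c1).
have kfp i : kahler_function g (f i \o phi) by exact: (kahler_comp hg aphi (Hf i).1).
have [_ c2] := kahler_crd_sum (index_enum _) (c 0) kfp Hy.
rewrite mulmxA -/c mulmx_sum_row => u.
have -> : \sum_i c 0 i *: row i (\matrix_i y i) = \sum_i c 0 i *: y i.
  by apply: eq_bigr => i _; rewrite rowK.
by rewrite c2 /= hE.
Qed.

Lemma acts_gg phi M (x : L) : Aut g phi -> acts phi M -> (x <= gg)%MS -> (x *m M <= gg)%MS.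
Proof.
move=> aphi aM /ggP[f kf cf]; apply/ggP; exists (f \o phi); first exact: kahler_comp.
exact: aM.
Qed.

(** The inverse [psi] is recorded together with its own path, because the conjugation found for [f]
    has to be undone within [Aut0] at the end. *)
Definition GG (M : 'M[R]_(q * q)) := exists phi psi,
  [/\ Paut g phi, Paut g psi, cancel phi psi, cancel psi phi & acts phi M].

Lemma GG1 : GG 1%:M.
Proof.
exists id, id; split => //; [exact: Paut_id | exact: Paut_id |].
by move=> f x _ cf; rewrite mulmx1.
Qed.

Lemma GGM u v : GG u -> GG v -> GG (u *m v).
Proof.
move=> [phi [psi [p1 p2 K1 K2 a1]]] [phi' [psi' [p1' p2' K1' K2' a2]]].
exists (phi \o phi'), (psi' \o psi); split.
- exact: Paut_comp.
- exact: Paut_comp.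
- exact: can_comp.
- exact: can_comp.
move=> f x kf cf; rewrite mulmxA.
apply: (a2 (f \o phi)); last exact: a1.
by apply: kahler_comp => //; exact: Paut_Aut.
Qed.

Lemma GGmem u (x : L) : GG u -> (x <= gg)%MS -> (x *m u <= gg)%MS.
Proof. by move=> [phi [psi [p1 _ _ _ a]]]; apply: acts_gg a; exact: Paut_Aut. Qed.

(** The linear forms [Lam u] separate vectors, so they span the dual and differentiability may be
    tested on them. *)
Lemma crd_derive (x : R -> L) (t : R) (x' : L) :
  (forall u, is_derive t 1 (fun s => Lam u (x s)) (Lam u x')) -> is_derive t 1 x x'.
Proof.
move=> H.
pose S := [set a : L | is_derive t 1 (fun s => inner (x s) a) (inner x' a)].
have [M SM] : exists M : 'M[R]_(q * q), forall a : L, S a <-> (a <= M)%MS.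
  apply: subspace_mx.
    rewrite /S /=; have i0 z : inner z (0 : L) = 0 by rewrite innerC inner0l.
    by under eq_fun do rewrite i0; rewrite i0; exact: is_derive_cst.
  move=> a y z Sy Sz; rewrite /S /=.
  have e w : inner w (a *: y + z) = a *: (inner w y : R^o) + inner w z.
    by rewrite innerC innerP ![inner _ w]innerC.
  under eq_fun do rewrite e; rewrite e.
  exact: (is_deriveD (is_deriveZ a Sy) Sz).
pose av u : L := \row_i Lam u (delta_mx 0 i).
have avE u y : Lam u y = inner y (av u).
  have ll : linear (Lam u : L -> R^o) by move=> a y1 y2; rewrite LamP.
  rewrite {1}(row_sum_delta y) -[LHS]/(mklin ll _) linear_sum.
  by apply: eq_bigr => i _; rewrite linearZ mxE.
have avM u : (av u <= M)%MS.
  apply/SM; rewrite /S /=; under eq_fun do rewrite -avE; rewrite -avE; exact: H.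
have full (a : L) : (a <= M)%MS.
  have [h [w [aE hM wM]]] := orth_decomp M a.
  suff w0 : w = 0 by rewrite aE w0 addr0.
  apply: Lam_inj => u; rewrite !avE innerC wM// inner0l.
  by [].
apply: derive_mx_entries => i.
have /SM := full (delta_mx 0 i); rewrite /S /=.
by under eq_fun do rewrite inner_delta; rewrite inner_delta.
Qed.

Lemma GGflow (k : L) : (k <= gg)%MS -> exists2 c : R, 0 < c &
  exists U : R -> 'M[R]_(q * q), forall t : R, `|t| < c -> GG (U t) /\
    forall x, (x <= gg)%MS -> x *m U 0 = x /\
      is_derive t 1 (fun s => x *m U s) (hbr k (x *m U t)).
Proof.
move=> /ggP[f [sf [Z0 [sZ hZ kZ]]] cf].
have [_ [_ cN] _ _ _] := hK.
have [c [phi [c0 phi0 pA dphi]]] := kahler_flow hg cN sf sZ hZ kZ.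
exists c => //.
have /choice[U HU] : forall t : R, exists M, `|t| < c -> acts (phi t) M.
  move=> t; have [tc|_] := boolP (`|t| < c); last by exists 0.
  have [p1 _ _ _] := pA t tc; have [M aM] := acts_exists (Paut_Aut p1).
  by exists M.
exists U => t tc; have [p1 p2 K1 K2] := pA t tc; split.
  by exists (phi t), (phi (- t)); split => //; exact: HU.
move=> x /ggP[h kh ch]; have [sh _] := kh; split.
  have z0 : `|0 : R| < c by rewrite normr0.
  have := HU 0 z0 h x kh ch.
  have -> : h \o phi 0 = h by apply/funext => p /=; rewrite phi0.
  by move=> /crd_unique; apply.
apply: crd_derive => u.
have kt : kahler_function g (h \o phi t) by apply: kahler_comp => //; exact: Paut_Aut.
have [st _] := kt.
rewrite (Lam_br u sf sZ hZ kZ cf st (HU t tc h x kh ch)).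
have dd := dphi h (P u) t sh tc.
have d2 : is_derive t 1 (fun s => Zf sv W (lsubmx u) *: (h (phi s (P u)) : R^o))
   (Zf sv W (lsubmx u) *: (dfun ((h \o phi t) : N -> R^o) (P u) (Z0 (P u)) : R^o)).
  exact: is_deriveZ.
have near_t : \forall s \near (t : R^o), `|s| < c by exact: (near_norm_lt (V := R^o)).
have Ex : \forall s \near (t : R^o), Zf sv W (lsubmx u) *: (h (phi s (P u)) : R^o) = Lam u (x *m U s).
  by apply: filterS near_t => s sc; rewrite (HU s sc h x kh ch) mulrC.
have did : differentiable (fun y : R^o => y) (Zf sv W (lsubmx u) *: (h (phi t (P u)) : R^o)).
  exact: ex_diff.
have d3 := derive_comp_near d2 did Ex.
apply: (is_derive_eq d3).
have [_ e4] := is_diff_id (Zf sv W (lsubmx u) *: (h (phi t (P u)) : R^o)).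
apply: (etrans (congr1 (fun z : R^o -> R^o => z _) e4)).
by rewrite mulrC.
Qed.

(** Automorphisms preserve the Poisson bracket, since the Hamiltonian field of [f \o phi] is related
    by [phi] to that of [f]. The bracket function [b] is identified on all of [N] by density before
    [phi] is applied. *)
Lemma acts_br phi M (x y : L) : Aut g phi -> acts phi M -> (x <= gg)%MS -> (y <= gg)%MS ->
  hbr x y *m M = hbr (x *m M) (y *m M).
Proof.
move=> aphi aM xg yg.
have bg := gg_br GGmem GGflow xg yg.
have /ggP[f kf cf] := xg; have /ggP[h kh ch] := yg; have /ggP[b kb cb] := bg.
have [sf [Xf [sX hX kX]]] := kf; have [sh _] := kh.
have kfp := kahler_comp hg aphi kf; have [sfp [Xp [sXp hXp kXp]]] := kfp.
have khp := kahler_comp hg aphi kh; have [shp _] := khp.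
have [[sphi _] _ _] := aphi.
have bE p : b p = dfun (h : N -> R^o) p (Xf p).
  apply: (dense_eq (f2 := fun p => dfun (h : N -> R^o) p (Xf p)) (free_points_dense hK)
    (kahler_continuous kb) (dfun_field_continuous hg sh sX)) => r /(PP_free hT)[u <-].
  have := cb u; rewrite (Lam_br u sf sX hX kX cf sh ch) => /mulIf -> //.
  by rewrite gt_eqF// (Zf_gt0 sv W0 q0).
apply: (crd_unique (f := b \o phi)); first exact: aM.
move=> u; rewrite (Lam_br u sfp sXp hXp kXp (aM _ _ kf cf) shp (aM _ _ kh ch)).
congr (_ * _); rewrite /= bE (dfun_comp hg _ _ sphi sh).
by rewrite (hamiltonian_comp hg (P u) aphi sf hX hXp).
Qed.

Lemma GGbr u (x y : L) : GG u -> (x <= gg)%MS -> (y <= gg)%MS ->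
  hbr x y *m u = hbr (x *m u) (y *m u).
Proof. by move=> [phi [psi [p1 _ _ _ a]]]; apply: acts_br a; exact: Paut_Aut. Qed.

Definition dgm (a : 'I_q -> R) : 'M[R[i]]_q := \matrix_(i, j) ((a i *+ (i == j))%:C)%C.

Lemma dgm_herm a : herm (dgm a).
Proof.
move=> i j; rewrite !mxE eq_sym; apply: cP => /=; last by rewrite oppr0.
by have [->|] := eqVneq j i; rewrite ?mulr0n.
Qed.

Lemma qf_dgm a u : qf sv W (dgm a) u = ((\sum_i prf sv W i (lsubmx u) * a i) * Z u)%:C%C.
Proof.
rewrite mulr_suml -real_sum; apply: eq_bigr => i _.
rewrite (bigD1 i)//= big1 ?addr0 => [|j ji]; last first.
  by rewrite mxE eq_sym (negbTE ji) mulr0n !mul0r.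
rewrite mxE eqxx mulr1n -mulrA (et_conj sv W0) realM; congr (_%:C)%C.
rewrite /prf; have Zn : Z u != 0 by rewrite gt_eqF// (Zf_gt0 sv W0 q0).
by field.
Qed.

Lemma separating : exists d : 'rV[R]_n, injective (fun i => inner (sv i) d).
Proof.
have [xi Hxi] := generic_vector [seq sv p.1 - sv p.2 | p <- enum {: 'I_q * 'I_q}].
exists xi => i j e; apply: svI; apply/eqP; rewrite -subr_eq0; apply/negPn/negP => nz.
have mm : sv i - sv j \in [seq sv p.1 - sv p.2 | p <- enum {: 'I_q * 'I_q}].
  by apply/mapP; exists (i, j); rewrite ?mem_enum.
by have := Hxi _ mm nz; rewrite innerBl e subrr eqxx.
Qed.

Lemma crd_affine f a0 (a : 'rV[R]_n) :
  (forall u, f (P u) = a0 + inner (eta sv W (lsubmx u)) a) ->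
  crd f (enc (dgm (fun i => a0 + inner (sv i) a))).
Proof.
move=> fE u; rewrite /Lam (encK (dgm_herm _)) qf_dgm /=; congr (_ * _).
rewrite fE inner_eta; under eq_bigr do rewrite mulrDr.
by rewrite big_split /= -mulr_suml (prf_sum sv W0 q0) mul1r.
Qed.

(** Its diagonal entries are pairwise distinct, so commuting with it means being diagonal
    ([hbr_dgm]). *)
Definition Dg : L := enc (dgm (fun i => inner (sv i) (projT1 (cid separating)))).

Lemma Dg_gg : (Dg <= gg)%MS.
Proof.
set d := projT1 (cid separating).
have [f kf fE] := affine_kahler hK hT 0 d.
apply/ggP; exists f => //; have := crd_affine fE; congr (crd _ (enc (dgm _))).
by apply/funext => i; rewrite add0r.
Qed.

Lemma hbr_dgm (x : L) : hbr x Dg = 0 -> forall i j, i != j -> cmx x i j = 0.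
Proof.
move=> /(congr1 (@cmx R _)); rewrite cmx_hbr.
have c0 : cmx 0 = 0 :> 'M[R[i]]_q by apply/matrixP => i j; rewrite !mxE; apply: cP => /=; field.
rewrite c0 /Dg (encK (dgm_herm _)); set d := projT1 (cid separating); move: (cmx x) => B e i j ij.
have dI : injective (fun i => inner (sv i) d) by exact: (projT2 (cid separating)).
have /matrixP/(_ i j) := e; rewrite !mxE.
have -> : \sum_k B i k * dgm (fun i => inner (sv i) d) k j = B i j * (inner (sv j) d)%:C%C.
  rewrite (bigD1 j)//= big1 ?addr0 => [|k kj]; first by rewrite mxE eqxx mulr1n.
  by rewrite mxE (negbTE kj) mulr0n mulr0.
have -> : \sum_k dgm (fun i => inner (sv i) d) i k * B k j = (inner (sv i) d)%:C%C * B i j.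
  rewrite (bigD1 i)//= big1 ?addr0 => [|k ki]; first by rewrite mxE eqxx mulr1n.
  by rewrite mxE eq_sym (negbTE ki) mulr0n mul0r.
have nz : inner (sv j) d - inner (sv i) d != 0.
  by rewrite subr_eq0; apply: contra_neq ij => /dI.
case: (B i j) => a b /= h.
have h1 := congr1 (@cRe R) h; have h2 := congr1 (@cIm R) h; rewrite /= in h1 h2.
have a0 : (inner (sv j) d - inner (sv i) d) * a = 0 by move: h2; lra.
have b0 : (inner (sv j) d - inner (sv i) d) * b = 0 by move: h1; lra.
move/eqP: a0; rewrite mulf_eq0 (negbTE nz) /= => /eqP ->.
by move/eqP: b0; rewrite mulf_eq0 (negbTE nz) /= => /eqP ->.
Qed.

Lemma diag_affine f (x : L) : kahler_function g f -> crd f x -> hbr x Dg = 0 ->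
  exists a0 a, forall u, f (P u) = a0 + inner (eta sv W (lsubmx u)) a.
Proof.
move=> [sf [Xf [sX hX kX]]] cx x0; have [V kV _] := kahler_kmat sf sX hX kX cx.
have H := kmat_diag W0 q0 kV (hbr_dgm x0).
exists (cRe (cc sv W (f \o P) V 0)), (- rsubmx (V 0)) => u.
by rewrite [inner _ (- _)]innerC innerNl [inner (rsubmx _) _]innerC; exact: H.
Qed.

Theorem kahler_conj f : kahler_function g f -> exists phi psi a0 a,
  [/\ Paut g phi, Paut g psi, cancel phi psi, cancel psi phi &
    forall u, f (phi (P u)) = a0 + inner (eta sv W (lsubmx u)) a].
Proof.
move=> kf; have [x cx] := crd_exists kf.
have xg : (x <= gg)%MS by apply/ggP; exists f.
have sg : subalg hbr gg gg.
  by split => // y z yg zg; exact: (gg_br GGmem GGflow).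
have [u [Gu xu _]] := conjugate_commute (@hbrP _ _) (@hbrN _ _) (@hbrJ _ _) (@hbrI _ _)
  GG1 GGM GGmem GGbr GGflow (leqnn _) sg xg Dg_gg.
have [phi [psi [p1 p2 K1 K2 a]]] := Gu.
have kfp := kahler_comp hg (Paut_Aut p1) kf.
have [a0 [b H]] := diag_affine kfp (a _ _ kf cx) xu.
by exists phi, psi, a0, b; split.
Qed.

Variables (kappa K : N -> {ptws 'I_m -> R}).
Hypothesis kG : forall x, kappa (G x) = EL_proj E x.
Hypothesis hE : natural_extension E Phi kappa K.
Local Notation eta := (eta sv W).
Local Notation F := (estimator E).

Lemma K_PP u : K (P u) = dens E (lsubmx u).
Proof.
have [_ _ KE] := hE; rewrite KE; last by apply/(PP_free hT); exists u.
by rewrite /PP kG EL_projE.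
Qed.

Lemma expect_continuous V : continuous ((fun p => expect (K p) V) : N -> R^o).
Proof.
have [cK _ _] := hE.
have c1 x : continuous ((fun p => K p x) : N -> R^o).
  move=> p; apply: (@continuous_comp _ _ _ K (@proj 'I_m (fun=> R) x) p (cK p)).
  exact: proj_continuous.
move=> p; rewrite /expect.
have -> : (fun p => \sum_x V x * K p x : R^o) = \sum_x (fun p => V x * K p x : R^o).
  by apply/funext => r; rewrite fct_sumE.
apply: (big_ind (fun f : N -> R^o => {for p, continuous f})).
- exact: cst_continuous.
- by move=> f1 f2 h1 h2; exact: continuousD.
by move=> x _; apply: (@continuousM _ _ (fun=> V x)); [exact: cst_continuous | exact: c1].
Qed.

Lemma affine_inner V : affine_rv E V -> exists a0 a, forall x, V x = a0 + inner (F x) a.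
Proof.
move=> [a0 [a Va]]; exists a0, (\row_k a k) => x; rewrite Va inner_est.
by congr (_ + _); apply: eq_bigr => k _; rewrite mxE.
Qed.

Lemma expect_dens V a0 a : (forall x, V x = a0 + inner (F x) a) ->
  forall th, expect (dens E th) V = a0 + inner (eta th) a.
Proof.
move=> VE th; have -> : V = (fun x => a0 + \sum_k (a 0 k) * ef_F E k x).
  apply/funext => x; rewrite VE inner_est.
  by [].
rewrite expect_affine; congr (_ + inner _ _).
by apply/rowP => k; rewrite mxE.
Qed.

Lemma expect_PP V a0 a : (forall x, V x = a0 + inner (F x) a) ->
  forall u, expect (K (P u)) V = a0 + inner (eta (lsubmx u)) a.
Proof. by move=> VE u; rewrite K_PP; exact: expect_dens. Qed.

Lemma expect_kahler V : affine_rv E V -> kahler_function g (fun p => expect (K p) V).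
Proof.
move=> /affine_inner[a0 [a VE]]; have [f kf fE] := affine_kahler hK hT a0 a.
suff -> : (fun p => expect (K p) V) = f by [].
apply/funext; apply: (dense_eq (free_points_dense hK) (@expect_continuous V)) => [|p /(PP_free hT)[u <-]].
  exact: (kahler_continuous kf).
by rewrite (expect_PP VE) fE.
Qed.

(** The conjugating automorphism makes [f] affine in [eta] on the free points, hence an expectation
    there and by continuity everywhere; its inverse is the automorphism of the statement. *)
Lemma kahler_expect f : kahler_function g f -> exists (V : 'I_m -> R) (phi : N -> N),
  [/\ affine_rv E V, Aut0 g phi & forall p, f p = expect (K (phi p)) V].
Proof.
move=> kf; have [phi [psi [a0 [a [p1 p2 K1 K2 fE]]]]] := kahler_conj kf.
pose V x := a0 + \sum_k a 0 k * ef_F E k x.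
have VE x : V x = a0 + inner (F x) a by rewrite inner_est.
exists V, psi; split; [by exists a0, (a 0) | exact: Paut_Aut0 |].
move=> p; rewrite -{1}(K2 p).
have kfp := kahler_comp hg (Paut_Aut p1) kf.
apply: (dense_eq (f1 := f \o phi) (f2 := fun p => expect (K p) V) (free_points_dense hK)) => //.
- exact: (kahler_continuous kfp).
- exact: expect_continuous.
by move=> r /(PP_free hT)[u <-]; rewrite (expect_PP VE) /= fE.
Qed.

Lemma dgmM (a b : 'I_q -> R) : dgm a *m dgm b = dgm (fun i => a i * b i).
Proof.
apply/matrixP => i j; rewrite mxE (bigD1 i)//= big1 => [|k ki]; last first.
  by rewrite mxE eq_sym (negbTE ki) mulr0n mul0r.
rewrite addr0 [dgm a i i]mxE [dgm b i j]mxE [RHS]mxE eqxx mulr1n realM; congr (_%:C)%C.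
by rewrite mulrnAr.
Qed.

Lemma hbr_dgm0 (a b : 'I_q -> R) : hbr (enc (dgm a)) (enc (dgm b)) = 0.
Proof.
apply: cmx_inj; rewrite cmx_hbr !(encK (dgm_herm _)) !dgmM.
have -> : (fun i => a i * b i) = (fun i => b i * a i) by apply/funext => i; rewrite mulrC.
by rewrite subrr scaler0; apply/matrixP => i j; rewrite !mxE; apply: cP => /=; field.
Qed.

(** The automorphism [w] is corrected by some [phi] fixing the expectation of [V], so that the
    pullbacks of the expectations of all the [F_k] become diagonal too. The corrected automorphism
    acts affinely on [eta] and hence permutes the sample space. *)
Lemma expect_perm (V V' : 'I_m -> R) (w : N -> N) : injective F -> affine_rv E V ->
  affine_rv E V' -> Aut g w -> (forall p, expect (K p) V = expect (K (w p)) V') ->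
  exists2 s : 'S_m, PermE E s & forall k, V k = V' (s k).
Proof.
move=> FI aV aV' aw Vw.
have kV := expect_kahler aV; have kV' := expect_kahler aV'.
have [a0 [a VE]] := affine_inner aV; have [a0' [a' VE']] := affine_inner aV'.
have /choice[ef Hef] : forall i : 'I_n, exists f, kahler_function g f /\
    forall u, f (P u) = 0 + inner (eta (lsubmx u)) (delta_mx 0 i).
  by move=> i; have [f k fE] := affine_kahler hK hT 0 (delta_mx 0 i); exists f.
have [M aM] := acts_exists aw.
pose z i : 'rV[R]_(q * q) := enc (dgm (fun j => 0 + inner (sv j) (delta_mx 0 i))).
have cz i : crd (ef i) (z i) := crd_affine (Hef i).2.
pose z0 : 'rV[R]_(q * q) := enc (dgm (fun j => a0 + inner (sv j) a)).
pose z0' : 'rV[R]_(q * q) := enc (dgm (fun j => a0' + inner (sv j) a')).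
have c0 : crd (fun p => expect (K p) V) z0 := crd_affine (expect_PP VE).
have c0' : crd (fun p => expect (K p) V') z0' := crd_affine (expect_PP VE').
have z0E : z0' *m M = z0.
  have := aM _ _ kV' c0'.
  have -> : (fun p => expect (K p) V') \o w = (fun p => expect (K p) V).
    by apply/funext => p; rewrite Vw.
  by move=> h; exact: (crd_unique h c0).
have zg i : (z i <= gg)%MS by apply/ggP; exists (ef i); [exact: (Hef i).1 | exact: cz].
have z0g' : (z0' <= gg)%MS by apply/ggP; exists (fun p => expect (K p) V').
have z0g : (z0 <= gg)%MS by apply/ggP; exists (fun p => expect (K p) V).
(* Coordinates of the expectations of the [F_k] pulled back by [w]. They commute with each other and
   with [z0], being images of diagonal matrices under a map preserving brackets. *)
pose l := [seq z i *m M | i <- enum 'I_n].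
have form y : y \in l ++ [:: z0] -> exists c, (enc (dgm c) <= gg)%MS /\ y = enc (dgm c) *m M.
  rewrite mem_cat inE => /orP[/mapP[i _ ->]|/eqP ->].
    by exists (fun j => 0 + inner (sv j) (delta_mx 0 i)); split => //; exact: zg.
  by exists (fun j => a0' + inner (sv j) a'); rewrite -z0E.
have h1 y : y \in [:: z0] -> (y <= gg)%MS /\ hbr y (Dg) = 0.
  by rewrite inE => /eqP ->; split => //; exact: hbr_dgm0.
have h2 x : x \in l -> (x <= gg)%MS by move=> /mapP[i _ ->]; exact: (acts_gg aw aM (zg i)).
have h3 x y : x \in l ++ [:: z0] -> y \in l ++ [:: z0] -> hbr x y = 0.
  move=> /form[c [cg ->]] /form[c' [cg' ->]].
  by rewrite -(acts_br aw aM cg cg') hbr_dgm0 mul0mx.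
have [u [Gu fu du]] := simultaneous (@hbrP _ _) (@hbrN _ _) (@hbrJ _ _) (@hbrI _ _) GG1
    GGM GGmem GGbr
    GGflow (Dg_gg) h1 h2 h3.
have [phi [psi [p1 p2 K1 K2 aphi]]] := Gu.
pose w' := w \o phi.
have aw' : Aut g w' by apply: Aut_comp => //; exact: Paut_Aut.
have Vw' p : expect (K (w' p)) V' = expect (K p) V.
  rewrite -Vw.
  have kVp := kahler_comp hg (Paut_Aut p1) kV.
  have cVp := aphi _ _ kV c0; rewrite (fu z0 (mem_head _ _)) in cVp.
  exact: (crd_fun (kahler_continuous kVp) (kahler_continuous kV) cVp c0).
have /choice[al Hal] : forall i : 'I_n, exists al, exists b, forall u,
    ef i (w' (P u)) = al + inner (eta (lsubmx u)) b.
  move=> i; have kw := kahler_comp hg aw (Hef i).1.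
  have kwp := kahler_comp hg (Paut_Aut p1) kw.
  have cwp := aphi _ _ kw (aM _ _ (Hef i).1 (cz i)).
  apply: (diag_affine kwp cwp); apply: du.
  by apply: map_f; rewrite mem_enum.
have /choice[bb Hbb] := Hal.
pose B : 'M[R]_n := \matrix_(k, i) bb i 0 k.
have HB u1 u2 : P u2 = w' (P u1) -> eta (lsubmx u2) = eta (lsubmx u1) *m B + \row_i al i.
  move=> e; apply/rowP => i; have := (Hef i).2 u2; rewrite e Hbb add0r.
  rewrite inner_delta.
  move=> <-; rewrite [RHS]mxE [RHS]addrC; congr (_ + _); first by rewrite mxE.
  by rewrite mxE; apply: eq_bigr => k _; rewrite mxE.
have [u0 [r [ka [Bi [b [r0 BB Hka]]]]]] := theta_affine hK hT aw' HB.
pose uu (th : 'rV[R]_n) : X := row_mx th (rsubmx u0).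
have uub th : `|th - lsubmx u0| < r -> ball u0 r (uu th).
  move=> tr; rewrite -ball_normE /=; apply: le_lt_trans tr.
  have -> : u0 - uu th = row_mx (lsubmx u0 - th) 0.
    by rewrite -{1}(hsubmxK u0) /uu opp_row_mx add_row_mx subrr.
  by rewrite [in leRHS]distrC; exact: norm_row_mx0.
have He th : `|th - lsubmx u0| < r -> eta (th *m Bi + b) = eta th *m B + \row_i al i.
  move=> /uub/Hka[k1 k2]; have := HB _ _ k1; rewrite k2 /uu row_mxKl.
  by [].
have [s [sP sF sd]] := affine_perm r0 FI BB He.
exists s => //.
have BB2 : B^T *m Bi = 1%:M by rewrite mulmx1C.
have TB : Bi^T *m B = 1%:M by rewrite -[B]trmxK -trmx_mul BB2 trmx1.
have Fs x : F (s x) = F x *m B + \row_i al i.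
  by rewrite -[LHS]mulmx1 -TB mulmxA sF mulmxDl -mulmxA TB mulmx1.
(* The difference between the permuted [V'] and [V] is affine in the estimator with linear part [c];
   its expectation vanishes for all parameters near [lsubmx u0]. *)
pose c := a' *m B^T - a; pose d0 := a0' + inner (\row_i al i) a' - a0.
have DE x : V' (s x) - V x = d0 + inner (F x) c.
  rewrite VE VE' Fs innerDl /c innerBr inner_mulr trmxK /d0.
  ring.
have Dth th : `|th - lsubmx u0| < r -> d0 + inner (eta th) c = 0.
  move=> tr; rewrite -(expect_dens DE).
  have [k1 k2] := Hka _ (uub th tr).
  have e : expect (dens E (th *m Bi + b)) V' = expect (dens E th) V.
    have := Vw' (P (uu th)); rewrite -k1 !K_PP k2 /uu row_mxKl.
    by [].
  have e2 : expect (dens E (th *m Bi + b)) V' = \sum_x V' (s x) * dens E th x.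
    rewrite /expect (reindex_inj (@perm_inj _ s)); apply: eq_bigr => x _.
    by rewrite sd.
  rewrite /expect; under eq_bigr do rewrite mulrBl.
  by rewrite sumrB -e2 e subrr.
(* Differentiating the vanishing expectation in the direction [c] gives the variance of [c], which
   would be positive for [c != 0]. *)
have c0E : c = 0.
  apply/eqP/negPn/negP => nz; have := cov_pos E (lsubmx u0) nz.
  have [se de] := eta_smooth sv (@ef_W0 _ _ _ E) (ef_q0 E) c.
  have := de u0 (row_mx c 0); rewrite row_mxKl => <-.
  have dc : differentiable (fun _ : X => - d0 : R^o) u0 by exact: differentiable_cst.
  have nE : \forall x \near u0, (- d0 : R^o) = inner (eta (lsubmx x)) c.
    have : nbhs u0 (ball u0 r) by exact: nbhsx_ballx.
    apply: filterS => x; rewrite -ball_normE /= => xr.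
    have /Dth : `|lsubmx x - lsubmx u0| < r.
      by rewrite -raddfB /=; apply: le_lt_trans (norm_lsubmx _) _; rewrite distrC.
    by move=> /eqP; rewrite addrC addr_eq0 => /eqP.
  have [_ e] := near_eq_diff nE dc.
  have e0 : 'd (fun x : X => inner (eta (lsubmx x)) c : R^o) u0 (row_mx c 0) = 0.
    apply: (etrans (congr1 (fun h : X -> R^o => h (row_mx c 0)) e)).
    by rewrite diff_cst.
  by rewrite e0 ltxx.
have d00 : d0 = 0.
  have := Dth (lsubmx u0); rewrite subrr normr0 => /(_ r0).
  by rewrite c0E innerC inner0l addr0.
move=> x; apply/esym/eqP; rewrite -subr_eq0 DE d00 c0E innerC inner0l addr0.
by [].
Qed.

End Coordinates.

Theorem theorem6p21 (R : realType) (m n : nat) (E : expfam R m n)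
    (N : charted R (n + n)) (g : tensor2 N) (Phi : torus R n -> N -> N)
    (hN : kahler_toric g Phi) (hreg : regular_torification E g Phi)
    (kappa K : N -> {ptws 'I_m -> R})
    (hkappa : compatible_projection E g Phi kappa)
    (hK : natural_extension E Phi kappa K)
    (f : N -> R) (hf : smooth_fun (f : N -> R^o)) :
  (kahler_function g f <->
     exists (X : 'I_m -> R) (phi : N -> N), [/\ affine_rv E X, Aut0 g phi &
       forall p, f p = expect (K (phi p)) X]) /\
  (injective (estimator E) ->
     forall (phi phi' : N -> N) (X X' : 'I_m -> R),
       Aut0 g phi -> Aut0 g phi' -> affine_rv E X -> affine_rv E X' ->
       (forall p, f p = expect (K (phi p)) X) ->
       (forall p, f p = expect (K (phi' p)) X') ->
       exists2 sigma : 'S_m, PermE E sigma &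
         forall k, X k = X' (sigma k)).
Proof.
have [Y [G [hT kG]]] := hkappa; have hg : kahler_manifold g by case: hN.
have A0 (phi : N -> N) : Aut0 g phi -> Aut g phi by exact: connected_component_sub.
split; first split.
- exact: (kahler_expect hN hT kG hK).
- move=> [X [phi [aX aphi fE]]].
  have -> : f = (fun p => expect (K p) X) \o phi by apply/funext => p; rewrite fE.
  by apply: (kahler_comp hg); [exact: A0 | exact: (expect_kahler hN hT kG hK)].
move=> FI phi phi' X X' /A0 aphi /A0 aphi' aX aX' fE fE'.
have [_ _ [psi [K1 K2 _]]] := aphi.
(* At the point [phi p] the two expressions of [f p] compare the expectation of [X] with that of
   [X'] after [phi' \o psi], where [psi] is the inverse of [phi]. *)
apply: (expect_perm hN hT kG hK FI aX aX' (w := phi' \o psi)).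
  by apply: (Aut_comp hg) => //; exact: (Aut_inv hg aphi K1 K2).
by move=> p; rewrite /= -fE' -{1}(K2 p) -fE.
Qed.
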